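(* Let $a=\{a_n\}_{n\in\mathbb{N}}$ be a complex sequence with $\sum_{n=1}^\infty |a_n|<\infty$, and define for $x>0$ $$f(x)=\sum_{n=1}^\infty a_n\left[J^2_{in/2}(x)+Y^2_{in/2}(x)\right].$$ For $x>0$ and $n\in\mathbb{N}$ let $$\Phi_n(x)=x\int_0^\pi J_0(2x\cosh u)\,\sinh(2u)\,\sin(nu)\,du.$$ Then for every $n\in\mathbb{N}$, $$a_n=\sinh\left(\frac{\pi n}{2}\right)\int_0^\infty \Phi_n(x)f(x)\,dx,$$ where the integral converges in the improper sense, i.e. as $\lim_{T\to\infty}\int_0^T$.
   Context: $J_\nu$ and $Y_\nu$ denote the Bessel functions of the first and second kind of (complex) order $\nu$; here the orders $in/2$ are purely imaginary, $i$ being the imaginary unit. *)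

(* Defs.v *)
From Stdlib Require Export Reals Factorial.
From Coquelicot Require Export Coquelicot.
Export Coquelicot.Complex.

Open Scope R_scope.

Definition Cexp (z : C) : C :=
  (exp (Re z) * cos (Im z), exp (Re z) * sin (Im z)).
Definition Ccos (z : C) : C := ((Cexp (Ci * z) + Cexp (- (Ci * z))) / 2)%C.
Definition Csin (z : C) : C := ((Cexp (Ci * z) - Cexp (- (Ci * z))) / (2 * Ci))%C.

Definition Cpow_pos (t : R) (z : C) : C := Cexp (z * RtoC (ln t))%C.

(** Limit of a complex sequence and sum of a complex series
    (componentwise; these are the usual limit / sum whenever they exist). *)
Definition Clim_seq (u : nat -> C) : C :=
  (real (Lim_seq (fun m => Re (u m))), real (Lim_seq (fun m => Im (u m)))).
Definition CSeries (u : nat -> C) : C :=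
  (Series (fun m => Re (u m)), Series (fun m => Im (u m))).

(** Reciprocal Gamma function 1/Γ(z) via Gauss' product formula:
    1/Γ(z) = lim_{m→∞} z (z+1) ... (z+m) / (m^z m!). *)
Fixpoint Cpoch (z : C) (m : nat) : C :=
  match m with
  | O => z
  | S k => (Cpoch z k * (z + INR (S k)))%C
  end.
Definition rgamma (z : C) : C :=
  Clim_seq (fun m => (Cpoch z m / (Cpow_pos (INR m) z * INR (fact m)))%C).

Definition BesselJ (nu : C) (x : R) : C :=
  CSeries (fun k =>
    ((-1) ^ k / INR (fact k))%R *
    (Cpow_pos (x / 2) (RtoC (2 * INR k) + nu) * rgamma (RtoC (INR k) + nu + 1)))%C.

(** Bessel function of the second kind for non-integer order nu:
    Y_nu(x) = (J_nu(x) cos(nu π) - J_{-nu}(x)) / sin(nu π). *)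
Definition BesselY (nu : C) (x : R) : C :=
  ((BesselJ nu x * Ccos (nu * PI) - BesselJ (- nu) x) / Csin (nu * PI))%C.

Definition J0 (y : R) : R :=
  Series (fun k => (-1) ^ k * (y / 2) ^ (2 * k) / (INR (fact k)) ^ 2).

Definition Phi (n : nat) (x : R) : R :=
  x * RInt (fun u => J0 (2 * x * cosh u) * sinh (2 * u) * sin (INR n * u)) 0 PI.

Definition ord (n : nat) : C := (Ci * RtoC (INR n / 2))%C.

Definition fser (a : nat -> C) (x : R) : C :=
  CSeries (fun k => let n := S k in
    (a n * (BesselJ (ord n) x * BesselJ (ord n) x
            + BesselY (ord n) x * BesselY (ord n) x))%C).

(* Main.v *)
Require Import Defs.
From Stdlib Require Import Lra Lia Psatz.

(** Nicholson's formula reads J² + Y² = (8/π²) ∫ K_0(2x sinh s) cos(m s) ds over s > 0 for the order im/2.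
    In the variables ξ = ln x and e^τ = sinh s the right-hand side is the convolution on the line of the kernel
    K_0(2 e^σ) with the bounded symbol cos(m s) tanh s. Both sides solve the third-order equation of products of
    Bessel functions and agree as ξ -> -∞; matching them there needs |Γ(1+im/2)|² and the value
    ∫_0^∞ sin(m s) coth s ds = (π/2) coth(π m/2) (Abel sense), which follow from Euler's product for sinh.

    For a symbol g, Fubini and the Wronskian of J_0(2 x cosh u) and K_0(2 x w) evaluate ∫_0^T Φ_n f in closed
    form; as T -> ∞ it tends to ∫_0^π (∫ g(τ) / (4 (cosh² u + e^{2τ})) dτ) sinh(2u) sin(nu) du. For the symbol of
    order m the inner integral is π sin(m u) / (4 sinh(π m/2) sinh(2u)), so the orthogonality of the sines picks
    out the coefficient with m = n. Since every step is a bounded linear functional of the symbol, the series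
    over m is summed at the level of symbols. *)

(** * Integrals over the line of exponentially dominated functions *)

(** Only real integrals and linear differential equations are used, with no contour integration. So
    Euler's product and the transform of sech² are both drawn from the concentration of high powers
    of cos and sech. The oscillation at ξ -> -∞ must moreover match in phase, not only in modulus:
    beyond |Γ(1+iμ)|² one needs that the Mellin transform of [k2] at 2iμ is Γ(1+iμ)², which is read
    off from Gauss' product by a third concentration argument. The exponents are tied together.
    K_0(2 e^σ) grows only linearly as σ -> -∞ and decays faster than any exponential at +∞, so it is
    O(e^{-3σ/4}); a symbol is O(min(1, e^t)); their product is O(e^{-|t|/4}), and this one rate
    [dec] serves for every integral over the line. A convolution is then O(e^{-3ξ/4}), which beats
    the growth e^{ξ/2} of the ξ-derivative of J_0(e^ξ): the integral over [0, T] converges like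
    T^{-1/4} by size alone, with no cancellation to exploit. *)

Lemma derive_continuous (f : R -> R) (x l : R) : is_derive f x l -> continuous f x.
Proof. intros H. apply (@ex_derive_continuous R_AbsRing R_NormedModule). now exists l. Qed.

Lemma Derive_eta (f : R -> R) (x l : R) : is_derive f x l -> Derive (fun y : R => f y) x = l.
Proof. intros H. now apply is_derive_unique. Qed.

Lemma ex_derive_continuous_R (f : R -> R) (x : R) : ex_derive f x -> continuous f x.
Proof. exact (@ex_derive_continuous R_AbsRing R_NormedModule f x). Qed.

Lemma RInt_correct_cont (f : R -> R) (a b : R) :
  (forall t, continuous f t) -> is_RInt f a b (RInt f a b).
Proof.
  intros H. apply (@RInt_correct R_CompleteNormedModule).
  apply (@ex_RInt_continuous R_CompleteNormedModule). intros; apply H.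
Qed.

Lemma is_RInt_derive_R (F f : R -> R) (a b : R) :
  (forall x, is_derive F x (f x)) -> (forall x, continuous f x) -> is_RInt f a b (F b - F a).
Proof.
  intros H1 H2. apply (is_RInt_derive F f); intros; auto.
Qed.

Definition dec (t : R) : R := exp (- Rabs t / 4).

Definition tame_by (C : R) (f : R -> R) : Prop :=
  (forall t, continuous f t) /\ (forall t, Rabs (f t) <= C * dec t).

Definition tame (f : R -> R) : Prop := exists C, tame_by C f.

(** A total function of the integrand, taken along integer windows. For [tame] integrands
    [IR_approx] shows that the windows are immaterial, so that it is the integral over the line. *)
Definition IR (f : R -> R) : R := real (Lim_seq (fun n => RInt f (- INR n) (INR n))).

Lemma dec_pos (t : R) : 0 < dec t.
Proof. apply exp_pos. Qed.

Lemma dec_opp (t : R) : dec (- t) = dec t.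
Proof. unfold dec. now rewrite Rabs_Ropp. Qed.

Lemma dec_nonneg (t : R) : 0 <= t -> dec t = exp (- t / 4).
Proof. intros H. unfold dec. now rewrite Rabs_pos_eq. Qed.

Lemma dec_neg (t : R) : t <= 0 -> dec t = exp (t / 4).
Proof. intros H. unfold dec. rewrite Rabs_left1 by lra. f_equal; lra. Qed.

Lemma exp_le (a b : R) : a <= b -> exp a <= exp b.
Proof. intros [H|H]; [left; now apply exp_increasing | subst; right; reflexivity]. Qed.

Lemma tame_by_const_pos (C : R) (f : R -> R) : tame_by C f -> 0 <= C.
Proof.
  intros [_ H]. specialize (H 0). pose proof (Rabs_pos (f 0)). pose proof (dec_pos 0).
  nra.
Qed.

Lemma continuous_ex_RInt (f : R -> R) (a b : R) :
  (forall t, continuous f t) -> ex_RInt f a b.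
Proof. intros H. apply (@ex_RInt_continuous R_CompleteNormedModule). intros; apply H. Qed.

Lemma is_RInt_exp_decay (a b : R) :
  is_RInt (fun t => exp (- t / 4)) a b (4 * exp (- a / 4) - 4 * exp (- b / 4)).
Proof.
  replace (4 * exp (- a / 4) - 4 * exp (- b / 4))
    with (minus ((fun t => - 4 * exp (- t / 4)) b) ((fun t => - 4 * exp (- t / 4)) a))
    by (unfold minus, plus, opp; simpl; ring).
  apply (is_RInt_derive (fun t => - 4 * exp (- t / 4)) (fun t => exp (- t / 4))).
  - intros x _. auto_derive; [exact I|]. unfold Rdiv; field.
  - intros x _. apply ex_derive_continuous_R. auto_derive. exact I.
Qed.

(** The factor 4 is the integral of e^{-t/4} over the half-line, the reciprocal of the rate in
    [dec]. *)
Lemma RInt_tail_right (C : R) (f : R -> R) (a b : R) :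
  tame_by C f -> 0 <= a <= b -> Rabs (RInt f a b) <= 4 * C * dec a.
Proof.
  intros Hf Hab. pose proof (tame_by_const_pos C f Hf) as HC. destruct Hf as [Hc Hb].
  pose proof (is_RInt_exp_decay a b) as HI.
  apply (is_RInt_scal _ _ _ C) in HI.
  pose proof (continuous_ex_RInt f a b Hc) as Hex.
  apply Rle_trans with (1 := abs_RInt_le f a b (proj2 Hab) Hex).
  apply Rle_trans with (C * (4 * exp (- a / 4) - 4 * exp (- b / 4))).
  - apply (is_RInt_le (fun t => Rabs (f t)) (fun t => scal C (exp (- t / 4))) a b).
    + lra.
    + apply RInt_correct_cont. intros t. apply continuous_comp; [apply Hc|].
      apply continuous_Rabs.
    + exact HI.
    + intros x Hx. rewrite <- (dec_nonneg x) by lra. apply Hb.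
  - rewrite (dec_nonneg a) by lra. pose proof (exp_pos (- b / 4)). nra.
Qed.

Lemma tame_by_opp_arg (C : R) (f : R -> R) : tame_by C f -> tame_by C (fun t => f (- t)).
Proof.
  intros [Hc Hb]. split.
  - intros t. apply (continuous_comp Ropp f). apply (@continuous_opp R_UniformSpace R_AbsRing R_NormedModule). apply continuous_id. apply Hc.
  - intros t. rewrite <- dec_opp. apply Hb.
Qed.

Lemma RInt_opp_arg (f : R -> R) (a b : R) :
  (forall t, continuous f t) -> RInt f (- b) (- a) = RInt (fun t => f (- t)) a b.
Proof.
  intros Hc.
  assert (H : is_RInt (fun y => scal (-1) (f (-1 * y + 0))) a b (RInt f (-1 * a + 0) (-1 * b + 0))).
  { apply (@is_RInt_comp_lin R_NormedModule). now apply RInt_correct_cont. }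
  replace (-1 * a + 0) with (- a) in H by ring. replace (-1 * b + 0) with (- b) in H by ring.
  apply (is_RInt_scal _ _ _ (-1)) in H.
  rewrite <- (opp_RInt_swap f) by now apply continuous_ex_RInt.
  symmetry. apply is_RInt_unique.
  eapply is_RInt_ext; [|replace (opp (RInt f (- a) (- b))) with (scal (-1) (RInt f (- a) (- b)));
    [exact H|]].
  - intros x _. unfold scal; simpl. unfold mult; simpl.
    replace (-1 * x + 0) with (- x) by ring. ring.
  - unfold scal, opp; simpl. unfold mult; simpl. ring.
Qed.

Lemma RInt_tail_left (C : R) (f : R -> R) (a b : R) :
  tame_by C f -> 0 <= a <= b -> Rabs (RInt f (- b) (- a)) <= 4 * C * dec a.
Proof.
  intros Hf Hab. rewrite RInt_opp_arg by apply Hf.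
  apply RInt_tail_right; [now apply tame_by_opp_arg | assumption].
Qed.

Lemma RInt_window_diff (C : R) (f : R -> R) (a b c d : R) :
  tame_by C f -> 0 <= a <= c -> 0 <= b <= d ->
  Rabs (RInt f (- c) d - RInt f (- a) b) <= 4 * C * (dec a + dec b).
Proof.
  intros Hf Ha Hb.
  assert (He : forall x y, ex_RInt f x y) by (intros; apply continuous_ex_RInt; apply Hf).
  rewrite <- (RInt_Chasles f (- c) (- a) d) by apply He.
  rewrite <- (RInt_Chasles f (- a) b d) by apply He.
  unfold plus; simpl.
  replace (RInt f (- c) (- a) + (RInt f (- a) b + RInt f b d) - RInt f (- a) b)
    with (RInt f (- c) (- a) + RInt f b d) by ring.
  apply Rle_trans with (1 := Rabs_triang _ _).
  pose proof (RInt_tail_left C f a c Hf Ha). pose proof (RInt_tail_right C f b d Hf Hb). lra.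
Qed.

Lemma dec_le (a b : R) : 0 <= a <= b -> dec b <= dec a.
Proof. intros H. rewrite !dec_nonneg by lra. apply exp_le. lra. Qed.

Lemma exp_decay_small (a C eps : R) : 0 < a -> 0 < eps ->
  exists M, forall t, M < t -> C * exp (- a * t) < eps.
Proof.
  intros Ha He. pose proof (Rabs_pos C).
  exists (- ln (eps / (Rabs C + 1)) / a). intros t Ht.
  assert (H1 : exp (- a * t) < eps / (Rabs C + 1)).
  { rewrite <- (exp_ln (eps / (Rabs C + 1))) by (apply Rdiv_lt_0_compat; lra).
    apply exp_increasing.
    apply (Rmult_lt_compat_l a) in Ht; [|lra].
    replace (a * (- ln (eps / (Rabs C + 1)) / a)) with (- ln (eps / (Rabs C + 1))) in Ht
      by (field; lra). lra. }
  pose proof (exp_pos (- a * t)). pose proof (Rle_abs C).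
  apply Rle_lt_trans with ((Rabs C + 1) * exp (- a * t)); [nra|].
  apply (Rmult_lt_compat_l (Rabs C + 1)) in H1; [|lra].
  replace ((Rabs C + 1) * (eps / (Rabs C + 1))) with eps in H1 by (field; lra). exact H1.
Qed.

Lemma is_lim_p_exp (f : R -> R) (l a C M : R) : 0 < a ->
  (forall t, M < t -> Rabs (f t - l) <= C * exp (- a * t)) -> is_lim f p_infty l.
Proof.
  intros Ha H. apply is_lim_spec. intros eps.
  destruct (exp_decay_small a C eps Ha (cond_pos eps)) as [M' HM'].
  exists (Rmax M M'). intros t Ht.
  apply Rle_lt_trans with (2 := HM' t (Rle_lt_trans _ _ _ (Rmax_r M M') Ht)).
  apply H. apply (Rle_lt_trans _ _ _ (Rmax_l M M') Ht).
Qed.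

Lemma is_lim_m_exp (f : R -> R) (l a C M : R) : 0 < a ->
  (forall t, t < M -> Rabs (f t - l) <= C * exp (a * t)) -> is_lim f m_infty l.
Proof.
  intros Ha H. apply is_lim_spec. intros eps.
  destruct (exp_decay_small a C eps Ha (cond_pos eps)) as [M' HM'].
  exists (Rmin M (- M')). intros t Ht.
  apply Rle_lt_trans with (C * exp (a * t)).
  - apply H. apply (Rlt_le_trans _ _ _ Ht (Rmin_l M (- M'))).
  - replace (a * t) with (- a * (- t)) by ring. apply HM'.
    pose proof (Rlt_le_trans _ _ _ Ht (Rmin_r M (- M'))). lra.
Qed.

Lemma dec_small (C eps : R) : 0 < eps -> exists M, 0 <= M /\ forall t, M <= t -> C * dec t < eps.
Proof.
  intros He. destruct (exp_decay_small (1/4) C eps ltac:(lra) He) as [M HM].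
  exists (Rmax 0 (M + 1)). split; [apply Rmax_l|]. intros t Ht.
  pose proof (Rmax_l 0 (M+1)). pose proof (Rmax_r 0 (M+1)).
  rewrite dec_nonneg by lra. replace (- t / 4) with (- (1/4) * t) by lra. apply HM. lra.
Qed.

Lemma is_lim_seq_INR_fun (f : R -> R) (l : Rbar) :
  is_lim f p_infty l -> is_lim_seq (fun n => f (INR n)) l.
Proof.
  intros H. apply (is_lim_comp_seq f INR p_infty l H); [|apply is_lim_seq_INR].
  exists 0%nat. intros; discriminate.
Qed.

Lemma IR_lim_seq (C : R) (f : R -> R) : tame_by C f ->
  is_lim_seq (fun n => RInt f (- INR n) (INR n)) (IR f).
Proof.
  intros Hf. apply Lim_seq_correct'. apply ex_lim_seq_cauchy_corr. intros eps.
  destruct (dec_small (16 * C) eps (cond_pos eps)) as [M [HM0 HM]].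
  destruct (INR_unbounded M) as [N HN].
  pose proof (tame_by_const_pos C f Hf) as HC.
  assert (Hw : forall n, (N <= n)%nat ->
    Rabs (RInt f (- INR n) (INR n) - RInt f (- INR N) (INR N)) <= 8 * C * dec M).
  { intros n Hn. apply le_INR in Hn.
    apply Rle_trans with (1 := RInt_window_diff C f (INR N) (INR N) (INR n) (INR n) Hf
       (conj (pos_INR N) Hn) (conj (pos_INR N) Hn)).
    pose proof (dec_le M (INR N) ltac:(lra)). nra. }
  exists N. intros n m Hn Hm.
  apply Rle_lt_trans with (2 := HM M (Rle_refl M)).
  pose proof (Hw n Hn) as H1. pose proof (Hw m Hm) as H2.
  apply Rabs_le_between in H1. apply Rabs_le_between in H2. apply Rabs_le. lra.
Qed.

Lemma IR_approx (C : R) (f : R -> R) (a b : R) : tame_by C f -> 0 <= a -> 0 <= b ->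
  Rabs (IR f - RInt f (- a) b) <= 4 * C * (dec a + dec b).
Proof.
  intros Hf Ha Hb.
  assert (H : is_lim_seq (fun n => Rabs (RInt f (- INR n) (INR n) - RInt f (- a) b))
                (Rabs (IR f - RInt f (- a) b))).
  { apply (is_lim_seq_abs (fun n => _ - _) (Finite (IR f - RInt f (- a) b))).
    apply is_lim_seq_minus'; [apply (IR_lim_seq C f Hf) | apply is_lim_seq_const]. }
  eapply (is_lim_seq_le_loc _ (fun _ => 4 * C * (dec a + dec b)) (Rabs _)
    (4 * C * (dec a + dec b))); [|exact H|apply is_lim_seq_const].
  destruct (INR_unbounded (Rmax a b)) as [N HN]. exists N. intros n Hn. apply le_INR in Hn.
  pose proof (Rmax_l a b). pose proof (Rmax_r a b).
  apply RInt_window_diff; [assumption|lra|lra].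
Qed.

Lemma dec_0 : dec 0 = 1.
Proof. unfold dec. rewrite Rabs_R0, <- exp_0. f_equal. lra. Qed.

(** The empty window leaves two tails of size 4C each. Every operator bound below is an instance of
    this one. *)
Lemma IR_bound (C : R) (f : R -> R) : tame_by C f -> Rabs (IR f) <= 8 * C.
Proof.
  intros Hf. pose proof (IR_approx C f 0 0 Hf (Rle_refl 0) (Rle_refl 0)) as H.
  rewrite Ropp_0, RInt_point, dec_0 in H. unfold zero in H; simpl in H.
  rewrite Rminus_0_r in H. lra.
Qed.

Lemma IR_unique (C : R) (f : R -> R) (l : R) : tame_by C f ->
  is_lim_seq (fun n => RInt f (- INR n) (INR n)) l -> IR f = l.
Proof. intros _ H. unfold IR. now rewrite (is_lim_seq_unique _ _ H). Qed.

Lemma IR_ext (f g : R -> R) : (forall t, f t = g t) -> IR f = IR g.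
Proof.
  intros H. unfold IR. f_equal. apply Lim_seq_ext. intros n. apply RInt_ext. intros; apply H.
Qed.

Lemma tame_by_ext (C : R) (f g : R -> R) : (forall t, f t = g t) -> tame_by C f -> tame_by C g.
Proof.
  intros H [Hc Hb]. split.
  - intros t. apply (continuous_ext f); auto.
  - intros t. rewrite <- H. auto.
Qed.

Lemma tame_by_plus (C D : R) (f g : R -> R) :
  tame_by C f -> tame_by D g -> tame_by (C + D) (fun t => f t + g t).
Proof.
  intros [Hc Hb] [Hc' Hb']. split.
  - intros t. apply (@continuous_plus R_UniformSpace R_AbsRing R_NormedModule); auto.
  - intros t. apply Rle_trans with (1 := Rabs_triang _ _).
    specialize (Hb t). specialize (Hb' t). lra.
Qed.

Lemma tame_by_scal (C c : R) (f : R -> R) :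
  tame_by C f -> tame_by (Rabs c * C) (fun t => c * f t).
Proof.
  intros [Hc Hb]. split.
  - intros t. apply (@continuous_scal_r R_UniformSpace R_AbsRing R_NormedModule). auto.
  - intros t. rewrite Rabs_mult, Rmult_assoc. apply Rmult_le_compat_l; auto. apply Rabs_pos.
Qed.

Lemma tame_plus (f g : R -> R) : tame f -> tame g -> tame (fun t => f t + g t).
Proof. intros [C HC] [D HD]. eexists. now apply tame_by_plus; eassumption. Qed.

Lemma tame_scal (c : R) (f : R -> R) : tame f -> tame (fun t => c * f t).
Proof. intros [C HC]. eexists. apply tame_by_scal; eassumption. Qed.

Lemma tame_ext (f g : R -> R) : (forall t, f t = g t) -> tame f -> tame g.
Proof. intros H [C HC]. exists C. eapply tame_by_ext; eassumption. Qed.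

Lemma tame_minus (f g : R -> R) : tame f -> tame g -> tame (fun t => f t - g t).
Proof.
  intros Hf Hg. apply (tame_ext (fun t => f t + (-1) * g t)); [intros; ring|].
  apply tame_plus; auto. now apply tame_scal.
Qed.

Lemma IR_plus (f g : R -> R) : tame f -> tame g ->
  IR (fun t => f t + g t) = IR f + IR g.
Proof.
  intros [C HC] [D HD]. apply (IR_unique (C + D)). now apply tame_by_plus.
  apply (is_lim_seq_ext (fun n => RInt f (- INR n) (INR n) + RInt g (- INR n) (INR n))).
  - intros n. symmetry. apply (@RInt_plus R_CompleteNormedModule); apply continuous_ex_RInt; [apply HC|apply HD].
  - apply is_lim_seq_plus'; [apply (IR_lim_seq C f HC) | apply (IR_lim_seq D g HD)].
Qed.

Lemma IR_scal (c : R) (f : R -> R) : tame f -> IR (fun t => c * f t) = c * IR f.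
Proof.
  intros [C HC]. apply (IR_unique (Rabs c * C)). now apply tame_by_scal.
  apply (is_lim_seq_ext (fun n => c * RInt f (- INR n) (INR n))).
  - intros n. symmetry. apply (@RInt_scal R_CompleteNormedModule). apply continuous_ex_RInt, HC.
  - apply (is_lim_seq_scal_l _ c (Finite (IR f))). apply (IR_lim_seq C f HC).
Qed.

Lemma IR_minus (f g : R -> R) : tame f -> tame g ->
  IR (fun t => f t - g t) = IR f - IR g.
Proof.
  intros Hf Hg. rewrite (IR_ext _ (fun t => f t + (-1) * g t)) by (intros; ring).
  rewrite IR_plus, IR_scal; auto. ring. now apply tame_scal.
Qed.

Lemma IR_nonneg (f : R -> R) : tame f -> (forall t, 0 <= f t) -> 0 <= IR f.
Proof.
  intros [C HC] H.
  apply (is_lim_seq_le (fun _ => 0) (fun n => RInt f (- INR n) (INR n)) 0 (IR f)).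
  - intros n. apply RInt_ge_0; [pose proof (pos_INR n); lra| |intros; apply H].
    apply continuous_ex_RInt, HC.
  - apply is_lim_seq_const.
  - apply (IR_lim_seq C f HC).
Qed.

Lemma IR_le (f g : R -> R) : tame f -> tame g -> (forall t, f t <= g t) -> IR f <= IR g.
Proof.
  intros Hf Hg H.
  assert (H0 : 0 <= IR (fun t => g t - f t)).
  { apply IR_nonneg. now apply tame_minus. intros t. specialize (H t). lra. }
  rewrite IR_minus in H0; auto. lra.
Qed.

Lemma IR_abs_le (f g : R -> R) : tame f -> tame g ->
  (forall t, Rabs (f t) <= g t) -> Rabs (IR f) <= IR g.
Proof.
  intros Hf Hg H. apply Rabs_le. split.
  - assert (IR (fun t => (-1) * g t) <= IR f).
    { apply IR_le; auto. now apply tame_scal. intros t. specialize (H t).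
      apply Rabs_le_between in H. lra. }
    rewrite IR_scal in H0; auto. lra.
  - apply IR_le; auto. intros t. specialize (H t). apply Rabs_le_between in H. lra.
Qed.

Lemma IR_FTC (F f : R -> R) (la lb : R) : tame f ->
  (forall t, is_derive F t (f t)) -> is_lim F p_infty lb -> is_lim F m_infty la ->
  IR f = lb - la.
Proof.
  intros [C HC] HF Hb Ha. apply (IR_unique C f _ HC).
  apply (is_lim_seq_ext (fun n => F (INR n) - F (- INR n))).
  - intros n. symmetry. apply is_RInt_unique. apply is_RInt_derive_R; [apply HF|apply HC].
  - apply is_lim_seq_minus'.
    + now apply is_lim_seq_INR_fun.
    + apply (is_lim_comp_seq F (fun n => - INR n) m_infty la Ha).
      * exists 0%nat. intros; discriminate.
      * apply (is_lim_seq_opp INR p_infty), is_lim_seq_INR.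
Qed.

Lemma tame_lim_0 (f : R -> R) : tame f -> is_lim f p_infty 0 /\ is_lim f m_infty 0.
Proof.
  intros [C [_ HC]]. split.
  - apply (is_lim_p_exp f 0 (1/4) C 0); [lra|]. intros t Ht. rewrite Rminus_0_r.
    apply Rle_trans with (1 := HC t). rewrite dec_nonneg by lra.
    right. do 2 f_equal. lra.
  - apply (is_lim_m_exp f 0 (1/4) C 0); [lra|]. intros t Ht. rewrite Rminus_0_r.
    apply Rle_trans with (1 := HC t). rewrite dec_neg by lra.
    right. do 2 f_equal. lra.
Qed.

(** The form in which all integrations by parts over the line are carried out: the combined
    integrand is exhibited as the derivative of a [tame] function, so no boundary terms remain. *)
Lemma IR_derive_zero (F f : R -> R) : tame F -> tame f ->
  (forall t, is_derive F t (f t)) -> IR f = 0.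
Proof.
  intros HF Hf H. destruct (tame_lim_0 F HF). rewrite (IR_FTC F f 0 0); auto. ring.
Qed.

Lemma tame_shift (f : R -> R) (c : R) : tame f -> tame (fun t => f (t + c)).
Proof.
  intros [C [Hc Hb]]. exists (C * exp (Rabs c / 4)). split.
  - intros t. apply (continuous_comp (fun t => t + c) f); [|apply Hc].
    apply (@continuous_plus R_UniformSpace R_AbsRing R_NormedModule); [apply continuous_id|apply continuous_const].
  - intros t. apply Rle_trans with (1 := Hb (t + c)).
    pose proof (tame_by_const_pos C f (conj Hc Hb)).
    rewrite Rmult_assoc. apply Rmult_le_compat_l; auto. unfold dec. rewrite <- exp_plus.
    apply exp_le. pose proof (Rabs_triang_inv t (- c)).
    unfold Rminus in H0. rewrite Ropp_involutive, Rabs_Ropp in H0. lra.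
Qed.

Lemma RInt_shift (f : R -> R) (a b c : R) : (forall t, continuous f t) ->
  RInt (fun t => f (t + c)) a b = RInt f (a + c) (b + c).
Proof.
  intros Hc. rewrite <- (Rmult_1_l a) at 2. rewrite <- (Rmult_1_l b) at 2.
  rewrite <- (RInt_comp_lin f 1 c a b) by now apply continuous_ex_RInt.
  apply RInt_ext. intros x _. unfold scal; simpl; unfold mult; simpl. rewrite !Rmult_1_l. reflexivity.
Qed.

Lemma IR_shift (f : R -> R) (c : R) : tame f -> IR (fun t => f (t + c)) = IR f.
Proof.
  intros Hf. destruct (tame_shift f c Hf) as [D HD]. destruct Hf as [C HC].
  apply (IR_unique D _ _ HD). apply is_lim_seq_spec. intros eps.
  destruct (dec_small (8 * C) eps (cond_pos eps)) as [M [HM0 HM]].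
  destruct (INR_unbounded (M + Rabs c)) as [N HN]. exists N. intros n Hn. apply le_INR in Hn.
  rewrite RInt_shift by apply HC. rewrite <- Rabs_Ropp, Ropp_minus_distr.
  pose proof (Rle_abs c). pose proof (Rle_abs (- c)). rewrite Rabs_Ropp in H0.
  replace (- INR n + c) with (- (INR n - c)) by ring.
  apply Rle_lt_trans with (1 := IR_approx C f (INR n - c) (INR n + c) HC ltac:(lra) ltac:(lra)).
  pose proof (HM (INR n - c) ltac:(lra)). pose proof (HM (INR n + c) ltac:(lra)). lra.
Qed.

(** * Differentiation under the integral sign *)

Lemma derive_remainder (f f1 f2 : R -> R) (x0 h C : R) :
  (forall x, is_derive f x (f1 x)) -> (forall x, is_derive f1 x (f2 x)) ->
  (forall x, Rabs (x - x0) <= Rabs h -> Rabs (f2 x) <= C) ->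
  Rabs (f (x0 + h) - f x0 - h * f1 x0) <= C * h ^ 2.
Proof.
  intros H1 H2 HC.
  destruct (MVT_cor4 f f1 x0 (Rabs h) (fun c _ => H1 c) (x0 + h)) as [c [Hc Hc']].
  { replace (x0 + h - x0) with h by ring. lra. }
  destruct (MVT_cor4 f1 f2 x0 (Rabs h) (fun c _ => H2 c) c) as [d [Hd Hd']].
  { replace (x0 + h - x0) with h in Hc' by ring. lra. }
  replace (x0 + h - x0) with h in * by ring.
  replace (f (x0 + h) - f x0 - h * f1 x0) with (f2 d * (c - x0) * h)
    by (rewrite <- Hd, Hc; ring).
  rewrite !Rabs_mult. rewrite <- pow2_abs.
  specialize (HC d ltac:(lra)). pose proof (Rabs_pos (f2 d)). pose proof (Rabs_pos h).
  pose proof (Rabs_pos (c - x0)).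
  assert (Rabs (f2 d) * Rabs (c - x0) <= C * Rabs h) by nra. nra.
Qed.

Lemma is_derive_quadratic (F : R -> R) (x0 l C : R) :
  (forall h, Rabs h <= 1 -> Rabs (F (x0 + h) - F x0 - h * l) <= C * h ^ 2) ->
  is_derive F x0 l.
Proof.
  intros H. apply is_derive_Reals. intros eps Heps.
  assert (HC : 0 < Rabs C + 1) by (pose proof (Rabs_pos C); lra).
  assert (Hd : 0 < Rmin 1 (eps / (Rabs C + 1))).
  { apply Rmin_pos; [lra|]. apply Rdiv_lt_0_compat; lra. }
  exists (mkposreal _ Hd). intros h Hh0 Hh. simpl in Hh.
  pose proof (Rlt_le_trans _ _ _ Hh (Rmin_l _ _)) as Ha.
  pose proof (Rlt_le_trans _ _ _ Hh (Rmin_r _ _)) as Hb.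
  specialize (H h ltac:(lra)).
  replace ((F (x0 + h) - F x0) / h - l) with ((F (x0 + h) - F x0 - h * l) / h) by (field; auto).
  unfold Rdiv. rewrite Rabs_mult, Rabs_inv. pose proof (Rabs_pos_lt h Hh0) as Hp.
  apply (Rmult_lt_reg_r (Rabs h)); [assumption|].
  rewrite Rmult_assoc, Rinv_l, Rmult_1_r by lra.
  apply Rle_lt_trans with (1 := H). rewrite <- pow2_abs.
  apply (Rmult_lt_compat_r (Rabs C + 1)) in Hb; [|assumption].
  unfold Rdiv in Hb. rewrite Rmult_assoc, Rinv_l, Rmult_1_r in Hb by lra.
  pose proof (Rle_abs C). nra.
Qed.

(** A bound on the second derivative that is uniform for |x - x0| <= 1 makes the Taylor remainder at
    most C h² [dec] t, which integrates to 8 C h². This takes the place of dominated convergence. *)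
Lemma IR_derive (f f1 f2 : R -> R -> R) (x0 C : R) :
  (forall t x, is_derive (fun x => f x t) x (f1 x t)) ->
  (forall t x, is_derive (fun x => f1 x t) x (f2 x t)) ->
  (forall x t, Rabs (x - x0) <= 1 -> Rabs (f2 x t) <= C * dec t) ->
  (forall x, tame (f x)) -> tame (f1 x0) ->
  is_derive (fun x => IR (f x)) x0 (IR (f1 x0)).
Proof.
  intros H1 H2 HC Hf Hf1. apply (is_derive_quadratic _ _ _ (8 * C)). intros h Hh.
  rewrite <- IR_scal by assumption.
  rewrite <- IR_minus by apply Hf.
  rewrite <- IR_minus; [|apply tame_minus; apply Hf|now apply tame_scal].
  replace (8 * C * h ^ 2) with (8 * (C * h ^ 2)) by ring. apply IR_bound. split.
  - destruct (tame_minus (fun t => f (x0 + h) t - f x0 t) (fun t => h * f1 x0 t)) as [D HD];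
    [apply tame_minus; apply Hf|now apply tame_scal|apply HD].
  - intros t. apply Rle_trans with (C * dec t * h ^ 2); [|right; ring].
    apply (derive_remainder (fun x => f x t) (fun x => f1 x t) (fun x => f2 x t)); auto.
    intros x Hx. apply HC. lra.
Qed.

Lemma incr_of_derive (f f' : R -> R) (a b : R) : a <= b ->
  (forall x, a <= x <= b -> is_derive f x (f' x)) ->
  (forall x, a <= x <= b -> 0 <= f' x) -> f a <= f b.
Proof.
  intros Hab H1 H2.
  destruct (MVT_gen f a b f') as [c [Hc Heq]].
  - intros x. rewrite Rmin_left, Rmax_right by lra. intros. apply H1. lra.
  - intros x. rewrite Rmin_left, Rmax_right by lra. intros Hx.
    apply continuity_pt_filterlim. apply (derive_continuous f x (f' x)). now apply H1.
  - rewrite Rmin_left, Rmax_right in Hc by lra.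
    specialize (H2 c Hc). nra.
Qed.

(** * Hyperbolic identities and inequalities *)

Lemma is_derive_cosh (x : R) : is_derive cosh x (sinh x).
Proof. apply is_derive_Reals, derivable_pt_lim_cosh. Qed.

Lemma is_derive_sinh (x : R) : is_derive sinh x (cosh x).
Proof. apply is_derive_Reals, derivable_pt_lim_sinh. Qed.

Lemma cosh2_sinh2 (x : R) : cosh x ^ 2 = 1 + sinh x ^ 2.
Proof. unfold cosh, sinh. pose proof (exp_plus x (- x)) as H. rewrite Rplus_opp_r, exp_0 in H. nra. Qed.

Lemma cosh_double (x : R) : cosh (2 * x) = 1 + 2 * sinh x ^ 2.
Proof.
  unfold cosh, sinh. replace (2 * x) with (x + x) by ring.
  replace (- (x + x)) with (- x + - x) by ring. rewrite !exp_plus.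
  pose proof (exp_plus x (- x)) as H. rewrite Rplus_opp_r, exp_0 in H. nra.
Qed.

Lemma sinh_double (x : R) : sinh (2 * x) = 2 * sinh x * cosh x.
Proof.
  unfold cosh, sinh. replace (2 * x) with (x + x) by ring.
  replace (- (x + x)) with (- x + - x) by ring. rewrite !exp_plus. field.
Qed.

Lemma cosh_pos (x : R) : 0 < cosh x.
Proof. unfold cosh. pose proof (exp_pos x). pose proof (exp_pos (- x)). lra. Qed.

Lemma cosh_ge_1 (x : R) : 1 <= cosh x.
Proof. pose proof (cosh2_sinh2 x). pose proof (cosh_pos x). nra. Qed.

Lemma cosh_even (x : R) : cosh (- x) = cosh x.
Proof. unfold cosh. rewrite Ropp_involutive. lra. Qed.

Lemma sinh_odd (x : R) : sinh (- x) = - sinh x.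
Proof. unfold sinh. rewrite Ropp_involutive. lra. Qed.

Lemma sinh_ge_id (x : R) : 0 <= x -> x <= sinh x.
Proof.
  intros H. enough (sinh 0 - 0 <= sinh x - x) by (rewrite sinh_0 in *; lra).
  apply (incr_of_derive (fun x => sinh x - x) (fun x => cosh x - 1)); [assumption| |].
  - intros t _. apply (is_derive_minus sinh (fun t => t)); [apply is_derive_sinh|apply @is_derive_id].
  - intros t _. pose proof (cosh_ge_1 t). lra.
Qed.

Lemma sinh_pos (x : R) : 0 < x -> 0 < sinh x.
Proof. intros H. pose proof (sinh_ge_id x). lra. Qed.

Lemma sinh_nonneg (x : R) : 0 <= x -> 0 <= sinh x.
Proof. intros H. pose proof (sinh_ge_id x). lra. Qed.

Lemma sinh_le_id_cosh (x : R) : 0 <= x -> sinh x <= x * cosh x.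
Proof.
  intros H. enough (0 * cosh 0 - sinh 0 <= x * cosh x - sinh x) by (rewrite sinh_0 in *; lra).
  apply (incr_of_derive (fun x => x * cosh x - sinh x) (fun x => x * sinh x)); [assumption| |].
  - intros t _. replace (t * sinh t) with ((1 * cosh t + t * sinh t) - cosh t) by ring.
    apply (is_derive_minus (fun t => t * cosh t) sinh); [|apply is_derive_sinh].
    apply (is_derive_mult (fun t => t) cosh); [apply @is_derive_id|apply is_derive_cosh|].
    intros; apply Rmult_comm.
  - intros t Ht. pose proof (sinh_nonneg t). nra.
Qed.

Lemma cosh_incr (x y : R) : 0 <= x <= y -> cosh x <= cosh y.
Proof.
  intros H. apply (incr_of_derive cosh sinh); [lra| |].
  - intros; apply is_derive_cosh.
  - intros; apply sinh_nonneg; lra.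
Qed.

Lemma cosh_ge_exp_abs (t : R) : exp (Rabs t) / 2 <= cosh t.
Proof.
  unfold cosh. pose proof (exp_pos t). pose proof (exp_pos (- t)).
  unfold Rabs. destruct Rcase_abs; lra.
Qed.

Lemma inv_cosh_le_dec (t : R) : / cosh t <= 2 * dec t.
Proof.
  pose proof (cosh_ge_exp_abs t). pose proof (exp_pos (Rabs t)).
  apply Rle_trans with (/ (exp (Rabs t) / 2)).
  - apply Rinv_le_contravar; lra.
  - rewrite Rinv_div. unfold Rdiv. rewrite <- exp_Ropp. unfold dec.
    pose proof (exp_le (- Rabs t) (- Rabs t / 4)). pose proof (Rabs_pos t). lra.
Qed.

(** * Euler's product for sinh *)

Fixpoint sinhprod (mu : R) (N : nat) : R :=
  match N with
  | O => 1
  | S k => sinhprod mu k * (1 + mu ^ 2 / INR (S k) ^ 2)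
  end.

Lemma sinhprod_ge_1 (mu : R) (N : nat) : 1 <= sinhprod mu N.
Proof.
  induction N; [simpl; lra|].
  change (sinhprod mu (S N)) with (sinhprod mu N * (1 + mu ^ 2 / INR (S N) ^ 2)).
  assert (0 <= mu ^ 2 / INR (S N) ^ 2).
  { apply Rdiv_le_0_compat; [nra|]. apply pow_lt. apply lt_0_INR; lia. }
  nra.
Qed.

(** [∫ cosh(2μt) cos^{2k} t dt]: integrating by parts twice relates consecutive [k], and as
    [k -> ∞] the mass concentrates at [0], where [cosh] is [1]; this yields Euler's product. *)
Definition wallis (mu : R) (k : nat) : R :=
  RInt (fun t => cosh (2 * mu * t) * cos t ^ (2 * k)) 0 (PI / 2).

Lemma is_derive_cosh_lin (c t : R) : is_derive (fun t => cosh (c * t)) t (c * sinh (c * t)).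
Proof.
  unfold cosh, sinh. auto_derive; [exact I|]. field.
Qed.

Lemma is_derive_sinh_lin (c t : R) : is_derive (fun t => sinh (c * t)) t (c * cosh (c * t)).
Proof.
  unfold cosh, sinh. auto_derive; [exact I|]. field.
Qed.

Lemma wallis_continuous (mu : R) (k : nat) (t : R) :
  continuous (fun t => cosh (2 * mu * t) * cos t ^ (2 * k)) t.
Proof. apply ex_derive_continuous_R. unfold cosh. auto_derive. exact I. Qed.

Lemma wallis_step (mu : R) (j : nat) :
  (4 * INR (S j) ^ 2 + 4 * mu ^ 2) * wallis mu (S j) =
  2 * INR (S j) * (2 * INR (S j) - 1) * wallis mu j.
Proof.
  set (k := INR (S j)).
  (* Green's formula: [G] is f w' - f' w for f = cosh(2μt) and w = cos^{2k} t. It vanishes at 0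
     through sin and sinh, and at π/2 through the powers of cos. *)
  set (G := fun t => cosh (2 * mu * t) * (- (2 * k) * cos t ^ (2 * j + 1) * sin t)
     - 2 * mu * sinh (2 * mu * t) * cos t ^ (2 * (S j))).
  set (g := fun t => (2 * k * (2 * k - 1)) * (cosh (2 * mu * t) * cos t ^ (2 * j))
     - (4 * k ^ 2 + 4 * mu ^ 2) * (cosh (2 * mu * t) * cos t ^ (2 * (S j)))).
  assert (HG : forall t, is_derive G t (g t)).
  { intros t. unfold G, g, cosh, sinh.
    replace (2 * j + 1)%nat with (S (2 * j)) by lia.
    replace (2 * S j)%nat with (S (S (2 * j))) by lia.
    auto_derive; [repeat split|].
    change (match (j + (j + 0))%nat with 0%nat => 1 | S _ => INR (j + (j + 0)) + 1 end)
      with (INR (S (j + (j + 0)))).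
    replace (INR (S (j + (j + 0)))) with (2 * k - 1)
      by (unfold k; rewrite !S_INR, !plus_INR; simpl; ring).
    simpl (cos t ^ S (S (2 * j))). simpl (cos t ^ (2 * j)).
    assert (Hs : sin t * sin t = 1 - cos t * cos t)
      by (pose proof (sin2_cos2 t) as H; unfold Rsqr in H; lra).
    unfold Rdiv. assert (Hh : 2 * / 2 = 1) by lra. generalize dependent (/ 2). intros h Hh.
    ring [Hs Hh]. }
  assert (Hgc : forall t, continuous g t).
  { intros t. unfold g. apply (@continuous_minus R_UniformSpace R_AbsRing R_NormedModule);
    apply (@continuous_scal_r R_UniformSpace R_AbsRing R_NormedModule); apply wallis_continuous. }
  pose proof (is_RInt_derive_R G g 0 (PI / 2) HG Hgc) as H1.
  assert (H2 : is_RInt g 0 (PI / 2) ((2 * k * (2 * k - 1)) * wallis mu j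
     - (4 * k ^ 2 + 4 * mu ^ 2) * wallis mu (S j))).
  { apply (@is_RInt_minus R_NormedModule); apply (@is_RInt_scal R_NormedModule);
    apply RInt_correct_cont; intros; apply wallis_continuous. }
  apply (@is_RInt_unique R_CompleteNormedModule) in H1.
  apply (@is_RInt_unique R_CompleteNormedModule) in H2. rewrite H1 in H2.
  unfold G in H2. rewrite cos_PI2, sin_0, !Rmult_0_r, sinh_0 in H2.
  rewrite !pow_i in H2 by lia. fold k. lra.
Qed.

Lemma wallis_pos (mu : R) (k : nat) : 0 < wallis mu k.
Proof.
  pose proof PI_RGT_0.
  apply RInt_gt_0; [lra| |intros; apply wallis_continuous].
  intros x Hx. apply Rmult_lt_0_compat; [apply cosh_pos|]. apply pow_lt, cos_gt_0; lra.
Qed.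

Lemma id_cos_le_sin (t : R) : 0 <= t <= PI -> t * cos t <= sin t.
Proof.
  intros H. enough (sin 0 - 0 * cos 0 <= sin t - t * cos t) by (rewrite sin_0 in *; lra).
  apply (incr_of_derive (fun t => sin t - t * cos t) (fun t => t * sin t)); [lra| |].
  - intros x _. auto_derive; [exact I|]. ring.
  - intros x Hx. pose proof (sin_ge_0 x). nra.
Qed.

Lemma cosh_minus_1_le (x : R) : 0 <= x -> cosh x - 1 <= x ^ 2 / 2 * cosh (x / 2) ^ 2.
Proof.
  intros H. replace x with (2 * (x / 2)) at 1 by field. rewrite cosh_double.
  pose proof (sinh_le_id_cosh (x / 2) ltac:(lra)). pose proof (sinh_nonneg (x / 2) ltac:(lra)).
  assert (sinh (x / 2) ^ 2 <= (x / 2 * cosh (x / 2)) ^ 2) by nra. nra.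
Qed.

(** The inequality t <= tan t gives t² cos² t <= 1 - cos² t, and cosh(2μt) - 1 <= B t² with B as in
    the bound. So the excess over the case μ = 0 is at most B times the difference of two
    consecutive integrals with μ = 0, and the recurrence evaluates that difference as the later
    integral divided by 2k - 1. *)
Lemma wallis_ratio (mu : R) (j : nat) : 0 < mu ->
  0 <= wallis mu (S j) / wallis 0 (S j) - 1 <=
    2 * mu ^ 2 * cosh (mu * (PI / 2)) ^ 2 / (2 * INR (S j) - 1).
Proof.
  intros Hmu. pose proof PI_RGT_0.
  pose proof (wallis_pos 0 (S j)) as Hp.
  set (k := INR (S j)).
  assert (Hk : 1 <= k) by (unfold k; rewrite S_INR; pose proof (pos_INR j); lra).
  set (B := 2 * mu ^ 2 * cosh (mu * (PI / 2)) ^ 2).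
  assert (Hw : forall t, cosh (2 * 0 * t) = 1).
  { intros t. replace (2 * 0 * t) with 0 by ring. apply cosh_0. }
  assert (HB : wallis mu (S j) - wallis 0 (S j) <= B * (wallis 0 j - wallis 0 (S j))).
  { assert (H1 : is_RInt (fun t => minus (cosh (2 * mu * t) * cos t ^ (2 * S j))
        (cosh (2 * 0 * t) * cos t ^ (2 * S j))) 0 (PI / 2) (wallis mu (S j) - wallis 0 (S j))).
    { apply (@is_RInt_minus R_NormedModule); apply RInt_correct_cont; intros; apply wallis_continuous. }
    assert (H2 : is_RInt (fun t => scal B (minus (cosh (2 * 0 * t) * cos t ^ (2 * j))
        (cosh (2 * 0 * t) * cos t ^ (2 * S j)))) 0 (PI / 2) (B * (wallis 0 j - wallis 0 (S j)))).
    { apply (@is_RInt_scal R_NormedModule), (@is_RInt_minus R_NormedModule);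
      apply RInt_correct_cont; intros; apply wallis_continuous. }
    apply (is_RInt_le _ _ 0 (PI / 2) _ _ ltac:(lra) H1 H2).
    intros t Ht.
    change (cosh (2 * mu * t) * cos t ^ (2 * S j) - cosh (2 * 0 * t) * cos t ^ (2 * S j) <=
      B * (cosh (2 * 0 * t) * cos t ^ (2 * j) - cosh (2 * 0 * t) * cos t ^ (2 * S j))).
    rewrite !Hw.
    replace (2 * S j)%nat with (S (S (2 * j))) by lia.
    change (cos t ^ S (S (2 * j))) with (cos t * (cos t * cos t ^ (2 * j))).
    set (c := cos t ^ (2 * j)).
    assert (Hc : 0 <= c) by (apply pow_le, cos_ge_0; lra).
    pose proof (id_cos_le_sin t ltac:(lra)) as Hs.
    pose proof (cos_ge_0 t ltac:(lra) ltac:(lra)) as Hcos.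
    pose proof (cosh_minus_1_le (2 * mu * t) ltac:(nra)) as Hch.
    replace (2 * mu * t / 2) with (mu * t) in Hch by field.
    pose proof (cosh_incr (mu * t) (mu * (PI / 2)) ltac:(nra)) as Hci.
    pose proof (cosh_pos (mu * t)) as Hcp.
    assert (Hs2 : t ^ 2 * (cos t * cos t) <= 1 - cos t * cos t).
    { pose proof (sin2_cos2 t) as H0. unfold Rsqr in H0.
      assert (0 <= t * cos t) by nra. nra. }
    assert (Hc2 : cosh (mu * t) ^ 2 <= cosh (mu * (PI / 2)) ^ 2) by nra.
    assert (Hfin : cosh (2 * mu * t) - 1 <= B * t ^ 2).
    { unfold B. apply Rle_trans with (1 := Hch).
      replace ((2 * mu * t) ^ 2 / 2) with (2 * (mu * t) ^ 2) by field.
      pose proof (pow2_ge_0 (mu * t)). nra. }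
    assert (HBp : 0 <= B) by (unfold B; pose proof (pow2_ge_0 mu); pose proof (pow2_ge_0 (cosh (mu * (PI/2)))); nra).
    assert (Hcc : 0 <= cos t * cos t) by nra.
    apply Rle_trans with ((B * t ^ 2) * (cos t * cos t * c)).
    - replace (cosh (2 * mu * t) * (cos t * (cos t * c)) - 1 * (cos t * (cos t * c)))
        with ((cosh (2 * mu * t) - 1) * (cos t * cos t * c)) by ring.
      apply Rmult_le_compat_r; [apply Rmult_le_pos; lra|assumption].
    - replace (B * t ^ 2 * (cos t * cos t * c)) with (B * (t ^ 2 * (cos t * cos t)) * c) by ring.
      replace (B * (1 * c - 1 * (cos t * (cos t * c)))) with (B * (1 - cos t * cos t) * c) by ring.
      apply Rmult_le_compat_r; [lra|]. now apply Rmult_le_compat_l. }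
  pose proof (wallis_step 0 j) as Hst. fold k in Hst.
  assert (Hst' : wallis 0 j - wallis 0 (S j) = wallis 0 (S j) / (2 * k - 1)).
  { apply (Rmult_eq_reg_l (2 * k * (2 * k - 1))); [|nra].
    rewrite Rmult_minus_distr_l, <- Hst. field. lra. }
  split.
  - apply Rmult_le_reg_r with (wallis 0 (S j)); [assumption|].
    unfold Rdiv. rewrite Rmult_minus_distr_r, Rmult_assoc, Rinv_l by lra.
    enough (wallis 0 (S j) <= wallis mu (S j)) by lra.
    apply RInt_le; [lra| | |].
    1,2: apply continuous_ex_RInt; intros; apply wallis_continuous.
    intros t Ht. apply Rmult_le_compat_r; [apply pow_le, cos_ge_0; lra|].
    rewrite Hw. apply cosh_ge_1.
  - apply Rmult_le_reg_r with (wallis 0 (S j)); [assumption|].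
    unfold Rdiv. rewrite Rmult_minus_distr_r, Rmult_assoc, Rinv_l by lra.
    rewrite Hst' in HB. fold B. unfold Rdiv in HB. lra.
Qed.

(** Dividing the recurrence for μ by the one for 0 leaves one factor 1 + μ²/k² of Euler's product
    per step. *)
Lemma wallis_product (mu : R) (N : nat) :
  wallis mu 0 / wallis 0 0 = sinhprod mu N * (wallis mu N / wallis 0 N).
Proof.
  induction N as [|N IH]; [simpl; ring|]. rewrite IH.
  change (sinhprod mu (S N)) with (sinhprod mu N * (1 + mu ^ 2 / INR (S N) ^ 2)).
  rewrite Rmult_assoc. f_equal.
  pose proof (wallis_step mu N) as H1. pose proof (wallis_step 0 N) as H2.
  pose proof (wallis_pos 0 N). pose proof (wallis_pos 0 (S N)).
  set (k := INR (S N)) in *.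
  assert (Hk : 1 <= k) by (unfold k; rewrite S_INR; pose proof (pos_INR N); lra).
  apply (Rmult_eq_reg_l (2 * k * (2 * k - 1))); [|nra].
  apply (Rmult_eq_reg_r (wallis 0 N)); [|lra].
  replace (2 * k * (2 * k - 1) * (wallis mu N / wallis 0 N) * wallis 0 N)
    with (2 * k * (2 * k - 1) * wallis mu N) by (field; lra).
  replace (2 * k * (2 * k - 1) * ((1 + mu ^ 2 / k ^ 2) * (wallis mu (S N) / wallis 0 (S N))) * wallis 0 N)
    with ((1 + mu ^ 2 / k ^ 2) * (wallis mu (S N) / wallis 0 (S N)) * (2 * k * (2 * k - 1) * wallis 0 N))
    by ring.
  rewrite <- H1, <- H2. field. lra.
Qed.

Lemma wallis_0_ratio (mu : R) : 0 < mu ->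
  wallis mu 0 / wallis 0 0 = sinh (PI * mu) / (PI * mu).
Proof.
  intros Hmu. pose proof PI_RGT_0.
  assert (H0 : wallis 0 0 = PI / 2).
  { apply is_RInt_unique. apply (is_RInt_ext (fun _ => 1)).
    - intros t _. simpl. replace (2 * 0 * t) with 0 by ring. rewrite cosh_0. ring.
    - evar_last. apply (@is_RInt_const R_NormedModule). unfold scal; simpl; unfold mult; simpl. ring. }
  assert (H1 : wallis mu 0 = sinh (PI * mu) / (2 * mu)).
  { apply is_RInt_unique. apply (is_RInt_ext (fun t => cosh (2 * mu * t))).
    - intros t _. simpl. ring.
    - replace (sinh (PI * mu) / (2 * mu))
        with (/ (2 * mu) * sinh (2 * mu * (PI / 2)) - / (2 * mu) * sinh (2 * mu * 0)).
      + apply (is_RInt_derive_R (fun t => / (2 * mu) * sinh (2 * mu * t)) (fun t => cosh (2 * mu * t))).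
        * intros t. replace (cosh (2 * mu * t)) with (/ (2 * mu) * (2 * mu * cosh (2 * mu * t))) by (field; lra).
          apply (is_derive_scal (fun t => sinh (2 * mu * t)) t (/ (2 * mu))). apply is_derive_sinh_lin.
        * intros t. apply (derive_continuous _ _ _ (is_derive_cosh_lin (2 * mu) t)).
      + rewrite Rmult_0_r, sinh_0. replace (2 * mu * (PI / 2)) with (PI * mu) by field.
        field. lra. }
  rewrite H0, H1. field. lra.
Qed.

Lemma is_lim_seq_squeeze_inv (u : nat -> R) (l B : R) :
  (forall n, Rabs (u (S n) - l) <= B / INR (S n)) -> is_lim_seq u l.
Proof.
  intros H. apply is_lim_seq_incr_1. apply is_lim_seq_spec. intros eps.
  destruct (INR_unbounded (B / eps)) as [N HN]. exists N. intros n Hn.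
  apply Rle_lt_trans with (1 := H n).
  assert (Hn' : INR N < INR (S n)) by (apply lt_INR; lia).
  pose proof (pos_INR N). pose proof (cond_pos eps).
  apply (Rmult_lt_reg_r (INR (S n))); [lra|].
  unfold Rdiv. rewrite Rmult_assoc, Rinv_l, Rmult_1_r by lra.
  apply (Rmult_lt_compat_r eps) in HN; [|lra].
  unfold Rdiv in HN. rewrite Rmult_assoc, Rinv_l, Rmult_1_r in HN by lra. nra.
Qed.

Lemma sinhprod_lim (mu : R) : 0 < mu ->
  is_lim_seq (sinhprod mu) (sinh (PI * mu) / (PI * mu)).
Proof.
  intros Hmu.
  assert (Hr : is_lim_seq (fun N => wallis mu N / wallis 0 N) 1).
  { apply (is_lim_seq_squeeze_inv _ _ (2 * mu ^ 2 * cosh (mu * (PI / 2)) ^ 2)). intros n.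
    pose proof (wallis_ratio mu n Hmu) as [H1 H2]. rewrite Rabs_pos_eq by assumption.
    apply Rle_trans with (1 := H2). apply Rmult_le_compat_l.
    - pose proof (pow2_ge_0 mu). pose proof (pow2_ge_0 (cosh (mu * (PI / 2)))). nra.
    - assert (1 <= INR (S n)) by (rewrite S_INR; pose proof (pos_INR n); lra).
      apply Rinv_le_contravar; lra. }
  rewrite <- (wallis_0_ratio mu Hmu).
  apply (is_lim_seq_ext (fun N => wallis mu 0 / wallis 0 0 / (wallis mu N / wallis 0 N))).
  - intros N. rewrite (wallis_product mu N). pose proof (wallis_pos mu N). pose proof (wallis_pos 0 N).
    field. lra.
  - evar_last. apply is_lim_seq_div'; [apply is_lim_seq_const|exact Hr|lra]. f_equal. field.
    pose proof (wallis_pos 0 0). lra.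
Qed.

(** * Fourier transform of sech² and the integral of sin(yt) coth t *)

(** The Fourier transform of sech^{2k}. Its recurrence in k carries the factors 4k² + y², that is
    Euler's product at y/2. As k grows, sech^{2k} concentrates at 0 and the ratio to the case y = 0
    tends to 1; unwinding the product from there gives the transform of sech² itself. *)
Definition sech_moment (y : R) (k : nat) : R := IR (fun t => cos (y * t) * / cosh t ^ (2 * k)).

Lemma tame_sech_mult (g : R -> R) (B : R) (k : nat) : (1 <= k)%nat ->
  (forall t, continuous g t) -> (forall t, Rabs (g t) <= B) ->
  tame_by (2 * B) (fun t => g t * / cosh t ^ (2 * k)).
Proof.
  intros Hk Hc Hb. split.
  - intros t. apply (@continuous_mult R_UniformSpace R_AbsRing); [apply Hc|].
    apply ex_derive_continuous_R. unfold cosh. auto_derive.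
    pose proof (cosh_pos t) as H. apply (pow_lt _ (2 * k)) in H. unfold cosh in H. unfold Rdiv in H.
    apply Rgt_not_eq. exact H.
  - intros t. rewrite Rabs_mult. pose proof (cosh_pos t) as Hp.
    assert (H1 : 0 < cosh t ^ (2 * k)) by now apply pow_lt.
    rewrite (Rabs_pos_eq (/ _)) by (left; now apply Rinv_0_lt_compat).
    assert (H2 : / cosh t ^ (2 * k) <= 2 * dec t).
    { apply Rle_trans with (2 := inv_cosh_le_dec t). apply Rinv_le_contravar; [assumption|].
      rewrite <- (pow_1 (cosh t)) at 1. apply Rle_pow; [apply cosh_ge_1|lia]. }
    replace (2 * B * dec t) with (B * (2 * dec t)) by ring.
    apply Rmult_le_compat; auto; [apply Rabs_pos|left; now apply Rinv_0_lt_compat].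
Qed.

Lemma cos_lin_continuous (y t : R) : continuous (fun t => cos (y * t)) t.
Proof. apply ex_derive_continuous_R. auto_derive. exact I. Qed.

Lemma sin_lin_continuous (y t : R) : continuous (fun t => sin (y * t)) t.
Proof. apply ex_derive_continuous_R. auto_derive. exact I. Qed.

Lemma cos_abs_le_1 (x : R) : Rabs (cos x) <= 1.
Proof. apply Rabs_le. pose proof (COS_bound x). lra. Qed.

Lemma sin_abs_le_1 (x : R) : Rabs (sin x) <= 1.
Proof. apply Rabs_le. pose proof (SIN_bound x). lra. Qed.

Lemma tame_cos_sech (y : R) (k : nat) : (1 <= k)%nat ->
  tame (fun t => cos (y * t) * / cosh t ^ (2 * k)).
Proof.
  intros Hk. eexists. apply (tame_sech_mult (fun t => cos (y * t)) 1 k Hk).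
  - intros. apply cos_lin_continuous.
  - intros. apply cos_abs_le_1.
Qed.

Lemma tame_sin_sech (y : R) (k : nat) : (1 <= k)%nat ->
  tame (fun t => sin (y * t) * / cosh t ^ (2 * k)).
Proof.
  intros Hk. eexists. apply (tame_sech_mult (fun t => sin (y * t)) 1 k Hk).
  - intros. apply sin_lin_continuous.
  - intros. apply sin_abs_le_1.
Qed.

Lemma tanh_abs_lt_1 (t : R) : Rabs (sinh t / cosh t) <= 1.
Proof.
  pose proof (cosh_pos t). pose proof (cosh2_sinh2 t).
  unfold Rdiv. rewrite Rabs_mult, Rabs_inv, (Rabs_pos_eq (cosh t)) by lra.
  apply (Rmult_le_reg_r (cosh t)); [assumption|].
  rewrite Rmult_assoc, Rinv_l, Rmult_1_r, Rmult_1_l by lra.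
  apply Rabs_le. nra.
Qed.

Lemma tanh_continuous (t : R) : continuous (fun t => sinh t / cosh t) t.
Proof.
  apply (@continuous_mult R_UniformSpace R_AbsRing).
  - apply (derive_continuous _ _ _ (is_derive_sinh t)).
  - apply continuous_Rinv_comp; [apply (derive_continuous _ _ _ (is_derive_cosh t))|].
    pose proof (cosh_pos t). lra.
Qed.

Lemma sech_moment_step (y : R) (j : nat) :
  (4 * INR (S j) ^ 2 + y ^ 2) * sech_moment y (S j) =
  2 * INR (S j) * (2 * INR (S j) + 1) * sech_moment y (S (S j)).
Proof.
  set (k := INR (S j)).
  (* Again f w' - f' w, now for f = cos(yt) and w = sech^{2k} t. *)
  set (G := fun t => (- (2 * k)) * ((cos (y * t) * (sinh t / cosh t)) * / cosh t ^ (2 * S j))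
     + y * (sin (y * t) * / cosh t ^ (2 * S j))).
  set (g := fun t => (4 * k ^ 2 + y ^ 2) * (cos (y * t) * / cosh t ^ (2 * S j))
     - (2 * k * (2 * k + 1)) * (cos (y * t) * / cosh t ^ (2 * S (S j)))).
  assert (HG : forall t, is_derive G t (g t)).
  { intros t. unfold G, g.
    pose proof (cosh_pos t) as Hp. pose proof (cosh2_sinh2 t) as Hcs.
    assert (Hpow : is_derive (fun t => / cosh t ^ (2 * S j)) t
       (- (2 * k) * (sinh t / cosh t) * / cosh t ^ (2 * S j))).
    { replace (- (2 * k) * (sinh t / cosh t) * / cosh t ^ (2 * S j))
        with (- (INR (2 * S j) * sinh t * cosh t ^ pred (2 * S j)) / (cosh t ^ (2 * S j)) ^ 2).
      - apply is_derive_inv; [|apply pow_nonzero; lra].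
        apply (is_derive_pow cosh (2 * S j)). apply is_derive_cosh.
      - replace (INR (2 * S j)) with (2 * k) by (rewrite mult_INR; simpl (INR 2); reflexivity).
        replace (2 * S j)%nat with (S (2 * j + 1)) by lia. simpl pred.
        simpl (cosh t ^ S (2 * j + 1)). field. split; [|lra].
        apply pow_nonzero; lra. }
    assert (Htanh : is_derive (fun t => sinh t / cosh t) t (/ cosh t ^ 2)).
    { replace (/ cosh t ^ 2) with ((cosh t * cosh t - sinh t * sinh t) / cosh t ^ 2).
      - apply is_derive_div; [apply is_derive_sinh|apply is_derive_cosh|lra].
      - replace (cosh t * cosh t - sinh t * sinh t) with 1 by nra. field. lra. }
    set (P := fun t => / cosh t ^ (2 * S j)) in *. set (T := fun t => sinh t / cosh t) in *.
    assert (Hnext : / cosh t ^ (2 * S (S j)) = P t * / cosh t ^ 2).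
    { unfold P. rewrite <- Rinv_mult, <- pow_add. do 2 f_equal. lia. }
    rewrite Hnext.
    assert (Hgen : forall (P T : R -> R) P' T', is_derive P t P' -> is_derive T t T' ->
       is_derive (fun t => (- (2 * k)) * ((cos (y * t) * T t) * P t) + y * (sin (y * t) * P t)) t
        (- (2 * k) * ((- (y * sin (y * t)) * T t + cos (y * t) * T') * P t + cos (y * t) * T t * P')
          + y * (y * cos (y * t) * P t + sin (y * t) * P'))).
    { intros P0 T0 P' T' HP HT. auto_derive.
      - repeat split; eexists; eassumption.
      - rewrite (Derive_eta _ _ _ HP), (Derive_eta _ _ _ HT). ring. }
    evar_last; [exact (Hgen P T _ _ Hpow Htanh)|].
    - change (sinh t / cosh t) with (T t). change (/ cosh t ^ (2 * S j)) with (P t).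
      assert (HT : / cosh t ^ 2 = 1 - T t ^ 2).
      { unfold T. apply (Rmult_eq_reg_r (cosh t ^ 2)); [|apply pow_nonzero; lra].
        rewrite Rinv_l by (apply pow_nonzero; lra).
        replace ((1 - (sinh t / cosh t) ^ 2) * cosh t ^ 2) with (cosh t ^ 2 - sinh t ^ 2) by (field; lra).
        lra. }
      rewrite HT. ring. }
  assert (Hg : tame g).
  { apply tame_minus; apply tame_scal; apply tame_cos_sech; lia. }
  assert (HGt : tame G).
  { apply tame_plus; apply tame_scal; [|apply tame_sin_sech; lia].
    eexists. apply (tame_sech_mult (fun t => cos (y * t) * (sinh t / cosh t)) 1 (S j)); [lia| |].
    - intros t. apply (@continuous_mult R_UniformSpace R_AbsRing);
      [apply cos_lin_continuous|apply tanh_continuous].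
    - intros t. rewrite Rabs_mult. pose proof (cos_abs_le_1 (y * t)). pose proof (tanh_abs_lt_1 t).
      pose proof (Rabs_pos (cos (y * t))). pose proof (Rabs_pos (sinh t / cosh t)). nra. }
  pose proof (IR_derive_zero G g HGt Hg HG) as H0. unfold g in H0.
  rewrite IR_minus in H0 by (apply tame_scal; apply tame_cos_sech; lia).
  rewrite !IR_scal in H0 by (apply tame_cos_sech; lia).
  unfold sech_moment. lra.
Qed.

Lemma is_derive_tanh (t : R) : is_derive (fun t => sinh t / cosh t) t (/ cosh t ^ 2).
Proof.
  pose proof (cosh_pos t). pose proof (cosh2_sinh2 t).
  replace (/ cosh t ^ 2) with ((cosh t * cosh t - sinh t * sinh t) / cosh t ^ 2).
  - apply is_derive_div; [apply is_derive_sinh|apply is_derive_cosh|lra].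
  - replace (cosh t * cosh t - sinh t * sinh t) with 1 by nra. field. lra.
Qed.

Lemma tanh_minus_1 (t : R) : 0 <= t -> 0 <= 1 - sinh t / cosh t <= 2 * exp (- t).
Proof.
  intros Ht. pose proof (cosh_ge_1 t). pose proof (exp_pos t). pose proof (exp_pos (- t)).
  assert (H2 : 1 - sinh t / cosh t = exp (- t) / cosh t).
  { apply (Rmult_eq_reg_r (cosh t)); [|lra]. field_simplify; [|lra|lra]. unfold cosh, sinh. lra. }
  rewrite H2. split; [apply Rdiv_le_0_compat; lra|].
  apply (Rmult_le_reg_r (cosh t)); [lra|]. unfold Rdiv. rewrite Rmult_assoc, Rinv_l by lra. nra.
Qed.

Lemma tanh_lim_p : is_lim (fun t => sinh t / cosh t) p_infty 1.
Proof.
  apply (is_lim_p_exp _ 1 1 2 0); [lra|]. intros t Ht.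
  pose proof (tanh_minus_1 t ltac:(lra)). rewrite Rabs_left1 by lra.
  replace (- (1) * t) with (- t) by ring. lra.
Qed.

Lemma tanh_lim_m : is_lim (fun t => sinh t / cosh t) m_infty (-1).
Proof.
  apply (is_lim_m_exp _ (-1) 1 2 0); [lra|]. intros t Ht.
  pose proof (tanh_minus_1 (- t) ltac:(lra)) as H. rewrite sinh_odd, cosh_even in H.
  unfold Rdiv in *. rewrite <- Ropp_mult_distr_l in H.
  rewrite Ropp_involutive in H. rewrite Rabs_pos_eq by lra. rewrite Rmult_1_l. lra.
Qed.

Lemma sech_moment_0_1 : sech_moment 0 1 = 2.
Proof.
  unfold sech_moment. rewrite (IR_FTC (fun t => sinh t / cosh t) _ (-1) 1).
  - ring.
  - apply tame_cos_sech. lia.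
  - intros t. rewrite Rmult_0_l, cos_0, Rmult_1_l. apply is_derive_tanh.
  - apply tanh_lim_p.
  - apply tanh_lim_m.
Qed.

Lemma sech_moment_0_pos (j : nat) : 0 < sech_moment 0 (S j).
Proof.
  induction j; [rewrite sech_moment_0_1; lra|].
  pose proof (sech_moment_step 0 j) as H. set (k := INR (S j)) in *.
  assert (Hk : 1 <= k) by (unfold k; rewrite S_INR; pose proof (pos_INR j); lra).
  assert (0 < (4 * k ^ 2 + 0 ^ 2) * sech_moment 0 (S j)) by (apply Rmult_lt_0_compat; nra).
  rewrite H in H0. apply (Rmult_lt_reg_l (2 * k * (2 * k + 1))); nra.
Qed.

Lemma one_minus_cos_le (x : R) : 0 <= 1 - cos x <= x ^ 2 / 2.
Proof.
  split; [pose proof (COS_bound x); lra|].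
  assert (H : forall z, 0 <= z -> 1 - cos z <= z ^ 2 / 2).
  { intros z Hz. enough (0 ^ 2 / 2 - (1 - cos 0) <= z ^ 2 / 2 - (1 - cos z)) by (rewrite cos_0 in *; lra).
    apply (incr_of_derive (fun z => z ^ 2 / 2 - (1 - cos z)) (fun z => z - sin z)); [assumption| |].
    - intros t _. auto_derive; [exact I|]. field.
    - intros t [Ht _]. destruct (Req_dec t 0) as [->|Hn]; [rewrite sin_0; lra|].
      pose proof (sin_lt_x t). lra. }
  destruct (Rle_dec 0 x); [now apply H|].
  rewrite <- cos_neg. replace (x ^ 2) with ((- x) ^ 2) by ring. apply H. lra.
Qed.

Lemma sq_le_sinh2 (t : R) : t ^ 2 <= sinh t ^ 2.
Proof.
  destruct (Rle_dec 0 t).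
  - pose proof (sinh_ge_id t). nra.
  - pose proof (sinh_ge_id (- t)). rewrite sinh_odd in H. nra.
Qed.

(** From 1 - cos(yt) <= y²t²/2 <= (y²/2)(cosh² t - 1): the deviation from y = 0 is dominated by the
    difference of two consecutive moments at y = 0, which the recurrence evaluates. *)
Lemma sech_moment_ratio (y : R) (j : nat) :
  Rabs (sech_moment y (S (S j)) / sech_moment 0 (S (S j)) - 1) <= (y ^ 2 / 2) / INR (S j).
Proof.
  pose proof (sech_moment_0_pos (S j)) as Hp. set (k := INR (S j)).
  assert (Hk : 1 <= k) by (unfold k; rewrite S_INR; pose proof (pos_INR j); lra).
  assert (HB : Rabs (sech_moment y (S (S j)) - sech_moment 0 (S (S j))) <=
     y ^ 2 / 2 * (sech_moment 0 (S j) - sech_moment 0 (S (S j)))).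
  { unfold sech_moment. rewrite <- !IR_minus by (apply tame_cos_sech; lia).
    rewrite <- IR_scal by (apply tame_minus; apply tame_cos_sech; lia).
    apply IR_abs_le; [apply tame_minus; apply tame_cos_sech; lia|
      apply tame_scal; apply tame_minus; apply tame_cos_sech; lia|].
    intros t. rewrite Rmult_0_l, cos_0.
    pose proof (cosh_pos t) as Hc. pose proof (cosh2_sinh2 t).
    assert (H1 : 0 < / cosh t ^ (2 * S (S j))) by now apply Rinv_0_lt_compat, pow_lt.
    assert (H2 : / cosh t ^ (2 * S j) = / cosh t ^ (2 * S (S j)) * cosh t ^ 2).
    { replace (2 * S (S j))%nat with (2 * S j + 2)%nat by lia. rewrite pow_add.
      assert (cosh t ^ (2 * S j) <> 0) by (apply pow_nonzero; lra). field. split; [lra|assumption]. }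
    rewrite H2. set (c := / cosh t ^ (2 * S (S j))) in *.
    replace (cos (y * t) * c - 1 * c) with (- ((1 - cos (y * t)) * c)) by ring.
    pose proof (one_minus_cos_le (y * t)).
    rewrite Rabs_Ropp, Rabs_pos_eq by nra.
    replace (y ^ 2 / 2 * (1 * (c * cosh t ^ 2) - 1 * c)) with ((y ^ 2 / 2 * (cosh t ^ 2 - 1)) * c) by ring.
    apply Rmult_le_compat_r; [lra|].
    pose proof (sq_le_sinh2 t). pose proof (pow2_ge_0 y).
    apply Rle_trans with ((y * t) ^ 2 / 2); [lra|].
    replace ((y * t) ^ 2 / 2) with (y ^ 2 / 2 * t ^ 2) by field. nra. }
  pose proof (sech_moment_step 0 j) as Hst. fold k in Hst.
  assert (Hst' : sech_moment 0 (S j) - sech_moment 0 (S (S j)) = sech_moment 0 (S (S j)) / (2 * k)).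
  { apply (Rmult_eq_reg_l (4 * k ^ 2 + 0 ^ 2)); [|nra].
    rewrite Rmult_minus_distr_l, Hst. field. lra. }
  rewrite Hst' in HB.
  replace (sech_moment y (S (S j)) / sech_moment 0 (S (S j)) - 1)
    with ((sech_moment y (S (S j)) - sech_moment 0 (S (S j))) / sech_moment 0 (S (S j))) by (field; lra).
  unfold Rdiv at 1. rewrite Rabs_mult, Rabs_inv, (Rabs_pos_eq (sech_moment 0 _)) by lra.
  apply (Rmult_le_reg_r (sech_moment 0 (S (S j)))); [assumption|].
  rewrite Rmult_assoc, Rinv_l, Rmult_1_r by lra.
  apply Rle_trans with (1 := HB). unfold Rdiv. rewrite Rinv_mult.
  assert (0 < / k) by (apply Rinv_0_lt_compat; lra). pose proof (pow2_ge_0 y).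
  assert (0 <= y ^ 2 * / k) by nra. nra.
Qed.

Lemma sech_moment_product (y : R) (N : nat) :
  sech_moment y (S N) / sech_moment 0 (S N) =
  sech_moment y 1 / sech_moment 0 1 * sinhprod (y / 2) N.
Proof.
  induction N as [|N IH]; [simpl sinhprod; ring|].
  change (sinhprod (y / 2) (S N)) with (sinhprod (y / 2) N * (1 + (y / 2) ^ 2 / INR (S N) ^ 2)).
  rewrite <- Rmult_assoc, <- IH.
  pose proof (sech_moment_step y N) as H1. pose proof (sech_moment_step 0 N) as H2.
  pose proof (sech_moment_0_pos N). pose proof (sech_moment_0_pos (S N)).
  set (k := INR (S N)) in *.
  assert (Hk : 1 <= k) by (unfold k; rewrite S_INR; pose proof (pos_INR N); lra).
  replace (sech_moment y (S (S N))) with ((4 * k ^ 2 + y ^ 2) * sech_moment y (S N) / (2 * k * (2 * k + 1)))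
    by (rewrite H1; field; lra).
  replace (sech_moment 0 (S (S N))) with ((4 * k ^ 2 + 0 ^ 2) * sech_moment 0 (S N) / (2 * k * (2 * k + 1)))
    by (rewrite H2; field; lra).
  field. repeat split; nra.
Qed.

Lemma fourier_sech2 (y : R) : 0 < y ->
  sech_moment y 1 = PI * y / sinh (PI * y / 2).
Proof.
  intros Hy. pose proof PI_RGT_0.
  assert (Hs : 0 < sinh (PI * (y / 2))) by (apply sinh_pos; nra).
  assert (H1 : is_lim_seq (fun N => sech_moment y (S N) / sech_moment 0 (S N)) 1).
  { apply (is_lim_seq_squeeze_inv _ _ (y ^ 2 / 2)). intros n. apply sech_moment_ratio. }
  assert (H2 : is_lim_seq (fun N => sech_moment y (S N) / sech_moment 0 (S N))
     (sech_moment y 1 / sech_moment 0 1 * (sinh (PI * (y / 2)) / (PI * (y / 2))))).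
  { apply (is_lim_seq_ext (fun N => sech_moment y 1 / sech_moment 0 1 * sinhprod (y / 2) N)).
    - intros N. symmetry. apply sech_moment_product.
    - apply (is_lim_seq_scal_l _ _ (Finite _)). apply sinhprod_lim. lra. }
  apply is_lim_seq_unique in H1. apply is_lim_seq_unique in H2. rewrite H1 in H2.
  injection H2 as H2. rewrite sech_moment_0_1 in H2.
  replace (PI * y / 2) with (PI * (y / 2)) by field.
  apply (Rmult_eq_reg_r (sinh (PI * (y / 2)) / (PI * y))).
  - replace (sech_moment y 1 * (sinh (PI * (y / 2)) / (PI * y)))
      with (sech_moment y 1 / 2 * (sinh (PI * (y / 2)) / (PI * (y / 2)))) by (field; lra).
    rewrite <- H2. field. lra.
  - apply Rgt_not_eq. apply Rdiv_lt_0_compat; nra.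
Qed.

(** The quotient f(t)/t continued by the value [l] at 0. It turns sin(yt) coth t into a continuous
    function on the whole line, so that integrals from 0 are proper. *)
Definition slope (f : R -> R) (l t : R) : R := if Req_EM_T t 0 then l else f t / t.

Lemma slope_continuous (f : R -> R) (l : R) : f 0 = 0 -> is_derive f 0 l ->
  (forall t, continuous f t) -> forall t, continuous (slope f l) t.
Proof.
  intros H0 Hd Hc t. destruct (Req_dec t 0) as [->|Hn].
  - apply is_derive_Reals in Hd. apply continuity_pt_filterlim. intros eps Heps.
    destruct (Hd eps Heps) as [d Hd']. exists d. split; [apply cond_pos|].
    intros x [_ Hx]. simpl in *. unfold R_dist in *. unfold slope.
    destruct (Req_EM_T 0 0) as [_|]; [|congruence].
    destruct (Req_EM_T x 0) as [->|Hx0]; [rewrite Rminus_diag, Rabs_R0; assumption|].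
    rewrite Rminus_0_r in Hx. specialize (Hd' x Hx0 Hx). rewrite Rplus_0_l, H0, Rminus_0_r in Hd'.
    exact Hd'.
  - apply (continuous_ext_loc _ (fun t => f t / t)).
    + assert (He : 0 < Rabs t) by now apply Rabs_pos_lt.
      exists (mkposreal _ He). intros x Hx. unfold slope.
      destruct (Req_EM_T x 0) as [->|]; [|reflexivity].
      exfalso. unfold ball in Hx; simpl in Hx. unfold AbsRing_ball, abs, minus, plus, opp in Hx; simpl in Hx.
      rewrite Rplus_0_l, Rabs_Ropp in Hx. lra.
    + apply (@continuous_mult R_UniformSpace R_AbsRing); [apply Hc|].
      apply continuous_Rinv_comp; [apply continuous_id|assumption].
Qed.

(** [sin (y t) coth t], with its limit [y] at the removable singularity [t = 0]. *)
Definition sincoth (y t : R) : R :=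
  slope (fun t => sin (y * t)) y t * cosh t / slope sinh 1 t.

Lemma slope_sinh_pos (t : R) : 0 < slope sinh 1 t.
Proof.
  unfold slope. destruct (Req_EM_T t 0); [lra|].
  destruct (Rlt_dec 0 t).
  - apply Rdiv_lt_0_compat; [now apply sinh_pos|assumption].
  - rewrite <- (Ropp_involutive t), sinh_odd. unfold Rdiv. rewrite Rinv_opp.
    rewrite Rmult_opp_opp. apply Rdiv_lt_0_compat; [apply sinh_pos|]; lra.
Qed.

Lemma sincoth_continuous (y t : R) : continuous (sincoth y) t.
Proof.
  unfold sincoth.
  apply (@continuous_mult R_UniformSpace R_AbsRing); [apply (@continuous_mult R_UniformSpace R_AbsRing)|].
  - apply slope_continuous; [rewrite Rmult_0_r; apply sin_0| |intros; apply sin_lin_continuous].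
    auto_derive; [exact I|]. rewrite Rmult_0_r, cos_0. ring.
  - apply (derive_continuous _ _ _ (is_derive_cosh t)).
  - apply continuous_Rinv_comp.
    + apply slope_continuous; [apply sinh_0| |].
      * rewrite <- cosh_0. apply is_derive_sinh.
      * intros x. apply (derive_continuous _ _ _ (is_derive_sinh x)).
    + pose proof (slope_sinh_pos t). lra.
Qed.

Lemma sincoth_0 (y : R) : sincoth y 0 = y.
Proof.
  unfold sincoth, slope. destruct (Req_EM_T 0 0); [|congruence]. rewrite cosh_0. field.
Qed.

Lemma sinh_neq_0 (t : R) : t <> 0 -> sinh t <> 0.
Proof.
  intros H. destruct (Rlt_dec 0 t).
  - pose proof (sinh_pos t). lra.
  - pose proof (sinh_pos (- t)). rewrite sinh_odd in *. lra.
Qed.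

Lemma sincoth_neq_0 (y t : R) : t <> 0 -> sincoth y t = sin (y * t) * cosh t / sinh t.
Proof.
  intros H. unfold sincoth, slope. destruct (Req_EM_T t 0); [contradiction|].
  field. split; [now apply sinh_neq_0|assumption].
Qed.

Lemma sincoth_even (y t : R) : sincoth y (- t) = sincoth y t.
Proof.
  destruct (Req_dec t 0) as [->|H]; [now rewrite Ropp_0|].
  rewrite !sincoth_neq_0 by lra. rewrite cosh_even, sinh_odd, Ropp_mult_distr_r_reverse, sin_neg.
  field. now apply sinh_neq_0.
Qed.

(** The identity coth t + tanh t = 2 coth 2t, multiplied by sin(yt). *)
Lemma sincoth_double (y t : R) :
  sincoth y t + sin (y * t) * (sinh t / cosh t) = 2 * sincoth (y / 2) (2 * t).
Proof.
  destruct (Req_dec t 0) as [->|H].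
  - rewrite !Rmult_0_r, !sincoth_0, sin_0. field.
    rewrite cosh_0. lra.
  - rewrite !sincoth_neq_0 by lra. replace (y / 2 * (2 * t)) with (y * t) by field.
    rewrite cosh_double, sinh_double. pose proof (cosh2_sinh2 t) as Hcs.
    pose proof (sinh_neq_0 t H). pose proof (cosh_pos t).
    field_simplify_eq; [|lra]. rewrite Hcs. ring.
Qed.

Lemma coth_minus_1 (t : R) : 0 < t -> 0 <= cosh t / sinh t - 1 /\ t * (cosh t / sinh t - 1) <= exp (- t).
Proof.
  intros H. pose proof (sinh_pos t H). pose proof (sinh_ge_id t ltac:(lra)).
  assert (H2 : cosh t / sinh t - 1 = exp (- t) / sinh t).
  { apply (Rmult_eq_reg_r (sinh t)); [|lra]. field_simplify; [|lra|lra]. unfold cosh, sinh. lra. }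
  rewrite H2. pose proof (exp_pos (- t)). split; [apply Rdiv_le_0_compat; lra|].
  apply (Rmult_le_reg_r (sinh t)); [lra|]. unfold Rdiv.
  replace (t * (exp (- t) * / sinh t) * sinh t) with (t * exp (- t)) by (field; lra). nra.
Qed.

Lemma sin_abs_le (x : R) : Rabs (sin x) <= Rabs x.
Proof.
  assert (H : forall z, 0 <= z -> Rabs (sin z) <= z).
  { intros z Hz. destruct (Req_dec z 0) as [->|Hn]; [rewrite sin_0, Rabs_R0; lra|].
    destruct (Rle_dec z 1).
    - rewrite Rabs_pos_eq; [left; apply sin_lt_x; lra|]. pose proof PI2_1. apply sin_ge_0; lra.
    - pose proof (sin_abs_le_1 z). lra. }
  destruct (Rle_dec 0 x).
  - rewrite (Rabs_pos_eq x) by assumption. now apply H.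
  - rewrite <- (Rabs_Ropp x), <- (Rabs_Ropp (sin x)), <- sin_neg, (Rabs_pos_eq (- x)) by lra. apply H; lra.
Qed.

Definition sincoth_rem (y t : R) : R := sincoth y t - sin (y * Rabs t).

Lemma sincoth_rem_even (y t : R) : sincoth_rem y (- t) = sincoth_rem y t.
Proof. unfold sincoth_rem. now rewrite sincoth_even, Rabs_Ropp. Qed.

Lemma sincoth_rem_tame (y : R) : 0 < y -> tame_by y (sincoth_rem y).
Proof.
  intros Hy. split.
  - intros t. unfold sincoth_rem. apply (@continuous_minus R_UniformSpace R_AbsRing R_NormedModule).
    + apply sincoth_continuous.
    + apply (continuous_comp Rabs (fun t => sin (y * t))); [apply continuous_Rabs|apply sin_lin_continuous].
  - assert (H : forall t, 0 <= t -> Rabs (sincoth_rem y t) <= y * dec t).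
    { intros t Ht. destruct (Req_dec t 0) as [->|Hn].
      - unfold sincoth_rem. rewrite sincoth_0, Rabs_R0, Rmult_0_r, sin_0, Rminus_0_r, dec_0.
        rewrite Rabs_pos_eq; lra.
      - unfold sincoth_rem. rewrite (Rabs_pos_eq t) by assumption. rewrite sincoth_neq_0 by assumption.
        replace (sin (y * t) * cosh t / sinh t - sin (y * t)) with (sin (y * t) * (cosh t / sinh t - 1))
          by (field; now apply sinh_neq_0).
        destruct (coth_minus_1 t ltac:(lra)) as [H1 H2].
        rewrite Rabs_mult, (Rabs_pos_eq (_ - 1)) by assumption.
        pose proof (sin_abs_le (y * t)) as H3. rewrite (Rabs_pos_eq (y * t)) in H3 by nra.
        rewrite dec_nonneg by assumption. pose proof (exp_le (- t) (- t / 4) ltac:(lra)).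
        apply Rle_trans with (y * t * (cosh t / sinh t - 1)); [now apply Rmult_le_compat_r|].
        rewrite Rmult_assoc. apply Rmult_le_compat_l; lra. }
    intros t. destruct (Rle_dec 0 t); [now apply H|].
    rewrite <- sincoth_rem_even, <- dec_opp. apply H. lra.
Qed.

Lemma RInt_even (g : R -> R) (T : R) : (forall t, continuous g t) -> (forall t, g (- t) = g t) ->
  RInt g (- T) T = 2 * RInt g 0 T.
Proof.
  intros Hc He.
  rewrite <- (RInt_Chasles g (- T) 0 T) by now apply continuous_ex_RInt.
  rewrite <- Ropp_0 at 1. rewrite RInt_opp_arg by assumption.
  rewrite (RInt_ext (fun t => g (- t)) g) by (intros; apply He).
  unfold plus; simpl. ring.
Qed.

Lemma RInt_even_lim (C : R) (g : R -> R) : tame_by C g -> (forall t, g (- t) = g t) ->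
  is_lim (fun T => RInt g 0 T) p_infty (IR g / 2).
Proof.
  intros Hg He. apply (is_lim_p_exp _ _ (1/4) (4 * C) 0); [lra|]. intros T HT.
  pose proof (IR_approx C g T T Hg ltac:(lra) ltac:(lra)) as H.
  rewrite RInt_even in H by (apply Hg || assumption).
  rewrite <- Rabs_Ropp.
  replace (- (RInt g 0 T - IR g / 2)) with (/ 2 * (IR g - 2 * RInt g 0 T)) by field.
  rewrite Rabs_mult, Rabs_pos_eq by lra.
  rewrite dec_nonneg in H by lra. replace (- (1/4) * T) with (- T / 4) by field. lra.
Qed.

(** The Abel value of the integral of sin(yt) coth t over t > 0: the sine alone contributes 1/y, and
    the even remainder, in which coth t - 1 decays, contributes half of its integral over the
    line. *)
Definition beta (y : R) : R := / y + IR (sincoth_rem y) / 2.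

(** The term cos(yT)/y cancels the oscillating end point of the integral of sin(yt), which turns the
    Abel value into an ordinary limit. *)
Lemma sincoth_lim (y : R) : 0 < y ->
  is_lim (fun T => RInt (sincoth y) 0 T + cos (y * T) / y) p_infty (beta y).
Proof.
  intros Hy. pose proof (sincoth_rem_tame y Hy) as Ht.
  apply (is_lim_ext_loc (fun T => / y + RInt (sincoth_rem y) 0 T)).
  - exists 0. intros T HT.
    assert (H1 : is_RInt (fun t => sin (y * t)) 0 T (- (cos (y * T) / y) - - (cos (y * 0) / y))).
    { apply (is_RInt_derive_R (fun t => - (cos (y * t) / y))).
      - intros t. auto_derive; [lra|]. field. lra.
      - intros; apply sin_lin_continuous. }
    assert (H2 : RInt (sincoth_rem y) 0 T =
       RInt (sincoth y) 0 T - (- (cos (y * T) / y) - - (cos (y * 0) / y))).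
    { apply is_RInt_unique. apply (is_RInt_ext (fun t => minus (sincoth y t) (sin (y * t)))).
      - intros t. rewrite Rmin_left, Rmax_right by lra. intros Hx. unfold sincoth_rem.
        rewrite Rabs_pos_eq by lra. reflexivity.
      - apply (@is_RInt_minus R_NormedModule); [|exact H1].
        apply RInt_correct_cont. intros; apply sincoth_continuous. }
    rewrite H2, Rmult_0_r, cos_0. field. lra.
  - unfold beta. apply (is_lim_plus' (fun _ => / y)); [apply is_lim_const|].
    apply (RInt_even_lim y); [assumption|apply sincoth_rem_even].
Qed.

Lemma is_lim_double (f : R -> R) (l : R) : is_lim f p_infty l -> is_lim (fun T => f (2 * T)) p_infty l.
Proof.
  intros H. apply (is_lim_comp f (fun T => 2 * T) p_infty l p_infty H).
  - apply is_lim_spec. intros M. exists (Rabs M). intros x Hx. pose proof (Rle_abs M).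
    pose proof (Rabs_pos M). lra.
  - exists 0. intros; discriminate.
Qed.

(** Integrate [sincoth_double]. The right side gives [beta] at y/2 after the substitution of 2t; the
    term with tanh is integrated by parts and leaves 1/y times half the transform of sech². *)
Lemma beta_halve (y : R) : 0 < y -> beta y = beta (y / 2) - (PI / 2) / sinh (PI * y / 2).
Proof.
  intros Hy.
  pose proof (is_lim_double _ _ (sincoth_lim (y / 2) ltac:(lra))) as H1. cbv beta in H1.
  assert (Hs : is_lim (fun T => RInt (fun t => cos (y * t) * / cosh t ^ (2 * 1)) 0 T) p_infty
     (sech_moment y 1 / 2)).
  { destruct (tame_cos_sech y 1 (le_n _)) as [C HC]. apply (RInt_even_lim C _ HC).
    intros t. rewrite cosh_even, Ropp_mult_distr_r_reverse, cos_neg. reflexivity. }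
  assert (H2 : is_lim (fun T => RInt (sincoth y) 0 T + cos (y * T) / y) p_infty
     (beta (y / 2) - / y * 0 - / y * (sech_moment y 1 / 2))).
  { apply (is_lim_ext_loc (fun T => (RInt (sincoth (y / 2)) 0 (2 * T) + cos (y / 2 * (2 * T)) / (y / 2))
       - / y * (cos (y * T) * (1 - sinh T / cosh T))
       - / y * RInt (fun t => cos (y * t) * / cosh t ^ (2 * 1)) 0 T)).
    - exists 0. intros T HT.
      assert (Ha : is_RInt (fun t => minus (sin (y * t) * (sinh t / cosh t))
          (/ y * (cos (y * t) * / cosh t ^ (2 * 1)))) 0 T
        (- / y * (cos (y * T) * (sinh T / cosh T)) - (- / y * (cos (y * 0) * (sinh 0 / cosh 0))))).
      { apply (is_RInt_derive_R (fun t => - / y * (cos (y * t) * (sinh t / cosh t)))).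
        - intros t. pose proof (is_derive_tanh t) as Hd.
          assert (Hgen : forall (f : R -> R) l, is_derive f t l ->
            is_derive (fun t => - / y * (cos (y * t) * f t)) t
              (- / y * (- y * sin (y * t) * f t + cos (y * t) * l))).
          { intros f l Hf. auto_derive; [eexists; eassumption|]. rewrite (Derive_eta _ _ _ Hf). ring. }
          evar_last; [apply (Hgen _ _ Hd)|].
          unfold minus, plus, opp; simpl. pose proof (cosh_pos t). field. lra.
        - intros t. apply (@continuous_minus R_UniformSpace R_AbsRing R_NormedModule).
          + apply (@continuous_mult R_UniformSpace R_AbsRing); [apply sin_lin_continuous|apply tanh_continuous].
          + apply (@continuous_scal_r R_UniformSpace R_AbsRing R_NormedModule).
            destruct (tame_cos_sech y 1 (le_n _)) as [C HC]. apply HC. }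
      assert (Hb : is_RInt (fun t => scal (/ y) (cos (y * t) * / cosh t ^ (2 * 1))) 0 T
         (/ y * RInt (fun t => cos (y * t) * / cosh t ^ (2 * 1)) 0 T)).
      { apply (@is_RInt_scal R_NormedModule). apply RInt_correct_cont.
        destruct (tame_cos_sech y 1 (le_n _)) as [C HC]. apply HC. }
      assert (Hc : is_RInt (sincoth y) 0 T (RInt (sincoth y) 0 T))
        by (apply RInt_correct_cont; intros; apply sincoth_continuous).
      pose proof (is_RInt_plus _ _ _ _ _ _ Hc (is_RInt_plus _ _ _ _ _ _ Ha Hb)) as Hd.
      assert (He : is_RInt (fun t => scal 2 (sincoth (y / 2) (2 * t + 0))) 0 T
         (RInt (sincoth (y / 2)) (2 * 0 + 0) (2 * T + 0))).
      { apply (@is_RInt_comp_lin R_NormedModule). apply RInt_correct_cont.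
        intros; apply sincoth_continuous. }
      assert (Hf : RInt (sincoth y) 0 T + ((- / y * (cos (y * T) * (sinh T / cosh T))
           - (- / y * (cos (y * 0) * (sinh 0 / cosh 0)))) +
           / y * RInt (fun t => cos (y * t) * / cosh t ^ (2 * 1)) 0 T)
         = RInt (sincoth (y / 2)) 0 (2 * T)).
      { replace (2 * 0 + 0) with 0 in He by ring. rewrite Rplus_0_r in He.
        rewrite <- (is_RInt_unique _ _ _ _ He). symmetry. apply is_RInt_unique.
        eapply is_RInt_ext; [|exact Hd]. intros t _. rewrite Rplus_0_r.
        unfold minus, plus, opp, scal; simpl; unfold mult; simpl.
        rewrite <- sincoth_double. ring. }
      rewrite <- Hf. rewrite sinh_0. replace (y / 2 * (2 * T)) with (y * T) by field.
      pose proof (cosh_pos T). rewrite cosh_0. field. lra.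
    - apply (is_lim_minus' (fun T => _ - _)); [apply (is_lim_minus' _ (fun T => / y * _))|].
      + exact H1.
      + apply (is_lim_scal_l _ (/ y) p_infty (Finite 0)).
        apply (is_lim_p_exp _ 0 1 2 0); [lra|]. intros T HT. rewrite Rminus_0_r, Rabs_mult.
        pose proof (tanh_minus_1 T ltac:(lra)) as H3. rewrite (Rabs_pos_eq (1 - _)) by lra.
        pose proof (cos_abs_le_1 (y * T)). pose proof (Rabs_pos (cos (y * T))).
        replace (- (1) * T) with (- T) by ring. nra.
      + apply (is_lim_scal_l _ (/ y) p_infty (Finite _)). exact Hs. }
  pose proof (sincoth_lim y Hy) as H3. apply is_lim_unique in H2. apply is_lim_unique in H3.
  rewrite H3 in H2. injection H2 as H2. rewrite H2, (fourier_sech2 y Hy).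
  assert (0 < sinh (PI * y / 2)) by (apply sinh_pos; pose proof PI_RGT_0; nra).
  field. lra.
Qed.

Lemma coth_bounds (x : R) : 0 < x -> 0 <= cosh x / sinh x - / x <= x.
Proof.
  intros H. pose proof (sinh_pos x H).
  assert (H1 : sinh x <= x * cosh x) by (apply sinh_le_id_cosh; lra).
  assert (H2 : x * cosh x <= sinh x + x ^ 2 * sinh x).
  { enough (sinh 0 + 0 ^ 2 * sinh 0 - 0 * cosh 0 <= sinh x + x ^ 2 * sinh x - x * cosh x)
      by (rewrite sinh_0 in *; lra).
    apply (incr_of_derive (fun x => sinh x + x ^ 2 * sinh x - x * cosh x)
      (fun x => x * sinh x + x ^ 2 * cosh x)); [lra| |].
    - intros t _. unfold sinh, cosh. auto_derive; [exact I|]. field.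
    - intros t Ht. pose proof (sinh_nonneg t). pose proof (cosh_pos t).
      assert (0 <= t * sinh t) by (apply Rmult_le_pos; lra). nra. }
  assert (H3 : cosh x / sinh x - / x = (x * cosh x - sinh x) / (x * sinh x)) by (field; lra).
  rewrite H3. assert (0 < x * sinh x) by nra. split; [apply Rdiv_le_0_compat; lra|].
  apply (Rmult_le_reg_r (x * sinh x)); [assumption|]. unfold Rdiv. rewrite Rmult_assoc, Rinv_l by lra.
  nra.
Qed.

(** The right side obeys the same halving equation, since coth x - coth 2x = 1/sinh 2x, and both
    sides are 1/y + O(y) near 0. The difference is unchanged under y -> y/2 and is O(y), hence
    zero. *)
Lemma beta_eq (y : R) : 0 < y -> beta y = (PI / 2) * (cosh (PI * y / 2) / sinh (PI * y / 2)).
Proof.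
  intros Hy. pose proof PI_RGT_0 as HPI.
  set (b := fun y => (PI / 2) * (cosh (PI * y / 2) / sinh (PI * y / 2))).
  (* 4z bounds half of [IR (sincoth_rem z)]; π²/4 is π/2 times the factor in the bound coth x - 1/x
     <= x at x = πz/2. *)
  set (K := 4 + PI ^ 2 / 4).
  assert (Hb : forall z, 0 < z -> Rabs (beta z - b z) <= K * z).
  { intros z Hz. pose proof (IR_bound z _ (sincoth_rem_tame z Hz)) as H1.
    pose proof (coth_bounds (PI * z / 2) ltac:(nra)) as H2.
    unfold beta, b, K.
    replace (/ z + IR (sincoth_rem z) / 2 - PI / 2 * (cosh (PI * z / 2) / sinh (PI * z / 2)))
      with (IR (sincoth_rem z) / 2 - PI / 2 * (cosh (PI * z / 2) / sinh (PI * z / 2) - / (PI * z / 2)))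
      by (field; split; [|lra]; apply Rgt_not_eq, sinh_pos; nra).
    set (c := cosh (PI * z / 2) / sinh (PI * z / 2) - / (PI * z / 2)) in *.
    apply Rabs_le_between in H1. apply Rabs_le. nra. }
  assert (Hh : forall z, 0 < z -> beta z - b z = beta (z / 2) - b (z / 2)).
  { intros z Hz. rewrite (beta_halve z Hz). unfold b.
    set (x := PI * (z / 2) / 2). replace (PI * z / 2) with (2 * x) by (unfold x; field).
    assert (0 < sinh x) by (apply sinh_pos; unfold x; nra). pose proof (cosh_pos x).
    rewrite cosh_double, sinh_double. pose proof (cosh2_sinh2 x).
    field_simplify_eq; [|lra]. rewrite H1. ring. }
  assert (Hn : forall n, Rabs (beta y - b y) <= K * y * (/ 2) ^ n).
  { assert (Hn : forall n, beta y - b y = beta (y * (/ 2) ^ n) - b (y * (/ 2) ^ n)).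
    { induction n; [simpl; now rewrite Rmult_1_r|]. rewrite IHn, Hh.
      - replace (y * (/ 2) ^ n / 2) with (y * (/ 2) ^ S n) by (simpl; field). reflexivity.
      - apply Rmult_lt_0_compat; [assumption|apply pow_lt; lra]. }
    intros n. rewrite (Hn n), Rmult_assoc. apply Hb.
    apply Rmult_lt_0_compat; [assumption|apply pow_lt; lra]. }
  enough (Rabs (beta y - b y) <= 0) by (pose proof (Rabs_pos (beta y - b y));
    assert (Rabs (beta y - b y) = 0) as E by lra; apply Rabs_eq_0 in E; unfold b in E; lra).
  apply (is_lim_seq_le (fun _ => Rabs (beta y - b y)) (fun n => K * y * (/ 2) ^ n)
    (Rabs (beta y - b y)) 0 Hn).
  - apply is_lim_seq_const.
  - replace (Finite 0) with (Rbar_mult (K * y) 0) by (simpl; f_equal; ring).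
    apply is_lim_seq_scal_l. apply is_lim_seq_geom. rewrite Rabs_pos_eq; lra.
Qed.

Lemma exp_ge_1_plus (x : R) : 1 + x <= exp x.
Proof. destruct (Req_dec x 0) as [->|H]; [rewrite exp_0; lra|]. left. now apply exp_ineq1. Qed.

(** The convex function e^v/2 lies above its tangent of slope a, which touches at v = ln(2a). *)
Lemma exp_exp_decay (a : R) : 0 < a ->
  exists C, forall v, exp (- (exp v / 2)) <= C * exp (- a * v).
Proof.
  intros Ha. exists (exp (a * (ln (2 * a) - 1))). intros v. rewrite <- exp_plus. apply exp_le.
  replace v with (ln (2 * a) + (v - ln (2 * a))) at 1 by ring. rewrite exp_plus, exp_ln by lra.
  pose proof (exp_ge_1_plus (v - ln (2 * a))). nra.
Qed.

(** Half of the exponential absorbs the power: X <= 6 e^{X/6}, and 216 = 6³. *)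
Lemma pow_exp_le (X : R) (j : nat) : 0 <= X -> (j <= 3)%nat ->
  X ^ j * exp (- X) <= 216 * exp (- (X / 2)).
Proof.
  intros HX Hj. replace (- X) with (- (X / 2) + - (X / 2)) by field. rewrite exp_plus, <- Rmult_assoc.
  apply Rmult_le_compat_r; [left; apply exp_pos|].
  assert (H : X ^ j <= 216 * exp (X / 2)).
  { pose proof (exp_ge_1_plus (X / 6)) as H1.
    replace (X / 2) with (X / 6 + (X / 6 + X / 6)) by field. rewrite !exp_plus.
    set (e := exp (X / 6)) in *. assert (H2 : X <= 6 * e) by lra. assert (He : 1 <= e) by lra.
    assert (Hee : e <= e * e) by nra. assert (Heee : e * e <= e * (e * e)) by nra.
    assert (HXX : X * X <= (6 * e) * (6 * e)) by nra.
    destruct j as [|[|[|[|j]]]]; [simpl| simpl|simpl|simpl|lia]; nra. }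
  apply (Rmult_le_reg_r (exp (X / 2))); [apply exp_pos|].
  rewrite Rmult_assoc, <- exp_plus, Rplus_opp_l, exp_0. lra.
Qed.

(** * The kernel K_0(2 e^σ) and its moments *)

(** [besmom j σ = ½ ∫ X^j e^{-X} ds] with [X = 2 e^σ cosh s]; thus [besmom 0 σ = K_0(2 e^σ)]. *)
Definition besmom (j : nat) (sg : R) : R :=
  IR (fun s => (2 * exp sg * cosh s) ^ j * exp (- (2 * exp sg * cosh s))) / 2.

Lemma besarg_ge (sg s : R) : exp (sg + Rabs s) <= 2 * exp sg * cosh s.
Proof. rewrite exp_plus. pose proof (cosh_ge_exp_abs s). pose proof (exp_pos sg). nra. Qed.

(** The argument is at least e^{σ+|s|}, so any exponential rate a in σ + |s| is available, and a >=
    1/4 leaves [dec s]. Powers up to 3 occur because [kap] contains X and is differentiated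
    twice. *)
Lemma besarg_bound (a : R) : 1 / 4 <= a -> exists C, forall sg s j, (j <= 3)%nat ->
  (2 * exp sg * cosh s) ^ j * exp (- (2 * exp sg * cosh s)) <= C * exp (- a * sg) * dec s.
Proof.
  intros Ha. destruct (exp_exp_decay a ltac:(lra)) as [C HC]. exists (216 * C).
  intros sg s j Hj. pose proof (besarg_ge sg s) as Hg. pose proof (exp_pos (sg + Rabs s)).
  apply Rle_trans with (1 := pow_exp_le (2 * exp sg * cosh s) j ltac:(lra) Hj).
  replace (216 * C * exp (- a * sg) * dec s) with (216 * (C * (exp (- a * sg) * dec s))) by ring.
  apply Rmult_le_compat_l; [lra|].
  apply Rle_trans with (exp (- (exp (sg + Rabs s) / 2))); [apply exp_le; lra|].
  apply Rle_trans with (1 := HC _).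
  assert (0 <= C) by (specialize (HC 0); pose proof (exp_pos (- (exp 0 / 2))); pose proof (exp_pos (- a * 0)); nra).
  apply Rmult_le_compat_l; [assumption|]. unfold dec. rewrite <- exp_plus. apply exp_le.
  pose proof (Rabs_pos s). nra.
Qed.

Lemma besarg_continuous (j : nat) (sg s : R) :
  continuous (fun s => (2 * exp sg * cosh s) ^ j * exp (- (2 * exp sg * cosh s))) s.
Proof. apply ex_derive_continuous_R. unfold cosh. auto_derive. exact I. Qed.

Lemma besarg_nonneg (j : nat) (sg s : R) :
  0 <= (2 * exp sg * cosh s) ^ j * exp (- (2 * exp sg * cosh s)).
Proof.
  apply Rmult_le_pos; [|left; apply exp_pos]. apply pow_le.
  pose proof (exp_pos sg). pose proof (cosh_pos s). left. apply Rmult_lt_0_compat; lra.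
Qed.

Lemma besarg_tame (j : nat) (sg : R) : (j <= 3)%nat ->
  tame (fun s => (2 * exp sg * cosh s) ^ j * exp (- (2 * exp sg * cosh s))).
Proof.
  intros Hj. destruct (besarg_bound (1/4) (Rle_refl _)) as [C HC].
  exists (C * exp (- (1/4) * sg)). split; [apply besarg_continuous|].
  intros s. rewrite Rabs_pos_eq by apply besarg_nonneg. now apply HC.
Qed.

Lemma besmom_nonneg (j : nat) (sg : R) : (j <= 3)%nat -> 0 <= besmom j sg.
Proof.
  intros Hj. unfold besmom. pose proof (IR_nonneg _ (besarg_tame j sg Hj) (besarg_nonneg j sg)). lra.
Qed.

Lemma besmom_bound (a : R) : 1 / 4 <= a -> exists C, forall sg j, (j <= 3)%nat ->
  Rabs (besmom j sg) <= C * exp (- a * sg).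
Proof.
  intros Ha. destruct (besarg_bound a Ha) as [C HC]. exists (4 * C). intros sg j Hj.
  assert (H : tame_by (C * exp (- a * sg)) (fun s => (2 * exp sg * cosh s) ^ j * exp (- (2 * exp sg * cosh s)))).
  { split; [apply besarg_continuous|]. intros s. rewrite Rabs_pos_eq by apply besarg_nonneg. now apply HC. }
  apply IR_bound in H. unfold besmom, Rdiv. rewrite Rabs_mult, (Rabs_pos_eq (/ 2)) by lra. lra.
Qed.

Lemma is_derive_besmom_0 (sg : R) : is_derive (besmom 0) sg (- besmom 1 sg).
Proof.
  destruct (besarg_bound (1/4) (Rle_refl _)) as [C HC].
  assert (H : is_derive (fun sg => IR (fun s => (2 * exp sg * cosh s) ^ 0 * exp (- (2 * exp sg * cosh s)))) sg
     (IR (fun s => (-1) * ((2 * exp sg * cosh s) ^ 1 * exp (- (2 * exp sg * cosh s)))))).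
  { apply (IR_derive (fun sg s => (2 * exp sg * cosh s) ^ 0 * exp (- (2 * exp sg * cosh s)))
      (fun sg s => (-1) * ((2 * exp sg * cosh s) ^ 1 * exp (- (2 * exp sg * cosh s))))
      (fun sg s => (2 * exp sg * cosh s) ^ 2 * exp (- (2 * exp sg * cosh s)) -
        (2 * exp sg * cosh s) ^ 1 * exp (- (2 * exp sg * cosh s))) sg (2 * C * exp (- (1/4) * (sg - 1)))).
    - intros s x. simpl pow. auto_derive; [exact I|]. ring.
    - intros s x. simpl pow. auto_derive; [exact I|]. ring.
    - intros x s Hx. apply Rabs_le_between in Hx.
      pose proof (HC x s 2%nat ltac:(lia)). pose proof (HC x s 1%nat ltac:(lia)).
      pose proof (besarg_nonneg 2 x s). pose proof (besarg_nonneg 1 x s).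
      assert (0 <= C) by (pose proof (exp_pos (- (1/4) * x)); pose proof (dec_pos s);
        assert (0 < exp (- (1/4) * x) * dec s) by (now apply Rmult_lt_0_compat); rewrite Rmult_assoc in *; nra).
      pose proof (exp_le (- (1/4) * x) (- (1/4) * (sg - 1)) ltac:(lra)). pose proof (dec_pos s).
      assert (C * exp (- (1/4) * x) * dec s <= C * exp (- (1/4) * (sg - 1)) * dec s)
        by (apply Rmult_le_compat_r; [lra|now apply Rmult_le_compat_l]).
      apply Rabs_le. lra.
    - intros x. apply besarg_tame. lia.
    - apply tame_scal, besarg_tame. lia. }
  apply (is_derive_scal _ _ (/ 2)) in H. rewrite IR_scal in H by (apply besarg_tame; lia).
  replace (- besmom 1 sg) with (/ 2 * (-1 * IR (fun s => (2 * exp sg * cosh s) ^ 1 * exp (- (2 * exp sg * cosh s)))))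
    by (unfold besmom; field).
  eapply is_derive_ext; [|exact H]. intros t. unfold besmom. simpl. lra.
Qed.

(** The modified Bessel equation K'' = 4 e^{2σ} K in the variable σ, the left side being K''. With X
    = 2 e^σ cosh s one has X_s² = X² - 4 e^{2σ} and X_ss = X, so the integrand of the difference of
    the two sides is the s-derivative of -X_s e^{-X}. *)
Lemma besmom_2 (sg : R) : besmom 2 sg - besmom 1 sg = 4 * exp (2 * sg) * besmom 0 sg.
Proof.
  set (G := fun s => - (2 * exp sg * sinh s) * exp (- (2 * exp sg * cosh s))).
  set (g := fun s => ((2 * exp sg * cosh s) ^ 2 * exp (- (2 * exp sg * cosh s))
     - (2 * exp sg * cosh s) ^ 1 * exp (- (2 * exp sg * cosh s)))
     - 4 * exp (2 * sg) * ((2 * exp sg * cosh s) ^ 0 * exp (- (2 * exp sg * cosh s)))).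
  assert (Hg : tame g).
  { apply tame_minus; [apply tame_minus|apply tame_scal]; apply besarg_tame; lia. }
  assert (HG : tame G).
  { destruct (besarg_tame 1 sg ltac:(lia)) as [C [_ HC]]. exists C. split.
    - intros t. unfold G, sinh, cosh. apply ex_derive_continuous_R. auto_derive. exact I.
    - intros t. apply Rle_trans with (2 := HC t). unfold G. rewrite !(Rabs_mult _ (exp _)). apply Rmult_le_compat_r; [apply Rabs_pos|].
      rewrite pow_1, Rabs_Ropp, !Rabs_mult. apply Rmult_le_compat_l; [apply Rmult_le_pos; apply Rabs_pos|].
      rewrite (Rabs_pos_eq (cosh t)) by (left; apply cosh_pos).
      pose proof (cosh2_sinh2 t). pose proof (cosh_pos t). apply Rabs_le. nra. }
  assert (Hd : forall s, is_derive G s (g s)).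
  { intros s. unfold G, g.
    replace (exp (2 * sg)) with (exp sg * exp sg) by (rewrite <- exp_plus; f_equal; ring).
    pose proof (cosh2_sinh2 s) as H.
    assert (Hgen : is_derive (fun s => - (2 * exp sg * sinh s) * exp (- (2 * exp sg * cosh s))) s
      ((- (2 * exp sg * cosh s) + (2 * exp sg * sinh s) ^ 2) * exp (- (2 * exp sg * cosh s)))).
    { unfold sinh, cosh. auto_derive; [exact I|]. unfold Rdiv. ring. }
    evar_last; [apply Hgen|].
    replace ((2 * exp sg * sinh s) ^ 2) with (4 * (exp sg * exp sg) * (cosh s ^ 2 - 1)) by (rewrite H; ring).
    ring. }
  pose proof (IR_derive_zero G g HG Hg Hd) as H. unfold g in H.
  rewrite IR_minus in H by ((apply tame_minus; apply besarg_tame; lia) || (apply tame_scal; apply besarg_tame; lia)).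
  rewrite IR_minus, IR_scal in H by (apply besarg_tame; lia). unfold besmom. lra.
Qed.

(** In σ, [kap] is -K' and [k2] is K''; as Bessel functions they are 2e^σ K_1(2e^σ) and 4e^{2σ}
    K_0(2e^σ). The signs are chosen so that all three are nonnegative. *)
Definition K (sg : R) : R := besmom 0 sg.
Definition kap (sg : R) : R := besmom 1 sg.
Definition k2 (sg : R) : R := 4 * exp (2 * sg) * K sg.

Lemma is_derive_K (sg : R) : is_derive K sg (- kap sg).
Proof. apply is_derive_besmom_0. Qed.

Lemma is_derive_kap (sg : R) : is_derive kap sg (- k2 sg).
Proof.
  destruct (besarg_bound (1/4) (Rle_refl _)) as [C HC].
  set (X := fun sg s => 2 * exp sg * cosh s).
  assert (H : is_derive (fun sg => IR (fun s => X sg s ^ 1 * exp (- X sg s))) sg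
     (IR (fun s => X sg s ^ 1 * exp (- X sg s) - X sg s ^ 2 * exp (- X sg s)))).
  { apply (IR_derive (fun sg s => X sg s ^ 1 * exp (- X sg s))
      (fun sg s => X sg s ^ 1 * exp (- X sg s) - X sg s ^ 2 * exp (- X sg s))
      (fun sg s => X sg s ^ 1 * exp (- X sg s) - 3 * (X sg s ^ 2 * exp (- X sg s)) + X sg s ^ 3 * exp (- X sg s))
       sg (5 * C * exp (- (1/4) * (sg - 1)))).
    - intros s x. unfold X. simpl pow. auto_derive; [exact I|]. ring.
    - intros s x. unfold X. simpl pow. auto_derive; [exact I|]. ring.
    - intros x s Hx. apply Rabs_le_between in Hx.
      pose proof (HC x s 3%nat ltac:(lia)) as H3. pose proof (HC x s 2%nat ltac:(lia)) as H2.
      pose proof (HC x s 1%nat ltac:(lia)) as H1.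
      pose proof (besarg_nonneg 3 x s) as P3. pose proof (besarg_nonneg 2 x s) as P2.
      pose proof (besarg_nonneg 1 x s) as P1.
      assert (0 <= C) by (pose proof (exp_pos (- (1/4) * x)); pose proof (dec_pos s);
        assert (0 < exp (- (1/4) * x) * dec s) by (now apply Rmult_lt_0_compat); rewrite Rmult_assoc in *; nra).
      pose proof (exp_le (- (1/4) * x) (- (1/4) * (sg - 1)) ltac:(lra)). pose proof (dec_pos s).
      assert (C * exp (- (1/4) * x) * dec s <= C * exp (- (1/4) * (sg - 1)) * dec s)
        by (apply Rmult_le_compat_r; [lra|now apply Rmult_le_compat_l]).
      unfold X. apply Rabs_le. lra.
    - intros x. apply (besarg_tame 1). lia.
    - apply tame_minus; [apply (besarg_tame 1)|apply (besarg_tame 2)]; lia. }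
  apply (is_derive_scal _ _ (/ 2)) in H.
  rewrite IR_minus in H by ((apply (besarg_tame 1); lia) || (apply (besarg_tame 2); lia)).
  replace (- k2 sg) with (/ 2 * (IR (fun s => X sg s ^ 1 * exp (- X sg s)) - IR (fun s => X sg s ^ 2 * exp (- X sg s)))).
  - eapply is_derive_ext; [|exact H]. intros t. unfold kap, besmom, X. lra.
  - unfold k2, K. rewrite <- besmom_2. unfold besmom, X. field.
Qed.

Lemma is_derive_k2 (sg : R) : is_derive k2 sg (2 * k2 sg - 4 * exp (2 * sg) * kap sg).
Proof.
  unfold k2. pose proof (is_derive_K sg) as H. auto_derive; [eexists; exact H|].
  rewrite (Derive_eta _ _ _ H). ring.
Qed.

(** Faster decay than any exponential at +∞, and growth of at most e^{|t|/4} at -∞, which covers the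
    linear growth of [K] there. The class is stable under multiplication by e^{ct} with c >= 0. *)
Definition rapid (k : R -> R) : Prop :=
  (forall t, continuous k t) /\
  forall a, 1 / 4 <= a -> exists C, forall t, Rabs (k t) <= C * exp (- a * t).

Lemma rapid_K : rapid K.
Proof.
  split; [intros t; apply (derive_continuous _ _ _ (is_derive_K t))|].
  intros a Ha. destruct (besmom_bound a Ha) as [C HC]. exists C. intros t. apply HC. lia.
Qed.

Lemma rapid_kap : rapid kap.
Proof.
  split; [intros t; apply (derive_continuous _ _ _ (is_derive_kap t))|].
  intros a Ha. destruct (besmom_bound a Ha) as [C HC]. exists C. intros t. apply HC. lia.
Qed.

Lemma rapid_exp (k : R -> R) (c : R) : 0 <= c -> rapid k -> rapid (fun t => exp (c * t) * k t).
Proof.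
  intros Hc [Hk Hb]. split.
  - intros t. apply (@continuous_mult R_UniformSpace R_AbsRing); [|apply Hk].
    apply ex_derive_continuous_R. auto_derive. exact I.
  - intros a Ha. destruct (Hb (a + c) ltac:(lra)) as [C HC]. exists C. intros t.
    rewrite Rabs_mult, Rabs_pos_eq by (left; apply exp_pos).
    apply Rle_trans with (exp (c * t) * (C * exp (- (a + c) * t))).
    + apply Rmult_le_compat_l; [left; apply exp_pos|apply HC].
    + replace (exp (c * t) * (C * exp (- (a + c) * t))) with (C * (exp (c * t) * exp (- (a + c) * t))) by ring.
      rewrite <- exp_plus. right. do 2 f_equal. ring.
Qed.

Lemma rapid_scal (k : R -> R) (c : R) : rapid k -> rapid (fun t => c * k t).
Proof.
  intros [Hk Hb]. split.
  - intros t. apply (@continuous_scal_r R_UniformSpace R_AbsRing R_NormedModule), Hk.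
  - intros a Ha. destruct (Hb a Ha) as [C HC]. exists (Rabs c * C). intros t.
    rewrite Rabs_mult, Rmult_assoc. apply Rmult_le_compat_l; [apply Rabs_pos|apply HC].
Qed.

Lemma rapid_plus (k l : R -> R) : rapid k -> rapid l -> rapid (fun t => k t + l t).
Proof.
  intros [Hk Hb] [Hk' Hb']. split.
  - intros t. apply (@continuous_plus R_UniformSpace R_AbsRing R_NormedModule); auto.
  - intros a Ha. destruct (Hb a Ha) as [C HC]. destruct (Hb' a Ha) as [D HD]. exists (C + D). intros t.
    apply Rle_trans with (1 := Rabs_triang _ _). specialize (HC t). specialize (HD t). lra.
Qed.

Lemma rapid_ext (k l : R -> R) : (forall t, k t = l t) -> rapid k -> rapid l.
Proof.
  intros H [Hk Hb]. split.
  - intros t. apply (continuous_ext k); auto.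
  - intros a Ha. destruct (Hb a Ha) as [C HC]. exists C. intros t. rewrite <- H. auto.
Qed.

Lemma rapid_k2 : rapid k2.
Proof.
  apply (rapid_ext (fun t => 4 * (exp (2 * t) * K t))); [intros; unfold k2; ring|].
  apply rapid_scal, rapid_exp; [lra|apply rapid_K].
Qed.

(** For t <= 0 the rate 1/4 of [k] leaves e^{(a-1/4)t}, which is where a >= 1/2 enters; for t > 0
    the rate a + 1/4 is used. *)
Lemma tame_rapid_mult (k g : R -> R) (B a : R) : 1 / 2 <= a -> rapid k ->
  (forall t, continuous g t) -> (forall t, Rabs (g t) <= B * exp (a * t)) ->
  tame (fun t => k t * g t).
Proof.
  intros Ha [Hk Hb] Hg HB.
  destruct (Hb (1/4) (Rle_refl _)) as [C1 H1]. destruct (Hb (a + 1/4) ltac:(lra)) as [C2 H2].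
  assert (HC1 : 0 <= C1) by (specialize (H1 0); pose proof (Rabs_pos (k 0)); pose proof (exp_pos (- (1/4) * 0)); nra).
  assert (HC2 : 0 <= C2) by (specialize (H2 0); pose proof (Rabs_pos (k 0)); pose proof (exp_pos (- (a + 1/4) * 0)); nra).
  assert (HBp : 0 <= B) by (specialize (HB 0); pose proof (Rabs_pos (g 0)); pose proof (exp_pos (a * 0)); nra).
  exists (C1 * B + C2 * B). split.
  - intros t. apply (@continuous_mult R_UniformSpace R_AbsRing); auto.
  - intros t. rewrite Rabs_mult. pose proof (dec_pos t).
    assert (0 <= C1 * B) by nra. assert (0 <= C2 * B) by nra.
    destruct (Rle_dec t 0) as [Ht|Ht].
    + apply Rle_trans with ((C1 * exp (- (1/4) * t)) * (B * exp (a * t))).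
      * apply Rmult_le_compat; auto using Rabs_pos.
      * replace (C1 * exp (- (1 / 4) * t) * (B * exp (a * t))) with
          (C1 * B * (exp (- (1/4) * t) * exp (a * t))) by ring. rewrite <- exp_plus.
        assert (exp (- (1/4) * t + a * t) <= dec t) by (rewrite dec_neg by assumption; apply exp_le; nra).
        nra.
    + apply Rle_trans with ((C2 * exp (- (a + 1/4) * t)) * (B * exp (a * t))).
      * apply Rmult_le_compat; auto using Rabs_pos.
      * replace (C2 * exp (- (a + 1 / 4) * t) * (B * exp (a * t))) with
          (C2 * B * (exp (- (a + 1/4) * t) * exp (a * t))) by ring. rewrite <- exp_plus.
        assert (exp (- (a + 1/4) * t + a * t) <= dec t) by (rewrite dec_nonneg by lra; apply exp_le; nra).
        nra.
Qed.

(** With c = 2 e^σ, the inequalities sinh s <= cosh s <= 1 + sinh s compare the integrand with c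
    cosh s e^{-c sinh s}, an exact derivative whose integral over s > 0 is 1. Both bounds together
    make [kap] tend to 1 at -∞ at an exponential rate. *)
Lemma kap_bounds (sg : R) : exp (- (2 * exp sg)) <= kap sg <= 1.
Proof.
  set (c := 2 * exp sg). assert (Hc : 0 < c) by (unfold c; pose proof (exp_pos sg); lra).
  set (f := fun s => (2 * exp sg * cosh s) ^ 1 * exp (- (2 * exp sg * cosh s))).
  assert (Hl : is_lim (fun T => RInt f 0 T) p_infty (kap sg)).
  { destruct (besarg_tame 1 sg ltac:(lia)) as [C HC]. apply (RInt_even_lim C _ HC).
    intros t. rewrite cosh_even. reflexivity. }
  set (g := fun s => c * cosh s * exp (- (c * sinh s))).
  assert (Hgc : forall s, continuous g s).
  { intros s. unfold g, cosh, sinh. apply ex_derive_continuous_R. auto_derive. exact I. }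
  assert (Hfc : forall s, continuous f s) by apply besarg_continuous.
  assert (HG : forall T, is_RInt g 0 T (1 - exp (- (c * sinh T)))).
  { intros T. replace (1 - exp (- (c * sinh T)))
      with (- exp (- (c * sinh T)) - - exp (- (c * sinh 0)))
      by (rewrite sinh_0, Rmult_0_r, Ropp_0, exp_0; ring).
    apply (is_RInt_derive_R (fun s => - exp (- (c * sinh s)))); [|assumption].
    intros s. unfold g, sinh, cosh. auto_derive; [exact I|]. unfold Rdiv, Rminus. ring. }
  assert (Hfg : forall s, 0 <= s -> exp (- c) * g s <= f s <= g s).
  { intros s Hs. unfold f, g. fold c. rewrite pow_1. pose proof (cosh_pos s).
    assert (Hcs : sinh s <= cosh s <= 1 + sinh s).
    { unfold cosh, sinh. pose proof (exp_pos (- s)).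
      pose proof (exp_le (- s) 0 ltac:(lra)) as He. rewrite exp_0 in He. lra. }
    replace (exp (- c) * (c * cosh s * exp (- (c * sinh s)))) with
      (c * cosh s * (exp (- c) * exp (- (c * sinh s)))) by ring. rewrite <- exp_plus.
    assert (0 <= c * cosh s) by nra.
    split; apply Rmult_le_compat_l; try assumption; apply exp_le; nra. }
  split.
  - apply (is_lim_le_loc (fun T => exp (- c) * (1 - exp (- (c * sinh T)))) (fun T => RInt f 0 T) p_infty
      (exp (- c)) (kap sg)); [| |exact Hl].
    + exists 0. intros T HT.
      apply (is_RInt_le (fun s => exp (- c) * g s) f 0 T); [lra| | |].
      * apply (@is_RInt_scal R_NormedModule), HG.
      * apply RInt_correct_cont, Hfc.
      * intros s Hs. apply Hfg. lra.
    + apply (is_lim_p_exp _ _ c 1 0); [assumption|]. intros T HT.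
      replace (exp (- c) * (1 - exp (- (c * sinh T))) - exp (- c))
        with (- (exp (- c) * exp (- (c * sinh T)))) by ring.
      rewrite Rabs_Ropp, <- exp_plus, Rabs_pos_eq, Rmult_1_l by (left; apply exp_pos).
      apply exp_le. pose proof (sinh_ge_id T ltac:(lra)). nra.
  - apply (is_lim_le_loc (fun T => RInt f 0 T) (fun T => 1) p_infty (kap sg) 1); [|exact Hl|apply is_lim_const].
    exists 0. intros T HT. apply Rle_trans with (1 - exp (- (c * sinh T))).
    + apply (is_RInt_le f g 0 T); [lra| |apply HG|].
      * apply RInt_correct_cont, Hfc.
      * intros s Hs. apply Hfg. lra.
    + pose proof (exp_pos (- (c * sinh T))). lra.
Qed.

Lemma one_minus_kap (sg : R) : 0 <= 1 - kap sg <= 2 * exp sg.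
Proof.
  pose proof (kap_bounds sg). pose proof (exp_ge_1_plus (- (2 * exp sg))). lra.
Qed.

Lemma K_nonneg (sg : R) : 0 <= K sg.
Proof. apply besmom_nonneg. lia. Qed.

Lemma k2_nonneg (sg : R) : 0 <= k2 sg.
Proof. unfold k2. pose proof (K_nonneg sg). pose proof (exp_pos (2 * sg)). nra. Qed.

(** * Mellin moments of [k2] *)

Ltac tame_tac := repeat first [assumption | apply tame_minus | apply tame_plus | apply tame_scal].

(** [cmom] and [smom] are the real and imaginary parts of the Mellin transform of [k2] at 2N + im, a
    function known to be Γ(N + 1 + im/2)². That value is not presupposed: it is recovered from the
    recurrence in N and the behaviour for large N. *)
Definition cmom (m : R) (N : nat) : R := IR (fun t => k2 t * (exp (2 * INR N * t) * cos (m * t))).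
Definition smom (m : R) (N : nat) : R := IR (fun t => k2 t * (exp (2 * INR N * t) * sin (m * t))).

Lemma exp_trig_continuous (c m t : R) :
  continuous (fun t => exp (c * t) * cos (m * t)) t /\ continuous (fun t => exp (c * t) * sin (m * t)) t.
Proof. split; apply ex_derive_continuous_R; auto_derive; exact I. Qed.

Lemma exp_trig_bound (c m t : R) :
  Rabs (exp (c * t) * cos (m * t)) <= 1 * exp (c * t) /\ Rabs (exp (c * t) * sin (m * t)) <= 1 * exp (c * t).
Proof.
  pose proof (exp_pos (c * t)). pose proof (cos_abs_le_1 (m * t)). pose proof (sin_abs_le_1 (m * t)).
  split; rewrite Rabs_mult, (Rabs_pos_eq (exp _)) by lra; nra.
Qed.

Lemma tame_rapid_trig (k : R -> R) (c m : R) : rapid k -> 1 / 2 <= c ->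
  tame (fun t => k t * (exp (c * t) * cos (m * t))) /\ tame (fun t => k t * (exp (c * t) * sin (m * t))).
Proof.
  intros Hk Hc. split; apply (tame_rapid_mult k _ 1 c); auto; intros t;
    apply exp_trig_continuous || apply exp_trig_bound.
Qed.

Lemma tame_k2_mult (g : R -> R) (B a : R) : -3/2 <= a ->
  (forall t, continuous g t) -> (forall t, Rabs (g t) <= B * exp (a * t)) ->
  tame (fun t => k2 t * g t).
Proof.
  intros Ha Hg HB.
  apply (tame_ext (fun t => K t * (4 * exp (2 * t) * g t))); [intros; unfold k2; ring|].
  apply (tame_rapid_mult K _ (4 * B) (2 + a)); [lra|apply rapid_K| |].
  - intros t. apply (@continuous_mult R_UniformSpace R_AbsRing); [|apply Hg].
    apply ex_derive_continuous_R. auto_derive. exact I.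
  - intros t. replace ((2 + a) * t) with (2 * t + a * t) by ring.
    rewrite exp_plus, Rabs_mult, Rabs_pos_eq by (pose proof (exp_pos (2 * t)); lra).
    pose proof (HB t). pose proof (exp_pos (2 * t)). nra.
Qed.

Lemma tame_k2_trig (c m : R) : 0 <= c ->
  tame (fun t => k2 t * (exp (c * t) * cos (m * t))) /\ tame (fun t => k2 t * (exp (c * t) * sin (m * t))).
Proof.
  intros Hc. split; apply (tame_k2_mult _ 1 c); try lra; intros t;
    apply exp_trig_continuous || apply exp_trig_bound.
Qed.

Lemma moment_parts (k k1 : R -> R) (c m : R) : 1 / 2 <= c -> rapid k -> rapid k1 ->
  (forall t, is_derive k t (- k1 t)) ->
  IR (fun t => k1 t * (exp (c * t) * cos (m * t))) =
    c * IR (fun t => k t * (exp (c * t) * cos (m * t))) - m * IR (fun t => k t * (exp (c * t) * sin (m * t))) /\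
  IR (fun t => k1 t * (exp (c * t) * sin (m * t))) =
    c * IR (fun t => k t * (exp (c * t) * sin (m * t))) + m * IR (fun t => k t * (exp (c * t) * cos (m * t))).
Proof.
  intros Hc Hk Hk1 Hd.
  destruct (tame_rapid_trig k c m Hk Hc) as [T1 T2].
  destruct (tame_rapid_trig k1 c m Hk1 Hc) as [T3 T4]. split.
  - pose proof (IR_derive_zero (fun t => k t * (exp (c * t) * cos (m * t)))
      (fun t => c * (k t * (exp (c * t) * cos (m * t))) - m * (k t * (exp (c * t) * sin (m * t)))
         - k1 t * (exp (c * t) * cos (m * t))) T1) as H.
    rewrite !IR_minus, !IR_scal in H by auto using tame_minus, tame_scal.
    apply Rminus_diag_uniq_sym. apply H.
    + auto using tame_minus, tame_scal.
    + intros t. specialize (Hd t). auto_derive; [eexists; exact Hd|]. rewrite (Derive_eta _ _ _ Hd). ring.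
  - pose proof (IR_derive_zero (fun t => k t * (exp (c * t) * sin (m * t)))
      (fun t => c * (k t * (exp (c * t) * sin (m * t))) + m * (k t * (exp (c * t) * cos (m * t)))
         - k1 t * (exp (c * t) * sin (m * t))) T2) as H.
    rewrite IR_minus, IR_plus, !IR_scal in H by auto using tame_plus, tame_scal.
    apply Rminus_diag_uniq_sym. apply H.
    + auto using tame_minus, tame_plus, tame_scal.
    + intros t. specialize (Hd t). auto_derive; [eexists; exact Hd|]. rewrite (Derive_eta _ _ _ Hd). ring.
Qed.

(** The functional equation Γ(z+1)² = z² Γ(z)² at z = n + im/2: two integrations by parts bring [k2]
    down to [K] with the factor (2n + im)², and 4 e^{2t} K = [k2] lowers the exponent by 2. *)
Lemma moments_k2_step (m : R) (N : nat) : let n := INR (S N) in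
  cmom m (S N) = (n ^ 2 - (m / 2) ^ 2) * cmom m N - 2 * n * (m / 2) * smom m N /\
  smom m (S N) = (n ^ 2 - (m / 2) ^ 2) * smom m N + 2 * n * (m / 2) * cmom m N.
Proof.
  intros n. assert (Hn : 1 <= n) by (unfold n; rewrite S_INR; pose proof (pos_INR N); lra).
  unfold cmom, smom. fold n.
  destruct (moment_parts kap k2 (2 * n) m ltac:(lra) rapid_kap rapid_k2 is_derive_kap) as [H1 H2].
  destruct (moment_parts K kap (2 * n) m ltac:(lra) rapid_K rapid_kap is_derive_K) as [H3 H4].
  assert (He : forall t, exp (2 * n * t) = exp (2 * INR N * t) * exp (2 * t)).
  { intros t. rewrite <- exp_plus. f_equal. unfold n. rewrite S_INR. ring. }
  destruct (tame_k2_trig (2 * INR N) m ltac:(pose proof (pos_INR N); lra)) as [T1 T2].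
  assert (H5 : IR (fun t => K t * (exp (2 * n * t) * cos (m * t))) =
     / 4 * IR (fun t => k2 t * (exp (2 * INR N * t) * cos (m * t)))).
  { rewrite <- IR_scal by assumption. apply IR_ext. intros t. rewrite He. unfold k2. field. }
  assert (H6 : IR (fun t => K t * (exp (2 * n * t) * sin (m * t))) =
     / 4 * IR (fun t => k2 t * (exp (2 * INR N * t) * sin (m * t)))).
  { rewrite <- IR_scal by assumption. apply IR_ext. intros t. rewrite He. unfold k2. field. }
  rewrite H1, H2, H3, H4, H5, H6. split; field.
Qed.

Definition emom (N : nat) : R := IR (fun t => k2 t * exp (2 * INR N * t)).

Lemma tame_k2_exp (c : R) : -3/2 <= c -> tame (fun t => k2 t * exp (c * t)).
Proof.
  intros Hc. apply (tame_k2_mult _ 1 c Hc).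
  - intros t. apply ex_derive_continuous_R. auto_derive. exact I.
  - intros t. rewrite Rabs_pos_eq by (left; apply exp_pos). lra.
Qed.

Lemma cmom_0 (N : nat) : cmom 0 N = emom N.
Proof. apply IR_ext. intros t. rewrite Rmult_0_l, cos_0. ring. Qed.

Lemma rapid_lim (k : R -> R) : rapid k -> is_lim k p_infty 0.
Proof.
  intros [_ Hk]. destruct (Hk 1 ltac:(lra)) as [C HC].
  apply (is_lim_p_exp _ 0 1 C 0); [lra|]. intros t _. rewrite Rminus_0_r. apply HC.
Qed.

Lemma kap_lim_m : is_lim kap m_infty 1.
Proof.
  apply (is_lim_m_exp _ 1 1 2 0); [lra|]. intros t _. pose proof (one_minus_kap t).
  rewrite Rabs_left1, Rmult_1_l by lra. lra.
Qed.

Lemma emom_eq (N : nat) : emom N = INR (fact N) ^ 2.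
Proof.
  induction N as [|N IH].
  - unfold emom. rewrite (IR_ext _ k2) by (intros; simpl; rewrite Rmult_0_r, Rmult_0_l, exp_0; ring).
    rewrite (IR_FTC (fun t => - kap t) k2 (-1) 0).
    + simpl. ring.
    + apply (tame_ext (fun t => k2 t * exp (0 * t))); [intros; rewrite Rmult_0_l, exp_0; ring|].
      apply tame_k2_exp. lra.
    + intros t. rewrite <- (Ropp_involutive (k2 t)). apply (is_derive_opp kap). apply is_derive_kap.
    + replace (Finite 0) with (Rbar_opp 0) by (simpl; f_equal; ring).
      apply is_lim_opp. apply (rapid_lim kap rapid_kap).
    + apply (is_lim_opp kap m_infty 1), kap_lim_m.
  - rewrite <- cmom_0. destruct (moments_k2_step 0 N) as [H _]. rewrite H, cmom_0, IH.
    rewrite fact_simpl, mult_INR. replace (0 / 2) with 0 by field. ring.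
Qed.

Lemma abs_le_sinh_diff (x : R) : Rabs x <= Rabs (exp x - exp (- x)) / 2.
Proof.
  assert (H : forall z, 0 <= z -> z <= (exp z - exp (- z)) / 2) by (intros z Hz; apply (sinh_ge_id z Hz)).
  destruct (Rle_dec 0 x) as [Hx|Hx].
  - rewrite (Rabs_pos_eq x) by assumption. apply Rle_trans with (1 := H x Hx).
    pose proof (Rle_abs (exp x - exp (- x))). lra.
  - rewrite Rabs_left1 by lra. apply Rle_trans with (1 := H (- x) ltac:(lra)).
    rewrite Ropp_involutive. pose proof (Rle_abs (- (exp x - exp (- x)))). rewrite Rabs_Ropp in H0. lra.
Qed.

Lemma trig_lipschitz (x y : R) : Rabs (cos x - cos y) <= Rabs (x - y) /\ Rabs (sin x - sin y) <= Rabs (x - y).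
Proof.
  split.
  - destruct (MVT_gen cos y x (fun t => - sin t)) as [c [_ Hc]].
    + intros; auto_derive; [exact I|ring].
    + intros. apply continuity_cos.
    + rewrite Hc, Rabs_mult, Rabs_Ropp. pose proof (sin_abs_le_1 c). pose proof (Rabs_pos (x - y)). nra.
  - destruct (MVT_gen sin y x cos) as [c [_ Hc]].
    + intros; auto_derive; [exact I|ring].
    + intros. apply continuity_sin.
    + rewrite Hc, Rabs_mult. pose proof (cos_abs_le_1 c). pose proof (Rabs_pos (x - y)). nra.
Qed.

(** The measure [k2 t e^{2Nt} dt] concentrates at [t = ln N]: with [r = e^t / N] one has
    [|ln r| <= |r - 1/r| / 2], and [(r - 1/r)^2] integrates to three consecutive moments. *)
Lemma moment_concentration (F : R -> R) (m : R) (N : nat) :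
  (forall x y, Rabs (F x - F y) <= Rabs (x - y)) -> (forall x, Rabs (F x) <= 1) ->
  (forall t, continuous (fun t => F (m * t)) t) ->
  Rabs (IR (fun t => k2 t * (exp (2 * INR (S N) * t) * F (m * t))) / INR (fact (S N)) ^ 2
        - F (m * ln (INR (S N)))) <= Rabs m / sqrt (INR (S N)).
Proof.
  intros HF HF1 HFc. set (n := INR (S N)).
  assert (Hn : 1 <= n) by (unfold n; rewrite S_INR; pose proof (pos_INR N); lra).
  set (fN := INR (fact (S N)) ^ 2).
  assert (HfN : 0 < fN) by (apply pow_lt, INR_fact_lt_0).
  (* The width of the concentration, used as the weight in Young's inequality z/2 <= (dl + z²/dl)/4
     for z = |r - 1/r|. It balances the two terms, as the mean of z² is O(1/n). *)
  set (dl := / sqrt n). assert (Hs : 0 < sqrt n) by (apply sqrt_lt_R0; lra).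
  assert (Hdl : 0 < dl) by now apply Rinv_0_lt_compat.
  assert (Hdl2 : dl * dl * n = 1).
  { unfold dl. rewrite <- Rinv_mult, sqrt_sqrt by lra. field. lra. }
  assert (Ht1 : tame (fun t => k2 t * (exp (2 * n * t) * F (m * t)))).
  { apply (tame_k2_mult _ 1 (2 * n)); [lra| |].
    - intros t. apply (@continuous_mult R_UniformSpace R_AbsRing); [|apply HFc].
      apply ex_derive_continuous_R. auto_derive. exact I.
    - intros t. rewrite Rabs_mult, Rabs_pos_eq by (left; apply exp_pos).
      pose proof (exp_pos (2 * n * t)). pose proof (HF1 (m * t)). nra. }
  set (c0 := F (m * ln n)).
  set (E := fun t => exp (2 * n * t)).
  assert (Hm0 : IR (fun t => k2 t * exp (2 * INR N * t)) = fN / n ^ 2).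
  { fold (emom N). rewrite emom_eq. unfold fN. rewrite fact_simpl, mult_INR. fold n. field. lra. }
  assert (Hm1 : IR (fun t => k2 t * E t) = fN).
  { change (emom (S N) = fN). rewrite emom_eq. reflexivity. }
  assert (Hm2 : IR (fun t => k2 t * exp (2 * INR (S (S N)) * t)) = fN * (n + 1) ^ 2).
  { change (emom (S (S N)) = fN * (n + 1) ^ 2). rewrite emom_eq, fact_simpl, mult_INR.
    rewrite (S_INR (S N)). fold n. unfold fN. ring. }
  assert (Hpt : forall t, Rabs (k2 t * (E t * F (m * t)) - c0 * (k2 t * E t)) <=
     Rabs m / 4 * (dl * (k2 t * E t) + / dl * (/ n ^ 2 * (k2 t * exp (2 * INR (S (S N)) * t))
       - 2 * (k2 t * E t) + n ^ 2 * (k2 t * exp (2 * INR N * t))))).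
  { intros t. set (r := exp (t - ln n)).
    assert (Hr : exp t = n * r) by (unfold r; rewrite <- (exp_ln n) at 1 by lra; rewrite <- exp_plus; f_equal; ring).
    assert (Hrp : 0 < r) by apply exp_pos.
    assert (HE2 : exp (2 * INR (S (S N)) * t) = E t * (n * r) ^ 2).
    { rewrite <- Hr. replace (exp t ^ 2) with (exp t * exp t) by ring. unfold E. rewrite <- !exp_plus.
      f_equal. rewrite (S_INR (S N)). fold n. ring. }
    assert (HE0 : exp (2 * INR N * t) = E t * / (n * r) ^ 2).
    { rewrite <- Hr. replace (exp t ^ 2) with (exp (t + t)) by (rewrite exp_plus; ring).
      rewrite <- exp_Ropp. unfold E. rewrite <- exp_plus. f_equal.
      unfold n. rewrite S_INR. ring. }
    rewrite HE2, HE0. set (w := k2 t * E t).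
    assert (Hw : 0 <= w) by (apply Rmult_le_pos; [apply k2_nonneg|left; apply exp_pos]).
    replace (k2 t * (E t * F (m * t)) - c0 * w) with (w * (F (m * t) - c0)) by (unfold w; ring).
    replace (k2 t * (E t * (n * r) ^ 2)) with (w * (n * r) ^ 2) by (unfold w; ring).
    replace (k2 t * (E t * / (n * r) ^ 2)) with (w * / (n * r) ^ 2) by (unfold w; ring).
    replace (Rabs m / 4 * (dl * w + / dl * (/ n ^ 2 * (w * (n * r) ^ 2) - 2 * w + n ^ 2 * (w * / (n * r) ^ 2))))
      with (w * (Rabs m * ((dl + / dl * (r - / r) ^ 2) / 4))) by (field; lra).
    rewrite Rabs_mult, (Rabs_pos_eq w) by assumption. apply Rmult_le_compat_l; [assumption|].
    apply Rle_trans with (1 := HF _ _). rewrite <- Rmult_minus_distr_l, Rabs_mult.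
    apply Rmult_le_compat_l; [apply Rabs_pos|].
    apply Rle_trans with (1 := abs_le_sinh_diff _). rewrite exp_Ropp. fold r.
    set (z := Rabs (r - / r)). rewrite <- (pow2_abs (r - / r)). fold z.
    assert (0 <= (dl - z) ^ 2) by apply pow2_ge_0.
    apply (Rmult_le_reg_l (4 * dl)); [lra|].
    replace (4 * dl * ((dl + / dl * z ^ 2) / 4)) with (dl * dl + z ^ 2) by (field; lra). nra. }
  pose proof (tame_k2_exp (2 * n) ltac:(lra)) as HtE.
  pose proof (tame_k2_exp (2 * INR N) ltac:(pose proof (pos_INR N); lra)) as HtE0.
  pose proof (tame_k2_exp (2 * INR (S (S N))) ltac:(pose proof (pos_INR (S (S N))); lra)) as HtE2.
  assert (HtE' : tame (fun t => k2 t * E t)) by exact HtE.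
  pose proof (IR_abs_le _ _ (tame_minus _ _ Ht1 (tame_scal c0 _ HtE'))
    (tame_scal (Rabs m / 4) _ (tame_plus _ _ (tame_scal dl _ HtE') (tame_scal (/ dl) _
      (tame_plus _ _ (tame_minus _ _ (tame_scal (/ n ^ 2) _ HtE2) (tame_scal 2 _ HtE')) (tame_scal (n ^ 2) _ HtE0)))))
    Hpt) as H.
  rewrite IR_minus in H by tame_tac.
  rewrite IR_scal in H by tame_tac.
  rewrite IR_scal in H by tame_tac.
  rewrite IR_plus in H by tame_tac.
  rewrite !IR_scal in H by tame_tac.
  rewrite IR_plus, IR_minus, !IR_scal in H by tame_tac.
  rewrite Hm0, Hm1, Hm2 in H.
  set (I := IR (fun t => k2 t * (exp (2 * n * t) * F (m * t)))) in *.
  replace (I / fN - c0) with ((I - c0 * fN) / fN) by (field; lra).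
  unfold Rdiv at 1. rewrite Rabs_mult, Rabs_inv, (Rabs_pos_eq fN) by lra.
  apply (Rmult_le_reg_r fN); [assumption|]. rewrite Rmult_assoc, Rinv_l, Rmult_1_r by lra.
  apply Rle_trans with (1 := H).
  (* The three moments are in the ratio 1/n² : 1 : (n+1)², so the mean of (r - 1/r)² is 2/n +
     1/n². *)
  replace (/ n ^ 2 * (fN * (n + 1) ^ 2) - 2 * fN + n ^ 2 * (fN / n ^ 2)) with (fN * (2 / n + / n ^ 2))
    by (field; lra).
  assert (Hinv : / n ^ 2 <= / n) by (apply Rinv_le_contravar; [lra|nra]).
  assert (Hin : 0 < / n) by (apply Rinv_0_lt_compat; lra).
  replace (Rabs m / sqrt n) with (Rabs m * dl) by reflexivity.
  assert (Hdn : / dl * / n = dl).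
  { apply (Rmult_eq_reg_l (dl * n)); [|nra].
    replace (dl * n * (/ dl * / n)) with 1 by (field; lra). lra. }
  assert (Hb : dl * fN + / dl * (fN * (2 / n + / n ^ 2)) <= 4 * (dl * fN)).
  { assert (Hidl : 0 < / dl) by now apply Rinv_0_lt_compat.
    assert (/ dl * (fN * (2 / n + / n ^ 2)) <= / dl * (fN * (3 * / n))).
    { apply Rmult_le_compat_l; [lra|]. apply Rmult_le_compat_l; lra. }
    replace (/ dl * (fN * (3 * / n))) with (3 * fN * (/ dl * / n)) in H0 by ring. rewrite Hdn in H0. lra. }
  pose proof (Rabs_pos m).
  replace (Rabs m * dl * fN) with (Rabs m / 4 * (4 * (dl * fN))) by field.
  apply Rmult_le_compat_l; lra.
Qed.

Lemma is_lim_seq_inv_sqrt (c : R) : is_lim_seq (fun N => c / sqrt (INR (S N))) 0.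
Proof.
  replace (Finite 0) with (Rbar_mult c 0) by (simpl; f_equal; ring).
  apply (is_lim_seq_scal_l (fun N => / sqrt (INR (S N)))).
  apply (is_lim_seq_inv (fun N => sqrt (INR (S N))) p_infty); [|discriminate].
  apply (is_lim_comp_seq sqrt (fun N => INR (S N)) p_infty p_infty).
  - apply is_lim_sqrt_p, is_lim_id.
  - exists 0%nat. intros; discriminate.
  - apply (is_lim_seq_incr_1 INR). apply is_lim_seq_INR.
Qed.

(** * The reciprocal Gamma function on the line Re z = 1 *)

Definition clim (u : nat -> C) (l : C) : Prop :=
  is_lim_seq (fun n => Re (u n)) (Re l) /\ is_lim_seq (fun n => Im (u n)) (Im l).

Lemma Clim_seq_correct (u : nat -> C) (l : C) : clim u l -> Clim_seq u = l.
Proof.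
  intros [H1 H2]. unfold Clim_seq. rewrite (is_lim_seq_unique _ _ H1), (is_lim_seq_unique _ _ H2).
  destruct l; reflexivity.
Qed.

Lemma clim_unique (u : nat -> C) (l l' : C) : clim u l -> clim u l' -> l = l'.
Proof. intros H H'. rewrite <- (Clim_seq_correct _ _ H). now apply Clim_seq_correct. Qed.

Lemma clim_ext_loc (u v : nat -> C) (l : C) (N : nat) :
  (forall n, (N <= n)%nat -> u n = v n) -> clim u l -> clim v l.
Proof.
  intros H [H1 H2]. split.
  - apply (is_lim_seq_ext_loc (fun n => Re (u n))); [|assumption]. exists N. intros n Hn. now rewrite H.
  - apply (is_lim_seq_ext_loc (fun n => Im (u n))); [|assumption]. exists N. intros n Hn. now rewrite H.
Qed.

Lemma clim_const (c : C) : clim (fun _ => c) c.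
Proof. split; apply is_lim_seq_const. Qed.

Lemma clim_mult (u v : nat -> C) (l l' : C) : clim u l -> clim v l' ->
  clim (fun n => (u n * v n)%C) (l * l')%C.
Proof.
  intros [H1 H2] [H3 H4]. split; simpl.
  - apply is_lim_seq_minus'; now apply is_lim_seq_mult'.
  - apply is_lim_seq_plus'; now apply is_lim_seq_mult'.
Qed.

Lemma clim_incr_1 (u : nat -> C) (l : C) : clim (fun n => u (S n)) l <-> clim u l.
Proof.
  unfold clim. rewrite (is_lim_seq_incr_1 (fun n => Re (u n))), (is_lim_seq_incr_1 (fun n => Im (u n))).
  tauto.
Qed.

Lemma Re_Im_Cmod (z : C) : Rabs (Re z) <= Cmod z /\ Rabs (Im z) <= Cmod z.
Proof.
  destruct z as [x y]. unfold Cmod; simpl. rewrite !Rmult_1_r. split.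
  - rewrite <- (sqrt_Rsqr_abs x). apply sqrt_le_1_alt. unfold Rsqr. nra.
  - rewrite <- (sqrt_Rsqr_abs y). apply sqrt_le_1_alt. unfold Rsqr. nra.
Qed.

Lemma Cmod_le_Re_Im (x y : R) : Cmod (x, y) <= Rabs x + Rabs y.
Proof.
  unfold Cmod; simpl. rewrite !Rmult_1_r. apply Rsqr_incr_0_var.
  - rewrite Rsqr_sqrt by nra. unfold Rsqr. rewrite <- (Rabs_pos_eq (x * x)) by nra.
    rewrite <- (Rabs_pos_eq (y * y)) by nra. rewrite !Rabs_mult.
    pose proof (Rabs_pos x). pose proof (Rabs_pos y). nra.
  - pose proof (Rabs_pos x). pose proof (Rabs_pos y). lra.
Qed.

Lemma Cmod_sqr (x y : R) : Cmod (x, y) ^ 2 = x ^ 2 + y ^ 2.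
Proof. unfold Cmod; cbn [fst snd]. rewrite pow2_sqrt; [reflexivity|nra]. Qed.

Lemma clim_of_Cmod (u : nat -> C) (l : C) : is_lim_seq (fun n => Cmod (u n - l)%C) 0 -> clim u l.
Proof.
  intros H. split.
  - apply is_lim_seq_spec. intros eps. apply is_lim_seq_spec in H. destruct (H eps) as [N HN].
    exists N. intros n Hn. specialize (HN n Hn). rewrite Rminus_0_r, Rabs_pos_eq in HN by apply Cmod_ge_0.
    apply Rle_lt_trans with (2 := HN). apply (Re_Im_Cmod (u n - l)%C).
  - apply is_lim_seq_spec. intros eps. apply is_lim_seq_spec in H. destruct (H eps) as [N HN].
    exists N. intros n Hn. specialize (HN n Hn). rewrite Rminus_0_r, Rabs_pos_eq in HN by apply Cmod_ge_0.
    apply Rle_lt_trans with (2 := HN). apply (Re_Im_Cmod (u n - l)%C).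
Qed.

Lemma telescoping_cauchy (u : nat -> R) (B : R) :
  (forall n, Rabs (u (S n) - u n) <= B * (/ INR (S n) - / INR (S (S n)))) -> ex_finite_lim_seq u.
Proof.
  intros H. assert (HB : forall n, 0 < / INR (S n)) by (intros; apply Rinv_0_lt_compat, lt_0_INR; lia).
  assert (HB0 : 0 <= B).
  { specialize (H 0%nat). pose proof (Rabs_pos (u 1%nat - u 0%nat)). simpl in H. lra. }
  assert (Hw : forall n k, Rabs (u (n + k)%nat - u n) <= B * (/ INR (S n) - / INR (S (n + k)))).
  { intros n k. induction k.
    - rewrite Nat.add_0_r, !Rminus_diag, Rabs_R0. lra.
    - rewrite Nat.add_succ_r. specialize (H (n + k)%nat).
      replace (u (S (n + k)) - u n) with ((u (S (n + k)) - u (n + k)%nat) + (u (n + k)%nat - u n)) by ring.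
      apply Rle_trans with (1 := Rabs_triang _ _). lra. }
  apply ex_lim_seq_cauchy_corr. intros eps.
  destruct (INR_unbounded (2 * B / eps)) as [N HN]. exists N.
  pose proof (cond_pos eps) as He.
  assert (Hs : forall n, (N <= n)%nat -> Rabs (u n - u N) < eps / 2).
  { intros n Hn. replace n with (N + (n - N))%nat by lia.
    apply Rle_lt_trans with (1 := Hw _ _). apply Rle_lt_trans with (B * / INR (S N)).
    - apply Rmult_le_compat_l; [assumption|]. specialize (HB (N + (n - N))%nat). lra.
    - assert (HSN : INR N < INR (S N)) by (apply lt_INR; lia). pose proof (pos_INR N).
      apply (Rmult_lt_reg_r (INR (S N))); [lra|]. rewrite Rmult_assoc, Rinv_l, Rmult_1_r by lra.
      apply (Rmult_lt_compat_r eps) in HN; [|lra].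
      unfold Rdiv in HN. rewrite Rmult_assoc, Rinv_l, Rmult_1_r in HN by lra. nra. }
  intros n p Hn Hp. pose proof (Hs n Hn) as H1. pose proof (Hs p Hp) as H2.
  apply Rabs_def2 in H1. apply Rabs_def2 in H2. apply Rabs_def1; lra.
Qed.

Definition cis (t : R) : C := (cos t, sin t).

Lemma cis_plus (s t : R) : cis (s + t) = (cis s * cis t)%C.
Proof. unfold cis, Cmult; simpl. rewrite cos_plus, sin_plus. f_equal. ring. Qed.

Lemma Cmod_cis (t : R) : Cmod (cis t) = 1.
Proof.
  unfold Cmod, cis; simpl. rewrite !Rmult_1_r. pose proof (sin2_cos2 t) as H. unfold Rsqr in H.
  rewrite Rplus_comm, H. apply sqrt_1.
Qed.

Lemma cis_0 : cis 0 = 1%C.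
Proof. unfold cis. rewrite cos_0, sin_0. reflexivity. Qed.

Lemma cis_neq_0 (t : R) : cis t <> 0%C.
Proof. intros H. pose proof (Cmod_cis t) as H1. rewrite H, Cmod_0 in H1. lra. Qed.

Lemma cis_opp_mult (t : R) : (cis t * cis (- t))%C = 1%C.
Proof. rewrite <- cis_plus, Rplus_opp_r. apply cis_0. Qed.

Lemma sin_minus_id_le (x : R) : Rabs (x - sin x) <= x ^ 2 / 2.
Proof.
  assert (H : forall z, 0 <= z -> Rabs (z - sin z) <= z ^ 2 / 2).
  { intros z Hz.
    assert (H1 : sin z <= z) by (pose proof (sin_abs_le z) as H1; rewrite (Rabs_pos_eq z Hz) in H1;
      pose proof (Rle_abs (sin z)); lra).
    rewrite Rabs_pos_eq by lra.
    enough (0 ^ 2 / 2 - (0 - sin 0) <= z ^ 2 / 2 - (z - sin z)) by (rewrite sin_0 in *; lra).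
    apply (incr_of_derive (fun z => z ^ 2 / 2 - (z - sin z)) (fun z => z - (1 - cos z))); [assumption| |].
    - intros t _. auto_derive; [exact I|]. field.
    - intros t [Ht _]. pose proof (one_minus_cos_le t). pose proof (COS_bound t).
      destruct (Rle_dec t 2); nra. }
  destruct (Rle_dec 0 x); [now apply H|].
  specialize (H (- x) ltac:(lra)). rewrite sin_neg in H.
  rewrite <- Rabs_Ropp. replace (- (x - sin x)) with (- x - - sin x) by ring.
  replace (x ^ 2) with ((- x) ^ 2) by ring. assumption.
Qed.

Lemma ln_step_bounds (n : R) : 1 <= n ->
  / (n + 1) <= ln (n + 1) - ln n <= / n.
Proof.
  intros Hn.
  assert (H : forall x, 0 < x -> ln x <= x - 1).
  { intros x Hx. pose proof (exp_ge_1_plus (ln x)). rewrite exp_ln in H by assumption. lra. }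
  split.
  - pose proof (H (n / (n + 1)) ltac:(apply Rdiv_lt_0_compat; lra)) as H1.
    rewrite ln_div in H1 by lra. replace (n / (n + 1) - 1) with (- / (n + 1)) in H1 by (field; lra). lra.
  - pose proof (H ((n + 1) / n) ltac:(apply Rdiv_lt_0_compat; lra)) as H1.
    rewrite ln_div in H1 by lra. replace ((n + 1) / n - 1) with (/ n) in H1 by (field; lra). lra.
Qed.

(** Partial products of Gauss' formula for [1/Γ(1+iμ)]. *)
Definition gauss (mu : R) (N : nat) : C :=
  (Cpoch (1, mu) N * RtoC (/ INR (fact (S N))) * cis (- (mu * ln (INR (S N)))))%C.

Definition gstep (mu : R) (N : nat) : C :=
  ((1, (mu / INR (S (S N)))%R) * cis (- (mu * (ln (INR (S (S N))) - ln (INR (S N))))))%C.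

Lemma gauss_S (mu : R) (N : nat) : gauss mu (S N) = (gauss mu N * gstep mu N)%C.
Proof.
  unfold gauss, gstep.
  replace (- (mu * ln (INR (S (S N))))) with
    (- (mu * ln (INR (S N))) + - (mu * (ln (INR (S (S N))) - ln (INR (S N))))) by ring.
  rewrite cis_plus.
  replace (Cpoch (1, mu) (S N)) with (Cpoch (1, mu) N * (RtoC (INR (S (S N))) * (1, (mu / INR (S (S N)))%R)))%C.
  - rewrite (fact_simpl (S N)), mult_INR, Rinv_mult, RtoC_mult.
    assert (H : (RtoC (INR (S (S N))) * RtoC (/ INR (S (S N))))%C = 1%C).
    { rewrite <- RtoC_mult, Rinv_r; [reflexivity|]. apply not_0_INR. lia. }
    set (a := RtoC (INR (S (S N)))) in *. set (b := RtoC (/ INR (S (S N)))) in *.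
    transitivity ((a * b) * (Cpoch (1, mu) N * RtoC (/ INR (fact (S N))) *
      cis (- (mu * ln (INR (S N)))) *
      ((1, (mu / INR (S (S N)))%R) * cis (- (mu * (ln (INR (S (S N))) - ln (INR (S N)))))))) %C; [ring|].
    rewrite H. ring.
  - change (Cpoch (1, mu) (S N)) with (Cpoch (1, mu) N * ((1, mu) + INR (S N)))%C. f_equal.
    pose proof (not_0_INR (S (S N)) ltac:(lia)) as Hn.
    unfold Cmult, Cplus, RtoC; cbn [fst snd]. f_equal.
    + rewrite (S_INR (S N)). ring.
    + field. exact Hn.
Qed.

Lemma Cmod_gauss_sqr (mu : R) (N : nat) : Cmod (gauss mu N) ^ 2 = sinhprod mu (S N).
Proof.
  induction N as [|N IH].
  - unfold gauss. rewrite !Cmod_mult, Cmod_cis, Cmod_R. simpl Cpoch. rewrite !Rpow_mult_distr, Cmod_sqr.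
    simpl. rewrite Rabs_pos_eq by lra. field.
  - rewrite gauss_S, Cmod_mult, Rpow_mult_distr, IH. unfold gstep.
    rewrite Cmod_mult, Cmod_cis, Rmult_1_r, Cmod_sqr.
    change (sinhprod mu (S (S N))) with (sinhprod mu (S N) * (1 + mu ^ 2 / INR (S (S N)) ^ 2)).
    f_equal. field. apply not_0_INR. lia.
Qed.

(** Since ln(n+1) - ln n lies between 1/(n+1) and 1/n, the rotation cancels the argument of 1 +
    iμ/(n+1) up to O(1/n²). The error is written with 1/n - 1/(n+1) so that it telescopes. *)
Lemma gstep_near_1 (mu : R) (N : nat) :
  Cmod (gstep mu N - 1)%C <= (2 * mu ^ 2 + Rabs mu) * (/ INR (S N) - / INR (S (S N))).
Proof.
  set (n := INR (S N)). assert (Hn : 1 <= n) by (unfold n; rewrite S_INR; pose proof (pos_INR N); lra).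
  assert (Hn1 : INR (S (S N)) = n + 1) by (unfold n; now rewrite (S_INR (S N))).
  unfold gstep. fold n. rewrite Hn1.
  set (L := ln (n + 1) - ln n). pose proof (ln_step_bounds n Hn) as HL. fold L in HL.
  set (th := mu * L).
  assert (H : ((1, (mu / (n + 1))%R) * cis (- th) - 1)%C = (cis (- th) * ((1, (mu / (n + 1))%R) - cis th))%C).
  { transitivity (((1, (mu / (n + 1))%R) * cis (- th) - cis th * cis (- th))%C).
    - now rewrite cis_opp_mult.
    - ring. }
  rewrite H, Cmod_mult, Cmod_cis, Rmult_1_l.
  apply Rle_trans with (1 := Cmod_le_Re_Im _ _).
  change (Rabs (1 - cos th) + Rabs (mu / (n + 1) - sin th) <=
    (2 * mu ^ 2 + Rabs mu) * (/ n - / (n + 1))).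
  pose proof (one_minus_cos_le th) as H1. pose proof (sin_minus_id_le th) as H2.
  assert (Hin : 0 < / (n + 1)) by (apply Rinv_0_lt_compat; lra).
  assert (H3 : Rabs (mu / (n + 1) - th) <= Rabs mu * (/ n - / (n + 1))).
  { unfold th, Rdiv. rewrite <- Rmult_minus_distr_l, Rabs_mult. apply Rmult_le_compat_l; [apply Rabs_pos|].
    rewrite Rabs_left1; lra. }
  assert (H4 : Rabs (mu / (n + 1) - sin th) <= Rabs mu * (/ n - / (n + 1)) + th ^ 2 / 2).
  { replace (mu / (n + 1) - sin th) with ((mu / (n + 1) - th) + (th - sin th)) by ring.
    apply Rle_trans with (1 := Rabs_triang _ _). lra. }
  assert (H5 : th ^ 2 <= 2 * mu ^ 2 * (/ n - / (n + 1))).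
  { unfold th. rewrite Rpow_mult_distr.
    assert (L ^ 2 <= (/ n) ^ 2) by nra.
    assert ((/ n) ^ 2 <= 2 * (/ n - / (n + 1))).
    { replace (/ n - / (n + 1)) with (/ n * / (n + 1)) by (field; lra).
      assert (/ n <= 2 * / (n + 1)).
      { apply (Rmult_le_reg_r (n * (n + 1))); [nra|].
        replace (/ n * (n * (n + 1))) with (n + 1) by (field; lra).
        replace (2 * / (n + 1) * (n * (n + 1))) with (2 * n) by (field; lra). lra. }
      assert (0 < / n) by (apply Rinv_0_lt_compat; lra). nra. }
    pose proof (pow2_ge_0 mu).
    apply Rle_trans with (mu ^ 2 * (2 * (/ n - / (n + 1)))); [|right; ring].
    apply Rmult_le_compat_l; lra. }
  rewrite Rabs_pos_eq by lra. lra.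
Qed.

Lemma sinhprod_le_lim (mu : R) (N : nat) : 0 < mu -> sinhprod mu N <= sinh (PI * mu) / (PI * mu).
Proof.
  intros Hmu. apply (is_lim_seq_incr_compare (sinhprod mu)); [now apply sinhprod_lim|].
  intros n. change (sinhprod mu (S n)) with (sinhprod mu n * (1 + mu ^ 2 / INR (S n) ^ 2)).
  assert (0 <= mu ^ 2 / INR (S n) ^ 2).
  { apply Rdiv_le_0_compat; [nra|]. apply pow_lt, lt_0_INR; lia. }
  pose proof (sinhprod_ge_1 mu n). nra.
Qed.

(** The moduli increase and are bounded through Euler's product, so the increments inherit the
    telescoping bound of [gstep_near_1]. The limit is 1/Γ(1+iμ). *)
Lemma gauss_cv (mu : R) : 0 < mu -> exists rho, clim (gauss mu) rho.
Proof.
  intros Hmu. set (M := sqrt (sinh (PI * mu) / (PI * mu))).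
  assert (HM : forall N, Cmod (gauss mu N) <= M).
  { intros N. rewrite <- (sqrt_pow2 (Cmod (gauss mu N))) by apply Cmod_ge_0.
    apply sqrt_le_1_alt. rewrite Cmod_gauss_sqr. now apply sinhprod_le_lim. }
  assert (HMp : 0 <= M) by apply sqrt_pos.
  assert (Hd : forall N, Cmod (gauss mu (S N) - gauss mu N)%C <=
     (M * (2 * mu ^ 2 + Rabs mu)) * (/ INR (S N) - / INR (S (S N)))).
  { intros N. rewrite gauss_S. replace (gauss mu N * gstep mu N - gauss mu N)%C with (gauss mu N * (gstep mu N - 1))%C by ring.
    rewrite Cmod_mult, Rmult_assoc. apply Rmult_le_compat; auto using Cmod_ge_0, gstep_near_1. }
  destruct (telescoping_cauchy (fun n => Re (gauss mu n)) (M * (2 * mu ^ 2 + Rabs mu))) as [l1 H1].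
  { intros n. apply Rle_trans with (2 := Hd n). apply (Re_Im_Cmod (gauss mu (S n) - gauss mu n)%C). }
  destruct (telescoping_cauchy (fun n => Im (gauss mu n)) (M * (2 * mu ^ 2 + Rabs mu))) as [l2 H2].
  { intros n. apply Rle_trans with (2 := Hd n). apply (Re_Im_Cmod (gauss mu (S n) - gauss mu n)%C). }
  exists (l1, l2). split; assumption.
Qed.

(** The reflection formula on this line: |Γ(1+iμ)|^{-2} is Euler's product for sinh(πμ)/(πμ). *)
Lemma Cmod_gauss_lim (mu : R) (rho : C) : 0 < mu -> clim (gauss mu) rho ->
  Re rho ^ 2 + Im rho ^ 2 = sinh (PI * mu) / (PI * mu).
Proof.
  intros Hmu [H1 H2].
  assert (H : is_lim_seq (fun N => sinhprod mu (S N)) (Re rho * Re rho + Im rho * Im rho)).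
  { apply (is_lim_seq_ext (fun N => Re (gauss mu N) * Re (gauss mu N) + Im (gauss mu N) * Im (gauss mu N))).
    - intros N. rewrite <- Cmod_gauss_sqr. destruct (gauss mu N) as [x y]. rewrite Cmod_sqr. simpl. ring.
    - apply is_lim_seq_plus'; now apply is_lim_seq_mult'. }
  pose proof (sinhprod_lim mu Hmu) as H'. apply (is_lim_seq_incr_1 (sinhprod mu)) in H'.
  apply is_lim_seq_unique in H. apply is_lim_seq_unique in H'. rewrite H' in H. injection H as H.
  rewrite H. ring.
Qed.

Definition mom (mu : R) (N : nat) : C := (cmom (2 * mu) N, smom (2 * mu) N).

Lemma moments_poch (mu : R) (N : nat) :
  mom mu (S N) =
  (Cpoch (1, mu) N * Cpoch (1, mu) N * mom mu 0)%C.
Proof.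
  assert (Hst : forall M, mom mu (S M) =
     ((INR (S M), mu) * (INR (S M), mu) * mom mu M)%C).
  { intros M. destruct (moments_k2_step (2 * mu) M) as [H1 H2]. unfold mom. rewrite H1, H2.
    replace (2 * mu / 2) with mu by field. unfold Cmult; cbn [fst snd]. f_equal; ring. }
  induction N as [|N IH].
  - rewrite Hst. reflexivity.
  - rewrite Hst, IH.
    replace (Cpoch (1, mu) (S N)) with (Cpoch (1, mu) N * (INR (S (S N)), mu))%C.
    + ring.
    + change (Cpoch (1, mu) (S N)) with (Cpoch (1, mu) N * ((1, mu) + INR (S N)))%C.
      f_equal. unfold Cplus, RtoC; cbn [fst snd]. rewrite (S_INR (S N)). f_equal; ring.
Qed.

(** Identifies [mom mu 0] with Γ(1+iμ)², phase included. The squared Pochhammer product carries it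
    to the moment of index N+1, whose mass sits at t = ln(N+1); that moment is therefore asymptotic
    to (N+1)!² (N+1)^{2iμ}, exactly the normalisation in [gauss]. *)
Lemma gauss_moment (mu : R) (rho : C) : clim (gauss mu) rho ->
  (mom mu 0 * (rho * rho))%C = 1%C.
Proof.
  intros H. set (M0 := mom mu 0).
  apply (clim_unique (fun N => (M0 * (gauss mu N * gauss mu N))%C)).
  - apply clim_mult; [apply clim_const|now apply clim_mult].
  - apply clim_of_Cmod.
    apply (is_lim_seq_le_le (fun _ => 0) _ (fun N => (2 * Rabs (2 * mu)) / sqrt (INR (S N)))).
    + intros N. split; [apply Cmod_ge_0|].
      set (ph := 2 * mu * ln (INR (S N))). set (f := INR (fact (S N))).
      assert (Hf : f <> 0) by apply INR_fact_neq_0.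
      assert (Heq : (M0 * (gauss mu N * gauss mu N) - 1)%C =
        (cis (- ph) * ((cmom (2 * mu) (S N) / f ^ 2 - cos ph)%R, (smom (2 * mu) (S N) / f ^ 2 - sin ph)%R))%C).
      { transitivity ((cis (- ph) * (mom mu (S N) * RtoC (/ f ^ 2)) - 1)%C).
        - rewrite moments_poch. fold M0. unfold gauss. fold f.
          replace (- ph) with (- (mu * ln (INR (S N))) + - (mu * ln (INR (S N)))) by (unfold ph; ring).
          rewrite cis_plus. replace (/ f ^ 2) with (/ f * / f) by (field; assumption).
          rewrite RtoC_mult. ring.
        - rewrite <- (cis_opp_mult (- ph)), Ropp_involutive.
          transitivity (cis (- ph) * (mom mu (S N) * RtoC (/ f ^ 2) - cis ph))%C; [ring|].
          f_equal. unfold mom, cis, Cminus, Cplus, Copp, Cmult, RtoC, Rdiv; cbn [fst snd]. f_equal; ring. }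
      rewrite Heq, Cmod_mult, Cmod_cis, Rmult_1_l. apply Rle_trans with (1 := Cmod_le_Re_Im _ _).
      pose proof (moment_concentration cos (2 * mu) N (fun x y => proj1 (trig_lipschitz x y)) cos_abs_le_1
        (cos_lin_continuous (2 * mu))) as H1.
      pose proof (moment_concentration sin (2 * mu) N (fun x y => proj2 (trig_lipschitz x y)) sin_abs_le_1
        (sin_lin_continuous (2 * mu))) as H2.
      fold f ph in H1, H2. fold (cmom (2 * mu) (S N)) in H1. fold (smom (2 * mu) (S N)) in H2.
      unfold Rdiv in *. lra.
    + apply is_lim_seq_const.
    + apply is_lim_seq_inv_sqrt.
Qed.

Definition rgseq (z : C) (m : nat) : C := (Cpoch z m / (Cpow_pos (INR m) z * INR (fact m)))%C.

Lemma Cexp_cis (x y : R) : Cexp (x, y) = (RtoC (exp x) * cis y)%C.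
Proof. unfold Cexp, cis, Cmult, RtoC; simpl. f_equal; ring. Qed.

Lemma Cpow_pos_cis (t x y : R) : Cpow_pos t (x, y) = (RtoC (exp (x * ln t)) * cis (y * ln t))%C.
Proof.
  unfold Cpow_pos. replace ((x, y) * RtoC (ln t))%C with (x * ln t, y * ln t).
  - apply Cexp_cis.
  - unfold Cmult, RtoC; simpl. f_equal; ring.
Qed.

Lemma RtoC_neq_0 (x : R) : x <> 0 -> RtoC x <> 0%C.
Proof. intros H E. apply H. now apply RtoC_inj. Qed.

Lemma clim_inv_INR (z w : C) (c : R) :
  clim (fun N => ((z + RtoC (INR (S N) + c)) * RtoC (/ INR (S N)))%C) 1%C.
Proof.
  assert (H : is_lim_seq (fun N => / INR (S N)) 0).
  { replace (Finite 0) with (Rbar_inv p_infty) by reflexivity.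
    apply is_lim_seq_inv; [|discriminate]. apply (is_lim_seq_incr_1 INR), is_lim_seq_INR. }
  destruct z as [x y]. split; cbn [fst snd].
  - apply (is_lim_seq_ext (fun N => 1 + (x + c) * / INR (S N))).
    + intros N. unfold Cmult, Cplus, RtoC. cbn [fst snd]. unfold Re. cbn [fst snd].
      field. apply not_0_INR; lia.
    + replace (Finite (Re 1%C)) with (Finite (1 + (x + c) * 0)) by (simpl; f_equal; ring).
      apply is_lim_seq_plus'; [apply is_lim_seq_const|].
      apply (is_lim_seq_scal_l _ (x + c) (Finite 0) H).
  - apply (is_lim_seq_ext (fun N => y * / INR (S N))).
    + intros N. unfold Cmult, Cplus, RtoC. cbn [fst snd]. unfold Im. cbn [fst snd]. ring.
    + replace (Finite (Im 1%C)) with (Finite (y * 0)) by (simpl; f_equal; ring).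
      apply (is_lim_seq_scal_l _ y (Finite 0) H).
Qed.

(** At index N+1 and z = 1+iμ the sequence defining [rgamma] differs from [gauss mu N] only by the
    factor (z + N + 1)/(N + 1), which tends to 1. *)
Lemma rgseq_gauss (mu : R) (rho : C) : clim (gauss mu) rho -> clim (rgseq (1, mu)) rho.
Proof.
  intros H. apply clim_incr_1.
  replace rho with (rho * 1)%C by ring.
  apply (clim_ext_loc (fun N => (gauss mu N * (((1, mu) + RtoC (INR (S N) + 0)) * RtoC (/ INR (S N))))%C) _ _ 0).
  - intros N _. unfold rgseq, gauss. rewrite Cpow_pos_cis, Rmult_1_l.
    rewrite exp_ln by (apply lt_0_INR; lia).
    change (Cpoch (1, mu) (S N)) with (Cpoch (1, mu) N * ((1, mu) + INR (S N)))%C. rewrite Rplus_0_r.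
    pose proof (not_0_INR (S N) ltac:(lia)) as Hn. pose proof (INR_fact_neq_0 (S N)) as Hf.
    rewrite !RtoC_inv by assumption.
    pose proof (cis_opp_mult (mu * ln (INR (S N)))) as Hc.
    set (c := cis (mu * ln (INR (S N)))) in *. set (c' := cis (- (mu * ln (INR (S N))))) in *.
    assert (Hc0 : c <> 0%C) by apply cis_neq_0.
    replace c' with (/ c)%C.
    + field. repeat split; try assumption; now apply RtoC_neq_0.
    + transitivity (/ c * (c * c'))%C; [rewrite Hc; ring|]. field. assumption.
  - apply clim_mult; [assumption|]. apply (clim_inv_INR _ 1%C).
Qed.

(** The functional equation of 1/Γ at the level of the sequences, from z (z+1)...(z+1+M) =
    [z (z+1)...(z+M)] (z+M+1). Convergence at z+1 is obtained along with the value. *)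
Lemma rgseq_shift (z l : C) : z <> 0%C -> clim (rgseq z) l -> clim (rgseq (z + 1)%C) (l / z)%C.
Proof.
  intros Hz H. apply clim_incr_1. apply clim_incr_1 in H.
  replace (l / z)%C with (l * 1 * / z)%C by (unfold Cdiv; ring).
  apply (clim_ext_loc (fun N => (rgseq z (S N) * ((z + RtoC (INR (S N) + 1)) * RtoC (/ INR (S N))) * / z)%C) _ _ 0).
  - intros N _. unfold rgseq.
    assert (Hp : forall M, (z * Cpoch (z + 1) M)%C = (Cpoch z M * (z + RtoC (INR M + 1)))%C).
    { induction M as [|M IH].
      - simpl. rewrite Rplus_0_l. reflexivity.
      - change (Cpoch (z + 1) (S M)) with (Cpoch (z + 1) M * (z + 1 + INR (S M)))%C.
        change (Cpoch z (S M)) with (Cpoch z M * (z + INR (S M)))%C.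
        transitivity ((z * Cpoch (z + 1) M) * (z + 1 + INR (S M)))%C; [ring|]. rewrite IH.
        rewrite (RtoC_plus (INR (S M)) 1). rewrite <- S_INR. ring. }
    pose proof (not_0_INR (S N) ltac:(lia)) as Hn. pose proof (INR_fact_neq_0 (S N)) as Hf.
    assert (Hw : Cpow_pos (INR (S N)) (z + 1)%C = (Cpow_pos (INR (S N)) z * RtoC (INR (S N)))%C).
    { destruct z as [x y]. replace ((x, y) + 1)%C with (x + 1, y) by
        (unfold Cplus, RtoC; simpl; f_equal; ring).
      rewrite !Cpow_pos_cis. rewrite Rmult_plus_distr_r, exp_plus, Rmult_1_l, exp_ln by (apply lt_0_INR; lia).
      rewrite RtoC_mult. ring. }
    rewrite Hw. specialize (Hp (S N)).
    replace (Cpoch (z + 1) (S N)) with (Cpoch z (S N) * (z + RtoC (INR (S N) + 1)) * / z)%C.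
    + rewrite RtoC_inv by assumption.
      assert (Cpow_pos (INR (S N)) z <> 0%C).
      { destruct z as [x y]. rewrite Cpow_pos_cis. apply Cmult_neq_0; [|apply cis_neq_0].
        apply RtoC_neq_0. apply Rgt_not_eq, exp_pos. }
      field. repeat split; try assumption; now apply RtoC_neq_0.
    + rewrite <- Hp. field. assumption.
  - apply clim_mult; [|apply clim_const]. apply clim_mult; [assumption|]. apply (clim_inv_INR _ 1%C).
Qed.

Lemma rgamma_lim (z l : C) : clim (rgseq z) l -> rgamma z = l.
Proof. apply Clim_seq_correct. Qed.

Lemma is_lim_mult_R (f g : R -> R) (x : Rbar) (lf lg : R) :
  is_lim f x lf -> is_lim g x lg -> is_lim (fun t => f t * g t) x (lf * lg).
Proof. intros H1 H2. now apply (is_lim_mult f g x lf lg). Qed.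

(** * Bessel functions of imaginary order *)

(** Domination by an exponential series: a simple sufficient condition for an infinite radius of
    convergence, met by J_0 and by both parts of J_{iμ} as series in x²/4. *)
Definition entire (a : nat -> R) : Prop := exists C, forall k, Rabs (a k) <= C / INR (fact k).

Lemma entire_CV (a : nat -> R) (x : R) : entire a -> Rbar_lt (Rabs x) (CV_radius a).
Proof.
  intros [C HC].
  assert (H : CV_disk a (Rabs x + 1)).
  { unfold CV_disk. apply (@ex_series_le R_AbsRing R_CompleteNormedModule _
      (fun k => C * ((Rabs x + 1) ^ k * / INR (fact k)))).
    - intros k. unfold norm; simpl. unfold abs; simpl. rewrite Rabs_Rabsolu, Rabs_mult.
      rewrite (Rabs_pos_eq (_ ^ k)) by (apply pow_le; pose proof (Rabs_pos x); lra).
      specialize (HC k). unfold Rdiv in HC.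
      assert (0 <= (Rabs x + 1) ^ k) by (apply pow_le; pose proof (Rabs_pos x); lra). nra.
    - apply (@ex_series_scal R_AbsRing R_NormedModule). exists (exp (Rabs x + 1)).
      pose proof (is_exp_Reals (Rabs x + 1)) as H. unfold is_pseries in H.
      eapply is_series_ext; [|exact H]. intros k. rewrite pow_n_pow. reflexivity. }
  unfold CV_radius. destruct (Lub_Rbar_correct (CV_disk a)) as [Hub _].
  specialize (Hub _ H). unfold Rbar_le in Hub. destruct (Lub_Rbar (CV_disk a)); simpl in *; lra.
Qed.

Lemma is_derive_entire (a : nat -> R) (x : R) : entire a ->
  is_derive (PSeries a) x (PSeries (PS_derive a) x).
Proof. intros H. apply is_derive_PSeries. now apply entire_CV. Qed.

Lemma is_derive_entire2 (a : nat -> R) (x : R) : entire a ->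
  is_derive (PSeries (PS_derive a)) x (PSeries (PS_derive (PS_derive a)) x).
Proof. intros H. apply is_derive_PSeries. rewrite CV_radius_derive. now apply entire_CV. Qed.

(** Coefficient recurrence of a power series solution of Bessel's equation in the variable [x^2/4]. *)
Lemma entire_ode (a b : nat -> R) (mu x : R) : entire a -> entire b ->
  (forall k, INR (S k) ^ 2 * a (S k) - mu * (INR (S k) * b (S k)) = - a k) ->
  x * PSeries (PS_derive (PS_derive a)) x + PSeries (PS_derive a) x - mu * PSeries (PS_derive b) x
  = - PSeries a x.
Proof.
  intros Ha Hb Hrec.
  assert (Ha0 : ex_pseries a x) by (apply CV_radius_inside; now apply entire_CV).
  assert (Ha1 : ex_pseries (PS_derive a) x) by (apply ex_pseries_derive; now apply entire_CV).
  assert (Hb1 : ex_pseries (PS_derive b) x) by (apply ex_pseries_derive; now apply entire_CV).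
  assert (Ha2 : ex_pseries (PS_derive (PS_derive a)) x).
  { apply ex_pseries_derive. rewrite CV_radius_derive. now apply entire_CV. }
  rewrite <- PSeries_incr_1.
  assert (Hc1 : forall (c : R), mult x c = mult c x) by (intros; apply Rmult_comm).
  rewrite <- PSeries_plus; [|now apply ex_pseries_incr_1|assumption].
  rewrite <- (PSeries_scal mu), <- (PSeries_opp a).
  rewrite <- PSeries_minus.
  - apply PSeries_ext. intros k. specialize (Hrec k).
    unfold PS_minus, PS_plus, PS_opp, PS_scal, PS_incr_1, PS_derive.
    destruct k as [|k].
    + unfold plus, opp, scal, zero; simpl. unfold mult; simpl. simpl in Hrec. lra.
    + unfold plus, opp, scal; cbn. unfold mult; cbn.
      change (match k with 0%nat => 1 | S _ => INR k + 1 end) with (INR (S k)).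
      change (INR (S k) + 1 + 1) with (INR (S k) + 1 + 1).
      rewrite <- Hrec. rewrite !S_INR. ring.
  - apply ex_pseries_plus; [now apply ex_pseries_incr_1|assumption].
  - apply ex_pseries_scal; [apply Rmult_comm|assumption].
Qed.

Lemma entire_lim (a : nat -> R) : entire a ->
  is_lim (fun xi => PSeries a (exp (2 * xi) / 4)) m_infty (a 0%nat) .
Proof.
  intros Ha. rewrite <- (PSeries_0 a).
  apply (is_lim_comp_continuous (fun xi => exp (2 * xi) / 4) (PSeries a)).
  - apply (is_lim_m_exp _ 0 2 (1/4) 0); [lra|]. intros t _. rewrite Rminus_0_r, Rabs_pos_eq.
    + lra.
    + pose proof (exp_pos (2 * t)). lra.
  - apply (derive_continuous _ _ _ (is_derive_entire a 0 Ha)).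
Qed.

Lemma entire_deriv_lim (a : nat -> R) : entire a ->
  is_lim (fun xi => 2 * (exp (2 * xi) / 4) * PSeries (PS_derive a) (exp (2 * xi) / 4)) m_infty 0.
Proof.
  intros Ha. replace (Finite 0) with (Finite (0 * PSeries (PS_derive a) 0)) by (f_equal; ring).
  apply (is_lim_mult_R (fun xi => 2 * (exp (2 * xi) / 4))).
  - apply (is_lim_m_exp _ 0 2 (1/2) 0); [lra|]. intros t _. rewrite Rminus_0_r, Rabs_pos_eq.
    + lra.
    + pose proof (exp_pos (2 * t)). lra.
  - apply (is_lim_comp_continuous (fun xi => exp (2 * xi) / 4) (PSeries (PS_derive a))).
    + apply (is_lim_m_exp _ 0 2 (1/4) 0); [lra|]. intros t _. rewrite Rminus_0_r, Rabs_pos_eq.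
      * lra.
      * pose proof (exp_pos (2 * t)). lra.
    + apply (derive_continuous _ _ _ (is_derive_entire2 a 0 Ha)).
Qed.

Definition rgk (mu : R) (k : nat) : C := rgamma (INR k + 1, mu).

Lemma rgk_spec (mu : R) (rho : C) : 0 < mu -> clim (gauss mu) rho ->
  rgk mu 0 = rho /\ forall k, rgk mu (S k) = (rgk mu k / (INR (S k), mu))%C.
Proof.
  intros Hmu H.
  assert (Hnz : forall k, ((INR k + 1, mu) : C) <> 0%C).
  { intros k E. injection E as _ E. lra. }
  assert (H0 : clim (rgseq (INR 0 + 1, mu)) rho).
  { simpl INR. rewrite Rplus_0_l. now apply rgseq_gauss. }
  assert (Hc : forall k, clim (rgseq (INR k + 1, mu)) (rgk mu k) /\
     rgk mu (S k) = (rgk mu k / (INR (S k), mu))%C).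
  { assert (Hst : forall k, clim (rgseq (INR k + 1, mu)) (rgk mu k) ->
       clim (rgseq (INR (S k) + 1, mu)) (rgk mu k / (INR (S k), mu))%C).
    { intros k Hk. apply (rgseq_shift _ _ (Hnz k)) in Hk.
      replace (((INR k + 1)%R, mu) + 1)%C with (INR (S k) + 1, mu) in Hk.
      - rewrite (S_INR k) at 2. exact Hk.
      - unfold Cplus, RtoC; cbn [fst snd]. rewrite S_INR. f_equal; ring. }
    assert (Hall : forall k, clim (rgseq (INR k + 1, mu)) (rgk mu k)).
    { induction k.
      - unfold rgk. rewrite (rgamma_lim _ _ H0). exact H0.
      - specialize (Hst k IHk). unfold rgk at 1. rewrite (rgamma_lim _ _ Hst). exact Hst. }
    intros k. split; [apply Hall|]. unfold rgk at 1. apply rgamma_lim. apply Hst, Hall. }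
  split; [apply rgamma_lim, H0|]. intros k. apply Hc.
Qed.

Definition bcoef (mu : R) (k : nat) : C := (RtoC ((-1) ^ k / INR (fact k)) * rgk mu k)%C.

Lemma bcoef_rec (mu : R) (rho : C) (k : nat) : 0 < mu -> clim (gauss mu) rho ->
  (RtoC (INR (S k)) * ((INR (S k), mu) * bcoef mu (S k)))%C = (- bcoef mu k)%C.
Proof.
  intros Hmu H. destruct (rgk_spec mu rho Hmu H) as [_ Hr]. unfold bcoef. rewrite Hr.
  assert (Hz : ((INR (S k), mu) : C) <> 0%C) by (intros E; injection E as _ E; lra).
  assert (Hk : INR (S k) <> 0) by (apply not_0_INR; lia).
  assert (Hk' := RtoC_neq_0 _ Hk). pose proof (INR_fact_neq_0 k) as Hf.
  replace ((-1) ^ S k / INR (fact (S k))) with (- ((-1) ^ k / INR (fact k)) * / INR (S k)).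
  - rewrite RtoC_mult, RtoC_opp, RtoC_inv by assumption. field. split; assumption.
  - rewrite fact_simpl, mult_INR. rewrite <- tech_pow_Rmult. field. split; assumption.
Qed.

Lemma bcoef_bound (mu : R) (rho : C) (k : nat) : 0 < mu -> clim (gauss mu) rho ->
  Cmod (bcoef mu k) <= Cmod rho / INR (fact k).
Proof.
  intros Hmu H. destruct (rgk_spec mu rho Hmu H) as [H0 Hr]. unfold bcoef.
  rewrite Cmod_mult, Cmod_R. unfold Rdiv at 1. rewrite Rabs_mult, pow_1_abs, Rmult_1_l, Rabs_inv.
  rewrite (Rabs_pos_eq (INR _)) by apply pos_INR.
  unfold Rdiv. rewrite Rmult_comm. apply Rmult_le_compat_r.
  - left. apply Rinv_0_lt_compat, INR_fact_lt_0.
  - induction k; [rewrite H0; lra|]. rewrite Hr. rewrite Cmod_div.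
    + apply Rle_trans with (2 := IHk). assert (1 <= Cmod (INR (S k), mu)).
      { apply Rle_trans with (2 := proj1 (Re_Im_Cmod (INR (S k), mu))). unfold Re; cbn [fst].
        rewrite Rabs_pos_eq by apply pos_INR. rewrite S_INR. pose proof (pos_INR k). lra. }
      pose proof (Cmod_ge_0 (rgk mu k)). apply (Rmult_le_reg_r (Cmod (INR (S k), mu))); [lra|].
      unfold Rdiv. rewrite Rmult_assoc, Rinv_l by lra. nra.
    + intros E. injection E as _ E. lra.
Qed.

Definition bre (mu : R) (k : nat) : R := Re (bcoef mu k).
Definition bim (mu : R) (k : nat) : R := Im (bcoef mu k).

Lemma bre_bim_entire (mu : R) (rho : C) : 0 < mu -> clim (gauss mu) rho ->
  entire (bre mu) /\ entire (bim mu).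
Proof.
  intros Hmu H. split; exists (Cmod rho); intros k;
    apply Rle_trans with (2 := bcoef_bound mu rho k Hmu H); apply Re_Im_Cmod.
Qed.

(** The complex recurrence k (k + iμ) b_k = -b_{k-1} splits into two coupled real ones of the single
    shape treated in [entire_ode], with μ and -μ. *)
Lemma bre_bim_rec (mu : R) (rho : C) (k : nat) : 0 < mu -> clim (gauss mu) rho ->
  INR (S k) ^ 2 * bre mu (S k) - mu * (INR (S k) * bim mu (S k)) = - bre mu k /\
  INR (S k) ^ 2 * bim mu (S k) - (- mu) * (INR (S k) * bre mu (S k)) = - bim mu k.
Proof.
  intros Hmu H. pose proof (bcoef_rec mu rho k Hmu H) as E. unfold bre, bim.
  destruct (bcoef mu (S k)) as [x y]. destruct (bcoef mu k) as [x' y'].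
  unfold Cmult, Copp, RtoC in E; cbn [fst snd] in E.
  pose proof (f_equal fst E) as E1. pose proof (f_equal snd E) as E2. cbn [fst snd] in E1, E2.
  unfold Re, Im; cbn [fst snd]. split; [rewrite <- E1|rewrite <- E2]; ring.
Qed.

Definition phase (mu xi : R) : R := mu * (xi - ln 2).

(** [Re] and [Im] of [J_{iμ}(e^ξ)]. *)
Definition reJ (mu xi : R) : R :=
  cos (phase mu xi) * PSeries (bre mu) (exp (2 * xi) / 4)
  - sin (phase mu xi) * PSeries (bim mu) (exp (2 * xi) / 4).
Definition imJ (mu xi : R) : R :=
  sin (phase mu xi) * PSeries (bre mu) (exp (2 * xi) / 4)
  + cos (phase mu xi) * PSeries (bim mu) (exp (2 * xi) / 4).

Definition reJ1 (mu xi : R) : R :=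
  - mu * imJ mu xi
  + (cos (phase mu xi) * (2 * (exp (2 * xi) / 4) * PSeries (PS_derive (bre mu)) (exp (2 * xi) / 4))
  - sin (phase mu xi) * (2 * (exp (2 * xi) / 4) * PSeries (PS_derive (bim mu)) (exp (2 * xi) / 4))).
Definition imJ1 (mu xi : R) : R :=
  mu * reJ mu xi
  + (sin (phase mu xi) * (2 * (exp (2 * xi) / 4) * PSeries (PS_derive (bre mu)) (exp (2 * xi) / 4))
  + cos (phase mu xi) * (2 * (exp (2 * xi) / 4) * PSeries (PS_derive (bim mu)) (exp (2 * xi) / 4))).

Lemma is_derive_phase_comb (f g : R -> R) (f1 g1 : R -> R) (mu xi : R) :
  (forall y, is_derive f y (f1 y)) -> (forall y, is_derive g y (g1 y)) ->
  is_derive (fun xi => cos (phase mu xi) * f (exp (2 * xi) / 4) - sin (phase mu xi) * g (exp (2 * xi) / 4)) xi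
   (- mu * (sin (phase mu xi) * f (exp (2 * xi) / 4) + cos (phase mu xi) * g (exp (2 * xi) / 4))
    + (cos (phase mu xi) * (2 * (exp (2 * xi) / 4) * f1 (exp (2 * xi) / 4))
      - sin (phase mu xi) * (2 * (exp (2 * xi) / 4) * g1 (exp (2 * xi) / 4)))) /\
  is_derive (fun xi => sin (phase mu xi) * f (exp (2 * xi) / 4) + cos (phase mu xi) * g (exp (2 * xi) / 4)) xi
   (mu * (cos (phase mu xi) * f (exp (2 * xi) / 4) - sin (phase mu xi) * g (exp (2 * xi) / 4))
    + (sin (phase mu xi) * (2 * (exp (2 * xi) / 4) * f1 (exp (2 * xi) / 4))
      + cos (phase mu xi) * (2 * (exp (2 * xi) / 4) * g1 (exp (2 * xi) / 4)))).
Proof.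
  intros Hf Hg. pose proof (Hf (exp (2 * xi) * / 4)) as H1. pose proof (Hg (exp (2 * xi) * / 4)) as H2.
  unfold phase, Rdiv, Rminus. split.
  - auto_derive; [repeat split; eexists; eassumption|].
    rewrite (Derive_eta _ _ _ H1), (Derive_eta _ _ _ H2). field.
  - auto_derive; [repeat split; eexists; eassumption|].
    rewrite (Derive_eta _ _ _ H1), (Derive_eta _ _ _ H2). field.
Qed.

(** In ξ = ln x Bessel's equation loses its first-order term: J'' = -(μ² + e^{2ξ}) J for order iμ,
    separately for the real and the imaginary part. *)
Lemma is_derive_J (mu : R) (rho : C) (xi : R) : 0 < mu -> clim (gauss mu) rho ->
  is_derive (reJ mu) xi (reJ1 mu xi) /\ is_derive (imJ mu) xi (imJ1 mu xi) /\
  is_derive (reJ1 mu) xi (- (mu ^ 2 + exp (2 * xi)) * reJ mu xi) /\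
  is_derive (imJ1 mu) xi (- (mu ^ 2 + exp (2 * xi)) * imJ mu xi).
Proof.
  intros Hmu H. destruct (bre_bim_entire mu rho Hmu H) as [Ea Eb].
  pose proof (fun k => proj1 (bre_bim_rec mu rho k Hmu H)) as Ra.
  pose proof (fun k => proj2 (bre_bim_rec mu rho k Hmu H)) as Rb.
  destruct (is_derive_phase_comb (PSeries (bre mu)) (PSeries (bim mu))
    (PSeries (PS_derive (bre mu))) (PSeries (PS_derive (bim mu))) mu xi
    (fun y => is_derive_entire _ y Ea) (fun y => is_derive_entire _ y Eb)) as [H1 H2].
  split; [exact H1|]. split; [exact H2|].
  set (f := fun y => 2 * y * PSeries (PS_derive (bre mu)) y).
  set (g := fun y => 2 * y * PSeries (PS_derive (bim mu)) y).
  set (f1 := fun y => 2 * PSeries (PS_derive (bre mu)) y + 2 * y * PSeries (PS_derive (PS_derive (bre mu))) y).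
  set (g1 := fun y => 2 * PSeries (PS_derive (bim mu)) y + 2 * y * PSeries (PS_derive (PS_derive (bim mu))) y).
  assert (Hf : forall y, is_derive f y (f1 y)).
  { intros y. unfold f, f1. pose proof (is_derive_entire2 _ y Ea) as Hd.
    auto_derive; [eexists; exact Hd|]. rewrite (Derive_eta _ _ _ Hd). ring. }
  assert (Hg : forall y, is_derive g y (g1 y)).
  { intros y. unfold g, g1. pose proof (is_derive_entire2 _ y Eb) as Hd.
    auto_derive; [eexists; exact Hd|]. rewrite (Derive_eta _ _ _ Hd). ring. }
  destruct (is_derive_phase_comb f g f1 g1 mu xi Hf Hg) as [H3 H4].
  set (y := exp (2 * xi) / 4) in *.
  pose proof (entire_ode _ _ mu y Ea Eb Ra) as O1. pose proof (entire_ode _ _ (- mu) y Eb Ea Rb) as O2.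
  set (p := PSeries (bre mu) y) in *. set (r := PSeries (bim mu) y) in *.
  set (p1 := PSeries (PS_derive (bre mu)) y) in *. set (r1 := PSeries (PS_derive (bim mu)) y) in *.
  set (p2 := PSeries (PS_derive (PS_derive (bre mu))) y) in *.
  set (r2 := PSeries (PS_derive (PS_derive (bim mu))) y) in *.
  assert (Hy : exp (2 * xi) = 4 * y) by (unfold y; field).
  split.
  - assert (Hd := is_derive_plus _ _ _ _ _ (is_derive_scal _ _ (- mu) _ H2) H3).
    eapply is_derive_ext; [|evar_last; [exact Hd|]].
    + intros t. reflexivity.
    + unfold plus; simpl. unfold f, g, f1, g1, reJ. fold y. fold p r p1 r1 p2 r2. rewrite Hy.
      replace p with (- (y * p2 + p1 - mu * r1)) at 2 by lra.
      replace r with (- (y * r2 + r1 - - mu * p1)) at 2 by lra.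
      set (c := cos (phase mu xi)). set (s := sin (phase mu xi)).
      assert (E1 : p = - (y * p2 + p1 - mu * r1)) by lra.
      assert (E2 : r = - (y * r2 + r1 - - mu * p1)) by lra.
      rewrite E1, E2. ring.
  - assert (Hd := is_derive_plus _ _ _ _ _ (is_derive_scal _ _ mu _ H1) H4).
    eapply is_derive_ext; [|evar_last; [exact Hd|]].
    + intros t. reflexivity.
    + unfold plus; simpl. unfold f, g, f1, g1, imJ. fold y. fold p r p1 r1 p2 r2. rewrite Hy.
      set (c := cos (phase mu xi)). set (s := sin (phase mu xi)).
      assert (E1 : p = - (y * p2 + p1 - mu * r1)) by lra.
      assert (E2 : r = - (y * r2 + r1 - - mu * p1)) by lra.
      rewrite E1, E2. ring.
Qed.

Lemma BesselJ_eq (mu x : R) (rho : C) : 0 < mu -> clim (gauss mu) rho -> 0 < x ->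
  BesselJ (0, mu) x = (reJ mu (ln x), imJ mu (ln x)).
Proof.
  intros Hmu H Hx. destruct (bre_bim_entire mu rho Hmu H) as [Ea Eb].
  set (y := exp (2 * ln x) / 4).
  assert (Hy : y = (x / 2) ^ 2).
  { unfold y. replace (2 * ln x) with (ln x + ln x) by ring. rewrite exp_plus, exp_ln by assumption. field. }
  assert (Hterm : forall k, (RtoC ((-1) ^ k / INR (fact k)) *
    (Cpow_pos (x / 2) (RtoC (2 * INR k) + (0, mu)) * rgamma (RtoC (INR k) + (0, mu) + 1)))%C =
    (cis (phase mu (ln x)) * (RtoC (y ^ k) * bcoef mu k))%C).
  { intros k.
    replace (RtoC (2 * INR k) + (0, mu))%C with ((2 * INR k)%R, mu)
      by (unfold Cplus, RtoC; cbn [fst snd]; f_equal; ring).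
    replace (RtoC (INR k) + (0, mu) + 1)%C with ((INR k + 1)%R, mu)
      by (unfold Cplus, RtoC; cbn [fst snd]; f_equal; ring).
    rewrite Cpow_pos_cis. unfold bcoef, rgk, phase. rewrite ln_div by lra.
    replace (exp (2 * INR k * (ln x - ln 2))) with (y ^ k).
    - ring.
    - rewrite Hy, <- ln_div, <- pow_mult by lra.
      replace (2 * INR k) with (INR (2 * k)) by (rewrite mult_INR; reflexivity).
      rewrite <- (exp_ln ((x / 2) ^ (2 * k))) by (apply pow_lt; lra). rewrite ln_pow by lra. reflexivity. }
  assert (Hre : ex_series (fun k => bre mu k * y ^ k)).
  { assert (Hp : ex_pseries (bre mu) y) by (apply CV_radius_inside; now apply entire_CV).
    unfold ex_pseries in Hp. eapply ex_series_ext; [|exact Hp].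
    intros k. unfold scal; simpl; unfold mult; simpl. rewrite pow_n_pow. ring. }
  assert (Him : ex_series (fun k => bim mu k * y ^ k)).
  { assert (Hp : ex_pseries (bim mu) y) by (apply CV_radius_inside; now apply entire_CV).
    unfold ex_pseries in Hp. eapply ex_series_ext; [|exact Hp].
    intros k. unfold scal; simpl; unfold mult; simpl. rewrite pow_n_pow. ring. }
  unfold BesselJ, CSeries, reJ, imJ. fold y. unfold PSeries. f_equal.
  - rewrite <- !Series_scal_l, <- Series_minus; [|now apply (@ex_series_scal R_AbsRing R_NormedModule)..].
    apply Series_ext. intros k. rewrite Hterm.
    unfold bre, bim, cis. destruct (bcoef mu k) as [u v].
    unfold Cmult, RtoC, Re, Im; cbn [fst snd]. ring.
  - rewrite <- !Series_scal_l, <- Series_plus; [|now apply (@ex_series_scal R_AbsRing R_NormedModule)..].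
    apply Series_ext. intros k. rewrite Hterm.
    unfold bre, bim, cis. destruct (bcoef mu k) as [u v].
    unfold Cmult, RtoC, Re, Im; cbn [fst snd]. ring.
Qed.

(** * Conjugation in the order, and J² + Y² in real form *)

Lemma RtoC_conj (x : R) : Cconj (RtoC x) = RtoC x.
Proof. unfold Cconj, RtoC; simpl. f_equal. ring. Qed.

Lemma Cpow_pos_conj (t : R) (z : C) : Cpow_pos t (Cconj z) = Cconj (Cpow_pos t z).
Proof.
  destruct z as [x y]. unfold Cconj at 1; cbn [fst snd]. rewrite !Cpow_pos_cis.
  rewrite Cmult_conj, RtoC_conj. f_equal. unfold cis, Cconj; cbn [fst snd].
  replace (- y * ln t) with (- (y * ln t)) by ring. rewrite cos_neg, sin_neg. reflexivity.
Qed.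

Lemma Clim_seq_conj (u : nat -> C) : Clim_seq (fun n => Cconj (u n)) = Cconj (Clim_seq u).
Proof.
  unfold Clim_seq, Cconj; cbn [fst snd]. f_equal.
  change (fun m => Im (fst (u m), - snd (u m))) with (fun m => - Im (u m)).
  (* [real] sends both infinities to 0, so the sign passes through without knowing that the limit is
     finite. *)
  rewrite Lim_seq_opp. destruct (Lim_seq _); simpl; ring.
Qed.

Lemma rgamma_conj (z : C) : rgamma (Cconj z) = Cconj (rgamma z).
Proof.
  unfold rgamma. rewrite <- Clim_seq_conj. unfold Clim_seq.
  assert (H : forall m, (Cpoch (Cconj z) m / (Cpow_pos (INR m) (Cconj z) * INR (fact m)))%C =
     Cconj (Cpoch z m / (Cpow_pos (INR m) z * INR (fact m)))%C).
  { intros m. rewrite Cdiv_conj.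
    - rewrite Cmult_conj, RtoC_conj, Cpow_pos_conj. f_equal.
      induction m; [reflexivity|].
      change (Cpoch (Cconj z) (S m)) with (Cpoch (Cconj z) m * (Cconj z + INR (S m)))%C.
      change (Cpoch z (S m)) with (Cpoch z m * (z + INR (S m)))%C.
      rewrite IHm, Cmult_conj, Cplus_conj, RtoC_conj. reflexivity.
    - apply Cmult_neq_0.
      + destruct z as [x y]. rewrite Cpow_pos_cis. apply Cmult_neq_0; [|apply cis_neq_0].
        apply RtoC_neq_0, Rgt_not_eq, exp_pos.
      + apply RtoC_neq_0, INR_fact_neq_0. }
  f_equal; f_equal; apply Lim_seq_ext; intros m; now rewrite H.
Qed.

Lemma BesselJ_conj (nu : C) (x : R) : BesselJ (Cconj nu) x = Cconj (BesselJ nu x).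
Proof.
  unfold BesselJ.
  set (t := fun nu k => (RtoC ((-1) ^ k / INR (fact k)) *
    (Cpow_pos (x / 2) (RtoC (2 * INR k) + nu) * rgamma (RtoC (INR k) + nu + 1)))%C).
  change (CSeries (t (Cconj nu)) = Cconj (CSeries (t nu))).
  assert (H : forall k, t (Cconj nu) k = Cconj (t nu k)).
  { intros k. unfold t. rewrite !Cmult_conj, RtoC_conj, <- Cpow_pos_conj, <- rgamma_conj, !Cplus_conj, !RtoC_conj.
    reflexivity. }
  unfold CSeries, Cconj at 3; cbn [fst snd]. rewrite <- Series_opp.
  f_equal; apply Series_ext; intros k; rewrite H; reflexivity.
Qed.

(** [J_{iμ}^2 + Y_{iμ}^2] at [e^ξ]: on the imaginary axis [J_{-iμ}] is the conjugate of [J_{iμ}]. *)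
Definition bessN (mu xi : R) : R :=
  reJ mu xi ^ 2 / cosh (PI * mu / 2) ^ 2 + imJ mu xi ^ 2 / sinh (PI * mu / 2) ^ 2.

(** With J_{iμ} = A + iB and α = πμ/2, the conjugate value of J_{-iμ} makes Y_{iμ} = B coth α - i A
    tanh α. In J² + Y² the mixed terms 2iAB cancel, which leaves A²/cosh² α + B²/sinh² α. *)
Lemma BesselJY_eq (mu x : R) (rho : C) : 0 < mu -> clim (gauss mu) rho -> 0 < x ->
  (BesselJ (0, mu) x * BesselJ (0, mu) x + BesselY (0, mu) x * BesselY (0, mu) x)%C =
  RtoC (bessN mu (ln x)).
Proof.
  intros Hmu H Hx. pose proof PI_RGT_0 as HPI. unfold BesselY.
  replace (- (0, mu))%C with (Cconj (0, mu)) by (unfold Cconj, Copp; cbn [fst snd]; f_equal; ring).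
  rewrite BesselJ_conj, (BesselJ_eq mu x rho Hmu H Hx).
  set (al := PI * mu / 2).
  assert (Hcos : Ccos ((0, mu) * PI) = RtoC (cosh (2 * al))).
  { unfold Ccos. replace (Ci * ((0, mu) * PI))%C with ((- (2 * al))%R, 0)
      by (unfold Ci, Cmult, RtoC, al; cbn [fst snd]; f_equal; field).
    replace (- ((- (2 * al))%R, 0))%C with ((2 * al)%R, 0) by (unfold Copp; cbn [fst snd]; f_equal; ring).
    rewrite !Cexp_cis, cis_0. unfold cosh. rewrite RtoC_div, RtoC_plus by lra.
    unfold Cdiv. ring. }
  assert (Hsin : Csin ((0, mu) * PI) = (Ci * RtoC (sinh (2 * al)))%C).
  { unfold Csin. replace (Ci * ((0, mu) * PI))%C with ((- (2 * al))%R, 0)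
      by (unfold Ci, Cmult, RtoC, al; cbn [fst snd]; f_equal; field).
    replace (- ((- (2 * al))%R, 0))%C with ((2 * al)%R, 0) by (unfold Copp; cbn [fst snd]; f_equal; ring).
    rewrite !Cexp_cis, cis_0. unfold sinh. rewrite RtoC_div, RtoC_minus by lra.
    assert (Hi : (Ci * Ci = - 1)%C) by (unfold Ci, Cmult, Copp, RtoC; cbn [fst snd]; f_equal; ring).
    assert (Hi0 : Ci <> 0%C) by (intros E; injection E as E; lra).
    assert (H20 : RtoC 2 <> 0%C) by (apply RtoC_neq_0; lra).
    transitivity ((Ci * Ci) * (RtoC (exp (2 * al)) - RtoC (exp (- (2 * al)))) / (2 * Ci))%C.
    - rewrite Hi. field; repeat split; assumption.
    - field; repeat split; assumption. }
  rewrite Hcos, Hsin. set (A := reJ mu (ln x)). set (B := imJ mu (ln x)). unfold bessN. fold A B al.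
  assert (Hal : 0 < al) by (unfold al; apply Rdiv_lt_0_compat; nra).
  pose proof (cosh_pos al) as Hc. pose proof (sinh_pos al Hal) as Hs. pose proof (cosh2_sinh2 al) as Hcs.
  replace (((A, B) * RtoC (cosh (2 * al)) - Cconj (A, B)) / (Ci * RtoC (sinh (2 * al))))%C
    with ((B * cosh al / sinh al)%R, (- (A * sinh al / cosh al))%R).
  - unfold Cplus, Cmult, RtoC; cbn [fst snd]. f_equal.
    + field_simplify_eq; [|lra]. ring [Hcs].
    + field. lra.
  - assert (Hi0 : Ci <> 0%C) by (intros E; injection E as E; lra).
    assert (H20 : RtoC (sinh (2 * al)) <> 0%C).
    { apply RtoC_neq_0. apply Rgt_not_eq, sinh_pos. lra. }
    assert (Hw : ((A, B) * RtoC (cosh (2 * al)) - Cconj (A, B))%C =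
       (((B * cosh al / sinh al)%R, (- (A * sinh al / cosh al))%R) * (Ci * RtoC (sinh (2 * al))))%C).
    { rewrite cosh_double, sinh_double.
      unfold Ci, Cconj, Cminus, Cplus, Copp, Cmult, RtoC; cbn [fst snd]. f_equal.
      - field_simplify_eq; [|lra]. ring.
      - field_simplify_eq; [|lra]. ring [Hcs]. }
    rewrite Hw. unfold Cdiv. rewrite <- Cmult_assoc, Cinv_r, Cmult_1_r; [reflexivity|]. now apply Cmult_neq_0.
Qed.

Definition bessN1 (mu xi : R) : R :=
  2 * reJ mu xi * reJ1 mu xi / cosh (PI * mu / 2) ^ 2 + 2 * imJ mu xi * imJ1 mu xi / sinh (PI * mu / 2) ^ 2.

(** Equal to N'' + (4μ² + 4e^{2ξ}) N for N = [bessN mu]. Written as a sum of energies J'² + (μ² +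
    e^{2ξ}) J² it is differentiated at once, because only the explicit e^{2ξ} contributes. *)
Definition bessZ (mu xi : R) : R :=
  2 * (reJ1 mu xi ^ 2 + (mu ^ 2 + exp (2 * xi)) * reJ mu xi ^ 2) / cosh (PI * mu / 2) ^ 2
  + 2 * (imJ1 mu xi ^ 2 + (mu ^ 2 + exp (2 * xi)) * imJ mu xi ^ 2) / sinh (PI * mu / 2) ^ 2.

Lemma is_derive_bessN (mu : R) (rho : C) (xi : R) : 0 < mu -> clim (gauss mu) rho ->
  is_derive (bessN mu) xi (bessN1 mu xi) /\
  is_derive (bessN1 mu) xi (bessZ mu xi - (4 * mu ^ 2 + 4 * exp (2 * xi)) * bessN mu xi) /\
  is_derive (bessZ mu) xi (4 * exp (2 * xi) * bessN mu xi).
Proof.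
  intros Hmu H. destruct (is_derive_J mu rho xi Hmu H) as [H1 [H2 [H3 H4]]].
  assert (Hs : 0 < sinh (PI * mu / 2)) by (apply sinh_pos; pose proof PI_RGT_0; apply Rdiv_lt_0_compat; nra).
  pose proof (cosh_pos (PI * mu / 2)) as Hc.
  unfold bessN, bessN1, bessZ.
  set (c := cosh (PI * mu / 2)) in *. set (s := sinh (PI * mu / 2)) in *. clearbody c s.
  split; [|split].
  - auto_derive; [repeat split; eexists; eassumption|].
    rewrite (Derive_eta _ _ _ H1), (Derive_eta _ _ _ H2). field. lra.
  - auto_derive; [repeat split; eexists; eassumption|].
    rewrite (Derive_eta _ _ _ H1), (Derive_eta _ _ _ H2), (Derive_eta _ _ _ H3), (Derive_eta _ _ _ H4). field. lra.
  - auto_derive; [repeat split; eexists; eassumption|].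
    rewrite (Derive_eta _ _ _ H1), (Derive_eta _ _ _ H2), (Derive_eta _ _ _ H3), (Derive_eta _ _ _ H4). field. lra.
Qed.

(** * Behaviour of J² + Y² as ξ -> -∞ *)

Lemma is_lim_bounded_mult (f g : R -> R) (B : R) : (forall t, Rabs (g t) <= B) ->
  is_lim f m_infty 0 -> is_lim (fun t => g t * f t) m_infty 0.
Proof.
  intros HB Hf. apply is_lim_spec. intros eps. apply is_lim_spec in Hf.
  assert (HBp : 0 < Rabs B + 1) by (pose proof (Rabs_pos B); lra).
  destruct (Hf (mkposreal _ (Rdiv_lt_0_compat eps (Rabs B + 1) (cond_pos eps) HBp))) as [M HM].
  exists M. intros x Hx. specialize (HM x Hx). simpl in HM. rewrite Rminus_0_r in *.
  rewrite Rabs_mult. apply Rle_lt_trans with ((Rabs B + 1) * Rabs (f x)).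
  - apply Rmult_le_compat_r; [apply Rabs_pos|]. pose proof (HB x). pose proof (Rle_abs B). lra.
  - apply (Rmult_lt_compat_l (Rabs B + 1)) in HM; [|assumption].
    replace ((Rabs B + 1) * (eps / (Rabs B + 1))) with (pos eps) in HM by (field; lra). exact HM.
Qed.

Lemma is_lim_0_plus (f g : R -> R) (x : Rbar) : is_lim f x 0 -> is_lim g x 0 ->
  is_lim (fun t => f t + g t) x 0.
Proof. intros Hf Hg. rewrite <- (Rplus_0_l 0). now apply is_lim_plus'. Qed.

Lemma is_lim_0_mult (f g : R -> R) (x : Rbar) : is_lim f x 0 -> is_lim g x 0 ->
  is_lim (fun t => f t * g t) x 0.
Proof. intros Hf Hg. rewrite <- (Rmult_0_l 0). now apply is_lim_mult_R. Qed.

(** [leadRe] and [leadIm] are the parts of the leading term ρ (x/2)^{iμ} of J_{iμ}(x) at x = e^ξ,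
    with ρ = 1/Γ(1+iμ). *)
Definition leadRe (mu : R) (rho : C) (xi : R) : R :=
  cos (phase mu xi) * Re rho - sin (phase mu xi) * Im rho.
Definition leadIm (mu : R) (rho : C) (xi : R) : R :=
  sin (phase mu xi) * Re rho + cos (phase mu xi) * Im rho.

Lemma lead_bound (mu : R) (rho : C) (xi : R) :
  Rabs (leadRe mu rho xi) <= Rabs (Re rho) + Rabs (Im rho) /\
  Rabs (leadIm mu rho xi) <= Rabs (Re rho) + Rabs (Im rho).
Proof.
  pose proof (cos_abs_le_1 (phase mu xi)). pose proof (sin_abs_le_1 (phase mu xi)).
  pose proof (Rabs_pos (Re rho)). pose proof (Rabs_pos (Im rho)).
  unfold leadRe, leadIm. split.
  - unfold Rminus. apply Rle_trans with (1 := Rabs_triang _ _). rewrite Rabs_Ropp, !Rabs_mult. nra.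
  - apply Rle_trans with (1 := Rabs_triang _ _). rewrite !Rabs_mult. nra.
Qed.

Lemma lead_sqr (mu : R) (rho : C) (xi : R) :
  leadRe mu rho xi ^ 2 + leadIm mu rho xi ^ 2 = Re rho ^ 2 + Im rho ^ 2.
Proof.
  unfold leadRe, leadIm. pose proof (sin2_cos2 (phase mu xi)) as H. unfold Rsqr in H.
  transitivity ((Re rho ^ 2 + Im rho ^ 2) *
    (sin (phase mu xi) * sin (phase mu xi) + cos (phase mu xi) * cos (phase mu xi))); [ring|].
  rewrite H. ring.
Qed.

Lemma J_lims (mu : R) (rho : C) : 0 < mu -> clim (gauss mu) rho ->
  is_lim (fun xi => reJ mu xi - leadRe mu rho xi) m_infty 0 /\
  is_lim (fun xi => imJ mu xi - leadIm mu rho xi) m_infty 0 /\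
  is_lim (fun xi => reJ1 mu xi + mu * leadIm mu rho xi) m_infty 0 /\
  is_lim (fun xi => imJ1 mu xi - mu * leadRe mu rho xi) m_infty 0.
Proof.
  intros Hmu H. destruct (bre_bim_entire mu rho Hmu H) as [Ea Eb].
  destruct (rgk_spec mu rho Hmu H) as [H0 _].
  assert (Hb0 : bre mu 0 = Re rho /\ bim mu 0 = Im rho).
  { unfold bre, bim, bcoef. rewrite H0. destruct rho as [x y]. unfold Cmult, RtoC, Re, Im; cbn [fst snd].
    simpl. split; field. }
  destruct Hb0 as [Hb1 Hb2].
  assert (Hc : forall f, is_lim f m_infty 0 -> is_lim (fun xi => cos (phase mu xi) * f xi) m_infty 0)
    by (intros f Hf; apply (is_lim_bounded_mult f _ 1); [intros; apply cos_abs_le_1|assumption]).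
  assert (Hs : forall f, is_lim f m_infty 0 -> is_lim (fun xi => sin (phase mu xi) * f xi) m_infty 0)
    by (intros f Hf; apply (is_lim_bounded_mult f _ 1); [intros; apply sin_abs_le_1|assumption]).
  assert (Hm : forall (c : R) f, is_lim f m_infty 0 -> is_lim (fun xi => c * f xi) m_infty 0).
  { intros c f Hf. apply (is_lim_bounded_mult f (fun _ => c) (Rabs c)); [intros; apply Rle_refl|assumption]. }
  assert (Ha : is_lim (fun xi => PSeries (bre mu) (exp (2 * xi) / 4) - Re rho) m_infty 0).
  { rewrite <- (Rminus_diag (Re rho)). apply is_lim_minus'; [|apply is_lim_const].
    rewrite <- Hb1. now apply entire_lim. }
  assert (Hb : is_lim (fun xi => PSeries (bim mu) (exp (2 * xi) / 4) - Im rho) m_infty 0).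
  { rewrite <- (Rminus_diag (Im rho)). apply is_lim_minus'; [|apply is_lim_const].
    rewrite <- Hb2. now apply entire_lim. }
  pose proof (entire_deriv_lim _ Ea) as Ha1. pose proof (entire_deriv_lim _ Eb) as Hb1'.
  assert (L1 : is_lim (fun xi => reJ mu xi - leadRe mu rho xi) m_infty 0).
  { eapply is_lim_ext; [|apply (is_lim_0_plus _ _ _ (Hc _ Ha) (Hm (-1) _ (Hs _ Hb)))].
    intros xi. unfold reJ, leadRe. simpl. ring. }
  assert (L2 : is_lim (fun xi => imJ mu xi - leadIm mu rho xi) m_infty 0).
  { eapply is_lim_ext; [|apply (is_lim_0_plus _ _ _ (Hs _ Ha) (Hc _ Hb))].
    intros xi. unfold imJ, leadIm. simpl. ring. }
  split; [exact L1|split; [exact L2|split]].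
  - eapply is_lim_ext; [|apply (is_lim_0_plus _ _ _ (Hm (- mu) _ L2)
      (is_lim_0_plus _ _ _ (Hc _ Ha1) (Hm (-1) _ (Hs _ Hb1'))))].
    intros xi. unfold reJ1. simpl. ring.
  - eapply is_lim_ext; [|apply (is_lim_0_plus _ _ _ (Hm mu _ L1)
      (is_lim_0_plus _ _ _ (Hs _ Ha1) (Hc _ Hb1')))].
    intros xi. unfold imJ1. simpl. ring.
Qed.

(** The leading terms oscillate and have no limit at -∞, so asymptotic equalities are multiplied
    instead of limits; boundedness of [u] and [v] is what makes this work. *)
Lemma is_lim_prod_approx (f g u v : R -> R) (B : R) :
  (forall t, Rabs (u t) <= B) -> (forall t, Rabs (v t) <= B) ->
  is_lim (fun t => f t - u t) m_infty 0 -> is_lim (fun t => g t - v t) m_infty 0 ->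
  is_lim (fun t => f t * g t - u t * v t) m_infty 0.
Proof.
  intros Hu Hv Hf Hg.
  eapply is_lim_ext; [|apply (is_lim_0_plus _ _ _ (is_lim_bounded_mult _ _ B Hu Hg)
    (is_lim_0_plus _ _ _ (is_lim_bounded_mult _ _ B Hv Hf) (is_lim_0_mult _ _ _ Hf Hg)))].
  intros t. simpl. ring.
Qed.

(** In Z the squares of the leading terms combine to the constant |ρ|², so Z has a genuine limit. In
    N' the product of the two leading terms survives with the factor 1/sinh² α - 1/cosh² α = 4/sinh²
    2α, α = πμ/2. For N itself a bound suffices, as it does in the uniqueness argument. *)
Lemma bessN_lims (mu : R) (rho : C) : 0 < mu -> clim (gauss mu) rho ->
  is_lim (fun xi => bessN1 mu xi -
    8 * mu / sinh (PI * mu) ^ 2 * (leadRe mu rho xi * leadIm mu rho xi)) m_infty 0 /\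
  is_lim (bessZ mu) m_infty (8 * mu * cosh (PI * mu) / (PI * sinh (PI * mu))) /\
  exists M C, forall xi, xi < M -> Rabs (bessN mu xi) <= C.
Proof.
  intros Hmu H. destruct (J_lims mu rho Hmu H) as [L1 [L2 [L3 L4]]].
  pose proof PI_RGT_0 as HPI. pose proof (Cmod_gauss_lim mu rho Hmu H) as Hrho.
  set (al := PI * mu / 2). assert (Hal : 0 < al) by (unfold al; apply Rdiv_lt_0_compat; nra).
  pose proof (sinh_pos al Hal) as Hs. pose proof (cosh_pos al) as Hc. pose proof (cosh2_sinh2 al) as Hcs.
  replace (PI * mu) with (2 * al) in * by (unfold al; field).
  set (a := leadRe mu rho) in *. set (b := leadIm mu rho) in *.
  set (B0 := Rabs (Re rho) + Rabs (Im rho)).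
  assert (HB0 : 0 <= B0) by (unfold B0; pose proof (Rabs_pos (Re rho)); pose proof (Rabs_pos (Im rho)); lra).
  set (B := (1 + mu) * B0).
  assert (Ha : forall t, Rabs (a t) <= B) by (intros t; unfold B; pose proof (proj1 (lead_bound mu rho t)) as E; fold a B0 in E; nra).
  assert (Hb : forall t, Rabs (b t) <= B) by (intros t; unfold B; pose proof (proj2 (lead_bound mu rho t)) as E; fold b B0 in E; nra).
  assert (Hma : forall t, Rabs (mu * a t) <= B).
  { intros t. rewrite Rabs_mult, (Rabs_pos_eq mu) by lra. unfold B. pose proof (proj1 (lead_bound mu rho t)) as E; fold a B0 in E; nra. }
  assert (Hmb : forall t, Rabs (- mu * b t) <= B).
  { intros t. rewrite Rabs_mult, Rabs_Ropp, (Rabs_pos_eq mu) by lra. unfold B. pose proof (proj2 (lead_bound mu rho t)) as E; fold b B0 in E; nra. }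
  assert (L3' : is_lim (fun xi => reJ1 mu xi - - mu * b xi) m_infty 0)
    by (eapply is_lim_ext; [|exact L3]; intros; simpl; ring).
  assert (Hm : forall (c : R) f, is_lim f m_infty 0 -> is_lim (fun xi => c * f xi) m_infty 0).
  { intros c f Hf. apply (is_lim_bounded_mult f (fun _ => c) (Rabs c)); [intros; apply Rle_refl|assumption]. }
  pose proof (is_lim_prod_approx _ _ _ _ B Ha Hmb L1 L3') as P1.
  pose proof (is_lim_prod_approx _ _ _ _ B Hb Hma L2 L4) as P2.
  pose proof (is_lim_prod_approx _ _ _ _ B Ha Ha L1 L1) as P3.
  pose proof (is_lim_prod_approx _ _ _ _ B Hb Hb L2 L2) as P4.
  pose proof (is_lim_prod_approx _ _ _ _ B Hmb Hmb L3' L3') as P5.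
  pose proof (is_lim_prod_approx _ _ _ _ B Hma Hma L4 L4) as P6.
  assert (He : is_lim (fun xi => exp (2 * xi)) m_infty 0).
  { apply (is_lim_m_exp _ 0 2 1 0); [lra|]. intros t _. rewrite Rminus_0_r, Rabs_pos_eq by (left; apply exp_pos). lra. }
  assert (Hsq : forall xi, a xi ^ 2 + b xi ^ 2 = sinh (2 * al) / (2 * al))
    by (intros xi; unfold a, b; rewrite lead_sqr; exact Hrho).
  split; [|split].
  - eapply is_lim_ext; [|apply (is_lim_0_plus _ _ _ (Hm (2 / cosh al ^ 2) _ P1) (Hm (2 / sinh al ^ 2) _ P2))].
    intros xi. unfold bessN1. fold al. rewrite sinh_double. simpl.
    set (A := reJ mu xi). set (A1 := reJ1 mu xi). set (A2 := imJ mu xi). set (A3 := imJ1 mu xi).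
    apply Rminus_diag_uniq.
    transitivity (2 * mu * (a xi * b xi) * ((sinh al ^ 2 - cosh al ^ 2 + 1) * / (cosh al ^ 2 * sinh al ^ 2) )).
    + field. lra.
    + rewrite Hcs. ring.
  - set (Zl := 8 * mu * cosh (2 * al) / (PI * sinh (2 * al))).
    assert (PP : is_lim (fun xi => 2 / cosh al ^ 2 * ((reJ1 mu xi * reJ1 mu xi - - mu * b xi * (- mu * b xi))
        + mu ^ 2 * (reJ mu xi * reJ mu xi - a xi * a xi)) +
        2 / sinh al ^ 2 * ((imJ1 mu xi * imJ1 mu xi - mu * a xi * (mu * a xi))
        + mu ^ 2 * (imJ mu xi * imJ mu xi - b xi * b xi))) m_infty 0).
    { apply is_lim_0_plus; apply Hm; apply is_lim_0_plus; try assumption; now apply Hm. }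
    assert (PQ : is_lim (fun xi => 2 / cosh al ^ 2 * (exp (2 * xi) * (reJ mu xi * reJ mu xi - a xi * a xi)
        + (a xi * a xi) * exp (2 * xi)) + 2 / sinh al ^ 2 * (exp (2 * xi) * (imJ mu xi * imJ mu xi - b xi * b xi)
        + (b xi * b xi) * exp (2 * xi))) m_infty 0).
    { assert (Hq : forall u : R -> R, (forall t, Rabs (u t) <= B) -> forall t, Rabs (u t * u t) <= B * B).
      { intros u Hu t. rewrite Rabs_mult. pose proof (Hu t). pose proof (Rabs_pos (u t)). nra. }
      apply is_lim_0_plus; apply Hm; apply is_lim_0_plus;
        try (now apply is_lim_0_mult); apply (is_lim_bounded_mult _ _ (B * B)); auto. }
    pose proof (is_lim_plus' _ _ _ _ _ (is_lim_const Zl m_infty) (is_lim_0_plus _ _ _ PP PQ)) as PR.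
    rewrite Rplus_0_r in PR. eapply is_lim_ext; [|exact PR].
    intros xi. unfold bessZ. fold al. simpl.
    assert (HZ : Zl = 2 * mu ^ 2 * (a xi ^ 2 + b xi ^ 2) * (/ cosh al ^ 2 + / sinh al ^ 2)).
    { rewrite Hsq. unfold Zl. rewrite cosh_double, sinh_double.
      replace PI with (2 * al / mu) by (unfold al; field; lra).
      field_simplify_eq; [|repeat split; lra]. ring [Hcs]. }
    rewrite HZ. field. lra.
  - apply is_lim_spec in P3. apply is_lim_spec in P4.
    destruct (P3 (mkposreal 1 Rlt_0_1)) as [M3 HM3]. destruct (P4 (mkposreal 1 Rlt_0_1)) as [M4 HM4].
    exists (Rmin M3 M4), ((1 + B * B) * / cosh al ^ 2 + (1 + B * B) * / sinh al ^ 2).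
    intros xi Hxi. specialize (HM3 xi (Rlt_le_trans _ _ _ Hxi (Rmin_l _ _))).
    specialize (HM4 xi (Rlt_le_trans _ _ _ Hxi (Rmin_r _ _))). simpl in HM3, HM4.
    rewrite Rminus_0_r in HM3, HM4. apply Rabs_def2 in HM3. apply Rabs_def2 in HM4.
    specialize (Ha xi). specialize (Hb xi). apply Rabs_le_between in Ha. apply Rabs_le_between in Hb.
    assert (Hia : 0 < / cosh al ^ 2) by (apply Rinv_0_lt_compat, pow_lt; lra).
    assert (Hib : 0 < / sinh al ^ 2) by (apply Rinv_0_lt_compat, pow_lt; lra).
    unfold bessN. fold al.
    assert (0 <= reJ mu xi ^ 2 <= 1 + B * B) by (split; [apply pow2_ge_0|nra]).
    assert (0 <= imJ mu xi ^ 2 <= 1 + B * B) by (split; [apply pow2_ge_0|nra]).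
    unfold Rdiv. rewrite Rabs_pos_eq.
    + apply Rplus_le_compat; apply Rmult_le_compat_r; lra.
    + apply Rplus_le_le_0_compat; apply Rmult_le_pos; lra.
Qed.

(** * Convolutions and Nicholson's integral *)

Definition ker (C : R) (k : R -> R) : Prop :=
  (forall t, continuous k t) /\ forall t, Rabs (k t) <= C * exp (- (3/4) * t).

Definition sym (D : R) (g : R -> R) : Prop :=
  (forall t, continuous g t) /\ forall t, Rabs (g t) <= D * Rmin 1 (exp t).

(** With w = e^t and x = e^ξ this is the integral of k(ln(x w)) g(ln w) dw/w; for k = [K] it
    superposes the functions K_0(2 x w). *)
Definition conv (k g : R -> R) (xi : R) : R := IR (fun t => k (xi + t) * g t).

Lemma rapid_ker (k : R -> R) : rapid k -> exists C, ker C k.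
Proof. intros [Hc Hb]. destruct (Hb (3/4) ltac:(lra)) as [C HC]. exists C. now split. Qed.

Lemma ker_const_pos (C : R) (k : R -> R) : ker C k -> 0 <= C.
Proof.
  intros [_ H]. specialize (H 0). pose proof (Rabs_pos (k 0)). pose proof (exp_pos (- (3/4) * 0)). nra.
Qed.

Lemma Rmin_1_exp (t : R) : 0 < Rmin 1 (exp t) <= 1 /\ Rmin 1 (exp t) <= exp t.
Proof.
  pose proof (exp_pos t). split; [split|].
  - apply Rmin_pos; lra.
  - apply Rmin_l.
  - apply Rmin_r.
Qed.

Lemma sym_const_pos (D : R) (g : R -> R) : sym D g -> 0 <= D.
Proof.
  intros [_ H]. specialize (H 0). pose proof (Rabs_pos (g 0)). pose proof (Rmin_1_exp 0). nra.
Qed.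

Lemma exp_Rmin_dec (t : R) : exp (- (3/4) * t) * Rmin 1 (exp t) <= dec t.
Proof.
  pose proof (Rmin_1_exp t) as H. pose proof (exp_pos (- (3/4) * t)).
  destruct (Rle_dec 0 t).
  - rewrite dec_nonneg by assumption. pose proof (exp_le (- (3/4) * t) (- t / 4) ltac:(lra)). nra.
  - rewrite dec_neg by lra. apply Rle_trans with (exp (- (3/4) * t) * exp t).
    + apply Rmult_le_compat_l; lra.
    + rewrite <- exp_plus. apply exp_le. lra.
Qed.

Lemma conv_tame (C D : R) (k g : R -> R) (xi : R) : ker C k -> sym D g ->
  tame_by (C * D * exp (- (3/4) * xi)) (fun t => k (xi + t) * g t).
Proof.
  intros Hk Hg. pose proof (ker_const_pos _ _ Hk). pose proof (sym_const_pos _ _ Hg).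
  destruct Hk as [Hk Hkb]. destruct Hg as [Hg Hgb]. split.
  - intros t. apply (@continuous_mult R_UniformSpace R_AbsRing); [|apply Hg].
    apply (continuous_comp (fun t => xi + t) k); [|apply Hk].
    apply (@continuous_plus R_UniformSpace R_AbsRing R_NormedModule); [apply continuous_const|apply continuous_id].
  - intros t. rewrite Rabs_mult. pose proof (Rmin_1_exp t).
    apply Rle_trans with ((C * exp (- (3/4) * (xi + t))) * (D * Rmin 1 (exp t))).
    + apply Rmult_le_compat; auto using Rabs_pos.
    + rewrite Rmult_plus_distr_l, exp_plus.
      replace (C * (exp (- (3 / 4) * xi) * exp (- (3 / 4) * t)) * (D * Rmin 1 (exp t)))
        with (C * D * exp (- (3 / 4) * xi) * (exp (- (3 / 4) * t) * Rmin 1 (exp t))) by ring.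
      apply Rmult_le_compat_l; [|apply exp_Rmin_dec].
      pose proof (exp_pos (- (3/4) * xi)). apply Rmult_le_pos; [now apply Rmult_le_pos|lra].
Qed.

Lemma conv_tame' (C D : R) (k g : R -> R) (xi : R) : ker C k -> sym D g ->
  tame (fun t => k (xi + t) * g t).
Proof. intros Hk Hg. eexists. now apply (conv_tame C D). Qed.

Lemma conv_bound (C D : R) (k g : R -> R) (xi : R) : ker C k -> sym D g ->
  Rabs (conv k g xi) <= 8 * C * D * exp (- (3/4) * xi).
Proof.
  intros Hk Hg. apply Rle_trans with (1 := IR_bound _ _ (conv_tame C D k g xi Hk Hg)). right. ring.
Qed.

Lemma conv_derive (C C1 C2 D : R) (k k1 k2 g : R -> R) (xi : R) :
  ker C k -> ker C1 k1 -> ker C2 k2 -> sym D g ->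
  (forall t, is_derive k t (k1 t)) -> (forall t, is_derive k1 t (k2 t)) ->
  is_derive (conv k g) xi (conv k1 g xi).
Proof.
  intros Hk Hk1 Hk2 Hg H1 H2.
  assert (Hs : forall f f1 t x, (forall t, is_derive f t (f1 t)) ->
     is_derive (fun x => f (x + t) * g t) x (f1 (x + t) * g t)).
  { intros f f1 t x Hf. specialize (Hf (x + t)). auto_derive; [eexists; exact Hf|].
    rewrite (Derive_eta _ _ _ Hf). ring. }
  apply (IR_derive (fun xi t => k (xi + t) * g t) (fun xi t => k1 (xi + t) * g t)
    (fun xi t => k2 (xi + t) * g t) xi (C2 * D * exp (- (3/4) * (xi - 1)))).
  - intros t x. now apply Hs.
  - intros t x. now apply Hs.
  - intros x t Hx. apply Rabs_le_between in Hx.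
    apply Rle_trans with (1 := proj2 (conv_tame C2 D k2 g x Hk2 Hg) t).
    apply Rmult_le_compat_r; [left; apply dec_pos|]. apply Rmult_le_compat_l.
    + apply Rmult_le_pos; [eapply ker_const_pos|eapply sym_const_pos]; eassumption.
    + apply exp_le. lra.
  - intros x. now apply (conv_tame' C D).
  - now apply (conv_tame' C1 D).
Qed.

Lemma conv_parts (C C1 D D1 : R) (k k1 g g1 : R -> R) (xi : R) :
  ker C k -> ker C1 k1 -> sym D g -> sym D1 g1 ->
  (forall t, is_derive k t (k1 t)) -> (forall t, is_derive g t (g1 t)) ->
  conv k1 g xi = - conv k g1 xi.
Proof.
  intros Hk Hk1 Hg Hg1 Dk Dg.
  assert (H : IR (fun t => k1 (xi + t) * g t + k (xi + t) * g1 t) = 0).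
  { apply (IR_derive_zero (fun t => k (xi + t) * g t)).
    - now apply (conv_tame' C D).
    - apply tame_plus; [now apply (conv_tame' C1 D)|now apply (conv_tame' C D1)].
    - intros t. pose proof (Dk (xi + t)) as H1. pose proof (Dg t) as H2.
      auto_derive; [split; [eexists; exact H1|split; [eexists; exact H2|exact I]]|].
      rewrite (Derive_eta _ _ _ H1), (Derive_eta _ _ _ H2). ring. }
  rewrite IR_plus in H by ((now apply (conv_tame' C1 D)) || (now apply (conv_tame' C D1))).
  unfold conv. lra.
Qed.

Lemma conv_opp (k g : R -> R) (xi C D : R) : ker C k -> sym D g ->
  conv (fun t => - k t) g xi = - conv k g xi.
Proof.
  intros Hk Hg. unfold conv. rewrite (IR_ext _ (fun t => (-1) * (k (xi + t) * g t))) by (intros; ring).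
  rewrite IR_scal by now apply (conv_tame' C D). ring.
Qed.

Lemma ker_opp (C : R) (k : R -> R) : ker C k -> ker C (fun t => - k t).
Proof.
  intros [H1 H2]. split.
  - intros t. apply (@continuous_opp R_UniformSpace R_AbsRing R_NormedModule), H1.
  - intros t. rewrite Rabs_Ropp. apply H2.
Qed.

(** Substituting [sinh s = e^t] turns [qs m] into [cos (m s) tanh s]. *)
Definition tt (t : R) : R := arcsinh (exp t).

Lemma sinh_tt (t : R) : sinh (tt t) = exp t.
Proof. apply sinh_arcsinh. Qed.

Lemma tt_pos (t : R) : 0 < tt t.
Proof. unfold tt. rewrite <- arcsinh_0. apply arcsinh_lt, exp_pos. Qed.

Lemma cosh_tt (t : R) : cosh (tt t) = sqrt (exp t ^ 2 + 1).
Proof.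
  pose proof (cosh2_sinh2 (tt t)) as H. rewrite sinh_tt in H. pose proof (cosh_pos (tt t)).
  replace (exp t ^ 2 + 1) with (cosh (tt t) ^ 2) by lra. rewrite sqrt_pow2; lra.
Qed.

Lemma is_derive_tt (t : R) : is_derive tt t (sinh (tt t) / cosh (tt t)).
Proof.
  rewrite sinh_tt, cosh_tt. unfold tt, Rdiv.
  apply (is_derive_comp arcsinh exp).
  - apply is_derive_Reals, derivable_pt_lim_arcsinh.
  - apply is_derive_Reals, derivable_pt_lim_exp.
Qed.

Lemma tt_le_exp (t : R) : tt t <= exp t.
Proof. rewrite <- sinh_tt. apply sinh_ge_id. left. apply tt_pos. Qed.

Lemma exp_le_cosh_tt (t : R) : exp t <= cosh (tt t).
Proof. rewrite <- sinh_tt. unfold sinh, cosh. pose proof (exp_pos (- tt t)). lra. Qed.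

Lemma tt_bounds (t : R) : t + ln 2 <= tt t /\ tt t - (t + ln 2) <= exp (- t).
Proof.
  assert (He : exp (tt t) = exp t + cosh (tt t)) by (rewrite <- (sinh_tt t); unfold sinh, cosh; lra).
  pose proof (exp_pos t) as Hp. pose proof (exp_le_cosh_tt t) as Hc.
  assert (H2 : cosh (tt t) <= exp t + 1).
  { pose proof (cosh2_sinh2 (tt t)) as H. rewrite sinh_tt in H. pose proof (cosh_pos (tt t)). nra. }
  assert (Hl : exp (t + ln 2) = 2 * exp t) by (rewrite exp_plus, exp_ln by lra; ring).
  split.
  - apply Rnot_lt_le. intros Hn. apply exp_increasing in Hn. lra.
  - assert (H3 : exp (tt t - (t + ln 2)) <= exp (exp (- t))).
    { unfold Rminus. rewrite exp_plus, exp_Ropp, Hl, He.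
      apply Rle_trans with (1 + exp (- t)); [|apply exp_ge_1_plus].
      assert (H4 : exp t * exp (- t) = 1) by (rewrite <- exp_plus, Rplus_opp_r; apply exp_0).
      apply (Rmult_le_reg_r (2 * exp t)); [lra|].
      rewrite Rmult_assoc, Rinv_l by lra. nra. }
    apply Rnot_lt_le. intros Hn. apply exp_increasing in Hn. lra.
Qed.

Definition qs (m t : R) : R := cos (m * tt t) * (sinh (tt t) / cosh (tt t)).
(** [Qs] is a primitive of [qs], and [ps] is defined so that Qs'' + m² Qs = ps. This source decays
    at both ends of the line, and it also satisfies e^{2t} ps = qs - qs'; these two relations carry
    the differential equation of [nich]. *)
Definition Qs (m t : R) : R := sin (m * tt t) / m.
Definition ps (m t : R) : R :=
  (m * sin (m * tt t) + cos (m * tt t) * (sinh (tt t) / cosh (tt t))) / cosh (tt t) ^ 2.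

Lemma is_derive_Qs (m t : R) : 0 < m -> is_derive (Qs m) t (qs m t).
Proof.
  intros Hm. unfold Qs, qs. pose proof (is_derive_tt t) as H.
  auto_derive; [eexists; exact H|]. rewrite (Derive_eta _ _ _ H). field.
  pose proof (cosh_pos (tt t)). lra.
Qed.

Lemma is_derive_qs (m t : R) : 0 < m -> is_derive (qs m) t (ps m t - m ^ 2 * Qs m t).
Proof.
  intros Hm. pose proof (cosh_pos (tt t)) as Hc. pose proof (cosh2_sinh2 (tt t)) as Hcs.
  assert (H : is_derive (fun s => cos (m * s) * (sinh s / cosh s)) (tt t)
     (- (m * sin (m * tt t)) * (sinh (tt t) / cosh (tt t)) + cos (m * tt t) * / cosh (tt t) ^ 2)).
  { pose proof (is_derive_tanh (tt t)) as Ht.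
    assert (Hgen : forall (f : R -> R) l, is_derive f (tt t) l ->
      is_derive (fun s => cos (m * s) * f s) (tt t) (- (m * sin (m * tt t)) * f (tt t) + cos (m * tt t) * l)).
    { intros f l Hf. auto_derive; [eexists; eassumption|]. rewrite (Derive_eta _ _ _ Hf). ring. }
    apply (Hgen _ _ Ht). }
  pose proof (is_derive_comp _ tt t _ _ H (is_derive_tt t)) as H1.
  evar_last; [exact H1|]. unfold scal; simpl; unfold mult; simpl. unfold ps, Qs.
  set (s := sinh (tt t)) in *. set (c := cosh (tt t)) in *.
  field_simplify_eq; [|lra]. ring [Hcs].
Qed.

Lemma exp2_ps (m t : R) : 0 < m -> exp (2 * t) * ps m t = qs m t - (ps m t - m ^ 2 * Qs m t).
Proof.
  intros Hm.
  replace (exp (2 * t)) with (sinh (tt t) ^ 2)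
    by (rewrite (sinh_tt t); replace (2 * t) with (t + t) by ring; rewrite exp_plus; ring).
  pose proof (cosh_pos (tt t)) as Hc. pose proof (cosh2_sinh2 (tt t)) as Hcs.
  unfold ps, Qs, qs. set (s := sinh (tt t)) in *. set (c := cosh (tt t)) in *.
  field_simplify_eq; [|split; lra]. ring [Hcs].
Qed.

Lemma tanh_tt_bound (t : R) : 0 <= sinh (tt t) / cosh (tt t) <= Rmin 1 (exp t).
Proof.
  pose proof (cosh_ge_1 (tt t)) as Hc. pose proof (exp_le_cosh_tt t). pose proof (exp_pos t).
  rewrite sinh_tt. split; [apply Rdiv_le_0_compat; lra|].
  apply Rmin_glb; apply (Rmult_le_reg_r (cosh (tt t))); try lra;
    unfold Rdiv; rewrite Rmult_assoc, Rinv_l by lra; nra.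
Qed.

Lemma tt_continuous (f : R -> R) (t : R) : (forall s, continuous f s) -> continuous (fun t => f (tt t)) t.
Proof.
  intros H. apply (continuous_comp tt f); [|apply H]. apply (derive_continuous _ _ _ (is_derive_tt t)).
Qed.

Lemma sym_qs (m : R) : sym 1 (qs m).
Proof.
  split.
  - intros t. apply (tt_continuous (fun s => cos (m * s) * (sinh s / cosh s))). intros s.
    apply (@continuous_mult R_UniformSpace R_AbsRing); [apply cos_lin_continuous|apply tanh_continuous].
  - intros t. unfold qs. rewrite Rabs_mult. pose proof (tanh_tt_bound t).
    rewrite (Rabs_pos_eq (_ / _)) by lra. pose proof (cos_abs_le_1 (m * tt t)).
    pose proof (Rabs_pos (cos (m * tt t))). nra.
Qed.

Lemma sin_tt_bound (m t : R) : 0 < m -> Rabs (sin (m * tt t)) <= (1 + m) * Rmin 1 (exp t).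
Proof.
  intros Hm. pose proof (sin_abs_le (m * tt t)) as H1. pose proof (sin_abs_le_1 (m * tt t)) as H2.
  pose proof (tt_pos t). pose proof (tt_le_exp t). rewrite (Rabs_pos_eq (m * tt t)) in H1 by nra.
  unfold Rmin. destruct (Rle_dec 1 (exp t)); nra.
Qed.

Lemma sym_Qs (m : R) : 0 < m -> sym ((1 + m) / m) (Qs m).
Proof.
  intros Hm. split.
  - intros t. apply (derive_continuous _ _ _ (is_derive_Qs m t Hm)).
  - intros t. unfold Qs, Rdiv. rewrite Rabs_mult, (Rabs_pos_eq (/ m)) by (left; now apply Rinv_0_lt_compat).
    pose proof (sin_tt_bound m t Hm).
    replace ((1 + m) * / m * Rmin 1 (exp t)) with ((1 + m) * Rmin 1 (exp t) * / m) by ring.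
    apply Rmult_le_compat_r; [left; now apply Rinv_0_lt_compat|assumption].
Qed.

Lemma ps_num_bound (m t : R) : 0 < m ->
  Rabs (ps m t) <= (m * (1 + m) + 1) * Rmin 1 (exp t) / cosh (tt t) ^ 2.
Proof.
  intros Hm. unfold ps. unfold Rdiv at 1. rewrite Rabs_mult. unfold Rdiv at 2.
  assert (Hc : 0 < / cosh (tt t) ^ 2) by (apply Rinv_0_lt_compat, pow_lt, cosh_pos).
  rewrite (Rabs_pos_eq (/ cosh (tt t) ^ 2)) by lra. apply Rmult_le_compat_r; [lra|].
  apply Rle_trans with (1 := Rabs_triang _ _). rewrite Rabs_mult, (Rabs_pos_eq m) by lra.
  pose proof (sin_tt_bound m t Hm). destruct (sym_qs m) as [_ Hq]. specialize (Hq t). unfold qs in Hq. nra.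
Qed.

Lemma ps_continuous (m t : R) : continuous (ps m) t.
Proof.
  apply (tt_continuous (fun s => (m * sin (m * s) + cos (m * s) * (sinh s / cosh s)) / cosh s ^ 2)).
  intros s. apply (@continuous_mult R_UniformSpace R_AbsRing).
  - apply (@continuous_plus R_UniformSpace R_AbsRing R_NormedModule).
    + apply (@continuous_scal_r R_UniformSpace R_AbsRing R_NormedModule), sin_lin_continuous.
    + apply (@continuous_mult R_UniformSpace R_AbsRing); [apply cos_lin_continuous|apply tanh_continuous].
  - pose proof (cosh_pos s). apply continuous_Rinv_comp; [|apply pow_nonzero; lra].
    apply ex_derive_continuous_R. unfold cosh. auto_derive. exact I.
Qed.

Lemma sym_ps (m : R) : 0 < m -> sym (m * (1 + m) + 1) (ps m).
Proof.
  intros Hm. split; [apply ps_continuous|].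
  intros t. apply Rle_trans with (1 := ps_num_bound m t Hm).
  pose proof (cosh_ge_1 (tt t)). pose proof (Rmin_1_exp t).
  assert (0 <= (m * (1 + m) + 1) * Rmin 1 (exp t)) by (apply Rmult_le_pos; nra).
  assert (H2 : / cosh (tt t) ^ 2 <= 1) by (rewrite <- Rinv_1; apply Rinv_le_contravar; nra).
  unfold Rdiv. set (X := (m * (1 + m) + 1) * Rmin 1 (exp t)) in *.
  apply Rle_trans with (X * 1); [now apply Rmult_le_compat_l|lra].
Qed.

Lemma sym_plus (D E : R) (f g : R -> R) : sym D f -> sym E g -> sym (D + E) (fun t => f t + g t).
Proof.
  intros [H1 H2] [H3 H4]. split.
  - intros t. apply (@continuous_plus R_UniformSpace R_AbsRing R_NormedModule); auto.
  - intros t. apply Rle_trans with (1 := Rabs_triang _ _). specialize (H2 t). specialize (H4 t). lra.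
Qed.

Lemma sym_scal (D c : R) (f : R -> R) : sym D f -> sym (Rabs c * D) (fun t => c * f t).
Proof.
  intros [H1 H2]. split.
  - intros t. apply (@continuous_scal_r R_UniformSpace R_AbsRing R_NormedModule), H1.
  - intros t. rewrite Rabs_mult, Rmult_assoc. apply Rmult_le_compat_l; [apply Rabs_pos|apply H2].
Qed.

Lemma sym_ext (D : R) (f g : R -> R) : (forall t, f t = g t) -> sym D f -> sym D g.
Proof.
  intros H [H1 H2]. split.
  - intros t. apply (continuous_ext f); auto.
  - intros t. rewrite <- H. apply H2.
Qed.

Lemma sym_qs' (m : R) : 0 < m -> exists D, sym D (fun t => ps m t - m ^ 2 * Qs m t).
Proof.
  intros Hm. eexists. eapply sym_ext; [|apply (sym_plus _ _ _ _ (sym_ps m Hm) (sym_scal _ (- m ^ 2) _ (sym_Qs m Hm)))].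
  intros t. simpl. ring.
Qed.

Lemma conv_plus (k f g : R -> R) (C D E xi : R) : ker C k -> sym D f -> sym E g ->
  conv k (fun t => f t + g t) xi = conv k f xi + conv k g xi.
Proof.
  intros Hk Hf Hg. unfold conv.
  rewrite (IR_ext _ (fun t => k (xi + t) * f t + k (xi + t) * g t)) by (intros; ring).
  apply IR_plus; [now apply (conv_tame' C D)|now apply (conv_tame' C E)].
Qed.

Lemma conv_scal (k f : R -> R) (c C D xi : R) : ker C k -> sym D f ->
  conv k (fun t => c * f t) xi = c * conv k f xi.
Proof.
  intros Hk Hf. unfold conv.
  rewrite (IR_ext _ (fun t => c * (k (xi + t) * f t))) by (intros; ring).
  apply IR_scal. now apply (conv_tame' C D).
Qed.

Lemma conv_ext (k f g : R -> R) (xi : R) : (forall t, f t = g t) -> conv k f xi = conv k g xi.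
Proof. intros H. apply IR_ext. intros t. now rewrite H. Qed.

Lemma rapid_k2_deriv : rapid (fun t => - (2 * k2 t - 4 * exp (2 * t) * kap t)).
Proof.
  apply (rapid_ext (fun t => (-2) * k2 t + 4 * (exp (2 * t) * kap t))); [intros; ring|].
  apply rapid_plus; [apply rapid_scal, rapid_k2|apply rapid_scal, rapid_exp; [lra|apply rapid_kap]].
Qed.

(** [nich m] is Nicholson's integral [∫ K_0(2x sinh s) cos(m s) ds] at [x = e^ξ]; with [Z = D'' + (m^2 + 4 e^{2ξ}) D]
    the equation of products of Bessel functions reads [Z' = 4 e^{2ξ} D]. *)
Definition nich (m xi : R) : R := conv K (qs m) xi.
Definition nich1 (m xi : R) : R := - conv kap (qs m) xi.
Definition nichZ (m xi : R) : R := 4 * exp (2 * xi) * nich m xi + conv kap (ps m) xi.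

(** Two integrations by parts turn nich'', which is K'' against [qs], into [kap] against [ps] minus
    m² nich; this is why [nichZ] has its form. For the derivative of [nichZ], e^{2t} ps = qs - qs'
    evaluates [k2] against [ps] as 4 e^{2ξ} (nich + nich'). *)
Lemma nich_ode (m xi : R) : 0 < m ->
  is_derive (nich m) xi (nich1 m xi) /\
  is_derive (nich1 m) xi (nichZ m xi - (m ^ 2 + 4 * exp (2 * xi)) * nich m xi) /\
  is_derive (nichZ m) xi (4 * exp (2 * xi) * nich m xi).
Proof.
  intros Hm.
  destruct (rapid_ker _ rapid_K) as [CK HK]. destruct (rapid_ker _ rapid_kap) as [Ck Hk].
  destruct (rapid_ker _ rapid_k2) as [C2 H2]. destruct (rapid_ker _ rapid_k2_deriv) as [C3 H3].
  pose proof (sym_qs m) as Sq. pose proof (sym_Qs m Hm) as SQ. pose proof (sym_ps m Hm) as Sp.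
  destruct (sym_qs' m Hm) as [D Sq'].
  pose proof (fun t => is_derive_Qs m t Hm) as DQ. pose proof (fun t => is_derive_qs m t Hm) as Dq.
  assert (Dk2 : forall t, is_derive (fun t => - kap t) t (k2 t)).
  { intros t. rewrite <- (Ropp_involutive (k2 t)). apply (is_derive_opp kap), is_derive_kap. }
  assert (Dmk2 : forall t, is_derive (fun t => - k2 t) t (- (2 * k2 t - 4 * exp (2 * t) * kap t))).
  { intros t. apply (is_derive_opp k2), is_derive_k2. }
  assert (H1 : is_derive (nich m) xi (nich1 m xi)).
  { unfold nich1. rewrite <- (conv_opp kap (qs m) xi Ck 1 Hk Sq).
    apply (conv_derive CK Ck C2 1 K (fun t => - kap t) k2 (qs m)); auto using ker_opp, is_derive_K. }
  assert (Hc2 : conv k2 (qs m) xi = conv kap (ps m) xi - m ^ 2 * nich m xi).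
  { assert (E1 : conv (fun t => - k2 t) (qs m) xi = - conv kap (fun t => ps m t - m ^ 2 * Qs m t) xi)
      by (apply (conv_parts Ck C2 1 D); auto using ker_opp, is_derive_kap).
    rewrite (conv_opp k2 (qs m) xi C2 1 H2 Sq) in E1.
    assert (E2 : conv (fun t => - kap t) (Qs m) xi = - conv K (qs m) xi)
      by (apply (conv_parts CK Ck ((1 + m) / m) 1); auto using ker_opp, is_derive_K).
    rewrite (conv_opp kap (Qs m) xi Ck _ Hk SQ) in E2.
    rewrite (conv_ext kap _ (fun t => ps m t + (- m ^ 2) * Qs m t)) in E1 by (intros; ring).
    rewrite (conv_plus kap _ _ Ck _ _ xi Hk Sp (sym_scal _ (- m ^ 2) _ SQ)) in E1.
    rewrite (conv_scal kap _ _ Ck _ xi Hk SQ) in E1. unfold nich. nra. }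
  assert (Hd1 : is_derive (nich1 m) xi (conv k2 (qs m) xi)).
  { unfold nich1. apply (is_derive_ext (conv (fun t => - kap t) (qs m))).
    - intros t. apply (conv_opp kap (qs m) t Ck 1 Hk Sq).
    - apply (conv_derive Ck C2 C3 1 (fun t => - kap t) k2 (fun t => 2 * k2 t - 4 * exp (2 * t) * kap t));
        auto using ker_opp, is_derive_k2.
      apply ker_opp in H3. split; [intros t; apply (continuous_ext _ _ t (fun t => Ropp_involutive _)), H3|].
      intros t. destruct H3 as [_ H3]. rewrite <- (Ropp_involutive (2 * k2 t - _)). apply H3. }
  split; [exact H1|]. split.
  - evar_last; [exact Hd1|]. rewrite Hc2. unfold nichZ. ring.
  - assert (Hdp : is_derive (conv kap (ps m)) xi (- conv k2 (ps m) xi)).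
    { rewrite <- (conv_opp k2 (ps m) xi C2 _ H2 Sp).
      apply (conv_derive Ck C2 C3 _ kap (fun t => - k2 t) (fun t => - (2 * k2 t - 4 * exp (2 * t) * kap t)) (ps m) xi
        Hk (ker_opp _ _ H2) H3 Sp is_derive_kap Dmk2). }
    assert (Hk2p : conv k2 (ps m) xi = 4 * exp (2 * xi) * (nich m xi + nich1 m xi)).
    { assert (E1 : conv (fun t => - kap t) (qs m) xi = - conv K (fun t => ps m t - m ^ 2 * Qs m t) xi)
        by (apply (conv_parts CK Ck 1 D); auto using ker_opp, is_derive_K).
      rewrite (conv_opp kap (qs m) xi Ck 1 Hk Sq) in E1. unfold nich, nich1. rewrite E1.
      change (conv K (qs m) xi + - conv K (fun t => ps m t - m ^ 2 * Qs m t) xi)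
        with (IR (fun t => K (xi + t) * qs m t) - IR (fun t => K (xi + t) * (ps m t - m ^ 2 * Qs m t))).
      rewrite <- IR_minus by ((now apply (conv_tame' CK 1)) || (now apply (conv_tame' CK D))).
      rewrite <- IR_scal by (apply tame_minus; [now apply (conv_tame' CK 1)|now apply (conv_tame' CK D)]).
      apply IR_ext. intros t. unfold k2. rewrite Rmult_plus_distr_l, exp_plus.
      rewrite <- Rmult_minus_distr_l, <- exp2_ps by assumption. ring. }
    rewrite Hk2p in Hdp. unfold nichZ.
    assert (Hgen : forall (f g : R -> R) f1 g1, is_derive f xi f1 -> is_derive g xi g1 ->
      is_derive (fun xi => 4 * exp (2 * xi) * f xi + g xi) xi (4 * exp (2 * xi) * (2 * f xi + f1) + g1)).
    { intros f g f1 g1 Hf Hg. auto_derive; [repeat split; eexists; eassumption|].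
      rewrite (Derive_eta _ _ _ Hf), (Derive_eta _ _ _ Hg). ring. }
    evar_last; [exact (Hgen _ _ _ _ H1 Hdp)|]. ring.
Qed.

(** * Behaviour of Nicholson's integral as ξ -> -∞ *)

Lemma tame_exp_sym (D : R) (g : R -> R) : sym D g ->
  (exists E, forall t, Rabs (g t) <= E * exp (- t)) -> tame (fun t => exp (t / 8) * g t).
Proof.
  intros Hs [E HE]. pose proof (sym_const_pos _ _ Hs) as HD. destruct Hs as [Hc Hb].
  assert (HEp : 0 <= E) by (specialize (HE 0); pose proof (Rabs_pos (g 0)); pose proof (exp_pos (- 0)); nra).
  exists (D + E). split.
  - intros t. apply (@continuous_mult R_UniformSpace R_AbsRing); [|apply Hc].
    apply ex_derive_continuous_R. auto_derive. exact I.
  - intros t. rewrite Rabs_mult, Rabs_pos_eq by (left; apply exp_pos).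
    pose proof (dec_pos t). pose proof (Rmin_1_exp t) as Hm. pose proof (exp_pos (t / 8)).
    destruct (Rle_dec 0 t).
    + apply Rle_trans with (exp (t / 8) * (E * exp (- t))); [apply Rmult_le_compat_l; [lra|apply HE]|].
      replace (exp (t / 8) * (E * exp (- t))) with (E * (exp (t / 8) * exp (- t))) by ring. rewrite <- exp_plus.
      assert (exp (t / 8 + - t) <= dec t) by (rewrite dec_nonneg by assumption; apply exp_le; lra). nra.
    + apply Rle_trans with (exp (t / 8) * (D * exp t)).
      * apply Rmult_le_compat_l; [lra|]. specialize (Hb t). nra.
      * replace (exp (t / 8) * (D * exp t)) with (D * (exp (t / 8) * exp t)) by ring. rewrite <- exp_plus.
        assert (exp (t / 8 + t) <= dec t) by (rewrite dec_neg by lra; apply exp_le; lra). nra.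
Qed.

Lemma sym_tame (D : R) (g : R -> R) : sym D g ->
  (exists E, forall t, Rabs (g t) <= E * exp (- t)) -> tame g.
Proof.
  intros Hs [E HE]. pose proof (sym_const_pos _ _ Hs) as HD. destruct Hs as [Hc Hb].
  assert (HEp : 0 <= E) by (specialize (HE 0); pose proof (Rabs_pos (g 0)); pose proof (exp_pos (- 0)); nra).
  exists (D + E). split; [assumption|]. intros t. pose proof (dec_pos t). pose proof (Rmin_1_exp t) as Hm.
  destruct (Rle_dec 0 t).
  - apply Rle_trans with (1 := HE t).
    assert (exp (- t) <= dec t) by (rewrite dec_nonneg by assumption; apply exp_le; lra). nra.
  - apply Rle_trans with (1 := Hb t).
    assert (exp t <= dec t) by (rewrite dec_neg by lra; apply exp_le; lra). nra.
Qed.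

Lemma ps_decay (m : R) : 0 < m -> exists E, forall t, Rabs (ps m t) <= E * exp (- t).
Proof.
  intros Hm. exists (m * (1 + m) + 1). intros t. apply Rle_trans with (1 := ps_num_bound m t Hm).
  pose proof (Rmin_1_exp t). pose proof (exp_le_cosh_tt t). pose proof (cosh_ge_1 (tt t)). pose proof (exp_pos t).
  unfold Rdiv. rewrite Rmult_assoc. apply Rmult_le_compat_l; [nra|].
  rewrite exp_Ropp. assert (/ cosh (tt t) ^ 2 <= / exp t) by (apply Rinv_le_contravar; nra).
  assert (0 < / cosh (tt t) ^ 2) by (apply Rinv_0_lt_compat, pow_lt; lra). nra.
Qed.

(** [kap] tends to 1 at -∞, and 1 - kap(σ) <= 2 e^{σ/8} holds for every σ. The exponent 1/8 is small
    enough for e^{t/8} g(t) to remain integrable, and it produces the rate e^{ξ/8}. *)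
Lemma kap_conv_lim (D : R) (g : R -> R) : sym D g ->
  (exists E, forall t, Rabs (g t) <= E * exp (- t)) ->
  is_lim (conv kap g) m_infty (IR g).
Proof.
  intros Hs HE. destruct (rapid_ker _ rapid_kap) as [Ck Hk].
  pose proof (sym_tame D g Hs HE) as Tg. pose proof (tame_exp_sym D g Hs HE) as Te.
  assert (Ta : tame (fun t => exp (t / 8) * Rabs (g t))).
  { destruct Te as [C [Hc Hb]]. exists C. split.
    - intros t. apply (@continuous_mult R_UniformSpace R_AbsRing).
      + apply ex_derive_continuous_R. auto_derive. exact I.
      + apply (continuous_comp g Rabs); [apply Hs|apply continuous_Rabs].
    - intros t. specialize (Hb t). rewrite Rabs_mult in *. now rewrite Rabs_Rabsolu. }
  apply (is_lim_m_exp _ _ (1/8) (2 * IR (fun t => exp (t / 8) * Rabs (g t))) 0); [lra|].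
  intros xi _. unfold conv. rewrite <- IR_minus by (assumption || now apply (conv_tame' Ck D)).
  replace (2 * IR (fun t => exp (t / 8) * Rabs (g t)) * exp (1 / 8 * xi))
    with ((2 * exp (1 / 8 * xi)) * IR (fun t => exp (t / 8) * Rabs (g t))) by ring.
  rewrite <- IR_scal by assumption. apply IR_abs_le.
  - apply tame_minus; [now apply (conv_tame' Ck D)|assumption].
  - now apply tame_scal.
  - intros t. replace (kap (xi + t) * g t - g t) with (- ((1 - kap (xi + t)) * g t)) by ring.
    pose proof (one_minus_kap (xi + t)) as H1. pose proof (kap_bounds (xi + t)) as H2.
    pose proof (exp_pos (- (2 * exp (xi + t)))).
    rewrite Rabs_Ropp, Rabs_mult, (Rabs_pos_eq (1 - _)) by lra.
    replace (2 * exp (1 / 8 * xi) * (exp (t / 8) * Rabs (g t))) with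
      (2 * (exp (1 / 8 * xi) * exp (t / 8)) * Rabs (g t)) by ring. rewrite <- exp_plus.
    replace (1 / 8 * xi + t / 8) with ((xi + t) / 8) by field.
    apply Rmult_le_compat_r; [apply Rabs_pos|].
    destruct (Rle_dec 0 (xi + t)).
    + pose proof (exp_ge_1_plus ((xi + t) / 8)). lra.
    + pose proof (exp_le (xi + t) ((xi + t) / 8) ltac:(lra)). lra.
Qed.

Lemma tt_lim_m : is_lim tt m_infty 0.
Proof.
  apply (is_lim_m_exp _ 0 1 1 0); [lra|]. intros t _. pose proof (tt_pos t). pose proof (tt_le_exp t).
  rewrite Rminus_0_r, Rabs_pos_eq, !Rmult_1_l by lra. assumption.
Qed.

Lemma tt_lim_p : is_lim tt p_infty p_infty.
Proof.
  apply is_lim_spec. intros M. exists M. intros t Ht. pose proof (proj1 (tt_bounds t)).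
  pose proof ln_lt_2. lra.
Qed.

(** Here ps = qs' + m sin(m s), and dt = coth s ds under e^t = sinh s, so the integral reduces to m
    times that of sin(m s) coth s. At +∞ the boundary value of [qs] behaves like cos(m s), exactly
    the correction that makes the Abel value a limit in [sincoth_lim]. *)
Lemma IR_ps (m : R) : 0 < m -> IR (ps m) = m * beta m.
Proof.
  intros Hm. rewrite (IR_FTC (fun t => qs m t + m * RInt (sincoth m) 0 (tt t)) _ 0 (m * beta m)).
  - ring.
  - apply (sym_tame _ _ (sym_ps m Hm) (ps_decay m Hm)).
  - intros t.
    assert (HU : is_derive (fun s => RInt (sincoth m) 0 s) (tt t) (sincoth m (tt t))).
    { apply (is_derive_RInt (sincoth m) _ 0).
      - exists (mkposreal 1 Rlt_0_1). intros y _. apply RInt_correct_cont. intros; apply sincoth_continuous.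
      - apply sincoth_continuous. }
    pose proof (is_derive_comp _ tt t _ _ HU (is_derive_tt t)) as H1.
    pose proof (is_derive_plus _ _ _ _ _ (is_derive_qs m t Hm) (is_derive_scal _ _ m _ H1)) as H2.
    evar_last; [exact H2|]. unfold plus, scal; simpl; unfold mult; simpl.
    pose proof (tt_pos t). rewrite sincoth_neq_0 by lra. unfold Qs.
    pose proof (cosh_pos (tt t)). assert (sinh (tt t) <> 0) by (apply sinh_neq_0; lra).
    field. repeat split; lra.
  - apply (is_lim_ext (fun t => m * (RInt (sincoth m) 0 (tt t) + cos (m * tt t) / m)
      - cos (m * tt t) * (1 - sinh (tt t) / cosh (tt t)))).
    { intros t. unfold qs. pose proof (cosh_pos (tt t)). field. split; lra. }
    replace (Finite (m * beta m)) with (Finite (m * beta m - 0)) by (f_equal; ring).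
    apply is_lim_minus'.
    + apply (is_lim_scal_l _ m p_infty (Finite (beta m))).
      apply (is_lim_comp (fun T => RInt (sincoth m) 0 T + cos (m * T) / m) tt p_infty (beta m) p_infty).
      * now apply sincoth_lim.
      * apply tt_lim_p.
      * exists 0. intros; discriminate.
    + apply (is_lim_p_exp _ 0 1 2 0); [lra|]. intros t Ht. rewrite Rminus_0_r, Rabs_mult.
      pose proof (tt_pos t). pose proof (tanh_minus_1 (tt t) ltac:(lra)) as H1.
      rewrite (Rabs_pos_eq (1 - _)) by lra. pose proof (cos_abs_le_1 (m * tt t)).
      pose proof (Rabs_pos (cos (m * tt t))).
      pose proof (proj1 (tt_bounds t)). pose proof ln_lt_2.
      pose proof (exp_le (- tt t) (- (1) * t) ltac:(lra)). nra.
  - replace (Finite 0) with (Finite (0 + 0)) by (f_equal; ring). apply is_lim_plus'.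
    + apply (is_lim_m_exp _ 0 1 1 0); [lra|]. intros t _. rewrite Rminus_0_r.
      destruct (sym_qs m) as [_ H]. apply Rle_trans with (1 := H t). pose proof (Rmin_1_exp t).
      rewrite !Rmult_1_l. lra.
    + replace (Finite 0) with (Finite (m * RInt (sincoth m) 0 0))
        by (rewrite RInt_point; unfold zero; simpl; f_equal; ring).
      apply (is_lim_scal_l _ m m_infty (Finite _)).
      apply (is_lim_comp_continuous tt (fun s => RInt (sincoth m) 0 s)); [apply tt_lim_m|].
      apply (derive_continuous _ _ (sincoth m 0)).
      apply (is_derive_RInt (sincoth m) _ 0).
      * exists (mkposreal 1 Rlt_0_1). intros y _. apply RInt_correct_cont. intros; apply sincoth_continuous.
      * apply sincoth_continuous.
Qed.

Lemma nich_bound (m : R) : exists C, forall xi, Rabs (nich m xi) <= C * exp (- (3/4) * xi).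
Proof.
  destruct (rapid_ker _ rapid_K) as [CK HK]. exists (8 * CK * 1). intros xi.
  exact (conv_bound CK 1 K (qs m) xi HK (sym_qs m)).
Qed.

Lemma nichZ_lim (m : R) : 0 < m -> is_lim (nichZ m) m_infty (m * beta m).
Proof.
  intros Hm. rewrite <- (IR_ps m Hm). unfold nichZ.
  replace (Finite (IR (ps m))) with (Finite (0 + IR (ps m))) by (f_equal; ring).
  apply is_lim_plus'.
  - destruct (nich_bound m) as [C HC]. apply (is_lim_m_exp _ 0 (5/4) (4 * C) 0); [lra|].
    intros xi _. rewrite Rminus_0_r, Rabs_mult, Rabs_pos_eq by (pose proof (exp_pos (2 * xi)); lra).
    pose proof (exp_pos (2 * xi)). specialize (HC xi).
    apply Rle_trans with (4 * exp (2 * xi) * (C * exp (- (3/4) * xi))); [apply Rmult_le_compat_l; lra|].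
    replace (4 * exp (2 * xi) * (C * exp (- (3 / 4) * xi))) with (4 * C * (exp (2 * xi) * exp (- (3/4) * xi))) by ring.
    rewrite <- exp_plus. right. do 2 f_equal. field.
  - apply (kap_conv_lim _ _ (sym_ps m Hm) (ps_decay m Hm)).
Qed.

(** As [ξ -> -∞], [nich1] oscillates with the amplitude of the Mellin transform of [k2] at [im]. *)
Lemma nich1_lim (m : R) : 0 < m ->
  is_lim (fun xi => nich1 m xi + / m * (smom m 0 * cos (m * (ln 2 - xi)) + cmom m 0 * sin (m * (ln 2 - xi))))
    m_infty 0.
Proof.
  intros Hm. destruct (rapid_ker _ rapid_kap) as [Ck Hk]. destruct (rapid_ker _ rapid_k2) as [C2 H2].
  pose proof (sym_qs m) as Sq. pose proof (sym_Qs m Hm) as SQ.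
  (* One derivative is moved from the symbol to the kernel and the translation from the kernel to
     the symbol: [k2] is integrable over the line, and for ξ -> -∞ the argument [tt (s - xi)] can be
     replaced by s - ξ + ln 2. *)
  assert (Hk2 : forall xi, nich1 m xi = - IR (fun s => k2 s * Qs m (s - xi))).
  { intros xi. unfold nich1. f_equal.
    assert (E : conv (fun t => - k2 t) (Qs m) xi = - conv kap (qs m) xi).
    { apply (conv_parts Ck C2 ((1 + m) / m) 1); auto using ker_opp, is_derive_kap.
      intros t. now apply is_derive_Qs. }
    rewrite (conv_opp k2 (Qs m) xi C2 _ H2 SQ) in E.
    replace (conv kap (qs m) xi) with (conv k2 (Qs m) xi) by lra.
    rewrite <- (IR_shift (fun s => k2 s * Qs m (s - xi)) xi).
    - apply IR_ext. intros t. replace (t + xi - xi) with t by ring. now rewrite (Rplus_comm xi t).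
    - apply (tame_ext (fun s => (fun t => k2 (xi + t) * Qs m t) (s + - xi))).
      + intros s. simpl. replace (xi + (s + - xi)) with s by ring. reflexivity.
      + apply (tame_shift (fun t => k2 (xi + t) * Qs m t)). now apply (conv_tame' C2 ((1 + m) / m)). }
  assert (T8 : tame (fun s => k2 s * exp ((-1/8) * s))) by (apply tame_k2_exp; lra).
  destruct (tame_k2_trig 0 m (Rle_refl 0)) as [Tc Ts].
  assert (Tc' : tame (fun s => k2 s * cos (m * s)))
    by (apply (tame_ext (fun t => k2 t * (exp (0 * t) * cos (m * t)))); [intros; rewrite Rmult_0_l, exp_0; ring|exact Tc]).
  assert (Ts' : tame (fun s => k2 s * sin (m * s)))
    by (apply (tame_ext (fun t => k2 t * (exp (0 * t) * sin (m * t)))); [intros; rewrite Rmult_0_l, exp_0; ring|exact Ts]).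
  assert (Ec : IR (fun s => k2 s * cos (m * s)) = cmom m 0)
    by (apply IR_ext; intros t; simpl INR; rewrite Rmult_0_r, Rmult_0_l, exp_0; ring).
  assert (Es : IR (fun s => k2 s * sin (m * s)) = smom m 0)
    by (apply IR_ext; intros t; simpl INR; rewrite Rmult_0_r, Rmult_0_l, exp_0; ring).
  apply (is_lim_m_exp _ 0 (1/8) (2 / m * IR (fun s => k2 s * exp ((-1/8) * s)) + IR (fun s => k2 s * exp ((-1/8) * s))) 0); [lra|].
  intros xi _. rewrite Rminus_0_r, Hk2. set (ph := m * (ln 2 - xi)).
  assert (TQ : tame (fun s => k2 s * Qs m (s - xi))).
  { apply (tame_ext (fun s => (fun t => k2 (xi + t) * Qs m t) (s + - xi))).
    + intros s. simpl. replace (xi + (s + - xi)) with s by ring. reflexivity.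
    + apply (tame_shift (fun t => k2 (xi + t) * Qs m t)). now apply (conv_tame' C2 ((1 + m) / m)). }
  assert (TT : tame (fun s => / m * (cos ph * (k2 s * sin (m * s)) + sin ph * (k2 s * cos (m * s)))))
    by exact (tame_scal _ _ (tame_plus _ _ (tame_scal _ _ Ts') (tame_scal _ _ Tc'))).
  assert (Hm0 : - IR (fun s => k2 s * Qs m (s - xi)) + / m * (smom m 0 * cos ph + cmom m 0 * sin ph) =
     IR (fun s => / m * (cos ph * (k2 s * sin (m * s)) + sin ph * (k2 s * cos (m * s))) - k2 s * Qs m (s - xi))).
  { rewrite (IR_minus _ _ TT TQ), (IR_scal _ _ (tame_plus _ _ (tame_scal _ _ Ts') (tame_scal _ _ Tc'))).
    rewrite (IR_plus _ _ (tame_scal _ _ Ts') (tame_scal _ _ Tc')), (IR_scal _ _ Ts'), (IR_scal _ _ Tc'), Ec, Es.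
    ring. }
  rewrite Hm0.
  set (W := IR (fun s => k2 s * exp (-1 / 8 * s))).
  assert (HW : 0 <= W).
  { apply IR_nonneg; [assumption|]. intros t. pose proof (k2_nonneg t). pose proof (exp_pos (-1/8 * t)). nra. }
  apply Rle_trans with ((2 / m + 1) * exp (1/8 * xi) * W); [|right; ring].
  unfold W. rewrite <- IR_scal by assumption. apply IR_abs_le; [exact (tame_minus _ _ TT TQ)|exact (tame_scal _ _ T8)|].
  intros s. unfold Qs.
  replace (/ m * (cos ph * (k2 s * sin (m * s)) + sin ph * (k2 s * cos (m * s))) - k2 s * (sin (m * tt (s - xi)) / m))
    with (k2 s * (/ m * (sin (m * s + ph) - sin (m * tt (s - xi))))) by (rewrite sin_plus; field; lra).
  replace (m * s + ph) with (m * ((s - xi) + ln 2)) by (unfold ph; ring).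
  pose proof (k2_nonneg s) as Hk2p.
  replace ((2 / m + 1) * exp (1 / 8 * xi) * (k2 s * exp (-1 / 8 * s)))
    with (k2 s * ((2 / m + 1) * (exp (1 / 8 * xi) * exp (-1 / 8 * s)))) by ring.
  rewrite <- exp_plus. replace (1 / 8 * xi + -1 / 8 * s) with (- ((s - xi) / 8)) by field.
  set (t := s - xi). rewrite Rabs_mult, (Rabs_pos_eq (k2 s)) by assumption.
  apply Rmult_le_compat_l; [assumption|].
  assert (Him : 0 < / m) by now apply Rinv_0_lt_compat.
  rewrite Rabs_mult, (Rabs_pos_eq (/ m)) by lra.
  (* For t >= 0 the error of tt(t) against t + ln 2 is at most e^{-t}; for t < 0 the trivial bound 2
     on a difference of sines is enough. Both lie below (2/m + 1) e^{-t/8}. *)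
  destruct (Rle_dec 0 t).
  - apply Rle_trans with (/ m * (m * exp (- t))).
    + apply Rmult_le_compat_l; [lra|]. apply Rle_trans with (1 := proj2 (trig_lipschitz _ _)).
      destruct (tt_bounds t) as [B1 B2]. rewrite <- Rmult_minus_distr_l, Rabs_mult, (Rabs_pos_eq m) by lra.
      apply Rmult_le_compat_l; [lra|]. rewrite Rabs_left1; lra.
    + rewrite <- Rmult_assoc, Rinv_l, Rmult_1_l by lra.
      pose proof (exp_le (- t) (- (t / 8)) ltac:(lra)). pose proof (exp_pos (- (t / 8))).
      unfold Rdiv. assert (0 <= 2 * / m * exp (- (t * / 8))) by (apply Rmult_le_pos; [lra|left; apply exp_pos]).
      unfold Rdiv in *. lra.
  - assert (Rabs (sin (m * (t + ln 2)) - sin (m * tt t)) <= 2).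
    { unfold Rminus. apply Rle_trans with (1 := Rabs_triang _ _). rewrite Rabs_Ropp.
      pose proof (sin_abs_le_1 (m * (t + ln 2))). pose proof (sin_abs_le_1 (m * tt t)). lra. }
    pose proof (exp_le 0 (- (t / 8)) ltac:(lra)) as He. rewrite exp_0 in He.
    apply Rle_trans with (/ m * 2); [apply Rmult_le_compat_l; lra|].
    unfold Rdiv. assert (2 * / m * 1 <= 2 * / m * exp (- (t * / 8))) by (apply Rmult_le_compat_l; [lra|assumption]).
    unfold Rdiv in *. lra.
Qed.

(** Uniqueness for the third-order equation satisfied by products of Bessel functions, with data at [-∞]. *)
Lemma product_ode_unique (m : R) (D D1 Z : R -> R) : 0 < m ->
  (forall xi, is_derive D xi (D1 xi)) ->
  (forall xi, is_derive D1 xi (Z xi - (m ^ 2 + 4 * exp (2 * xi)) * D xi)) ->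
  (forall xi, is_derive Z xi (4 * exp (2 * xi) * D xi)) ->
  is_lim D1 m_infty 0 -> is_lim Z m_infty 0 ->
  (exists M C, forall xi, xi < M -> Rabs (D xi) <= C * exp (- (3/4) * xi)) ->
  forall xi, D xi = 0.
Proof.
  intros Hm HD HD1 HZ L1 LZ [M [C HC]].
  assert (HCp : 0 <= C).
  { specialize (HC (M - 1) ltac:(lra)). pose proof (Rabs_pos (D (M - 1))).
    pose proof (exp_pos (- (3/4) * (M - 1))). nra. }
  (* The integral of 4 e^{2x} C e^{-3x/4} from -∞ to ξ is (16/5) C e^{5ξ/4}. As Z vanishes at -∞,
     its equation bounds it by this amount. *)
  set (c := 16/5 * C).
  assert (HZb : forall xi, xi < M -> Rabs (Z xi) <= c * exp (5/4 * xi)).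
  { intros xi Hxi.
    assert (Hmono : forall s, s = 1 \/ s = -1 -> s * Z xi <= c * exp (5/4 * xi)).
    { intros s Hs. set (F := fun x => c * exp (5/4 * x) - s * Z x).
      assert (HF : forall a, a <= xi -> F a <= F xi).
      { intros a Ha. apply (incr_of_derive F (fun x => c * (5/4 * exp (5/4 * x)) - s * (4 * exp (2 * x) * D x))); [assumption| |].
        - intros x _. unfold F. pose proof (HZ x) as H1. auto_derive; [eexists; exact H1|].
          rewrite (Derive_eta _ _ _ H1). ring.
        - intros x Hx. specialize (HC x ltac:(lra)). unfold c.
          assert (E : exp (5/4 * x) = exp (2 * x) * exp (- (3/4) * x)) by (rewrite <- exp_plus; f_equal; field).
          rewrite E. apply Rabs_le_between in HC. pose proof (exp_pos (2 * x)).
          replace (16 / 5 * C * (5 / 4 * (exp (2 * x) * exp (- (3 / 4) * x))) - s * (4 * exp (2 * x) * D x))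
            with (4 * exp (2 * x) * (C * exp (- (3/4) * x) - s * D x)) by field.
          apply Rmult_le_pos; [lra|]. destruct Hs as [-> | ->]; lra. }
      assert (LF : is_lim F m_infty 0).
      { replace (Finite 0) with (Finite (0 - s * 0)) by (f_equal; ring). apply is_lim_minus'.
        - apply (is_lim_m_exp _ 0 (5/4) c 0); [lra|]. intros t _. rewrite Rminus_0_r, Rabs_pos_eq; [lra|].
          apply Rmult_le_pos; [unfold c; lra|left; apply exp_pos].
        - apply (is_lim_scal_l Z s m_infty (Finite 0) LZ). }
      assert (0 <= F xi).
      { apply (is_lim_le_loc F (fun _ => F xi) m_infty 0 (F xi)); [|exact LF|apply is_lim_const].
        exists xi. intros x Hx. apply HF. lra. }
      unfold F in H. lra. }
    apply Rabs_le. pose proof (Hmono 1 (or_introl eq_refl)). pose proof (Hmono (-1) (or_intror eq_refl)). lra. }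
  (* The weight e^{-2ξ} on Z² is chosen so that, with z = e^{-ξ} Z, the mixed terms 2 D1 Z and 8 Z D
     are both O(e^ξ) E; its own derivative contributes only the negative term -2z². The resulting
     growth rate is integrable at -∞. *)
  set (E := fun xi => D1 xi ^ 2 + m ^ 2 * D xi ^ 2 + exp (-2 * xi) * Z xi ^ 2).
  set (k := 1 + / m ^ 2). assert (Hm2 : 0 < m ^ 2) by nra.
  assert (Hk : 1 <= k) by (unfold k; pose proof (Rinv_0_lt_compat _ Hm2); lra).
  assert (HDk : forall xi, D xi ^ 2 <= / m ^ 2 * (m ^ 2 * D xi ^ 2)).
  { intros xi. right. field. lra. }
  (* A primitive of the Gronwall rate 9k e^ξ + 8k e^{2ξ}, where k = 1 + 1/m² accounts for estimating
     D² by E/m². *)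
  set (W := fun xi => 9 * k * exp xi + 4 * k * exp (2 * xi)).
  set (G := fun xi => - (E xi * exp (- W xi))).
  set (E' := fun xi => 2 * D1 xi * (Z xi - 4 * exp (2 * xi) * D xi) - 2 * exp (-2 * xi) * Z xi ^ 2 + 8 * Z xi * D xi).
  assert (HG : forall xi, is_derive G xi (- (E' xi - (9 * k * exp xi + 8 * k * exp (2 * xi)) * E xi) * exp (- W xi))).
  { intros xi. pose proof (HD xi) as A1. pose proof (HD1 xi) as A2. pose proof (HZ xi) as A3.
    unfold G, E, W. auto_derive; [repeat split; eexists; eassumption|].
    rewrite (Derive_eta _ _ _ A1), (Derive_eta _ _ _ A2), (Derive_eta _ _ _ A3).
    unfold E', E.
    assert (Hee : exp (-2 * xi) * exp (2 * xi) = 1)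
      by (rewrite <- exp_plus; replace (-2 * xi + 2 * xi) with 0 by ring; apply exp_0).
    set (e2 := exp (2 * xi)) in *. set (em := exp (-2 * xi)) in *. set (ew := exp _).
    ring [Hee]. }
  assert (HE' : forall xi, E' xi <= (9 * k * exp xi + 8 * k * exp (2 * xi)) * E xi).
  { intros xi. unfold E', E. set (e := exp xi). assert (He : 0 < e) by apply exp_pos.
    assert (He2 : exp (2 * xi) = e * e) by (unfold e; rewrite <- exp_plus; f_equal; ring).
    assert (Hem : exp (-2 * xi) = / e * / e)
      by (unfold e; rewrite <- !exp_Ropp, <- exp_plus; f_equal; ring).
    rewrite He2, Hem. set (z := / e * Z xi).
    assert (Hz : Z xi = e * z) by (unfold z; field; lra). rewrite Hz.
    set (d := D xi). set (d1 := D1 xi).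
    replace (/ e * / e * (e * z) ^ 2) with (z ^ 2) by (field; lra).
    set (X := d1 ^ 2 + m ^ 2 * d ^ 2 + z ^ 2).
    assert (Hd : d ^ 2 <= / m ^ 2 * X).
    { apply Rle_trans with (1 := HDk xi). fold d. apply Rmult_le_compat_l; [left; now apply Rinv_0_lt_compat|].
      unfold X. nra. }
    assert (HX : 0 <= X) by (unfold X; nra).
    assert (Hkx : X + / m ^ 2 * X = k * X) by (unfold k; ring).
    assert (Hmd : 0 <= m ^ 2 * d ^ 2) by (apply Rmult_le_pos; [lra|apply pow2_ge_0]).
    pose proof (pow2_ge_0 (d1 - z)) as S1. pose proof (pow2_ge_0 (d1 + d)) as S2. pose proof (pow2_ge_0 (z - d)) as S3.
    pose proof (pow2_ge_0 z) as S4. pose proof (pow2_ge_0 d1) as S5.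
    assert (HX1 : d1 ^ 2 <= X) by (unfold X; lra). assert (HX2 : z ^ 2 <= X) by (unfold X; lra).
    assert (H1 : 2 * d1 * (e * z) <= e * X).
    { apply Rle_trans with (e * (2 * d1 * z)); [right; ring|]. apply Rmult_le_compat_l; [lra|]. unfold X. lra. }
    assert (H2 : - 8 * (d1 * d) <= 4 * (k * X)) by (rewrite <- Hkx; lra).
    assert (H3 : 8 * (z * d) <= 4 * (k * X)) by (rewrite <- Hkx; lra).
    assert (H4 : X <= k * X) by nra.
    replace (2 * d1 * (e * z - 4 * (e * e) * d) - 2 * / e * / e * (e * z) ^ 2 + 8 * (e * z) * d)
      with (2 * d1 * (e * z) + (e * e) * (- 8 * (d1 * d)) - 2 * z ^ 2 + e * (8 * (z * d))) by (field; lra).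
    assert (H5 : (e * e) * (- 8 * (d1 * d)) <= (e * e) * (4 * (k * X))) by (apply Rmult_le_compat_l; nra).
    assert (H6 : e * (8 * (z * d)) <= e * (4 * (k * X))) by (apply Rmult_le_compat_l; lra).
    assert (0 <= k * X) by nra.
    assert (H7 : e * X <= e * (k * X)) by (apply Rmult_le_compat_l; lra).
    assert (0 <= e * (k * X)) by nra. assert (0 <= e * e * (k * X)) by nra.
    replace ((9 * k * e + 8 * k * (e * e)) * X) with (9 * (e * (k * X)) + 8 * (e * e * (k * X))) by ring.
    nra. }
  assert (Hmono : forall a b, a <= b -> G a <= G b).
  { intros a b Hab. apply (incr_of_derive G _ a b Hab (fun x _ => HG x)). intros x _.
    apply Rmult_le_pos; [|left; apply exp_pos]. specialize (HE' x). lra. }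
  assert (HE0 : forall xi, 0 <= E xi).
  { intros xi. unfold E. pose proof (exp_pos (-2 * xi)). pose proof (pow2_ge_0 (Z xi)).
    pose proof (pow2_ge_0 (D xi)). pose proof (pow2_ge_0 (D1 xi)). nra. }
  intros xi.
  enough (HE1 : forall eps, 0 < eps -> E xi * exp (- W xi) <= eps).
  { assert (HEx : E xi * exp (- W xi) <= 0) by (apply le_epsilon; intros eps He; specialize (HE1 eps He); lra).
    pose proof (exp_pos (- W xi)). assert (E xi <= 0) by nra.
    unfold E in H0. pose proof (exp_pos (-2 * xi)). pose proof (pow2_ge_0 (Z xi)).
    pose proof (pow2_ge_0 (D1 xi)). assert (m ^ 2 * D xi ^ 2 <= 0) by nra.
    assert (D xi ^ 2 <= 0) by (pose proof (pow2_ge_0 (D xi)); nra). nra. }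
  intros eps Heps.
  (* At the point y found below, m² E(y) <= (2m² + 16) eta, using eta² <= eta; the factor 100 (1 +
     m²) leaves room to spare. *)
  set (eta := Rmin 1 (eps * m ^ 2 / (100 * (1 + m ^ 2)))).
  assert (Heta : 0 < eta).
  { apply Rmin_pos; [lra|]. apply Rdiv_lt_0_compat; nra. }
  apply is_lim_spec in L1. apply is_lim_spec in LZ.
  destruct (L1 (mkposreal eta Heta)) as [M1 HM1]. destruct (LZ (mkposreal eta Heta)) as [M2 HM2].
  assert (Ls : is_lim (fun x => 4 * (C * exp (5/4 * x)) + (c * exp (1/4 * x)) ^ 2) m_infty 0).
  { replace (Finite 0) with (Finite (0 + 0 * 0)) by (f_equal; ring). apply is_lim_plus'.
    - apply (is_lim_m_exp _ 0 (5/4) (4 * C) 0); [lra|]. intros t _. pose proof (exp_pos (5/4 * t)).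
      rewrite Rminus_0_r, Rabs_pos_eq; nra.
    - apply (is_lim_ext (fun x => (c * exp (1/4 * x)) * (c * exp (1/4 * x)))); [intros; ring|].
      assert (is_lim (fun x => c * exp (1/4 * x)) m_infty 0).
      { apply (is_lim_m_exp _ 0 (1/4) c 0); [lra|]. intros t _. pose proof (exp_pos (1/4 * t)).
        rewrite Rminus_0_r, Rabs_pos_eq; unfold c; nra. }
      now apply is_lim_mult_R. }
  apply is_lim_spec in Ls. destruct (Ls (mkposreal eta Heta)) as [M3 HM3].
  simpl in HM1, HM2, HM3.
  set (x0 := Rmin (Rmin M (Rmin M1 M2)) (Rmin M3 (Rmin xi 0)) - 2).
  assert (Hx0 : x0 + 2 <= M /\ x0 + 2 <= M1 /\ x0 + 2 <= M2 /\ x0 + 2 <= M3 /\ x0 + 2 <= xi /\ x0 + 2 <= 0).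
  { unfold x0.
    pose proof (Rmin_l (Rmin M (Rmin M1 M2)) (Rmin M3 (Rmin xi 0))).
    pose proof (Rmin_r (Rmin M (Rmin M1 M2)) (Rmin M3 (Rmin xi 0))).
    pose proof (Rmin_l M (Rmin M1 M2)). pose proof (Rmin_r M (Rmin M1 M2)).
    pose proof (Rmin_l M1 M2). pose proof (Rmin_r M1 M2).
    pose proof (Rmin_l M3 (Rmin xi 0)). pose proof (Rmin_r M3 (Rmin xi 0)).
    pose proof (Rmin_l xi 0). pose proof (Rmin_r xi 0). repeat split; lra. }
  destruct Hx0 as [X1 [X2 [X3 [X4 [X5 X6]]]]].
  (* No limit of D is given. The mean value theorem for D1 over a unit interval supplies a point y
     at which D1' is small, and there the equation for D1' makes m² D(y) small. *)
  destruct (MVT_cor4 D1 (fun x => Z x - (m ^ 2 + 4 * exp (2 * x)) * D x) x0 1 (fun c _ => HD1 c) (x0 + 1))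
    as [y [Hy Hy']].
  { replace (x0 + 1 - x0) with 1 by ring. rewrite Rabs_R1. lra. }
  replace (x0 + 1 - x0) with 1 in * by ring. rewrite Rabs_R1 in Hy'. apply Rabs_le_between in Hy'.
  pose proof (HM1 (x0 + 1) ltac:(lra)) as A1. pose proof (HM1 x0 ltac:(lra)) as A2.
  pose proof (HM1 y ltac:(lra)) as A3. pose proof (HM2 y ltac:(lra)) as A4.
  pose proof (HM3 y ltac:(lra)) as A5. rewrite Rminus_0_r in A1, A2, A3, A4, A5.
  apply Rabs_def2 in A1. apply Rabs_def2 in A2. apply Rabs_def2 in A3. apply Rabs_def2 in A4. apply Rabs_def2 in A5.
  pose proof (HC y ltac:(lra)) as A6. pose proof (HZb y ltac:(lra)) as A7.
  assert (A8 : Rabs (4 * exp (2 * y) * D y) <= 4 * (C * exp (5/4 * y))).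
  { rewrite Rabs_mult, Rabs_pos_eq by (pose proof (exp_pos (2 * y)); lra).
    replace (exp (5/4 * y)) with (exp (2 * y) * exp (- (3/4) * y)) by (rewrite <- exp_plus; f_equal; field).
    pose proof (exp_pos (2 * y)). nra. }
  apply Rabs_le_between in A8.
  assert (A9 : 0 <= (c * exp (1/4 * y)) ^ 2) by apply pow2_ge_0.
  assert (A10 : Rabs (m ^ 2 * D y) <= 4 * eta) by (apply Rabs_le; lra).
  assert (A11 : exp (-2 * y) * Z y ^ 2 <= (c * exp (1/4 * y)) ^ 2).
  { replace ((c * exp (1 / 4 * y)) ^ 2) with (exp (-2 * y) * (c * exp (5/4 * y)) ^ 2).
    - apply Rmult_le_compat_l; [left; apply exp_pos|]. rewrite <- (pow2_abs (Z y)).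
      pose proof (Rabs_pos (Z y)). nra.
    - replace ((c * exp (5 / 4 * y)) ^ 2) with (c ^ 2 * (exp (5/4 * y) * exp (5/4 * y))) by ring.
      replace ((c * exp (1 / 4 * y)) ^ 2) with (c ^ 2 * (exp (1/4 * y) * exp (1/4 * y))) by ring.
      rewrite <- !exp_plus.
      replace (exp (-2 * y) * (c ^ 2 * exp (5 / 4 * y + 5 / 4 * y))) with (c ^ 2 * (exp (-2 * y) * exp (5 / 4 * y + 5 / 4 * y))) by ring.
      rewrite <- exp_plus. do 2 f_equal. field. }
  assert (A12 : 0 <= 4 * (C * exp (5/4 * y))) by (pose proof (exp_pos (5/4 * y)); nra).
  assert (He1 : eta <= 1) by apply Rmin_l.
  assert (He2 : eta * (100 * (1 + m ^ 2)) <= eps * m ^ 2).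
  { pose proof (Rmin_r 1 (eps * m ^ 2 / (100 * (1 + m ^ 2)))) as H. fold eta in H.
    apply (Rmult_le_compat_r (100 * (1 + m ^ 2))) in H; [|nra].
    replace (eps * m ^ 2 / (100 * (1 + m ^ 2)) * (100 * (1 + m ^ 2))) with (eps * m ^ 2) in H by (field; nra). exact H. }
  assert (HEy : E y <= eps).
  { apply (Rmult_le_reg_l (m ^ 2)); [assumption|]. unfold E.
    assert (B1 : D1 y ^ 2 <= eta) by nra.
    assert (B2 : m ^ 2 * (m ^ 2 * D y ^ 2) <= 16 * eta).
    { replace (m ^ 2 * (m ^ 2 * D y ^ 2)) with ((m ^ 2 * D y) ^ 2) by ring. rewrite <- pow2_abs.
      pose proof (Rabs_pos (m ^ 2 * D y)). nra. }
    assert (B3 : exp (-2 * y) * Z y ^ 2 <= eta) by lra.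
    nra. }
  specialize (Hmono y xi ltac:(lra)). unfold G in Hmono.
  assert (HWy : exp (- W y) <= 1).
  { rewrite <- exp_0. apply exp_le. unfold W. pose proof (exp_pos y). pose proof (exp_pos (2 * y)).
    assert (0 <= k * exp y) by nra. assert (0 <= k * exp (2 * y)) by nra. lra. }
  pose proof (HE0 y). pose proof (exp_pos (- W y)). nra.
Qed.

Lemma nicholson (mu : R) (rho : C) (xi : R) : 0 < mu -> clim (gauss mu) rho ->
  bessN mu xi = 8 / PI ^ 2 * nich (2 * mu) xi.
Proof.
  intros Hmu H. pose proof PI_RGT_0 as HPI. set (m := 2 * mu). assert (Hm : 0 < m) by (unfold m; lra).
  set (c := PI ^ 2 / 8). assert (Hc : 0 < c) by (unfold c; apply Rdiv_lt_0_compat; nra).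
  assert (Hs : 0 < sinh (PI * mu)) by (apply sinh_pos; nra).
  enough (E : nich m xi - c * bessN mu xi = 0).
  { replace (nich m xi) with (c * bessN mu xi) by lra. unfold c. field. lra. }
  pose proof (fun x => nich_ode m x Hm) as O1. pose proof (fun x => is_derive_bessN mu rho x Hmu H) as O2.
  destruct (bessN_lims mu rho Hmu H) as [L1 [L2 [M [C0 L3]]]].
  apply (product_ode_unique m (fun x => nich m x - c * bessN mu x) (fun x => nich1 m x - c * bessN1 mu x)
    (fun x => nichZ m x - c * bessZ mu x)); [assumption| | | | | |].
  - intros x. destruct (O1 x) as [E1 _]. destruct (O2 x) as [F1 _].
    exact (is_derive_minus _ _ _ _ _ E1 (is_derive_scal _ _ c _ F1)).
  - intros x. destruct (O1 x) as [_ [E2 _]]. destruct (O2 x) as [_ [F2 _]].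
    evar_last; [exact (is_derive_minus _ _ _ _ _ E2 (is_derive_scal _ _ c _ F2))|].
    unfold minus, plus, opp; simpl. unfold m. ring.
  - intros x. destruct (O1 x) as [_ [_ E3]]. destruct (O2 x) as [_ [_ F3]].
    evar_last; [exact (is_derive_minus _ _ _ _ _ E3 (is_derive_scal _ _ c _ F3))|].
    unfold minus, plus, opp; simpl. ring.
  - (* the oscillating parts agree because [mom mu 0 * rho^2 = 1] *)
    pose proof (nich1_lim m Hm) as L4.
    assert (Hm0 : forall (k : R) f, is_lim f m_infty 0 -> is_lim (fun x => k * f x) m_infty 0).
    { intros k f Hf. apply (is_lim_bounded_mult f (fun _ => k) (Rabs k)); [intros; apply Rle_refl|assumption]. }
    pose proof (is_lim_0_plus _ _ _ L4 (Hm0 (- c) _ L1)) as L5.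
    eapply is_lim_ext; [|exact L5]. intros x. cbv beta.
    enough (Ek : / m * (smom m 0 * cos (m * (ln 2 - x)) + cmom m 0 * sin (m * (ln 2 - x))) =
       - c * (8 * mu / sinh (PI * mu) ^ 2 * (leadRe mu rho x * leadIm mu rho x))) by lra.
    pose proof (gauss_moment mu rho H) as Hmom. pose proof (Cmod_gauss_lim mu rho Hmu H) as Hr.
    unfold mom in Hmom. fold m in Hmom. destruct rho as [r1 r2]. unfold Re, Im in Hr; cbn [fst snd] in Hr.
    pose proof (f_equal fst Hmom) as E1. pose proof (f_equal snd Hmom) as E2.
    unfold Cmult, RtoC in E1, E2; cbn [fst snd] in E1, E2.
    set (R0 := sinh (PI * mu) / (PI * mu)) in *.
    assert (HR0 : 0 < R0) by (apply Rdiv_lt_0_compat; nra).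
    (* The moment is 1/ρ², the conjugate of ρ² divided by |ρ|⁴, with |ρ|² = R0. *)
    assert (Ec : cmom m 0 = (r1 * r1 - r2 * r2) / R0 ^ 2).
    { apply (Rmult_eq_reg_r (R0 ^ 2)); [|nra]. unfold Rdiv. rewrite Rmult_assoc, Rinv_l, Rmult_1_r by nra.
      rewrite <- Hr.
      transitivity ((cmom m 0 * (r1 * r1 - r2 * r2) - smom m 0 * (r1 * r2 + r2 * r1)) * (r1 * r1 - r2 * r2)
         + (cmom m 0 * (r1 * r2 + r2 * r1) + smom m 0 * (r1 * r1 - r2 * r2)) * (2 * r1 * r2)); [ring|].
      rewrite E1, E2. ring. }
    assert (Es : smom m 0 = - (2 * r1 * r2) / R0 ^ 2).
    { apply (Rmult_eq_reg_r (R0 ^ 2)); [|nra]. unfold Rdiv. rewrite (Rmult_assoc _ (/ R0 ^ 2)), Rinv_l, Rmult_1_r by nra.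
      rewrite <- Hr.
      transitivity ((cmom m 0 * (r1 * r2 + r2 * r1) + smom m 0 * (r1 * r1 - r2 * r2)) * (r1 * r1 - r2 * r2)
         - (cmom m 0 * (r1 * r1 - r2 * r2) - smom m 0 * (r1 * r2 + r2 * r1)) * (2 * r1 * r2)); [ring|].
      rewrite E1, E2. ring. }
    rewrite Ec, Es. unfold leadRe, leadIm, Re, Im; cbn [fst snd].
    replace (m * (ln 2 - x)) with (- (2 * phase mu x)) by (unfold phase, m; ring).
    rewrite cos_neg, sin_neg, sin_2a, cos_2a. unfold R0, c, m.
    set (ct := cos (phase mu x)). set (st := sin (phase mu x)). field. repeat split; lra.
  (* Both limits of Z are πμ coth(πμ): one by the value of [beta] at m = 2μ, the other by the
     reflection formula. *)
  - replace (Finite 0) with (Finite (m * beta m - c * (8 * mu * cosh (PI * mu) / (PI * sinh (PI * mu))))).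
    + apply is_lim_minus'; [now apply nichZ_lim|]. apply (is_lim_scal_l _ c m_infty (Finite _) L2).
    + f_equal. rewrite (beta_eq m Hm). replace (PI * m / 2) with (PI * mu) by (unfold m; field).
      unfold c, m. field. lra.
  - destruct (nich_bound m) as [C1 HC1]. exists (Rmin M 0), (C1 + c * C0). intros x Hx.
    pose proof (L3 x (Rlt_le_trans _ _ _ Hx (Rmin_l _ _))) as B1. specialize (HC1 x).
    pose proof (Rlt_le_trans _ _ _ Hx (Rmin_r _ _)) as Hx0.
    pose proof (exp_le 0 (- (3/4) * x) ltac:(lra)) as He. rewrite exp_0 in He.
    unfold Rminus. apply Rle_trans with (1 := Rabs_triang _ _). rewrite Rabs_Ropp, Rabs_mult, (Rabs_pos_eq c) by lra.
    pose proof (Rabs_pos (bessN mu x)).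
    assert (c * Rabs (bessN mu x) <= c * C0) by (apply Rmult_le_compat_l; lra).
    assert (0 <= c * C0) by (apply Rmult_le_pos; lra). nra.
Qed.

(** * Integrals of J_0 against Nicholson's integral *)

Definition e0 (k : nat) : R := (-1) ^ k / INR (fact k) ^ 2.

Lemma e0_entire : entire e0.
Proof.
  exists 1. intros k. unfold e0, Rdiv. rewrite Rabs_mult, pow_1_abs, Rmult_1_l, Rabs_inv.
  pose proof (INR_fact_lt_0 k) as Hf. assert (1 <= INR (fact k)).
  { pose proof (lt_O_fact k). apply (le_INR 1). lia. }
  rewrite Rabs_pos_eq, Rmult_1_l by (apply pow_le; lra). apply Rinv_le_contravar; [assumption|nra].
Qed.

Lemma e0_rec (k : nat) : INR (S k) ^ 2 * e0 (S k) - 0 * (INR (S k) * e0 (S k)) = - e0 k.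
Proof.
  unfold e0. rewrite fact_simpl, mult_INR, <- (tech_pow_Rmult (-1) k).
  pose proof (INR_fact_neq_0 k). pose proof (not_0_INR (S k) ltac:(lia)). field. split; assumption.
Qed.

Lemma J0_PSeries (y : R) : J0 y = PSeries e0 ((y / 2) ^ 2).
Proof.
  unfold J0, PSeries. apply Series_ext. intros k. unfold e0. rewrite <- pow_mult. unfold Rdiv. ring.
Qed.

Definition jj (eta : R) : R := PSeries e0 (exp (2 * eta) / 4).
Definition jj1 (eta : R) : R := 2 * (exp (2 * eta) / 4) * PSeries (PS_derive e0) (exp (2 * eta) / 4).

Lemma J0_exp (eta : R) : J0 (exp eta) = jj eta.
Proof.
  rewrite J0_PSeries. unfold jj. f_equal. replace (2 * eta) with (eta + eta) by ring. rewrite exp_plus. field.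
Qed.

Lemma is_derive_jj (eta : R) : is_derive jj eta (jj1 eta).
Proof.
  unfold jj, jj1. pose proof (is_derive_entire e0 (exp (2 * eta) * / 4) e0_entire) as H.
  unfold Rdiv. auto_derive; [eexists; exact H|]. rewrite (Derive_eta _ _ _ H). ring.
Qed.

Lemma is_derive_jj1 (eta : R) : is_derive jj1 eta (- exp (2 * eta) * jj eta).
Proof.
  pose proof (entire_ode e0 e0 0 (exp (2 * eta) * / 4) e0_entire e0_entire e0_rec) as Ho.
  rewrite Rmult_0_l, Rminus_0_r in Ho.
  unfold jj, jj1. pose proof (is_derive_entire2 e0 (exp (2 * eta) * / 4) e0_entire) as H.
  unfold Rdiv. auto_derive; [eexists; exact H|]. rewrite (Derive_eta _ _ _ H).
  apply (f_equal (fun z => exp (2 * eta) * z)) in Ho.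
  set (P0 := PSeries e0 (exp (2 * eta) * / 4)) in *. set (P1 := PSeries (PS_derive e0) (exp (2 * eta) * / 4)) in *.
  set (P2 := PSeries (PS_derive (PS_derive e0)) (exp (2 * eta) * / 4)) in *. set (E := exp (2 * eta)) in *.
  replace (- E * P0) with (E * - P0) by ring. rewrite <- Ho. field.
Qed.

Lemma jj_lim_m : is_lim jj m_infty 1.
Proof.
  pose proof (entire_lim e0 e0_entire) as H. replace (e0 0) with 1 in H by (unfold e0; simpl; field). exact H.
Qed.

Lemma jj1_small : exists M C, forall eta, eta < M -> Rabs (jj1 eta) <= C * exp (2 * eta).
Proof.
  assert (H : is_lim (fun eta => PSeries (PS_derive e0) (exp (2 * eta) / 4)) m_infty (PSeries (PS_derive e0) 0)).
  { apply (is_lim_comp_continuous (fun xi => exp (2 * xi) / 4) (PSeries (PS_derive e0))).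
    + apply (is_lim_m_exp _ 0 2 (1/4) 0); [lra|]. intros t _. rewrite Rminus_0_r, Rabs_pos_eq.
      * lra.
      * pose proof (exp_pos (2 * t)). lra.
    + apply (derive_continuous _ _ _ (is_derive_entire2 e0 0 e0_entire)). }
  apply is_lim_spec in H. destruct (H (mkposreal 1 Rlt_0_1)) as [M HM]. simpl in HM.
  exists M, (Rabs (PSeries (PS_derive e0) 0) + 1). intros eta Heta. specialize (HM eta Heta).
  unfold jj1. set (p := PSeries (PS_derive e0) (exp (2 * eta) / 4)) in *. set (p0 := PSeries (PS_derive e0) 0) in *.
  assert (Hp : Rabs p <= Rabs p0 + 1).
  { replace p with ((p - p0) + p0) by ring. apply Rle_trans with (1 := Rabs_triang _ _). lra. }
  pose proof (exp_pos (2 * eta)). rewrite Rabs_mult, Rabs_pos_eq by lra. pose proof (Rabs_pos p). nra.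
Qed.

(** Energy estimate: [V = (e^{2η} j^2 + j'^2 + j j') e^{-η}] satisfies [V' = - j j' e^{-η} <= e^{-η} V]. *)
Lemma jj_large : exists C, forall eta, 0 <= eta -> Rabs (jj eta) <= C /\ Rabs (jj1 eta) <= C * exp (eta / 2).
Proof.
  set (V := fun x => (exp (2 * x) * jj x ^ 2 + jj1 x ^ 2 + jj x * jj1 x) * exp (- x)).
  (* The factor exp(e^{-x}) integrates the rate e^{-x}; it decreases from e to 1 on the half-line,
     whence the factor 3 below. *)
  set (G := fun x => - (V x * exp (exp (- x)))).
  assert (HG : forall x, is_derive G x ((jj x * jj1 x + (exp (2 * x) * jj x ^ 2 + jj1 x ^ 2 + jj x * jj1 x) * exp (- x))
      * exp (- x) * exp (exp (- x)))).
  { intros x. unfold G, V. pose proof (is_derive_jj x) as H1. pose proof (is_derive_jj1 x) as H2.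
    auto_derive; [repeat split; eexists; eassumption|].
    rewrite (Derive_eta _ _ _ H1), (Derive_eta _ _ _ H2). ring. }
  assert (Hkey : forall x, 0 <= x -> Rabs (jj x * jj1 x) <= exp (- x) * (exp (2 * x) * jj x ^ 2 + jj1 x ^ 2) / 2 /\
     exp (- x) <= 1).
  { intros x Hx. pose proof (exp_pos x) as He. pose proof (exp_pos (- x)) as Hem.
    assert (Hee : exp x * exp (- x) = 1) by (rewrite <- exp_plus, Rplus_opp_r; apply exp_0).
    assert (He2 : exp (2 * x) = exp x * exp x) by (rewrite <- exp_plus; f_equal; ring).
    split; [|rewrite <- exp_0; apply exp_le; lra].
    replace (exp (- x) * (exp (2 * x) * jj x ^ 2 + jj1 x ^ 2) / 2)
      with (exp (- x) * ((exp x * jj x) ^ 2 + jj1 x ^ 2) / 2) by (rewrite He2; field).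
    replace (jj x * jj1 x) with (exp (- x) * ((exp x * jj x) * jj1 x))
      by (transitivity ((exp x * exp (- x)) * (jj x * jj1 x)); [ring|rewrite Hee; ring]).
    set (a := exp x * jj x). set (b := jj1 x). rewrite Rabs_mult, (Rabs_pos_eq (exp (- x))) by lra.
    unfold Rdiv. rewrite Rmult_assoc. apply Rmult_le_compat_l; [lra|]. apply Rabs_le.
    pose proof (pow2_ge_0 (a + b)). pose proof (pow2_ge_0 (a - b)). split; lra. }
  assert (HV : forall x, 0 <= x -> (exp (2 * x) * jj x ^ 2 + jj1 x ^ 2) * exp (- x) <= 2 * V x).
  { intros x Hx. destruct (Hkey x Hx) as [H1 H2]. apply Rabs_le_between in H1. unfold V.
    pose proof (exp_pos (- x)). pose proof (exp_pos (2 * x)). pose proof (pow2_ge_0 (jj x)). pose proof (pow2_ge_0 (jj1 x)).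
    set (S := exp (2 * x) * jj x ^ 2 + jj1 x ^ 2) in *. assert (0 <= S) by (unfold S; nra).
    replace (2 * ((S + jj x * jj1 x) * exp (- x))) with ((2 * (S + jj x * jj1 x)) * exp (- x)) by ring.
    apply Rmult_le_compat_r; [lra|]. nra. }
  assert (Hmono : forall x, 0 <= x -> V x <= 3 * V 0).
  { intros x Hx.
    assert (Hm : G 0 <= G x).
    { apply (incr_of_derive G _ 0 x Hx (fun y _ => HG y)). intros y [Hy _].
      destruct (Hkey y Hy) as [H1 H2]. specialize (HV y Hy). unfold V in HV.
      pose proof (exp_pos (- y)). apply Rmult_le_pos; [apply Rmult_le_pos|]; [|lra|left; apply exp_pos].
      apply Rabs_le_between in H1. lra. }
    unfold G in Hm. rewrite Ropp_0, exp_0 in Hm.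
    pose proof (exp_ge_1_plus (exp (- x))). pose proof (exp_pos (- x)). pose proof exp_le_3.
    assert (0 <= V x).
    { specialize (HV x Hx). apply Rmult_le_reg_l with 2; [lra|]. rewrite Rmult_0_r. apply Rle_trans with (2 := HV).
      pose proof (exp_pos (2 * x)). pose proof (pow2_ge_0 (jj x)). pose proof (pow2_ge_0 (jj1 x)).
      apply Rmult_le_pos; nra. }
    assert (0 <= V 0).
    { specialize (HV 0 (Rle_refl 0)). apply Rmult_le_reg_l with 2; [lra|]. rewrite Rmult_0_r. apply Rle_trans with (2 := HV).
      pose proof (exp_pos (2 * 0)). pose proof (exp_pos (- 0)). pose proof (pow2_ge_0 (jj 0)). pose proof (pow2_ge_0 (jj1 0)).
      apply Rmult_le_pos; nra. }
    nra. }
  exists (sqrt (6 * V 0)). intros x Hx. specialize (HV x Hx). specialize (Hmono x Hx).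
  pose proof (exp_pos x) as He. pose proof (exp_pos (- x)) as Hem.
  assert (Hee : exp x * exp (- x) = 1) by (rewrite <- exp_plus, Rplus_opp_r; apply exp_0).
  assert (He2 : exp (2 * x) = exp x * exp x) by (rewrite <- exp_plus; f_equal; ring).
  assert (He1 : 1 <= exp x) by (rewrite <- exp_0; apply exp_le; assumption).
  assert (Hb : exp x * jj x ^ 2 + jj1 x ^ 2 * exp (- x) <= 6 * V 0).
  { replace (exp x * jj x ^ 2 + jj1 x ^ 2 * exp (- x)) with ((exp (2 * x) * jj x ^ 2 + jj1 x ^ 2) * exp (- x)).
    - lra.
    - rewrite He2. transitivity ((exp x * exp (- x)) * exp x * jj x ^ 2 + jj1 x ^ 2 * exp (- x)); [ring|rewrite Hee; ring]. }
  pose proof (pow2_ge_0 (jj x)). pose proof (pow2_ge_0 (jj1 x)).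
  assert (0 <= jj1 x ^ 2 * exp (- x)) by (apply Rmult_le_pos; lra).
  assert (0 <= exp x * jj x ^ 2) by (apply Rmult_le_pos; lra). split.
  - rewrite <- sqrt_Rsqr_abs. apply sqrt_le_1_alt. unfold Rsqr. nra.
  - replace (exp (x / 2)) with (sqrt (exp x)).
    + rewrite <- sqrt_mult_alt by lra. rewrite <- sqrt_Rsqr_abs. apply sqrt_le_1_alt. unfold Rsqr.
      replace (jj1 x * jj1 x) with (jj1 x ^ 2 * exp (- x) * exp x)
        by (transitivity (jj1 x ^ 2 * (exp x * exp (- x))); [ring|rewrite Hee; ring]).
      apply Rmult_le_compat_r; nra.
    + rewrite <- (sqrt_pow2 (exp (x / 2))) by (left; apply exp_pos). f_equal.
      replace (exp (x / 2) ^ 2) with (exp (x / 2) * exp (x / 2)) by ring. rewrite <- exp_plus. f_equal. field.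
Qed.

(** The factor 1/(4(s² + w²)), w = e^t, is the value of the integral of x J_0(2sx) K_0(2wx) over x >
    0. *)
Definition wsym (s : R) (g : R -> R) (t : R) : R := g t / (4 * (s ^ 2 + exp (2 * t))).

Lemma wsym_sym (D s : R) (g : R -> R) : 1 <= s -> sym D g -> sym D (wsym s g) /\
  exists E, forall t, Rabs (wsym s g t) <= E * exp (- t).
Proof.
  intros Hs Hg. pose proof (sym_const_pos _ _ Hg) as HD. destruct Hg as [Hc Hb].
  assert (Hp : forall t, 1 <= 4 * (s ^ 2 + exp (2 * t)) /\ exp t <= 4 * (s ^ 2 + exp (2 * t))).
  { intros t. pose proof (exp_pos t). replace (exp (2 * t)) with (exp t * exp t) by (rewrite <- exp_plus; f_equal; ring).
    pose proof (pow2_ge_0 (exp t - 1)). assert (1 <= s ^ 2) by nra. split; nra. }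
  assert (Hq : forall t, Rabs (wsym s g t) = Rabs (g t) * / (4 * (s ^ 2 + exp (2 * t)))).
  { intros t. unfold wsym, Rdiv. rewrite Rabs_mult. f_equal. apply Rabs_pos_eq. left. apply Rinv_0_lt_compat.
    specialize (Hp t). lra. }
  split; [split|].
  - intros t. apply (@continuous_mult R_UniformSpace R_AbsRing); [apply Hc|].
    apply continuous_Rinv_comp; [|specialize (Hp t); lra].
    apply ex_derive_continuous_R. auto_derive. exact I.
  - intros t. rewrite Hq. specialize (Hp t). apply Rle_trans with (2 := Hb t).
    assert (/ (4 * (s ^ 2 + exp (2 * t))) <= 1) by (rewrite <- Rinv_1; apply Rinv_le_contravar; lra).
    pose proof (Rabs_pos (g t)). nra.
  - exists D. intros t. rewrite Hq. specialize (Hp t). specialize (Hb t). pose proof (Rmin_1_exp t). pose proof (exp_pos t).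
    rewrite exp_Ropp. apply Rmult_le_compat; [apply Rabs_pos| | |].
    + left; apply Rinv_0_lt_compat; lra.
    + apply Rle_trans with (1 := Hb). nra.
    + apply Rinv_le_contravar; lra.
Qed.

(** Closed form of [∫_0^{e^ξ} x J_0(2xs) (conv K g)(ln x) dx], from the Wronskian identity
    [(j k' - j' k)' = 4 (s^2 + w^2) e^{2ξ} j k] for [j = J_0(2 s e^ξ)] and [k = K_0(2 w e^ξ)]. *)
Definition JKint (s : R) (g : R -> R) (xi : R) : R :=
  IR (wsym s g) - jj (xi + ln (2 * s)) * conv kap (wsym s g) xi
    - jj1 (xi + ln (2 * s)) * conv K (wsym s g) xi.

Lemma is_derive_JKint (D s xi : R) (g : R -> R) : 1 <= s -> sym D g ->
  is_derive (JKint s g) xi (exp (2 * xi) * jj (xi + ln (2 * s)) * conv K g xi).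
Proof.
  intros Hs Hg. destruct (wsym_sym D s g Hs Hg) as [Sw _].
  destruct (rapid_ker _ rapid_K) as [CK HK]. destruct (rapid_ker _ rapid_kap) as [Ck Hk].
  destruct (rapid_ker _ rapid_k2) as [C2 H2]. destruct (rapid_ker _ rapid_k2_deriv) as [C3 H3].
  assert (Dk2 : forall t, is_derive (fun t => - kap t) t (k2 t)).
  { intros t. rewrite <- (Ropp_involutive (k2 t)). apply (is_derive_opp kap), is_derive_kap. }
  assert (Dmk2 : forall t, is_derive (fun t => - k2 t) t (- (2 * k2 t - 4 * exp (2 * t) * kap t))).
  { intros t. apply (is_derive_opp k2), is_derive_k2. }
  set (h := wsym s g) in *.
  assert (A1 : is_derive (conv K h) xi (- conv kap h xi)).
  { rewrite <- (conv_opp kap h xi Ck D Hk Sw).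
    exact (conv_derive CK Ck C2 D K (fun t => - kap t) k2 h xi HK (ker_opp _ _ Hk) H2 Sw is_derive_K Dk2). }
  assert (A2 : is_derive (conv kap h) xi (- conv k2 h xi)).
  { rewrite <- (conv_opp k2 h xi C2 D H2 Sw).
    exact (conv_derive Ck C2 C3 D kap (fun t => - k2 t) _ h xi Hk (ker_opp _ _ H2) H3 Sw is_derive_kap Dmk2). }
  pose proof (is_derive_jj (xi + ln (2 * s))) as B1. pose proof (is_derive_jj1 (xi + ln (2 * s))) as B2.
  assert (Hgen : forall (f1 f2 : R -> R) l1 l2, is_derive f1 xi l1 -> is_derive f2 xi l2 -> forall c,
    is_derive (fun xi => c - jj (xi + ln (2 * s)) * f1 xi - jj1 (xi + ln (2 * s)) * f2 xi) xi
     (- jj1 (xi + ln (2 * s)) * f1 xi - jj (xi + ln (2 * s)) * l1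
      + exp (2 * (xi + ln (2 * s))) * jj (xi + ln (2 * s)) * f2 xi - jj1 (xi + ln (2 * s)) * l2)).
  { intros f1 f2 l1 l2 F1 F2 c. auto_derive; [repeat split; eexists; eassumption|].
    rewrite (Derive_eta _ _ _ F1), (Derive_eta _ _ _ F2), (Derive_eta _ _ _ B1), (Derive_eta _ _ _ B2). ring. }
  unfold JKint. fold h. evar_last; [exact (Hgen _ _ _ _ A2 A1 (IR h))|].
  (* Under the integral [k2] at ξ + t is 4 e^{2ξ} e^{2t} K, so the sum of both terms restores the
     divisor 4(s² + e^{2t}) of [wsym]. *)
  assert (E : conv k2 h xi + 4 * s ^ 2 * exp (2 * xi) * conv K h xi = exp (2 * xi) * conv K g xi).
  { unfold conv.
    rewrite <- (IR_scal (4 * s ^ 2 * exp (2 * xi)) _ (conv_tame' CK D K h xi HK Sw)).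
    rewrite <- (IR_scal (exp (2 * xi)) _ (conv_tame' CK D K g xi HK Hg)).
    rewrite <- (IR_plus _ _ (conv_tame' C2 D k2 h xi H2 Sw) (tame_scal _ _ (conv_tame' CK D K h xi HK Sw))).
    apply IR_ext. intros t. unfold h, wsym, k2. rewrite Rmult_plus_distr_l, exp_plus.
    pose proof (exp_pos (2 * t)). field. nra. }
  replace (exp (2 * (xi + ln (2 * s)))) with (4 * s ^ 2 * exp (2 * xi)).
  - transitivity (jj (xi + ln (2 * s)) * (conv k2 h xi + 4 * s ^ 2 * exp (2 * xi) * conv K h xi)); [ring|].
    rewrite E. ring.
  - replace (2 * (xi + ln (2 * s))) with (2 * xi + (ln (2 * s) + ln (2 * s))) by ring.
    rewrite !exp_plus, exp_ln by lra. ring.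
Qed.

Lemma is_lim_shift_m (f : R -> R) (c : R) (l : Rbar) : is_lim f m_infty l -> is_lim (fun x => f (x + c)) m_infty l.
Proof.
  intros H. apply (is_lim_comp f (fun x => x + c) m_infty l m_infty H).
  - apply is_lim_spec. intros M. exists (M - c). intros x Hx. lra.
  - exists 0. intros; discriminate.
Qed.

(** The constant [IR (wsym s g)] in [JKint] is fixed by this limit: J_0 and [kap] both tend to 1, so
    the second term approaches it, while the third is O(e^{2ξ} e^{-3ξ/4}). *)
Lemma JKint_lim_m (D s : R) (g : R -> R) : 1 <= s -> sym D g -> is_lim (JKint s g) m_infty 0.
Proof.
  intros Hs Hg. destruct (wsym_sym D s g Hs Hg) as [Sw Ew]. destruct (rapid_ker _ rapid_K) as [CK HK].
  unfold JKint. set (h := wsym s g) in *.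
  replace (Finite 0) with (Finite (IR h - 1 * IR h - 0)) by (f_equal; ring).
  apply is_lim_minus'; [apply is_lim_minus'; [apply is_lim_const|]|].
  - apply is_lim_mult_R; [apply (is_lim_shift_m jj), jj_lim_m|]. now apply (kap_conv_lim D).
  - destruct jj1_small as [M [C HC]]. set (c := ln (2 * s)).
    assert (HCp : 0 <= C).
    { specialize (HC (M - 1) ltac:(lra)). pose proof (Rabs_pos (jj1 (M - 1))). pose proof (exp_pos (2 * (M - 1))). nra. }
    apply (is_lim_m_exp _ 0 (5/4) (C * exp (2 * c) * (8 * CK * D)) (M - c)); [lra|].
    intros xi Hxi. rewrite Rminus_0_r, Rabs_mult.
    apply Rle_trans with ((C * exp (2 * (xi + c))) * (8 * CK * D * exp (- (3/4) * xi))).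
    + apply Rmult_le_compat; auto using Rabs_pos.
      * apply HC. lra.
      * exact (conv_bound CK D K h xi HK Sw).
    + rewrite Rmult_plus_distr_l, exp_plus. right.
      replace (exp (5/4 * xi)) with (exp (2 * xi) * exp (- (3/4) * xi)) by (rewrite <- exp_plus; f_equal; field). ring.
Qed.

(** The decay e^{-3ξ/4} of a convolution beats the growth e^{ξ/2} of [jj1] and leaves e^{-ξ/4}. The
    bound is uniform in s because s enters only through the shift ln(2s) and through [wsym], which
    keeps the constant D. *)
Lemma JKint_lim_p (D S : R) (g : R -> R) : sym D g -> exists B, forall s xi, 1 <= s <= S -> 0 <= xi ->
  Rabs (JKint s g xi - IR (wsym s g)) <= B * exp (- (1/4) * xi).
Proof.
  intros Hg. destruct (rapid_ker _ rapid_K) as [CK HK]. destruct (rapid_ker _ rapid_kap) as [Ck Hk].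
  destruct jj_large as [C HC].
  pose proof (ker_const_pos _ _ HK) as HCK. pose proof (ker_const_pos _ _ Hk) as HCk. pose proof (sym_const_pos _ _ Hg) as HD.
  assert (HCp : 0 <= C) by (destruct (HC 0 (Rle_refl 0)) as [H _]; pose proof (Rabs_pos (jj 0)); lra).
  exists (C * (8 * Ck * D) + C * exp (ln (2 * S) / 2) * (8 * CK * D)). intros s xi Hs Hxi.
  destruct (wsym_sym D s g (proj1 Hs) Hg) as [Sw _]. unfold JKint. set (h := wsym s g) in *.
  set (c := ln (2 * s)).
  assert (Hc0 : 0 <= c) by (unfold c; rewrite <- ln_1; apply ln_le; lra).
  assert (HcS : c <= ln (2 * S)) by (unfold c; apply ln_le; lra).
  replace (IR h - jj (xi + c) * conv kap h xi - jj1 (xi + c) * conv K h xi - IR h)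
    with (- (jj (xi + c) * conv kap h xi) + - (jj1 (xi + c) * conv K h xi)) by ring.
  apply Rle_trans with (1 := Rabs_triang _ _). rewrite !Rabs_Ropp, !Rabs_mult.
  destruct (HC (xi + c) ltac:(lra)) as [J1 J2].
  pose proof (conv_bound Ck D kap h xi Hk Sw) as B1. pose proof (conv_bound CK D K h xi HK Sw) as B2.
  rewrite Rmult_plus_distr_r. apply Rplus_le_compat.
  - rewrite (Rmult_assoc C). apply Rmult_le_compat; auto using Rabs_pos.
    apply Rle_trans with (1 := B1). apply Rmult_le_compat_l; [nra|]. apply exp_le. lra.
  - apply Rle_trans with ((C * exp ((xi + c) / 2)) * (8 * CK * D * exp (- (3/4) * xi))).
    + apply Rmult_le_compat; auto using Rabs_pos.
    + replace (C * exp ((xi + c) / 2) * (8 * CK * D * exp (- (3 / 4) * xi)))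
        with ((C * (8 * CK * D)) * (exp ((xi + c) / 2) * exp (- (3/4) * xi))) by ring.
      replace (C * exp (ln (2 * S) / 2) * (8 * CK * D) * exp (- (1 / 4) * xi))
        with ((C * (8 * CK * D)) * (exp (ln (2 * S) / 2) * exp (- (1/4) * xi))) by ring.
      rewrite <- !exp_plus. apply Rmult_le_compat_l; [apply Rmult_le_pos; nra|]. apply exp_le. lra.
Qed.

(** * Parameter integrals and Fubini on a rectangle *)

Lemma continuous_RInt_param (f : R -> R -> R) (a b c : R) :
  (forall x y, continuity_2d_pt f x y) -> continuous (fun u => RInt (fun x => f u x) a b) c.
Proof.
  intros Hf.
  assert (Hfc : forall u x, continuous (fun x => f u x) x).
  { intros u x. apply continuity_pt_filterlim. intros eps Heps. destruct (Hf u x (mkposreal eps Heps)) as [d Hd].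
    exists d. split; [apply cond_pos|]. intros y [_ Hy]. apply Hd; [rewrite Rminus_diag, Rabs_R0; apply cond_pos|exact Hy]. }
  apply continuity_pt_filterlim. intros eps Heps.
  set (e := eps / (Rabs (b - a) + 1)).
  assert (Hab : 0 < Rabs (b - a) + 1) by (pose proof (Rabs_pos (b - a)); lra).
  assert (He : 0 < e) by now apply Rdiv_lt_0_compat.
  destruct (uniform_continuity_2d_1d' f (Rmin a b) (Rmax a b) c (fun x _ => Hf c x) (mkposreal e He)) as [d Hd].
  exists d. split; [apply cond_pos|]. intros u [_ Hu]. simpl in *. unfold R_dist in *.
  assert (Hex : forall v, ex_RInt (fun x => f v x) a b) by (intros; now apply continuous_ex_RInt).
  assert (Hm : RInt (fun x => f u x) a b - RInt (fun x => f c x) a b = RInt (fun x => f u x - f c x) a b).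
  { symmetry. apply (@RInt_minus R_CompleteNormedModule); apply Hex. }
  rewrite Hm.
  assert (Hb : forall x, Rmin a b <= x <= Rmax a b -> Rabs (f u x - f c x) <= e).
  { intros x Hx. left. apply Hd; try assumption.
    - pose proof (cond_pos d). lra.
    - apply Rabs_def2 in Hu. lra.
    - rewrite Rminus_diag, Rabs_R0. apply cond_pos. }
  assert (Hle : Rabs (RInt (fun x => f u x - f c x) a b) <= Rabs (b - a) * e).
  { apply (norm_RInt_le_const_abs (fun x => f u x - f c x) a b (RInt (fun x => f u x - f c x) a b) e).
    - intros x Hx. apply Hb. exact Hx.
    - apply (@RInt_correct R_CompleteNormedModule). apply (@ex_RInt_minus R_NormedModule); apply Hex. }
  apply Rle_lt_trans with (1 := Hle). unfold e.
  apply Rlt_le_trans with ((Rabs (b - a) + 1) * (eps / (Rabs (b - a) + 1))).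
  - apply Rmult_lt_compat_r; [assumption|lra].
  - right. field. lra.
Qed.

Lemma continuity_2d_swap (f : R -> R -> R) :
  (forall x y, continuity_2d_pt f x y) -> forall x y, continuity_2d_pt (fun u v => f v u) x y.
Proof.
  intros H x y eps. destruct (H y x eps) as [d Hd]. exists d. intros u v Hu Hv. now apply Hd.
Qed.

Lemma continuity_2d_section (f : R -> R -> R) (x y : R) :
  (forall x y, continuity_2d_pt f x y) -> continuous (fun u => f u y) x.
Proof.
  intros H. apply continuity_pt_filterlim. intros eps Heps. destruct (H x y (mkposreal eps Heps)) as [d Hd].
  exists d. split; [apply cond_pos|]. intros z [_ Hz]. apply Hd; [exact Hz|rewrite Rminus_diag, Rabs_R0; apply cond_pos].
Qed.

(** As functions of T both iterated integrals vanish at 0 and have the same derivative, the integral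
    of f(T, u) in u. *)
Lemma fubini_rectangle (f : R -> R -> R) (a b T : R) : (forall x y, continuity_2d_pt f x y) ->
  is_RInt (fun x => RInt (fun u => f x u) a b) 0 T (RInt (fun u => RInt (fun x => f x u) 0 T) a b).
Proof.
  intros Hf. set (L := fun T => RInt (fun u => RInt (fun x => f x u) 0 T) a b).
  pose proof (continuity_2d_swap f Hf) as Hs.
  assert (Hd0 : forall u T, is_derive (fun T => RInt (fun x => f x u) 0 T) T (f T u)).
  { intros u T'. apply (is_derive_RInt (fun x => f x u) _ 0).
    - exists (mkposreal 1 Rlt_0_1). intros y _. apply RInt_correct_cont. intros t. now apply continuity_2d_section.
    - now apply continuity_2d_section. }
  assert (HL : forall T, is_derive L T (RInt (fun u => f T u) a b)).
  { intros T'. unfold L.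
    replace (RInt (fun u => f T' u) a b) with (RInt (fun u => Derive (fun T => RInt (fun x => f x u) 0 T) T') a b).
    - apply (is_derive_RInt_param (fun T u => RInt (fun x => f x u) 0 T) a b T').
      + exists (mkposreal 1 Rlt_0_1). intros y _ t _. eexists. apply Hd0.
      + intros t _. apply (continuity_2d_pt_ext f); [|apply Hf].
        intros x0 y0. symmetry. apply is_derive_unique, Hd0.
      + exists (mkposreal 1 Rlt_0_1). intros y _. apply continuous_ex_RInt. intros t.
        apply (continuous_RInt_param (fun u x => f x u)). exact Hs.
    - apply RInt_ext. intros u _. apply is_derive_unique, Hd0. }
  pose proof (is_RInt_derive_R L (fun x => RInt (fun u => f x u) a b) 0 T HL) as H.
  replace (RInt (fun u => RInt (fun x => f x u) 0 T) a b) with (L T - L 0).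
  - apply H. intros x. now apply continuous_RInt_param.
  - assert (H0 : L 0 = 0).
    { unfold L. rewrite (RInt_ext (fun u => RInt (fun x => f x u) 0 0) (fun _ => 0) a b)
        by (intros; rewrite RInt_point; reflexivity).
      rewrite RInt_const. unfold scal; simpl; unfold mult; simpl. ring. }
    rewrite H0. unfold L. ring.
Qed.

(** The factor x of Φ_n is placed here, which leaves [Phi0]. A convolution is O(x^{-3/4}), so with
    this factor it is O(x^{1/4}) and extends continuously by 0: the integral from 0 is proper, and
    the integrand is continuous on the whole plane, as [fubini_rectangle] asks. *)
Definition wfun (g : R -> R) (x : R) : R := if Rlt_dec 0 x then x * conv K g (ln x) else 0.

Lemma conv_K_derivable (D xi : R) (g : R -> R) : sym D g -> is_derive (conv K g) xi (- conv kap g xi).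
Proof.
  intros Hg. destruct (rapid_ker _ rapid_K) as [CK HK]. destruct (rapid_ker _ rapid_kap) as [Ck Hk].
  destruct (rapid_ker _ rapid_k2) as [C2 H2].
  assert (Dk2 : forall t, is_derive (fun t => - kap t) t (k2 t)).
  { intros t. rewrite <- (Ropp_involutive (k2 t)). apply (is_derive_opp kap), is_derive_kap. }
  rewrite <- (conv_opp kap g xi Ck D Hk Hg).
  exact (conv_derive CK Ck C2 D K (fun t => - kap t) k2 g xi HK (ker_opp _ _ Hk) H2 Hg is_derive_K Dk2).
Qed.

Lemma wfun_continuous (D x : R) (g : R -> R) : sym D g -> continuous (wfun g) x.
Proof.
  intros Hg. destruct (Rtotal_order 0 x) as [Hx|[<-|Hx]].
  - apply (continuous_ext_loc _ (fun x => x * conv K g (ln x))).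
    + exists (mkposreal x Hx). intros y Hy. unfold ball in Hy; simpl in Hy.
      unfold AbsRing_ball, abs, minus, plus, opp in Hy; simpl in Hy. apply Rabs_def2 in Hy.
      unfold wfun. destruct (Rlt_dec 0 y); [reflexivity|lra].
    + apply (@continuous_mult R_UniformSpace R_AbsRing); [apply continuous_id|].
      apply (continuous_comp ln (conv K g)).
      * apply ex_derive_continuous_R. auto_derive. assumption.
      * apply (derive_continuous _ _ _ (conv_K_derivable D (ln x) g Hg)).
  - destruct (rapid_ker _ rapid_K) as [CK HK]. set (C := Rabs (8 * CK * D) + 1).
    assert (HC : 0 < C) by (unfold C; pose proof (Rabs_pos (8 * CK * D)); lra).
    assert (Hb : forall y, 0 < y -> Rabs (y * conv K g (ln y)) <= C * exp (ln y / 4)).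
    { intros y Hy. rewrite Rabs_mult, (Rabs_pos_eq y) by lra. rewrite <- (exp_ln y) at 1 by assumption.
      apply Rle_trans with (exp (ln y) * (8 * CK * D * exp (- (3/4) * ln y))).
      - apply Rmult_le_compat_l; [left; apply exp_pos|]. exact (conv_bound CK D K g (ln y) HK Hg).
      - replace (exp (ln y) * (8 * CK * D * exp (- (3 / 4) * ln y))) with (8 * CK * D * (exp (ln y) * exp (- (3/4) * ln y))) by ring.
        rewrite <- exp_plus. replace (ln y + - (3/4) * ln y) with (ln y / 4) by field.
        apply Rmult_le_compat_r; [left; apply exp_pos|]. unfold C. pose proof (Rle_abs (8 * CK * D)). lra. }
    (* This is (eps/C)⁴, obtained by solving C y^{1/4} = eps. *)
    apply continuity_pt_filterlim. intros eps Heps. exists (exp (4 * ln (eps / C))). split; [apply exp_pos|].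
    intros y [_ Hy]. simpl in *. unfold R_dist in *. rewrite Rminus_0_r in Hy. unfold wfun at 2.
    destruct (Rlt_dec 0 0); [lra|]. rewrite Rminus_0_r. unfold wfun. destruct (Rlt_dec 0 y) as [Hy0|]; [|rewrite Rabs_R0; assumption].
    rewrite Rabs_pos_eq in Hy by lra. apply Rle_lt_trans with (1 := Hb y Hy0).
    apply ln_increasing in Hy; [|assumption]. rewrite ln_exp in Hy.
    apply Rlt_le_trans with (C * exp (ln (eps / C))).
    + apply Rmult_lt_compat_l; [assumption|]. apply exp_increasing. lra.
    + rewrite exp_ln by now apply Rdiv_lt_0_compat. right. field. lra.
  - apply (continuous_ext_loc _ (fun _ => 0)); [|apply continuous_const].
    assert (Hx' : 0 < - x) by lra. exists (mkposreal (- x) Hx'). intros y Hy. unfold ball in Hy; simpl in Hy.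
    unfold AbsRing_ball, abs, minus, plus, opp in Hy; simpl in Hy. apply Rabs_def2 in Hy.
    unfold wfun. destruct (Rlt_dec 0 y); [lra|reflexivity].
Qed.

Lemma J0_continuous (y : R) : continuous J0 y.
Proof.
  apply (continuous_ext (fun y => PSeries e0 ((y / 2) ^ 2))); [intros; symmetry; apply J0_PSeries|].
  apply (continuous_comp (fun y => (y / 2) ^ 2) (PSeries e0)).
  - apply ex_derive_continuous_R. auto_derive. exact I.
  - apply (derive_continuous _ _ _ (is_derive_entire e0 _ e0_entire)).
Qed.

Lemma const_of_derive_0 (f : R -> R) : (forall x, is_derive f x 0) -> forall x y, f x = f y.
Proof.
  assert (H : forall f, (forall x, is_derive f x 0) -> forall x y, x <= y -> f x <= f y).
  { intros f0 Hf x y Hxy. apply (incr_of_derive f0 (fun _ => 0)); [assumption| |].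
    - intros z _. apply Hf.
    - intros. lra. }
  assert (H' : forall f, (forall x, is_derive f x 0) -> forall x y, x <= y -> f x = f y).
  { intros f0 Hf x y Hxy. apply Rle_antisym; [now apply H|].
    enough (- f0 x <= - f0 y) by lra. apply (H (fun x => - f0 x)); [|assumption].
    intros z. rewrite <- Ropp_0. apply (is_derive_opp f0), Hf. }
  intros Hf x y. destruct (Rle_dec x y); [now apply H'|]. symmetry. apply H'; [assumption|lra].
Qed.

(** Both sides have the same derivative in ξ and tend to 0 at -∞. *)
Lemma RInt_wfun_J0 (D s xi : R) (g : R -> R) : 1 <= s -> sym D g ->
  RInt (fun x => wfun g x * J0 (2 * x * s)) 0 (exp xi) = JKint s g xi.
Proof.
  intros Hs Hg. set (phi := fun x => wfun g x * J0 (2 * x * s)).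
  assert (Hc : forall x, continuous phi x).
  { intros x. apply (@continuous_mult R_UniformSpace R_AbsRing); [now apply (wfun_continuous D)|].
    apply (continuous_comp (fun x => 2 * x * s) J0); [|apply J0_continuous].
    apply ex_derive_continuous_R. auto_derive. exact I. }
  assert (HF : forall x, is_derive (fun T => RInt phi 0 T) x (phi x)).
  { intros x. apply (is_derive_RInt phi _ 0); [|apply Hc].
    exists (mkposreal 1 Rlt_0_1). intros y _. now apply RInt_correct_cont. }
  set (H := fun xi => RInt phi 0 (exp xi) - JKint s g xi).
  assert (HH : forall x, is_derive H x 0).
  { intros x.
    assert (He : is_derive exp x (exp x)) by apply is_derive_Reals, derivable_pt_lim_exp.
    pose proof (is_derive_comp (fun T => RInt phi 0 T) exp x _ _ (HF (exp x)) He) as A1.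
    evar_last; [exact (is_derive_minus _ _ _ _ _ A1 (is_derive_JKint D s x g Hs Hg))|].
    unfold minus, plus, opp, scal; simpl; unfold mult; simpl. unfold phi, wfun.
    destruct (Rlt_dec 0 (exp x)) as [|Hn]; [|exfalso; apply Hn, exp_pos].
    rewrite ln_exp. replace (2 * exp x * s) with (exp (x + ln (2 * s))) by (rewrite exp_plus, exp_ln by lra; ring).
    rewrite J0_exp. replace (2 * x) with (x + x) by ring. rewrite exp_plus. ring. }
  assert (HL : is_lim H m_infty 0).
  { replace (Finite 0) with (Finite (RInt phi 0 0 - 0)) by (rewrite RInt_point; unfold zero; simpl; f_equal; ring).
    apply is_lim_minus'; [|now apply (JKint_lim_m D)].
    apply (is_lim_comp_continuous exp (fun T => RInt phi 0 T)).
    - apply is_lim_exp_m.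
    - apply (derive_continuous _ _ _ (HF 0)). }
  assert (H0 : H xi = 0).
  { assert (HL' : is_lim H m_infty (H xi)).
    { apply (is_lim_ext (fun _ => H xi)); [intros; now apply const_of_derive_0|apply is_lim_const]. }
    apply is_lim_unique in HL. apply is_lim_unique in HL'. rewrite HL in HL'. now injection HL'. }
  unfold H in H0. fold phi. lra.
Qed.

Definition Phi0 (n : nat) (x : R) : R :=
  RInt (fun u => J0 (2 * x * cosh u) * sinh (2 * u) * sin (INR n * u)) 0 PI.

Lemma cosh_continuous (u : R) : continuous cosh u.
Proof. apply (derive_continuous _ _ _ (is_derive_cosh u)). Qed.

Lemma continuity_2d_1 (f : R -> R) (x y : R) : continuous f x -> continuity_2d_pt (fun u _ => f u) x y.
Proof.
  intros H. apply (continuity_1d_2d_pt_comp f (fun u _ => u)); [now apply continuity_pt_filterlim|].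
  apply continuity_2d_pt_id1.
Qed.

Lemma continuity_2d_2 (f : R -> R) (x y : R) : continuous f y -> continuity_2d_pt (fun _ v => f v) x y.
Proof.
  intros H. apply (continuity_1d_2d_pt_comp f (fun _ v => v)); [now apply continuity_pt_filterlim|].
  apply continuity_2d_pt_id2.
Qed.

Lemma kernel_2d (D : R) (g : R -> R) (n : nat) : sym D g -> forall x u,
  continuity_2d_pt (fun x u => (wfun g x * J0 (2 * x * cosh u)) * (sinh (2 * u) * sin (INR n * u))) x u.
Proof.
  intros Hg x u. apply continuity_2d_pt_mult; [apply continuity_2d_pt_mult|].
  - apply continuity_2d_1. now apply (wfun_continuous D).
  - apply (continuity_1d_2d_pt_comp J0 (fun x u => 2 * x * cosh u)).
    + apply continuity_pt_filterlim, J0_continuous.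
    + apply continuity_2d_pt_mult.
      * apply continuity_2d_1. apply ex_derive_continuous_R. auto_derive. exact I.
      * apply continuity_2d_2, cosh_continuous.
  - apply (continuity_2d_2 (fun u => sinh (2 * u) * sin (INR n * u))).
    apply (@continuous_mult R_UniformSpace R_AbsRing).
    + apply (derive_continuous _ _ _ (is_derive_sinh_lin 2 u)).
    + apply sin_lin_continuous.
Qed.

Definition Glim (n : nat) (g : R -> R) : R :=
  RInt (fun u => IR (wsym (cosh u) g) * (sinh (2 * u) * sin (INR n * u))) 0 PI.

(** Lipschitz in cosh² u: the difference of two weights is (b - a)/(4(a + w²)(b + w²)) with a, b >=
    1, and the second factor stays below min(1, e^{-t}). *)
Lemma IR_wsym_continuous (D : R) (g : R -> R) (u : R) : sym D g ->
  continuous (fun u => IR (wsym (cosh u) g)) u.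
Proof.
  intros Hg. pose proof (sym_const_pos _ _ Hg) as HD.
  assert (Ht : forall v, tame (wsym (cosh v) g)).
  { intros v. destruct (wsym_sym D (cosh v) g (cosh_ge_1 v) Hg) as [S E]. now apply (sym_tame D). }
  assert (Hb : forall v, Rabs (IR (wsym (cosh v) g) - IR (wsym (cosh u) g)) <=
     Rabs (cosh v ^ 2 - cosh u ^ 2) * (8 * D)).
  { intros v. rewrite <- IR_minus by apply Ht.
    replace (Rabs (cosh v ^ 2 - cosh u ^ 2) * (8 * D)) with (8 * (Rabs (cosh v ^ 2 - cosh u ^ 2) * D)) by ring.
    apply IR_bound. split.
    - destruct (tame_minus _ _ (Ht v) (Ht u)) as [C [Hc _]]. exact Hc.
    - intros t. unfold wsym.
      pose proof (cosh_ge_1 v). pose proof (cosh_ge_1 u). pose proof (exp_pos (2 * t)) as He2.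
      set (a := cosh v ^ 2). set (b := cosh u ^ 2). assert (1 <= a) by (unfold a; nra). assert (1 <= b) by (unfold b; nra).
      replace (g t / (4 * (a + exp (2 * t))) - g t / (4 * (b + exp (2 * t))))
        with ((b - a) * (g t * / (4 * ((a + exp (2 * t)) * (b + exp (2 * t)))))) by (field; lra).
      rewrite Rabs_mult, <- Rabs_Ropp, Ropp_minus_distr, Rmult_assoc. apply Rmult_le_compat_l; [apply Rabs_pos|].
      rewrite Rabs_mult.
      assert (Hd : 0 < / (4 * ((a + exp (2 * t)) * (b + exp (2 * t)))) <= Rmin 1 (exp (- t))).
      { assert (Hp1 : 1 + exp (2 * t) <= (a + exp (2 * t)) * (b + exp (2 * t))) by nra.
        assert (Hp2 : exp t <= 1 + exp (2 * t)).
        { replace (exp (2 * t)) with (exp t * exp t) by (rewrite <- exp_plus; f_equal; ring).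
          pose proof (pow2_ge_0 (exp t - 1)). nra. }
        split; [apply Rinv_0_lt_compat; lra|]. apply Rmin_glb.
        - rewrite <- Rinv_1. apply Rinv_le_contravar; lra.
        - rewrite exp_Ropp. apply Rinv_le_contravar; [apply exp_pos|lra]. }
      rewrite (Rabs_pos_eq (/ _)) by lra. destruct Hg as [_ Hg]. specialize (Hg t). pose proof (Rmin_1_exp t).
      pose proof (Rabs_pos (g t)). pose proof (Rmin_1_exp (- t)).
      assert (Hle : Rmin 1 (exp t) * Rmin 1 (exp (- t)) <= dec t).
      { destruct (Rle_dec 0 t).
        - apply Rle_trans with (1 * exp (- t)); [apply Rmult_le_compat; lra|].
          rewrite dec_nonneg, Rmult_1_l by assumption. apply exp_le. lra.
        - apply Rle_trans with (exp t * 1); [apply Rmult_le_compat; lra|].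
          rewrite dec_neg, Rmult_1_r by lra. apply exp_le. lra. }
      apply Rle_trans with ((D * Rmin 1 (exp t)) * Rmin 1 (exp (- t))).
      + apply Rmult_le_compat; lra.
      + rewrite Rmult_assoc. now apply Rmult_le_compat_l. }
  apply continuity_pt_filterlim. intros eps Heps.
  assert (Hcc : continuity_pt (fun v => cosh v ^ 2) u).
  { apply continuity_pt_filterlim. apply ex_derive_continuous_R. unfold cosh. auto_derive. exact I. }
  assert (He : 0 < eps / (8 * D + 1)) by (apply Rdiv_lt_0_compat; lra).
  destruct (Hcc _ He) as [d [Hd Hdd]]. exists d. split; [assumption|]. intros v Hv. specialize (Hdd v Hv).
  simpl in *. unfold R_dist in *. apply Rle_lt_trans with (1 := Hb v).
  apply Rle_lt_trans with (Rabs (cosh v ^ 2 - cosh u ^ 2) * (8 * D + 1)).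
  - apply Rmult_le_compat_l; [apply Rabs_pos|lra].
  - apply (Rmult_lt_compat_r (8 * D + 1)) in Hdd; [|lra].
    replace (eps / (8 * D + 1) * (8 * D + 1)) with eps in Hdd by (field; lra). exact Hdd.
Qed.

(** After Fubini the inner integral in x is [JKint] at s = cosh u and ξ = ln T. As cosh u <= cosh π
    on the range of u, the error e^{-ξ/4} is uniform and the limit passes under the integral in
    u. *)
Lemma RInt_Phi0_wfun_lim (D : R) (n : nat) (g : R -> R) : sym D g -> exists F : R -> R,
  (forall T, 0 < T -> is_RInt (fun x => Phi0 n x * wfun g x) 0 T (F T)) /\
  is_lim F p_infty (Glim n g).
Proof.
  intros Hg. pose proof PI_RGT_0 as HPI.
  set (f := fun x u => (wfun g x * J0 (2 * x * cosh u)) * (sinh (2 * u) * sin (INR n * u))).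
  pose proof (kernel_2d D g n Hg) as H2d. fold f in H2d.
  exists (fun T => RInt (fun u => RInt (fun x => f x u) 0 T) 0 PI). split.
  - intros T HT. apply (is_RInt_ext (fun x => RInt (fun u => f x u) 0 PI)); [|now apply fubini_rectangle].
    intros x _. unfold Phi0. rewrite Rmult_comm.
    rewrite <- (@RInt_scal R_CompleteNormedModule).
    + apply RInt_ext. intros u _. unfold f, scal; simpl; unfold mult; simpl. ring.
    + apply continuous_ex_RInt. intros u.
      apply (@continuous_mult R_UniformSpace R_AbsRing); [apply (@continuous_mult R_UniformSpace R_AbsRing)|].
      * apply (continuous_comp (fun u => 2 * x * cosh u) J0); [|apply J0_continuous].
        apply (@continuous_scal_r R_UniformSpace R_AbsRing R_NormedModule), cosh_continuous.
      * apply (derive_continuous _ _ _ (is_derive_sinh_lin 2 u)).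
      * apply sin_lin_continuous.
  - destruct (JKint_lim_p D (cosh PI) g Hg) as [B HB].
    assert (HBp : 0 <= B).
    { specialize (HB 1 0 ltac:(split; [lra|apply cosh_ge_1]) (Rle_refl 0)).
      pose proof (Rabs_pos (JKint 1 g 0 - IR (wsym 1 g))). pose proof (exp_pos (- (1/4) * 0)). nra. }
    set (M := sinh (2 * PI)). assert (HM : 0 <= M) by (apply sinh_nonneg; lra).
    assert (Hin : forall T u, 0 < T -> RInt (fun x => f x u) 0 T = JKint (cosh u) g (ln T) * (sinh (2 * u) * sin (INR n * u))).
    { intros T u HT. rewrite <- (RInt_wfun_J0 D (cosh u) (ln T) g (cosh_ge_1 u) Hg), exp_ln by assumption.
      rewrite Rmult_comm. rewrite <- (@RInt_scal R_CompleteNormedModule).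
      - apply RInt_ext. intros x _. unfold f, scal; simpl; unfold mult; simpl. ring.
      - apply continuous_ex_RInt. intros x. apply (@continuous_mult R_UniformSpace R_AbsRing); [now apply (wfun_continuous D)|].
        apply (continuous_comp (fun x => 2 * x * cosh u) J0); [|apply J0_continuous].
        apply ex_derive_continuous_R. auto_derive. exact I. }
    apply is_lim_spec. intros eps.
    destruct (exp_decay_small (1/4) (PI * (B * M)) eps ltac:(lra) (cond_pos eps)) as [X HX].
    exists (exp (Rmax 0 (X + 1))). intros T HT.
    assert (HT0 : 0 < T) by (pose proof (exp_pos (Rmax 0 (X + 1))); lra).
    assert (HlT : Rmax 0 (X + 1) < ln T) by (rewrite <- (ln_exp (Rmax 0 (X + 1))); apply ln_increasing; [apply exp_pos|assumption]).
    pose proof (Rmax_l 0 (X + 1)). pose proof (Rmax_r 0 (X + 1)).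
    apply Rle_lt_trans with (2 := HX (ln T) ltac:(lra)). unfold Glim.
    assert (C1 : forall u, continuous (fun u => RInt (fun x => f x u) 0 T) u).
    { intros u. apply (continuous_RInt_param (fun u x => f x u)). now apply continuity_2d_swap. }
    assert (C2 : forall u, continuous (fun u => IR (wsym (cosh u) g) * (sinh (2 * u) * sin (INR n * u))) u).
    { intros u. apply (@continuous_mult R_UniformSpace R_AbsRing); [now apply (IR_wsym_continuous D)|].
      apply (@continuous_mult R_UniformSpace R_AbsRing);
      [apply (derive_continuous _ _ _ (is_derive_sinh_lin 2 u))|apply sin_lin_continuous]. }
    pose proof (@is_RInt_minus R_NormedModule _ _ _ _ _ _ (RInt_correct_cont _ 0 PI C1) (RInt_correct_cont _ 0 PI C2)) as Hm.
    replace (PI * (B * M) * exp (- (1 / 4) * ln T)) with ((PI - 0) * (B * exp (- (1/4) * ln T) * M)) by ring.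
    apply (norm_RInt_le_const _ 0 PI _ (B * exp (- (1/4) * ln T) * M) ltac:(lra) ) with (2 := Hm).
    intros u Hu. unfold norm; simpl; unfold abs, minus, plus, opp; simpl.
    rewrite (Hin T u HT0).
    replace (JKint (cosh u) g (ln T) * (sinh (2 * u) * sin (INR n * u)) + - (IR (wsym (cosh u) g) * (sinh (2 * u) * sin (INR n * u))))
      with ((JKint (cosh u) g (ln T) - IR (wsym (cosh u) g)) * (sinh (2 * u) * sin (INR n * u))) by ring.
    rewrite Rabs_mult. apply Rmult_le_compat; try apply Rabs_pos.
    + apply HB; [|lra]. split; [apply cosh_ge_1|apply cosh_incr; lra].
    + rewrite Rabs_mult. pose proof (sin_abs_le_1 (INR n * u)). pose proof (Rabs_pos (sin (INR n * u))).
      assert (Hs : 0 <= sinh (2 * u) <= M).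
      { split; [apply sinh_nonneg; lra|]. unfold M.
        apply (incr_of_derive sinh cosh); [lra|intros; apply is_derive_sinh|intros; left; apply cosh_pos]. }
      rewrite (Rabs_pos_eq (sinh _)) by lra. nra.
Qed.

(** * Inversion for a single order *)

Lemma IR_odd (f : R -> R) : (forall t, continuous f t) -> (forall t, f (- t) = - f t) -> IR f = 0.
Proof.
  intros Hc Ho. unfold IR. rewrite (Lim_seq_ext _ (fun _ => 0)); [now rewrite Lim_seq_const|].
  intros n. pose proof (RInt_opp_arg f (- INR n) (INR n) Hc) as H. rewrite Ropp_involutive in H.
  rewrite (RInt_ext (fun t => f (- t)) (fun t => opp (f t))) in H by (intros; apply Ho).
  pose proof (@RInt_opp R_CompleteNormedModule f _ _ (continuous_ex_RInt f (- INR n) (INR n) Hc)) as H1.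
  apply (eq_trans H) in H1. unfold opp in H1; simpl in H1. lra.
Qed.

Lemma sinh_minus (x y : R) : sinh (x - y) = sinh x * cosh y - cosh x * sinh y.
Proof.
  unfold sinh, cosh, Rminus. rewrite Ropp_plus_distr, Ropp_involutive, !exp_plus. field.
Qed.

Lemma cosh_mult (t u : R) : cosh (t + u) * cosh (t - u) = cosh u ^ 2 + sinh t ^ 2.
Proof.
  unfold sinh, cosh, Rminus. rewrite !Ropp_plus_distr, !Ropp_involutive, !exp_plus.
  pose proof (exp_pos t). pose proof (exp_pos u). rewrite !exp_Ropp. field. lra.
Qed.

(** Partial fractions: cosh² u + sinh² t = cosh(t+u) cosh(t-u), so the weight of [wsym], with w =
    sinh t, becomes a difference of two translates of tanh. *)
Lemma tanh_diff (t u : R) : 0 < u ->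
  (sinh (t + u) / cosh (t + u) - sinh (t - u) / cosh (t - u)) / sinh (2 * u) = / (cosh u ^ 2 + sinh t ^ 2).
Proof.
  intros Hu. rewrite <- cosh_mult. pose proof (cosh_pos (t + u)). pose proof (cosh_pos (t - u)).
  pose proof (sinh_pos (2 * u) ltac:(lra)).
  assert (H2 : sinh (2 * u) = sinh (t + u) * cosh (t - u) - cosh (t + u) * sinh (t - u)).
  { rewrite <- sinh_minus. f_equal. ring. }
  rewrite H2 in *. field. lra.
Qed.

(** What remains after integrating cos(m t) by parts against that difference of translates: two
    translates of sech², whose transform is known. *)
Definition sechdiff (m u t : R) : R := sin (m * t) * (/ cosh (t + u) ^ 2 - / cosh (t - u) ^ 2).

Lemma IR_sin_sech_shift (m u : R) :
  tame (fun t => sin (m * t) * / cosh (t + u) ^ 2) /\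
  IR (fun t => sin (m * t) * / cosh (t + u) ^ 2) = - sin (m * u) * sech_moment m 1.
Proof.
  set (f := fun t => cos (m * u) * (sin (m * t) * / cosh t ^ (2 * 1)) - sin (m * u) * (cos (m * t) * / cosh t ^ (2 * 1))).
  pose proof (tame_sin_sech m 1 (le_n _)) as Hs. pose proof (tame_cos_sech m 1 (le_n _)) as Hc.
  assert (Hf : tame f) by (apply tame_minus; now apply tame_scal).
  assert (He : forall t, f (t + u) = sin (m * t) * / cosh (t + u) ^ 2).
  { intros t. unfold f. change (2 * 1)%nat with 2%nat.
    replace (m * t) with (m * (t + u) - m * u) by ring. rewrite sin_minus. ring. }
  split.
  - apply (tame_ext (fun t => f (t + u))); [exact He|now apply tame_shift].
  - rewrite <- (IR_ext _ _ He), IR_shift by assumption. unfold f.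
    rewrite IR_minus, !IR_scal by (assumption || now apply tame_scal).
    rewrite (IR_odd (fun t => sin (m * t) * / cosh t ^ (2 * 1))).
    + unfold sech_moment. ring.
    + destruct Hs as [C [Hs _]]. exact Hs.
    + intros t. rewrite cosh_even, Ropp_mult_distr_r_reverse, sin_neg. ring.
Qed.

Lemma sechdiff_IR (m u : R) : tame (sechdiff m u) /\ IR (sechdiff m u) = - 2 * sin (m * u) * sech_moment m 1.
Proof.
  destruct (IR_sin_sech_shift m u) as [T1 I1]. destruct (IR_sin_sech_shift m (- u)) as [T2 I2].
  assert (He : forall t, sin (m * t) * / cosh (t + u) ^ 2 - sin (m * t) * / cosh (t + - u) ^ 2 = sechdiff m u t).
  { intros t. unfold sechdiff, Rminus. ring. }
  split.
  - apply (tame_ext _ _ He). now apply tame_minus.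
  - rewrite <- (IR_ext _ _ He), IR_minus, I1, I2 by assumption.
    rewrite Ropp_mult_distr_r_reverse, sin_neg. ring.
Qed.

Lemma is_derive_tanh_shift (c t : R) :
  is_derive (fun t => sinh (t + c) / cosh (t + c)) t (/ cosh (t + c) ^ 2).
Proof.
  evar_last.
  - apply (is_derive_comp (fun t => sinh t / cosh t) (fun t => t + c)); [apply is_derive_tanh|].
    auto_derive; [exact I|reflexivity].
  - unfold scal; simpl; unfold mult; simpl. ring.
Qed.

(** Under e^t = sinh s one has tanh s dt = ds, so the integral is that of cos(m s)/(4(cosh² u +
    sinh² s)) over s > 0. By [tanh_diff] and one integration by parts, for which [W] is the
    primitive, it reduces to [fourier_sech2]; the translations by u and -u produce sin(m u). *)
Lemma IR_wsym_qs (m u : R) : 0 < m -> 0 < u ->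
  IR (wsym (cosh u) (qs m)) = PI * sin (m * u) / (4 * sinh (PI * m / 2) * sinh (2 * u)).
Proof.
  intros Hm Hu. destruct (sechdiff_IR m u) as [[C HC] HI].
  destruct (wsym_sym 1 (cosh u) (qs m) (cosh_ge_1 u) (sym_qs m)) as [Sw Ew].
  pose proof (sinh_pos (2 * u) ltac:(lra)) as Hsu. pose proof PI_RGT_0 as HPI.
  pose proof (sinh_pos (PI * m / 2) ltac:(nra)) as Hsm.
  set (d := fun t => sinh (t + u) / cosh (t + u) - sinh (t - u) / cosh (t - u)).
  set (W := fun t => sin (m * t) * d t - RInt (sechdiff m u) 0 t).
  assert (HW : forall t, is_derive W t (m * cos (m * t) * d t)).
  { intros t.
    assert (H1 : is_derive d t (/ cosh (t + u) ^ 2 - / cosh (t - u) ^ 2)).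
    { apply (is_derive_minus _ _ _ _ _ (is_derive_tanh_shift u t)). apply (is_derive_tanh_shift (- u)). }
    assert (H2 : is_derive (fun t => RInt (sechdiff m u) 0 t) t (sechdiff m u t)).
    { apply (is_derive_RInt (sechdiff m u) _ 0); [|apply HC].
      exists (mkposreal 1 Rlt_0_1). intros y _. apply RInt_correct_cont. apply HC. }
    assert (Hgen : forall (f g : R -> R) f1 g1, is_derive f t f1 -> is_derive g t g1 ->
      is_derive (fun t => sin (m * t) * f t - g t) t (m * cos (m * t) * f t + sin (m * t) * f1 - g1)).
    { intros f g f1 g1 Hf Hg. auto_derive; [repeat split; eexists; eassumption|].
      rewrite (Derive_eta _ _ _ Hf), (Derive_eta _ _ _ Hg). ring. }
    evar_last; [exact (Hgen _ _ _ _ H1 H2)|]. unfold sechdiff. ring. }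
  assert (HW0 : W 0 = 0).
  { unfold W. rewrite RInt_point, Rmult_0_r, sin_0. unfold zero; simpl. ring. }
  assert (HWp : is_lim (fun t => W (tt t)) p_infty (0 - IR (sechdiff m u) / 2)).
  { unfold W. apply is_lim_minus'.
    - apply (is_lim_p_exp _ 0 1 (4 * exp u) u); [lra|]. intros t Ht. rewrite Rminus_0_r, Rabs_mult.
      pose proof (proj1 (tt_bounds t)). pose proof ln_lt_2.
      pose proof (tanh_minus_1 (tt t + u) ltac:(lra)) as H1. pose proof (tanh_minus_1 (tt t - u) ltac:(lra)) as H2.
      pose proof (exp_le (- (tt t + u)) (u + - (1) * t) ltac:(lra)) as H3.
      pose proof (exp_le (- (tt t - u)) (u + - (1) * t) ltac:(lra)) as H4. rewrite exp_plus in H3, H4.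
      assert (Hd : Rabs (d (tt t)) <= 4 * exp u * exp (- (1) * t)) by (unfold d; apply Rabs_le; lra).
      pose proof (sin_abs_le_1 (m * tt t)). pose proof (Rabs_pos (sin (m * tt t))). pose proof (Rabs_pos (d (tt t))). nra.
    - apply (is_lim_comp (fun T => RInt (sechdiff m u) 0 T) tt p_infty (IR (sechdiff m u) / 2) p_infty).
      + apply (RInt_even_lim C _ HC). intros t. unfold sechdiff.
        rewrite Ropp_mult_distr_r_reverse, sin_neg. replace (- t + u) with (- (t - u)) by ring.
        replace (- t - u) with (- (t + u)) by ring. rewrite !cosh_even. ring.
      + apply tt_lim_p.
      + exists 0. intros; discriminate. }
  assert (HWm : is_lim (fun t => W (tt t)) m_infty 0).
  { rewrite <- HW0. apply (is_lim_comp_continuous tt W); [apply tt_lim_m|].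
    apply (derive_continuous _ _ _ (HW 0)). }
  set (c := / (4 * m * sinh (2 * u))).
  rewrite (IR_FTC (fun t => c * W (tt t)) _ (c * 0) (c * (0 - IR (sechdiff m u) / 2))).
  - rewrite HI, (fourier_sech2 m Hm). unfold c. field. repeat split; lra.
  - now apply (sym_tame _ _ Sw).
  - intros t. pose proof (is_derive_comp W tt t _ _ (HW (tt t)) (is_derive_tt t)) as H1.
    evar_last; [exact (is_derive_scal _ _ c _ H1)|]. unfold scal; simpl; unfold mult; simpl.
    unfold wsym, qs. replace (exp (2 * t)) with (sinh (tt t) ^ 2)
      by (rewrite (sinh_tt t); replace (2 * t) with (t + t) by ring; rewrite exp_plus; ring).
    pose proof (tanh_diff (tt t) u Hu) as Hd. fold (d (tt t)) in Hd.
    pose proof (cosh_ge_1 u). assert (0 < cosh u ^ 2 + sinh (tt t) ^ 2) by nra.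
    pose proof (cosh_pos (tt t)).
    replace (d (tt t)) with (sinh (2 * u) * / (cosh u ^ 2 + sinh (tt t) ^ 2)) by (rewrite <- Hd; field; lra).
    unfold c. field. repeat split; lra.
  - apply (is_lim_scal_l _ c p_infty (Finite _)). exact HWp.
  - apply (is_lim_scal_l _ c m_infty (Finite _)). exact HWm.
Qed.

Lemma sin_IZR_PI (k : Z) : sin (IZR k * PI) = 0.
Proof. apply sin_eq_0_1. now exists k. Qed.

Lemma RInt_sin_sin (n m : nat) : (1 <= n)%nat -> (1 <= m)%nat ->
  RInt (fun u => sin (INR m * u) * sin (INR n * u)) 0 PI = if Nat.eq_dec m n then PI / 2 else 0.
Proof.
  intros Hn Hm. apply is_RInt_unique.
  assert (Hn' : 0 < INR n) by now apply lt_0_INR. assert (Hm' : 0 < INR m) by now apply lt_0_INR.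
  assert (Hcont : forall x, continuous (fun u => sin (INR m * u) * sin (INR n * u)) x).
  { intros x. apply (@continuous_mult R_UniformSpace R_AbsRing); apply sin_lin_continuous. }
  assert (Hp : sin ((INR m + INR n) * PI) = 0) by (rewrite !INR_IZR_INZ, <- plus_IZR; apply sin_IZR_PI).
  destruct (Nat.eq_dec m n) as [<-|Hne].
  - set (F := fun u => u / 2 - sin ((INR m + INR m) * u) / (4 * INR m)).
    replace (PI / 2) with (F PI - F 0) by (unfold F; rewrite Hp, Rmult_0_r, sin_0; field; lra).
    apply is_RInt_derive_R; [|exact Hcont].
    intros x. unfold F. auto_derive; [lra|]. replace ((INR m + INR m) * x) with (2 * (INR m * x)) by ring.
    rewrite cos_2a_sin. field. lra.
  - assert (Hmn : sin ((INR m - INR n) * PI) = 0) by (rewrite !INR_IZR_INZ, <- minus_IZR; apply sin_IZR_PI).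
    assert (Hd : INR m - INR n <> 0) by (intros H; apply Hne, INR_eq; lra).
    set (F := fun u => sin ((INR m - INR n) * u) / (2 * (INR m - INR n)) - sin ((INR m + INR n) * u) / (2 * (INR m + INR n))).
    replace 0 with (F PI - F 0) at 2 by (unfold F; rewrite Hp, Hmn, !Rmult_0_r, sin_0; field; lra).
    apply is_RInt_derive_R; [|exact Hcont].
    intros x. unfold F. auto_derive; [repeat split; lra|].
    replace ((INR m - INR n) * x) with (INR m * x - INR n * x) by ring.
    replace ((INR m + INR n) * x) with (INR m * x + INR n * x) by ring.
    rewrite cos_minus, cos_plus. field. lra.
Qed.

Lemma Glim_qs (n m : nat) : (1 <= n)%nat -> (1 <= m)%nat ->
  Glim n (qs (INR m)) = if Nat.eq_dec m n then PI ^ 2 / (8 * sinh (PI * INR n / 2)) else 0.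
Proof.
  intros Hn Hm. assert (Hm' : 0 < INR m) by now apply lt_0_INR. pose proof PI_RGT_0 as HPI.
  pose proof (sinh_pos (PI * INR m / 2) ltac:(nra)) as Hsm. unfold Glim.
  rewrite (RInt_ext _ (fun u => scal (PI / (4 * sinh (PI * INR m / 2))) (sin (INR m * u) * sin (INR n * u)))).
  - etransitivity.
    + apply (@RInt_scal R_CompleteNormedModule (fun u => sin (INR m * u) * sin (INR n * u))).
      apply continuous_ex_RInt. intros x. apply (@continuous_mult R_UniformSpace R_AbsRing); apply sin_lin_continuous.
    + rewrite RInt_sin_sin by assumption. unfold scal; simpl; unfold mult; simpl.
      destruct (Nat.eq_dec m n) as [<-|]; [field; lra|ring].
  (* The factor sinh(2u) cancels only for u > 0; equality on the open interval is all that
     [RInt_ext] asks. *)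
  - intros u Hu. rewrite Rmin_left in Hu by lra. rewrite IR_wsym_qs by lra.
    unfold scal; simpl; unfold mult; simpl. pose proof (sinh_pos (2 * u) ltac:(lra)). field. lra.
Qed.

(** * Summation over the orders *)

(** The constant D of [sym D g] serves as the norm of the symbol. Evaluation of the convolution with
    [K] at a point and the limit functional [Glim] are the two instances. *)
Definition bounded_linear_on_sym (M : R) (L : (R -> R) -> R) : Prop :=
  (forall D g, sym D g -> Rabs (L g) <= M * D) /\
  (forall D E f g, sym D f -> sym E g -> L (fun t => f t + g t) = L f + L g) /\
  (forall D c f, sym D f -> L (fun t => c * f t) = c * L f).

Definition qsum (b : nat -> R) (t : R) : R := Series (fun k => b k * qs (INR (S k)) t).
Definition qpart (b : nat -> R) (N : nat) (t : R) : R := sum_f_R0 (fun k => b k * qs (INR (S k)) t) N.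
(** [qpart b N] includes the index N, hence the start at N + 1; the coefficient [b k] belongs to the
    order k + 1. *)
Definition tail (b : nat -> R) (N : nat) : R := Series (fun k => Rabs (b (S N + k)%nat)).

Lemma qsum_term_bound (b : nat -> R) (k : nat) (t : R) :
  Rabs (b k * qs (INR (S k)) t) <= Rabs (b k) * Rmin 1 (exp t).
Proof.
  rewrite Rabs_mult. apply Rmult_le_compat_l; [apply Rabs_pos|].
  destruct (sym_qs (INR (S k))) as [_ H]. specialize (H t). lra.
Qed.

Lemma ex_series_qsum (b : nat -> R) (t : R) : ex_series (fun k => Rabs (b k)) ->
  ex_series (fun k => Rabs (b k * qs (INR (S k)) t)).
Proof.
  intros Hb. apply (@ex_series_le R_AbsRing R_CompleteNormedModule _ (fun k => Rabs (b k) * Rmin 1 (exp t))).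
  - intros k. unfold norm; simpl; unfold abs; simpl. rewrite Rabs_Rabsolu. apply qsum_term_bound.
  - now apply ex_series_scal_r.
Qed.

(** The factor min(1, e^t) is kept, so that the remainder is itself a symbol, of norm at most
    [tail b N], and not merely uniformly small. *)
Lemma qsum_tail (b : nat -> R) (N : nat) (t : R) : ex_series (fun k => Rabs (b k)) ->
  Rabs (qsum b t - qpart b N t) <= tail b N * Rmin 1 (exp t).
Proof.
  intros Hb. unfold qsum. pose proof (ex_series_qsum b t Hb) as Hq.
  rewrite (Series_incr_n _ (S N)) by (lia || now apply ex_series_Rabs). simpl Init.Nat.pred. fold (qpart b N t).
  replace (qpart b N t + _ - qpart b N t) with (Series (fun k => b (S N + k)%nat * qs (INR (S (S N + k))) t)) by ring.
  pose proof (proj1 (ex_series_incr_n _ (S N)) Hq) as Hq'. cbv beta in Hq'.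
  apply Rle_trans with (1 := Series_Rabs _ Hq'). unfold tail.
  rewrite <- Series_scal_r. apply Series_le.
  - intros k. split; [apply Rabs_pos|apply qsum_term_bound].
  - apply ex_series_scal_r. now apply (ex_series_incr_n (fun k => Rabs (b k)) (S N)).
Qed.

Lemma tail_lim (b : nat -> R) : ex_series (fun k => Rabs (b k)) -> is_lim_seq (tail b) 0.
Proof.
  intros Hb. set (s := Series (fun k => Rabs (b k))).
  apply (is_lim_seq_ext (fun N => s - sum_n (fun k => Rabs (b k)) N)).
  - intros N. unfold s. rewrite (Series_incr_n _ (S N)) by (lia || assumption).
    simpl Init.Nat.pred. rewrite sum_n_Reals. unfold tail. ring.
  - replace (Finite 0) with (Finite (s - s)) by (f_equal; ring).
    apply is_lim_seq_minus'; [apply is_lim_seq_const|]. exact (Series_correct _ Hb).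
Qed.

Lemma qpart_linear (b : nat -> R) (M : R) (L : (R -> R) -> R) (N : nat) : bounded_linear_on_sym M L ->
  (exists D, sym D (qpart b N)) /\ L (qpart b N) = sum_f_R0 (fun k => b k * L (qs (INR (S k)))) N.
Proof.
  intros [_ [Hp Hs]]. induction N as [|N [[D HD] IH]].
  - split.
    + exists (Rabs (b 0%nat) * 1). exact (sym_scal 1 (b 0%nat) _ (sym_qs (INR 1))).
    + exact (Hs 1 (b 0%nat) _ (sym_qs (INR 1))).
  - pose proof (sym_scal 1 (b (S N)) _ (sym_qs (INR (S (S N))))) as H1. split.
    + exists (D + Rabs (b (S N)) * 1). exact (sym_plus _ _ _ _ HD H1).
    + rewrite tech5, <- IH, <- (Hs 1 _ _ (sym_qs (INR (S (S N))))). exact (Hp _ _ _ _ HD H1).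
Qed.

Lemma continuous_uniform (f : R -> R) (x : R) :
  (forall eps, 0 < eps -> exists g, continuous g x /\ forall y, Rabs (f y - g y) <= eps) -> continuous f x.
Proof.
  intros H. apply continuity_pt_filterlim. intros eps Heps.
  destruct (H (eps / 4) ltac:(lra)) as [g [Hg Hfg]]. apply continuity_pt_filterlim in Hg.
  destruct (Hg (eps / 4) ltac:(lra)) as [d [Hd Hgd]]. exists d. split; [assumption|]. intros y Hy.
  specialize (Hgd y Hy). simpl in *. unfold R_dist in *.
  pose proof (Hfg x) as H1. pose proof (Hfg y) as H2. apply Rabs_def2 in Hgd.
  apply Rabs_le_between in H1. apply Rabs_le_between in H2. apply Rabs_def1; lra.
Qed.

Lemma conv_functional (xi : R) : exists M, bounded_linear_on_sym M (fun g => conv K g xi).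
Proof.
  destruct (rapid_ker _ rapid_K) as [CK HK]. exists (8 * CK * exp (- (3/4) * xi)). repeat split.
  - intros D g Hg. apply Rle_trans with (1 := conv_bound CK D K g xi HK Hg). right. ring.
  - intros D E f g Hf Hg. exact (conv_plus K f g CK D E xi HK Hf Hg).
  - intros D c f Hf. exact (conv_scal K f c CK D xi HK Hf).
Qed.

Lemma qsum_sym (b : nat -> R) : ex_series (fun k => Rabs (b k)) ->
  (exists D, sym D (qsum b)) /\ forall N, sym (tail b N) (fun t => qsum b t - qpart b N t).
Proof.
  intros Hb. destruct (conv_functional 0) as [M HM].
  assert (Hpc : forall N t, continuous (qpart b N) t).
  { intros N. destruct (qpart_linear b M _ N HM) as [[D [H _]] _]. exact H. }
  assert (Hc : forall t, continuous (qsum b) t).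
  { intros t. apply continuous_uniform. intros eps Heps.
    pose proof (tail_lim b Hb) as Ht. apply is_lim_seq_spec in Ht. destruct (Ht (mkposreal eps Heps)) as [N HN].
    specialize (HN N (le_n _)). simpl in HN. rewrite Rminus_0_r in HN. exists (qpart b N). split; [apply Hpc|].
    intros y. apply Rle_trans with (1 := qsum_tail b N y Hb). pose proof (Rmin_1_exp y).
    pose proof (Rle_abs (tail b N)). pose proof (Rabs_pos (tail b N)). nra. }
  split.
  - exists (Series (fun k => Rabs (b k))). split; [exact Hc|]. intros t. unfold qsum.
    apply Rle_trans with (1 := Series_Rabs _ (ex_series_qsum b t Hb)). rewrite <- Series_scal_r. apply Series_le.
    + intros k. split; [apply Rabs_pos|apply qsum_term_bound].
    + now apply ex_series_scal_r.
  - intros N. split; [|intros t; now apply qsum_tail].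
    intros t. apply (@continuous_minus R_UniformSpace R_AbsRing R_NormedModule); [apply Hc|apply Hpc].
Qed.

(** The value on the remainder is at most M times [tail b N], so series and functional are
    interchanged by the norm bound alone. The premise on pointwise equal symbols does the work of
    functional extensionality. *)
Lemma linear_qsum (b : nat -> R) (M : R) (L : (R -> R) -> R) : bounded_linear_on_sym M L ->
  (forall f g, (forall t, f t = g t) -> L f = L g) -> ex_series (fun k => Rabs (b k)) ->
  is_series (fun k => b k * L (qs (INR (S k)))) (L (qsum b)).
Proof.
  intros HL Hext Hb. destruct (qsum_sym b Hb) as [_ HR].
  enough (H : is_lim_seq (sum_n (fun k => b k * L (qs (INR (S k))))) (L (qsum b))) by exact H.
  apply (is_lim_seq_ext (fun N => L (qsum b) - L (fun t => qsum b t - qpart b N t))).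
  - intros N. rewrite sum_n_Reals. destruct (qpart_linear b M L N HL) as [[D HD] <-].
    destruct HL as [_ [Hp _]].
    rewrite (Hext (qsum b) (fun t => (qsum b t - qpart b N t) + qpart b N t)) by (intros; ring).
    rewrite (Hp _ _ _ _ (HR N) HD). ring.
  - evar_last; [|exact (f_equal Finite (Rminus_0_r (L (qsum b))))].
    apply is_lim_seq_minus'; [apply is_lim_seq_const|]. apply is_lim_seq_abs_0.
    apply (is_lim_seq_le_le (fun _ => 0) _ (fun N => M * tail b N)).
    + intros N. split; [apply Rabs_pos|]. apply (proj1 HL), HR.
    + apply is_lim_seq_const.
    + replace (Finite 0) with (Rbar_mult M 0) by (simpl; f_equal; ring).
      apply is_lim_seq_scal_l. now apply tail_lim.
Qed.

Lemma wsym_tame (D s : R) (g : R -> R) : 1 <= s -> sym D g -> tame_by D (wsym s g).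
Proof.
  intros Hs Hg. destruct (wsym_sym D s g Hs Hg) as [[Hc _] _]. split; [exact Hc|].
  intros t. pose proof (sym_const_pos _ _ Hg) as HD. destruct Hg as [_ Hg]. specialize (Hg t).
  unfold wsym, Rdiv. pose proof (exp_pos (2 * t)) as He2. pose proof (Rmin_1_exp t).
  assert (Hs2 : 1 <= s ^ 2) by nra.
  rewrite Rabs_mult, Rabs_inv, (Rabs_pos_eq (4 * _)) by lra.
  assert (Hle : / (4 * (s ^ 2 + exp (2 * t))) * Rmin 1 (exp t) <= dec t).
  { destruct (Rle_dec 0 t).
    - apply Rle_trans with (exp (- t) * 1).
      + apply Rmult_le_compat; try lra; [left; apply Rinv_0_lt_compat; lra|].
        rewrite exp_Ropp. apply Rinv_le_contravar; [apply exp_pos|].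
        replace (exp (2 * t)) with (exp t * exp t) by (rewrite <- exp_plus; f_equal; ring).
        pose proof (pow2_ge_0 (exp t - 1)). nra.
      + rewrite dec_nonneg, Rmult_1_r by assumption. apply exp_le. lra.
    - apply Rle_trans with (1 * exp t).
      + apply Rmult_le_compat; try lra; [left; apply Rinv_0_lt_compat; lra|].
        rewrite <- Rinv_1. apply Rinv_le_contravar; lra.
      + rewrite dec_neg, Rmult_1_l by lra. apply exp_le. lra. }
  assert (0 < / (4 * (s ^ 2 + exp (2 * t)))) by (apply Rinv_0_lt_compat; lra).
  apply Rle_trans with (D * Rmin 1 (exp t) * / (4 * (s ^ 2 + exp (2 * t)))).
  - apply Rmult_le_compat_r; lra.
  - rewrite Rmult_assoc, (Rmult_comm (Rmin _ _)). now apply Rmult_le_compat_l.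
Qed.

Lemma Glim_functional (n : nat) : exists M, bounded_linear_on_sym M (Glim n).
Proof.
  pose proof PI_RGT_0 as HPI.
  assert (Ht : forall D g u, sym D g -> tame (wsym (cosh u) g)).
  { intros D g u Hg. exists D. apply wsym_tame; [apply cosh_ge_1|assumption]. }
  assert (Hc : forall D g x, sym D g ->
    continuous (fun u => IR (wsym (cosh u) g) * (sinh (2 * u) * sin (INR n * u))) x).
  { intros D g x Hg. apply (@continuous_mult R_UniformSpace R_AbsRing); [now apply (IR_wsym_continuous D)|].
    apply (@continuous_mult R_UniformSpace R_AbsRing);
    [apply (derive_continuous _ _ _ (is_derive_sinh_lin 2 x))|apply sin_lin_continuous]. }
  exists (PI * 8 * sinh (2 * PI)). repeat split.
  - intros D g Hg. pose proof (sym_const_pos _ _ Hg) as HD.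
    replace (PI * 8 * sinh (2 * PI) * D) with ((PI - 0) * (8 * D * sinh (2 * PI))) by ring.
    apply (norm_RInt_le_const _ 0 PI _ (8 * D * sinh (2 * PI)) ltac:(lra))
      with (2 := RInt_correct_cont _ 0 PI (fun x => Hc D g x Hg)).
    intros u Hu. unfold norm; simpl; unfold abs; simpl. rewrite Rabs_mult.
    apply Rmult_le_compat; try apply Rabs_pos.
    + apply IR_bound, wsym_tame; [apply cosh_ge_1|assumption].
    + rewrite Rabs_mult. pose proof (sin_abs_le_1 (INR n * u)). pose proof (Rabs_pos (sin (INR n * u))).
      assert (Hs : 0 <= sinh (2 * u) <= sinh (2 * PI)).
      { split; [apply sinh_nonneg; lra|].
        apply (incr_of_derive sinh cosh); [lra|intros; apply is_derive_sinh|intros; left; apply cosh_pos]. }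
      rewrite (Rabs_pos_eq (sinh _)) by lra. nra.
  - intros D E f g Hf Hg. unfold Glim.
    pose proof (@RInt_plus R_CompleteNormedModule _ _ 0 PI (continuous_ex_RInt _ 0 PI (fun x => Hc D f x Hf))
      (continuous_ex_RInt _ 0 PI (fun x => Hc E g x Hg))) as H.
    refine (eq_trans _ H). apply RInt_ext. intros u _. unfold plus; simpl.
    rewrite <- Rmult_plus_distr_r. f_equal. rewrite <- IR_plus by eauto.
    apply IR_ext. intros t. unfold wsym, Rdiv. ring.
  - intros D c f Hf. unfold Glim.
    pose proof (@RInt_scal R_CompleteNormedModule _ 0 PI c (continuous_ex_RInt _ 0 PI (fun x => Hc D f x Hf))) as H.
    refine (eq_trans _ H). apply RInt_ext. intros u _. unfold scal; simpl; unfold mult; simpl.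
    rewrite <- (Rmult_assoc c). f_equal. rewrite <- IR_scal by eauto.
    apply IR_ext. intros t. unfold wsym, Rdiv. ring.
Qed.

Lemma Glim_ext (n : nat) (f g : R -> R) : (forall t, f t = g t) -> Glim n f = Glim n g.
Proof.
  intros H. apply RInt_ext. intros u _. f_equal. apply IR_ext. intros t. unfold wsym. now rewrite H.
Qed.

(** By orthogonality the partial sums vanish before the index n and are constant from it on. *)
Lemma Glim_qsum (b : nat -> R) (n : nat) : ex_series (fun k => Rabs (b k)) ->
  Glim (S n) (qsum b) = b n * (PI ^ 2 / (8 * sinh (PI * INR (S n) / 2))).
Proof.
  intros Hb. destruct (Glim_functional (S n)) as [M HM].
  pose proof (linear_qsum b M _ HM (Glim_ext (S n)) Hb) as H1.
  set (c := PI ^ 2 / (8 * sinh (PI * INR (S n) / 2))).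
  assert (Ht : forall k, b k * Glim (S n) (qs (INR (S k))) = if Nat.eq_dec k n then b n * c else 0).
  { intros k. rewrite Glim_qs by lia. destruct (Nat.eq_dec (S k) (S n)), (Nat.eq_dec k n); subst; try lia; try ring.
    reflexivity. }
  assert (Hlt : forall N, (N < n)%nat -> sum_f_R0 (fun k => b k * Glim (S n) (qs (INR (S k)))) N = 0).
  { induction N as [|N IH]; intros HN.
    - change (sum_f_R0 ?f 0) with (f O). cbv beta. rewrite Ht. destruct (Nat.eq_dec 0 n); [lia|reflexivity].
    - rewrite tech5, IH, Ht by lia. destruct (Nat.eq_dec (S N) n); [lia|ring]. }
  assert (Hge : forall j, sum_f_R0 (fun k => b k * Glim (S n) (qs (INR (S k)))) (n + j) = b n * c).
  { induction j as [|j IH].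
    - rewrite Nat.add_0_r. destruct n as [|n].
      + change (sum_f_R0 ?f 0) with (f O). cbv beta. rewrite Ht. destruct (Nat.eq_dec 0 0); [reflexivity|lia].
      + rewrite tech5, Hlt, Ht by lia. destruct (Nat.eq_dec (S n) (S n)); [ring|lia].
    - rewrite Nat.add_succ_r, tech5, IH, Ht. destruct (Nat.eq_dec (S (n + j)) n); [lia|ring]. }
  assert (H2 : is_lim_seq (sum_n (fun k => b k * Glim (S n) (qs (INR (S k))))) (b n * c)).
  { apply is_lim_seq_ext_loc with (fun _ => b n * c); [|apply is_lim_seq_const].
    exists n. intros N HN. rewrite sum_n_Reals. replace N with (n + (N - n))%nat by lia. now rewrite Hge. }
  assert (H3 : is_lim_seq (sum_n (fun k => b k * Glim (S n) (qs (INR (S k))))) (Glim (S n) (qsum b))) by exact H1.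
  apply is_lim_seq_unique in H2. apply is_lim_seq_unique in H3. rewrite H2 in H3. now injection H3.
Qed.

(** J² + Y² is real at these orders, so the real and imaginary parts of the coefficients give two
    independent real series, each summed at the level of symbols. *)
Lemma fser_qsum (a : nat -> C) (x : R) : 0 < x ->
  ex_series (fun k => Rabs (Re (a (S k)))) -> ex_series (fun k => Rabs (Im (a (S k)))) ->
  fser a x = (8 / PI ^ 2 * conv K (qsum (fun k => Re (a (S k)))) (ln x),
              8 / PI ^ 2 * conv K (qsum (fun k => Im (a (S k)))) (ln x)).
Proof.
  intros Hx Hre Him. destruct (conv_functional (ln x)) as [M HM].
  assert (Hterm : forall k, (a (S k) * (BesselJ (ord (S k)) x * BesselJ (ord (S k)) x
      + BesselY (ord (S k)) x * BesselY (ord (S k)) x))%C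
      = (Re (a (S k)) * (8 / PI ^ 2 * conv K (qs (INR (S k))) (ln x)),
         Im (a (S k)) * (8 / PI ^ 2 * conv K (qs (INR (S k))) (ln x)))).
  { intros k. assert (Hmu : 0 < INR (S k) / 2) by (pose proof (lt_0_INR (S k) ltac:(lia)); lra).
    replace (ord (S k)) with (0, INR (S k) / 2)
      by (unfold ord, Ci, RtoC, Cmult; cbn [fst snd]; f_equal; ring).
    destruct (gauss_cv (INR (S k) / 2) Hmu) as [rho Hrho].
    rewrite (BesselJY_eq _ x rho Hmu Hrho Hx), (nicholson _ rho (ln x) Hmu Hrho).
    replace (2 * (INR (S k) / 2)) with (INR (S k)) by field. unfold nich.
    destruct (a (S k)) as [p q]. unfold RtoC, Cmult, Re, Im; cbn [fst snd]. f_equal; ring. }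
  assert (Hs : forall b, ex_series (fun k => Rabs (b k)) ->
    Series (fun k => b k * (8 / PI ^ 2 * conv K (qs (INR (S k))) (ln x))) = 8 / PI ^ 2 * conv K (qsum b) (ln x)).
  { intros b Hb.
    rewrite <- (is_series_unique _ _ (linear_qsum b M _ HM (fun f g => conv_ext K f g (ln x)) Hb)), <- Series_scal_l.
    apply Series_ext. intros k. ring. }
  unfold fser, CSeries. f_equal.
  - rewrite <- (Hs _ Hre). apply Series_ext. intros k. cbv zeta. rewrite Hterm. reflexivity.
  - rewrite <- (Hs _ Him). apply Series_ext. intros k. cbv zeta. rewrite Hterm. reflexivity.
Qed.

Lemma filterlim_C (F G : R -> R) (l m : R) : is_lim F p_infty l -> is_lim G p_infty m ->
  filterlim (fun T => (F T, G T) : C) (Rbar_locally p_infty) (locally ((l, m) : C)).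
Proof.
  intros HF HG P [eps HP]. apply is_lim_spec in HF. apply is_lim_spec in HG.
  destruct (HF eps) as [X HX]. destruct (HG eps) as [Y HY]. exists (Rmax X Y). intros T HT.
  pose proof (Rmax_l X Y). pose proof (Rmax_r X Y). apply HP. split; [apply HX|apply HY]; lra.
Qed.

Theorem theorem1 (a : nat -> C)
  (Ha : ex_series (fun k => Cmod (a (S k)))) :
  forall n : nat, (1 <= n)%nat ->
  exists (F : R -> C) (L : C),
    (forall T : R, 0 < T ->
       is_RInt (fun x => scal (Phi n x) (fser a x)) 0 T (F T)) /\
    filterlim F (Rbar_locally p_infty) (locally L) /\
    a n = (RtoC (sinh (PI * INR n / 2)) * L)%C.
Proof.
  intros n Hn. destruct n as [|n]; [lia|]. clear Hn. pose proof PI_RGT_0 as HPI.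
  set (br := fun k => Re (a (S k))). set (bi := fun k => Im (a (S k))).
  assert (Hdom : forall b : nat -> R, (forall k, Rabs (b k) <= Cmod (a (S k))) -> ex_series (fun k => Rabs (b k))).
  { intros b Hb. apply (@ex_series_le R_AbsRing R_CompleteNormedModule _ (fun k => Cmod (a (S k)))); [|exact Ha].
    intros k. unfold norm; simpl; unfold abs; simpl. rewrite Rabs_Rabsolu. apply Hb. }
  assert (Hr : ex_series (fun k => Rabs (br k))) by (apply Hdom; intros; apply Re_Im_Cmod).
  assert (Hi : ex_series (fun k => Rabs (bi k))) by (apply Hdom; intros; apply Re_Im_Cmod).
  destruct (qsum_sym br Hr) as [[Dr HDr] _]. destruct (qsum_sym bi Hi) as [[Di HDi] _].
  destruct (RInt_Phi0_wfun_lim Dr (S n) _ HDr) as [Fr [HFr Lr]].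
  destruct (RInt_Phi0_wfun_lim Di (S n) _ HDi) as [Fi [HFi Li]].
  rewrite (Glim_qsum br n Hr) in Lr. rewrite (Glim_qsum bi n Hi) in Li.
  set (s := sinh (PI * INR (S n) / 2)) in *.
  assert (Hs : 0 < s) by (apply sinh_pos; pose proof (lt_0_INR (S n) ltac:(lia)); nra).
  set (c := 8 / PI ^ 2).
  (* The factor 8/π² of Nicholson's formula cancels against π²/(8s), so the limit is [a (S n)]
     divided by s. *)
  exists (fun T => (c * Fr T, c * Fi T)),
    (c * (br n * (PI ^ 2 / (8 * s))), c * (bi n * (PI ^ 2 / (8 * s)))).
  repeat split.
  - intros T HT.
    assert (HC : forall (b : nat -> R) F, is_RInt (fun x => Phi0 (S n) x * wfun (qsum b) x) 0 T F ->
      is_RInt (fun x => Phi (S n) x * (c * conv K (qsum b) (ln x))) 0 T (c * F)).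
    { intros b F HF. apply (is_RInt_ext (fun x => scal c (Phi0 (S n) x * wfun (qsum b) x))).
      - intros x Hx. rewrite Rmin_left in Hx by lra. unfold wfun, scal; simpl; unfold mult; simpl.
        destruct (Rlt_dec 0 x); [|lra]. change (Phi (S n) x) with (x * Phi0 (S n) x). ring.
      - now apply (@is_RInt_scal R_NormedModule). }
    (* The closed form of the series requires x > 0; the open interval from 0 to T is enough
       here. *)
    apply (is_RInt_ext (fun x => (Phi (S n) x * (c * conv K (qsum br) (ln x)), Phi (S n) x * (c * conv K (qsum bi) (ln x))))).
    + intros x Hx. rewrite Rmin_left in Hx by lra. rewrite (fser_qsum a x) by (lra || assumption). reflexivity.
    + apply (@is_RInt_fct_extend_pair R_NormedModule R_NormedModule); apply HC; auto.
  - apply filterlim_C; apply (is_lim_scal_l _ c p_infty (Finite _)); assumption.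
  - unfold br, bi, c. destruct (a (S n)) as [p q]. unfold RtoC, Cmult, Re, Im; cbn [fst snd]. f_equal; field; lra.
Qed.
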